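(* There exists an infinite family of compact matched pairs $(\Gamma_i,G_i)_{i\in I}$ ($\Gamma_i$ countable discrete, $G_i$ compact) which are non-trivial, i.e. for which both associated actions $\alpha$ and $\beta$ are non-trivial, such that the associated compact bicrossed products $\mathbb{G}_i$ are pairwise non-isomorphic, non-commutative, non-cocommutative and infinite dimensional compact quantum groups, and such that every dual $\widehat{\mathbb{G}}_i$ has property $(T)$.
   Context: A compact matched pair $(\Gamma,G)$: $\Gamma$ (countable discrete) and $G$ (compact) are closed subgroups of a locally compact group $H$ with $\Gamma\cap G=\{e\}$ and complement of $\Gamma G$ of Haar measure zero. Then $\Gamma G=H$, and $\gamma g=\alpha_\gamma(g)\beta_g(\gamma)$ (with $\alpha_\gamma(g)\in G$, $\beta_g(\gamma)\in\Gamma$) defines a continuous left action $\alpha$ of $\Gamma$ on the space $G$ and a continuous right action $\beta$ of $G$ on the set $\Gamma$ (with finite orbits $\gamma\cdot G$). The bicrossed product $\mathbb{G}$ is the compact quantum group with $C_m(\mathbb{G})$ equal to the full crossed product of $C(G)$ by $\Gamma$ (generated by a copy $\alpha(C(G))$ of $C(G)$ and unitaries $u_\gamma$ with $u_\gamma\alpha(F)u_\gamma^*=\alpha(F\circ\alpha_{\gamma^{-1}})$), $\Delta_{\mathbb{G}}\circ\alpha=(\alpha\otimes\alpha)\circ\Delta_G$, $\Delta_{\mathbb{G}}(u_\gamma)=\sum_{r\in\gamma\cdot G}u_\gamma\alpha(v_{\gamma,r})\otimes u_r$, where $v_{\gamma,r}\in C(G)$ is the indicator function of $\{g\in G:\beta_g(\gamma)=r\}$;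 its counit satisfies $\varepsilon_{\mathbb{G}}(u_\gamma\alpha(F))=F(e)$. Two compact quantum groups are isomorphic if there is a $*$-isomorphism of their maximal C*-algebras intertwining the comultiplications. $\mathbb{G}$ is commutative if $C_m(\mathbb{G})$ is commutative, cocommutative if $\Delta_{\mathbb{G}}$ is invariant under the flip, and infinite dimensional if $C_m(\mathbb{G})$ is. $\widehat{\mathbb{G}}$ has property $(T)$ if every representation $\pi:C_m(\mathbb{G})\to\mathcal B(H)$ admitting unit vectors $\xi_n\in H$ with $\|\pi(x)\xi_n-\varepsilon_{\mathbb{G}}(x)\xi_n\|\to0$ for all $x\in C_m(\mathbb{G})$ admits a nonzero $\xi\in H$ with $\pi(x)\xi=\varepsilon_{\mathbb{G}}(x)\xi$ for all $x\in C_m(\mathbb{G})$. *)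

(* Defs.v *)
From HB Require Import structures.
From mathcomp Require Export all_boot all_order all_algebra.
From mathcomp Require Export all_classical all_reals all_analysis.
From mathcomp Require Export complex.

Set Implicit Arguments.
Unset Strict Implicit.
Unset Printing Implicit Defensive.

Import Order.TTheory GRing.Theory Num.Theory numFieldNormedType.Exports.

Local Open Scope classical_set_scope.
Local Open Scope complex_scope.
Local Open Scope ring_scope.

(* Only [R[i]^o] carries the norm topology in the library. *)
Notation Cplx R := (R[i]^o) (only parsing).

HB.mixin Record isTopologicalGroup H of PointedTopological H & Group H := {
  mulg_continuous : continuous (fun p : H * H => (p.1 * p.2)%g);
  invg_continuous : continuous (fun x : H => (x^-1)%g)
}.

#[short(type="topologicalGroupType")]
HB.structure Definition TopologicalGroup :=
  {H of PointedTopological H & Group H & isTopologicalGroup H}.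

(* Unital C*-algebras.  The norm is [R[i]]-valued, as for all normed modules
   over [R[i]] in the library.  Hierarchy-Builder accepts no structure below
   both [NormedModule] and a ring structure other than through the numeric
   domains, so the multiplication is a field of this structure instead of coming
   from [algType]. *)
HB.mixin Record isCStarAlgebra (R : realType) A
    of CompleteNormedModule R[i] A := {
  cmul : A -> A -> A;
  cone : A;
  star : A -> A;
  cmulA : associative cmul;
  cmul1l : left_id cone cmul;
  cmul1r : right_id cone cmul;
  cmulPl : forall (a : R[i]) (x y z : A),
    cmul (a *: x + y) z = a *: cmul x z + cmul y z;
  cmulPr : forall (a : R[i]) (x y z : A),
    cmul z (a *: x + y) = a *: cmul z x + cmul z y;
  starK : involutive star;
  starP : forall (a : R[i]) (x y : A),
    star (a *: x + y) = a^* *: star x + star y;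
  starM : forall x y : A, star (cmul x y) = cmul (star y) (star x);
  cstar_normM : forall x y : A, `|cmul x y| <= `|x| * `|y|;
  cstar_norm : forall x : A, `|cmul (star x) x| = `|x| ^+ 2
}.

#[short(type="cstarAlgType")]
HB.structure Definition CStarAlgebra (R : realType) :=
  {A of CompleteNormedModule R[i] A & isCStarAlgebra R A}.

Notation "x ** y" := (cmul x y) (at level 40, left associativity) : ring_scope.

HB.mixin Record isHilbert (R : realType) H
    of CompleteNormedModule R[i] H := {
  inner : H -> H -> R[i];
  innerP : forall (a : R[i]) (x y z : H),
    inner (a *: x + y) z = a * inner x z + inner y z;
  inner_conj : forall x y : H, inner y x = (inner x y)^*;
  inner_norm : forall x : H, inner x x = `|x| ^+ 2
}.

#[short(type="hilbertType")]
HB.structure Definition Hilbert (R : realType) :=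
  {H of CompleteNormedModule R[i] H & isHilbert R H}.

Section CStar.
Variable R : realType.
Implicit Types A B T : cstarAlgType R.

Definition lin_span (V : lmodType R[i]) (S : set V) : set V :=
  [set x | exists (n : nat) (c : 'I_n -> R[i]) (s : 'I_n -> V),
      (forall k, S (s k)) /\ x = \sum_k c k *: s k].

(* Unital *-homomorphisms (they are automatically contractive). *)
Definition star_hom A B (f : A -> B) : Prop :=
  [/\ linear f,
      forall x y, f (x ** y) = f x ** f y,
      f cone = cone &
      forall x, f (star x) = star (f x)].

Definition star_character A (e : A -> R[i]) : Prop :=
  [/\ forall (a : R[i]) x y, e (a *: x + y) = a * e x + e y,
      forall x y, e (x ** y) = e x * e y,
      e cone = 1 &
      forall x, e (star x) = (e x)^*].

(* For [S] compact: unital *-homomorphisms from C(S) to [B].  An element of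
   C(S) is represented by any function on the ambient space [X] that is
   continuous on [S]; values off [S] and arguments that are not continuous on
   [S] are irrelevant. *)
Definition star_hom_on (X : topologicalType) (S : set X) B
    (f : (X -> Cplx R) -> B) : Prop :=
  (forall F F' : X -> Cplx R,
     {within S, continuous F} -> {within S, continuous F'} ->
     {in S, F =1 F'} -> f F = f F') /\
  [/\ forall (a : R[i]) (F F' : X -> Cplx R),
        {within S, continuous F} -> {within S, continuous F'} ->
        f (fun x => a * F x + F' x) = a *: f F + f F',
      forall F F' : X -> Cplx R,
        {within S, continuous F} -> {within S, continuous F'} ->
        f (fun x => F x * F' x) = f F ** f F',
      f (fun=> 1) = cone &
      forall F : X -> Cplx R, {within S, continuous F} ->
        f (fun x => (F x : R[i])^*) = star (f F)].

Definition injective_on_C (X : topologicalType) (S : set X) B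
    (f : (X -> Cplx R) -> B) : Prop :=
  forall F : X -> Cplx R, {within S, continuous F} -> f F = 0 -> {in S, forall x, F x = 0}.

Definition cstar_generated A (S : set A) : Prop :=
  forall D : set A, closed D -> S `<=` D ->
    D cone ->
    (forall (a : R[i]) x y, D x -> D y -> D (a *: x + y)) ->
    (forall x y, D x -> D y -> D (x ** y)) ->
    (forall x, D x -> D (star x)) ->
    D = [set: A].

Definition unitary A (x : A) : Prop := star x ** x = cone /\ x ** star x = cone.

(* Unital representations on a Hilbert space by bounded operators. *)
Definition representation A (H : hilbertType R) (p : A -> H -> H) : Prop :=
  [/\ forall x, linear (p x) /\ continuous (p x),
      forall (a : R[i]) x y v, p (a *: x + y) v = a *: p x v + p y v,
      forall x y v, p (x ** y) v = p x (p y v),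
      forall v, p cone v = v &
      forall x v w, inner (p (star x) v) w = inner v (p x w)].

Definition faithful A (H : hilbertType R) (p : A -> H -> H) : Prop :=
  forall x, (forall v, p x v = 0) -> x = 0.

(* [L], with [t], is the Hilbert space tensor product of [H] and [K]. *)
Definition hilbert_tensor (H K L : hilbertType R) (t : H -> K -> L) : Prop :=
  [/\ forall k, linear (fun h => t h k),
      forall h, linear (t h),
      forall h h' k k', inner (t h k) (t h' k') = inner h h' * inner k k' &
      closure (lin_span [set t h k | h in [set: H] & k in [set: K]])
        = [set: L]].

(* [T], with [t], is the spatial (minimal) tensor product of [A] and [B]: for
   faithful representations of [A] on [H] and of [B] on [K], it is the closed
   linear span of the operators [a (x) b] on the Hilbert space tensor product
   of [H] and [K].  Up to isomorphism this does not depend on the chosen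
   faithful representations.  Bilinearity and multiplicativity of [t] follow
   from the faithfulness of [s]. *)
Definition spatial_tensor A B T (t : A -> B -> T) : Prop :=
  closure (lin_span [set t a b | a in [set: A] & b in [set: B]]) = [set: T] /\
  exists (H K L : hilbertType R) (ht : H -> K -> L)
         (p : A -> H -> H) (q : B -> K -> K) (s : T -> L -> L),
    [/\ hilbert_tensor ht,
        representation p /\ faithful p,
        representation q /\ faithful q,
        representation s /\ faithful s &
        forall a b h k, s (t a b) (ht h k) = ht (p a h) (q b k)].

End CStar.

(* Compact quantum groups, as C*-algebras with a coassociative comultiplication
   having the density (cancellation) property.  Isomorphism, commutativity,
   counit and property (T) refer to the maximal C*-algebra C_m, so [Cm] is meant
   to be that algebra, which carries a counit.  Maximality is not an axiom here:
   for bicrossed products it is the universal property of the full crossed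
   product.  Maps such as [Delta (x) id] are given as the *-homomorphisms with
   the expected values on elementary tensors; density makes them unique. *)
Record compactQuantumGroup (R : realType) := CompactQuantumGroup {
  Cm : cstarAlgType R;
  Cm2 : cstarAlgType R;
  tens : Cm -> Cm -> Cm2;
  tens_spatial : spatial_tensor tens;
  Delta : Cm -> Cm2;
  Delta_hom : star_hom Delta;
  Delta_coassoc :
    exists (Cm3 : cstarAlgType R)
           (tl : Cm2 -> Cm -> Cm3) (tr : Cm -> Cm2 -> Cm3)
           (Dl Dr : Cm2 -> Cm3),
      [/\ spatial_tensor tl /\ spatial_tensor tr,
          forall a b c, tl (tens a b) c = tr a (tens b c),
          star_hom Dl /\ (forall a b, Dl (tens a b) = tl (Delta a) b),
          star_hom Dr /\ (forall a b, Dr (tens a b) = tr a (Delta b)) &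
          forall x, Dl (Delta x) = Dr (Delta x)];
  Delta_cancel_l :
    closure (lin_span
      [set Delta a ** tens b cone | a in [set: Cm] & b in [set: Cm]])
      = [set: Cm2];
  Delta_cancel_r :
    closure (lin_span
      [set Delta a ** tens cone b | a in [set: Cm] & b in [set: Cm]])
      = [set: Cm2];
  counit : Cm -> R[i];
  counit_hom : star_character counit;
  counitP :
    exists El Er : Cm2 -> Cm,
      [/\ star_hom El /\ (forall a b, El (tens a b) = counit a *: b),
          star_hom Er /\ (forall a b, Er (tens a b) = counit b *: a) &
          forall x, El (Delta x) = x /\ Er (Delta x) = x]
}.

Section QuantumGroups.
Variable R : realType.
Implicit Types Q : compactQuantumGroup R.

Definition cqg_isomorphic Q Q' : Prop :=
  exists (f : Cm Q -> Cm Q') (ff : Cm2 Q -> Cm2 Q'),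
    [/\ star_hom f /\ bijective f,
        star_hom ff /\ (forall a b, ff (tens a b) = tens (f a) (f b)) &
        forall x, ff (Delta x) = Delta (f x)].

Definition cqg_commutative Q : Prop := forall x y : Cm Q, x ** y = y ** x.

Definition cqg_cocommutative Q : Prop :=
  exists flip : Cm2 Q -> Cm2 Q,
    [/\ star_hom flip,
        forall a b, flip (tens a b) = tens b a &
        forall x : Cm Q, flip (Delta x) = Delta x].

Definition finite_dimensional (V : lmodType R[i]) : Prop :=
  exists (n : nat) (s : 'I_n -> V), lin_span (range s) = [set: V].

Definition cqg_infinite_dimensional Q : Prop := ~ finite_dimensional (Cm Q).

Definition dual_property_T Q : Prop :=
  forall (H : hilbertType R) (p : Cm Q -> H -> H), representation p ->
    (exists xi : nat -> H,
       (forall n, `|xi n| = 1) /\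
       (forall x, (fun n => `|p x (xi n) - counit x *: xi n| : Cplx R) @ \oo
                    --> (0 : Cplx R))) ->
    exists xi : H, xi <> 0 /\ forall x, p x xi = counit x *: xi.

End QuantumGroups.

Section Haar.
Variables (R : realType) (H : topologicalGroupType).

Definition borel := g_sigma_algebraType (@open H).

(* Left Haar measures: nonzero left-invariant Radon measures. *)
Definition haar_measure (mu : {measure set borel -> \bar R}) : Prop :=
  mu [set: H] <> 0%E /\
  [/\ forall (x : H) (A : set borel), measurable A ->
        mu [set (x * a)%g | a in (A : set H)] = mu A,
      forall K : set H, compact K -> (mu K < +oo)%E,
      forall A : set borel, measurable A ->
        mu A = ereal_inf [set mu U | U in [set U : set H | open U /\ A `<=` U]] &
      forall U : set H, open U ->
        mu U = ereal_sup [set mu K | K in [set K : set H | compact K /\ K `<=` U]]].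

Definition subgroup (S : set H) : Prop :=
  [/\ S 1%g, forall x y, S x -> S y -> S (x * y)%g & forall x, S x -> S (x^-1)%g].

End Haar.

Record compactMatchedPair (R : realType) := CompactMatchedPair {
  ambient : topologicalGroupType;
  ambient_locally_compact : locally_compact [set: ambient];
  ambient_hausdorff : hausdorff_space ambient;
  Gam : set ambient;
  Gam_subgroup : subgroup Gam;
  Gam_closed : closed Gam;
  Gam_countable : countable Gam;
  Gam_discrete : forall x, Gam x -> exists2 U, nbhs x U & U `&` Gam = [set x];
  Gc : set ambient;
  Gc_subgroup : subgroup Gc;
  Gc_closed : closed Gc;
  Gc_compact : compact Gc;
  Gam_Gc : Gam `&` Gc = [set 1%g];
  Gam_Gc_conull : exists2 mu : {measure set (borel ambient) -> \bar R},
    haar_measure mu &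
    mu.-negligible (~` [set (x * g)%g | x in Gam & g in Gc])
}.

Arguments Gam {R} c.
Arguments Gc {R} c.

Section Bicrossed.
Variables (R : realType) (P : compactMatchedPair R).
Local Notation H := (ambient P).
Local Notation Gam := (Gam P).
Local Notation G := (Gc P).

(* For [x] in Gamma and [g] in [G], [x * g = alpha x g * beta g x] with
   [alpha x g] in [G] and [beta g x] in Gamma; such a factorisation exists
   because the product of the two subgroups is the whole group, and it is unique
   because they meet trivially. *)
Definition alpha (x g : H) : H :=
  xget 1%g [set a | G a /\ Gam (a^-1 * (x * g))%g].

Definition beta (g x : H) : H := ((alpha x g)^-1 * (x * g))%g.

Definition orbit_beta (x : H) : set H := [set beta g x | g in G].

(* [al] stands for a *-homomorphism on C(G), [u] is only relevant on Gamma. *)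
Definition covariant_pair (A : cstarAlgType R)
    (al : (H -> Cplx R) -> A) (u : H -> A) : Prop :=
  [/\ star_hom_on G al,
      forall x, Gam x -> unitary (u x),
      forall x y, Gam x -> Gam y -> u (x * y)%g = u x ** u y &
      forall x (F : H -> Cplx R), Gam x -> {within G, continuous F} ->
        u x ** al F ** star (u x) = al (fun g => F (alpha (x^-1)%g g))].

(* The C*-algebra generated by, and universal for, covariant pairs. *)
Definition full_crossed_product (A : cstarAlgType R)
    (al : (H -> Cplx R) -> A) (u : H -> A) : Prop :=
  [/\ covariant_pair al u,
      injective_on_C G al,
      cstar_generated ([set al F | F in [set F : H -> Cplx R | {within G, continuous F}]]
                       `|` [set u x | x in Gam]) &
      forall (B : cstarAlgType R) (al' : (H -> Cplx R) -> B) (u' : H -> B),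
        covariant_pair al' u' ->
        exists f : A -> B,
          [/\ star_hom f,
              forall F : H -> Cplx R, {within G, continuous F} -> f (al F) = al' F &
              forall x, Gam x -> f (u x) = u' x]].

(* [al2] is [al (x) al] on C(G x G), the tensor square of C(G).  The sum ranges
   over the (finite) orbit of [x] under [beta]. *)
Definition is_bicrossed_product (Q : compactQuantumGroup R) : Prop :=
  exists (al : (H -> Cplx R) -> Cm Q) (u : H -> Cm Q)
         (al2 : (H * H -> Cplx R) -> Cm2 Q),
    [/\ full_crossed_product al u,
        star_hom_on (G `*` G) al2 /\
        (forall F F' : H -> Cplx R, {within G, continuous F} -> {within G, continuous F'} ->
           al2 (fun p => F p.1 * F' p.2) = tens (al F) (al F')),
        forall F : H -> Cplx R, {within G, continuous F} ->
          Delta (al F) = al2 (fun p => F (p.1 * p.2)%g),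
        forall x, Gam x ->
          Delta (u x) = \sum_(r \in orbit_beta x)
            tens (u x ** al (\1_[set g | G g /\ beta g x = r])) (u r) &
        forall x (F : H -> Cplx R), Gam x -> {within G, continuous F} ->
          counit (u x ** al F) = F 1%g].

Definition nontrivial_pair : Prop :=
  (exists x g, [/\ Gam x, G g & alpha x g <> g]) /\
  (exists x g, [/\ Gam x, G g & beta g x <> x]).

End Bicrossed.

(* Main.v *)
From HB Require Import structures.
Require Import Defs.
From mathcomp Require Import fingroup perm gproduct cyclic ring lra finmap.
Set Implicit Arguments.
Unset Strict Implicit.
Unset Printing Implicit Defensive.
Import Order.TTheory GRing.Theory Num.Theory numFieldNormedType.Exports.
Local Open Scope classical_set_scope.
Local Open Scope complex_scope.
Local Open Scope ring_scope.

(* The matched pairs live in the discrete groups [Lambda x Sym(Z/4) x Z/(n+1)], where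
   [Lambda] is the subgroup of SL_3(F_5[X]) generated by three elementary matrices,
   the discrete factor is [Lambda x Stab(0)] and the finite one is the group
   [Z/4 x Z/(n+1)] of translations.

   Any two of the three generators of [Lambda] have order 5 and generate a Heisenberg
   group, so that their fixed spaces in a unitary representation meet, off the
   vectors fixed by the commutator, under an angle of cosine at most 1/sqrt 5 < 1/2.
   Hence the sum [D] of the three complementary projections satisfies
   [D^2 >= D / 10], and iterating [1 - D / 3] moves an almost invariant vector to a
   nearby invariant one: [Lambda] has property (T).

   Over a finite group [G] the crossed product is spanned by the elements
   [W t g = u_t 1_g], and it is realised as the algebra generated by the families
   [(U_t E_g)] indexed by all covariant representations on [l2 nat]; the GNS
   construction gives its universal property.  Invariant vectors for the discrete
   group, cut by [1_e], are invariant for the quantum group, whence property (T) of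
   the dual.  The number of characters of the maximal C*-algebra is an isomorphism
   invariant; it is finite, because the discrete group is generated by finitely many
   elements of finite order, and at least [n + 1], because the points of [Z/(n+1)]
   are fixed under [alpha]. *)

(** The order 5 comes from the cross terms: each of the three complementary projections enters two
    of the three pairs, so a cosine below 1/2 is what the squares can absorb, and a Heisenberg pair
    of prime order p has cosine 1/sqrt p. The positions (1,2), (2,3), (3,1) of the entries 1, 1, X
    form a 3-cycle, which gives every pair a central commutator; the entry X makes the group
    infinite. Both actions are nontrivial exactly when neither factor is normal, which is what
    Sym(Z/4) supplies; the central factor Z/(n+1) is there to produce characters.

    The universal property ranges over all C*-algebras, while the algebra has to be built from one
    fixed set of representations. The elements u_t 1_g are countably many, so the GNS space of any
    state restricted to their span fits into l2(nat), and norming states show that these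
    representations detect the norm. Such states come from Hahn-Banach; their positivity rests on
    that of [star x ** x], proved with square roots obtained by iteration in place of a functional
    calculus. *)

(** * Real-valued norms, limits and completeness *)

Section RealNorm.
Variable R : realType.
Local Notation C := R[i].

(* The norm of the library is [R[i]]-valued; [nr] and [ca] are its real versions. *)
Definition ca (a : C) : R := complex.Re `|a|.
Definition nr (V : normedModType C) (x : V) : R := complex.Re `|x|.

Lemma nonneg_Re (z : C) : 0 <= z -> z = (complex.Re z)%:C.
Proof. by move=> z0; rewrite [LHS]complexE (ger0_Im z0) rmorph0 mulr0 addr0. Qed.

Lemma caE (a : C) : `|a| = (ca a)%:C. Proof. exact: nonneg_Re. Qed.

Lemma ca_ge0 a : 0 <= ca a. Proof. by rewrite -lecR -caE normr_ge0. Qed.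
Lemma ca0 : ca 0 = 0. Proof. by apply: complexI; rewrite -caE normr0. Qed.
Lemma ca1 : ca 1 = 1. Proof. by apply: complexI; rewrite -caE normr1. Qed.
Lemma caN a : ca (- a) = ca a. Proof. by rewrite /ca normrN. Qed.
Lemma caM a b : ca (a * b) = ca a * ca b.
Proof. by apply: complexI; rewrite rmorphM /= -!caE normrM. Qed.
Lemma caV a : ca a^-1 = (ca a)^-1.
Proof. by apply: complexI; rewrite fmorphV /= -!caE normfV. Qed.
Lemma caD a b : ca (a + b) <= ca a + ca b.
Proof. by rewrite -lecR rmorphD /= -!caE ler_normD. Qed.
Lemma ca_eq0 a : ca a = 0 -> a = 0.
Proof. by move=> h; apply/eqP; rewrite -normr_eq0 caE h. Qed.
Lemma ca_real (x : R) : ca x%:C = `|x|.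
Proof. by apply: complexI; rewrite -caE normc_def /= expr0n /= addr0 sqrtr_sqr. Qed.
Lemma ca_conj (a : C) : ca a^* = ca a.
Proof. by rewrite /ca norm_conjC. Qed.
Lemma ca_sqr (a : C) : a * a^* = ((ca a) ^+ 2)%:C.
Proof. by rewrite -normCK caE rmorphXn. Qed.
Lemma ca_Re (a : C) : `|complex.Re a| <= ca a.
Proof. by rewrite -lecR -caE normc_ge_Re. Qed.
Lemma ca_Im (a : C) : `|complex.Im a| <= ca a.
Proof.
rewrite /ca normc_def /= -sqrtr_sqr ler_sqrt ?addr_ge0 ?sqr_ge0 //.
by rewrite lerDr sqr_ge0.
Qed.
Lemma ca_ReIm (a : C) : ca a <= `|complex.Re a| + `|complex.Im a|.
Proof.
rewrite {1}[a]complexE (le_trans (caD _ _)) // caM !ca_real.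
by rewrite /ca complexiE normCi mul1r.
Qed.
Lemma conj_real (x : R) : (x%:C)^* = x%:C.
Proof. by apply: conj_Creal; apply/complex_realP; exists x. Qed.
Lemma Re_conj (z : C) : complex.Re z^* = complex.Re z.
Proof.
have h : z + z^* = (complex.Re z *+ 2)%:C.
  by rewrite [in RHS]rmorphMn /= complexRe ReE -[RHS]mulr_natr mulfVK // pnatr_eq0.
have := congr1 (@complex.Re R) h; rewrite raddfD /= mulr2n => /eqP.
by rewrite (inj_eq (addrI _)) => /eqP.
Qed.
Lemma ReM (a b : C) : complex.Re (a * b) = complex.Re a * complex.Re b - complex.Im a * complex.Im b.
Proof. by case: a b => [a a'] [b b']. Qed.
Lemma ReZ (a : R) (b : C) : complex.Re (a%:C * b) = a * complex.Re b.
Proof. by rewrite ReM /= mul0r subr0. Qed.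
Lemma ReD (a b : C) : complex.Re (a + b) = complex.Re a + complex.Re b.
Proof. by case: a b => [a a'] [b b']. Qed.
Lemma ImD (a b : C) : complex.Im (a + b) = complex.Im a + complex.Im b.
Proof. by case: a b => [a a'] [b b']. Qed.
Lemma ReN (a : C) : complex.Re (- a) = - complex.Re a.
Proof. by case: a => [a a']. Qed.

Section V.
Variable V : normedModType C.
Implicit Types x y : V.

Lemma nrE x : `|x| = (nr x)%:C. Proof. exact: nonneg_Re. Qed.
Lemma nr_ge0 x : 0 <= nr x. Proof. by rewrite -lecR -nrE normr_ge0. Qed.
Lemma nr0 : nr (0 : V) = 0. Proof. by apply: complexI; rewrite -nrE normr0. Qed.
Lemma nrN x : nr (- x) = nr x. Proof. by rewrite /nr normrN. Qed.
Lemma nrD x y : nr (x + y) <= nr x + nr y.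
Proof. by rewrite -lecR rmorphD /= -!nrE ler_normD. Qed.
Lemma nrB x y : nr (x - y) <= nr x + nr y.
Proof. by rewrite (le_trans (nrD _ _)) // nrN. Qed.
Lemma nr_subC x y : nr (x - y) = nr (y - x).
Proof. by rewrite -opprB nrN. Qed.
Lemma nr_tri y x z : nr (x - z) <= nr (x - y) + nr (y - z).
Proof. by rewrite (le_trans _ (nrD _ _)) // addrA subrK. Qed.
Lemma nrZ a x : nr (a *: x) = ca a * nr x.
Proof. by apply: complexI; rewrite rmorphM /= -nrE normrZ caE nrE. Qed.
Lemma nr_eq0 x : nr x = 0 -> x = 0.
Proof. by move=> h; apply/eqP; rewrite -normr_eq0 nrE h. Qed.
Lemma nr_gt0 x : x <> 0 -> 0 < nr x.
Proof. by move=> /eqP x0; rewrite -ltcR -nrE normr_gt0. Qed.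
Lemma nr_sum (I : Type) (r : seq I) (P : pred I) (F : I -> V) :
  nr (\sum_(i <- r | P i) F i) <= \sum_(i <- r | P i) nr (F i).
Proof.
elim/big_rec2: _ => [|i a b _ h]; first by rewrite nr0.
by rewrite (le_trans (nrD _ _)) // lerD2l.
Qed.
Lemma nr_le_eq0 x : (forall e : R, 0 < e -> nr x <= e) -> x = 0.
Proof.
move=> h; apply: nr_eq0; apply/eqP; rewrite eq_le nr_ge0 andbT.
by apply/ler_addgt0Pl => e e0; rewrite addr0; apply: h.
Qed.


Lemma nbhs_nr (x : V) (A : set V) :
  nbhs x A <-> exists2 e : R, 0 < e & forall y, nr (x - y) < e -> A y.
Proof.
rewrite -nbhs_ballE /nbhs_ball_; split => [[e e0 eA]|[e e0 eA]].
  exists (complex.Re e); first by rewrite -ltcR -nonneg_Re // ltW.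
  move=> y xy; apply: eA; rewrite -ball_normE /=.
  by rewrite [e]nonneg_Re ?nrE ?ltcR // ltW.
exists e%:C => /=; first by rewrite ltcR.
by move=> y; rewrite -ball_normE /= nrE ltcR; exact: eA.
Qed.

Lemma closure_nr (D : set V) (x : V) :
  closure D x <-> forall e : R, 0 < e -> exists2 y, D y & nr (x - y) < e.
Proof.
split=> [h e e0|h B /nbhs_nr[e e0 eB]].
  have /h[y [Dy]] : nbhs x [set y | nr (x - y) < e] by apply/nbhs_nr; exists e.
  by exists y.
by have [y Dy xy] := h _ e0; exists y; split => //; exact: eB.
Qed.


Lemma cvg_nr (u : nat -> V) (l : V) :
  u @ \oo --> l <-> forall e : R, 0 < e -> exists N, forall n, (N <= n)%N -> nr (l - u n) < e.
Proof.
split=> [h e e0|h A /nbhs_nr[e e0 eA]].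
  have /h[N _ hN] : nbhs l [set y | nr (l - y) < e] by apply/nbhs_nr; exists e.
  by exists N => n Nn; exact: hN.
by have [N hN] := h _ e0; exists N => // n Nn; apply: eA; apply: hN.
Qed.

End V.

Definition cauchy_nr (V : normedModType C) (u : nat -> V) :=
  forall e : R, 0 < e -> exists N, forall m n, (N <= m)%N -> (N <= n)%N -> nr (u m - u n) < e.
Definition lim_nr (V : normedModType C) (u : nat -> V) (l : V) :=
  forall e : R, 0 < e -> exists N, forall n, (N <= n)%N -> nr (l - u n) < e.

Lemma lim_uniq (V : normedModType C) (u : nat -> V) l l' :
  lim_nr u l -> lim_nr u l' -> l = l'.
Proof.
move=> h h'; apply/eqP; rewrite -subr_eq0; apply/eqP/nr_le_eq0 => e e0.
have e2 : 0 < e / 2 by rewrite divr_gt0.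
have [N hN] := h _ e2; have [N' hN'] := h' _ e2.
have a := hN (maxn N N') (leq_maxl _ _); have b := hN' (maxn N N') (leq_maxr _ _).
have := nr_tri (u (maxn N N')) l l'; rewrite [nr (u _ - l')]nr_subC; lra.
Qed.

Lemma cauchy_cvg_nr (V : completeNormedModType C) (u : nat -> V) :
  cauchy_nr u -> exists l, lim_nr u l.
Proof.
move=> cu; suff : cvg (u @ \oo) by move/cvg_ex=> [l /cvg_nr ul]; exists l.
apply: cauchy_cvg; apply: cauchy_exP => e e0; have [|N hN] := cu (complex.Re e).
  by rewrite -ltcR -nonneg_Re // ltW.
exists (u N), N => // n /= Nn; rewrite -ball_normE /= nrE [e]nonneg_Re ?ltcR; last exact: ltW.
by apply: hN.
Qed.

Lemma half_pow_lt (e : R) : 0 < e -> exists N : nat, forall n, (N <= n)%N -> n.+1%:R^-1 < e.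
Proof.
move=> e0; have [N hN] := ltr_add_invr (y := 0) (x := e) e0.
exists N => n Nn; rewrite add0r in hN; apply: le_lt_trans hN.
by rewrite lef_pV2 ?posrE ?ltr0n // ler_nat ltnS.
Qed.

(** A Cauchy filter contains balls of radius 1/(n+1) for every n; their centres form a Cauchy
    sequence whose limit is that of the filter. This reduces the completeness of [l2] and [fam] to
    sequences. *)
Lemma seq_complete (V : normedModType C) :
  (forall u : nat -> V, cauchy_nr u -> exists l, lim_nr u l) ->
  forall F : set_system V, ProperFilter F -> cauchy F -> cvg F.
Proof.
move=> h F PF cF.
have /choice[x hx] (n : nat) : exists x : V, F [set y | nr (x - y) < n.+1%:R^-1].
  have := iffLR (cauchyP F) cF.
  move=> /(_ PF) /(_ (n.+1%:R^-1)%:C) []; first by rewrite ltcR invr_gt0 ltr0n.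
  move=> x Fx; exists x; apply: filterS Fx => y.
  by rewrite -ball_normE /= nrE ltcR.
have cu : cauchy_nr x.
  move=> e e0; have e2 : 0 < e / 2 by rewrite divr_gt0.
  have [N hN] := half_pow_lt e2.
  exists N => m n Nm Nn; have [y []] := filter_ex (filterI (hx m) (hx n)) => /= a b.
  have {}a := lt_trans a (hN _ Nm); have {}b := lt_trans b (hN _ Nn).
  have := nr_tri y (x m) (x n); rewrite [nr (y - _)]nr_subC; lra.
have [l hl] := h _ cu; apply/cvg_ex; exists l => A /nbhs_nr[e e0 eA].
have e2 : 0 < e / 2 by rewrite divr_gt0.
have [N hN] := hl _ e2; have [N' hN'] := half_pow_lt e2.
apply: filterS (hx (maxn N N')) => y /= hy; apply: eA.
have a := hN _ (leq_maxl N N'); have {}hy := lt_trans hy (hN' _ (leq_maxr N N')).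
have := nr_tri (x (maxn N N')) l y; lra.
Qed.

(** The hypothesis makes [q] nondecreasing, and telescoping bounds every tail of [u] by [Q - q n],
    where [Q] is the supremum of [q]. Square roots, Neumann series and the iteration behind property
    (T) all converge by this comparison. *)
Lemma dominated_cvg (V : completeNormedModType C) (u : nat -> V) (q : nat -> R) (M : R) :
  (forall n, nr (u n.+1 - u n) <= q n.+1 - q n) -> (forall n, q n <= M) ->
  exists (l : V) (Q : R), [/\ lim_nr u l, Q <= M, forall n, nr (l - u n) <= Q - q n &
    forall e, 0 < e -> exists N, forall n, (N <= n)%N -> Q - q n < e].
Proof.
move=> hu hq.
have incr m n : nr (u (m + n)%N - u m) <= q (m + n)%N - q m.
  elim: n => [|n IH]; first by rewrite addn0 !subrr nr0.
  rewrite addnS; have := hu (m + n)%N; have := nr_tri (u (m + n)%N) (u (m + n).+1) (u m); lra.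
have hs : has_sup (range q).
  by split; [exists (q 0%N), 0%N|exists M => _ [n _ <-]].
pose Q := sup (range q).
have qQ n : q n <= Q by apply: sup_upper_bound => //; exists n.
have hQ e : 0 < e -> exists N, forall n, (N <= n)%N -> Q - q n < e.
  move=> e0; have [_ [N _ <-] hN] := sup_adherent e0 hs.
  exists N => n Nn; have := incr N (n - N)%N; rewrite subnKC // => a.
  have := nr_ge0 (u n - u N); rewrite -/Q in hN; lra.
have cu : cauchy_nr u.
  move=> e e0; have e2 : 0 < e / 2 by rewrite divr_gt0.
  have [N hN] := hQ _ e2.
  exists N => m n Nm Nn; have a := incr N (m - N)%N; have b := incr N (n - N)%N.
  rewrite !subnKC // in a b; have c := hN _ (leqnn N); have d := qQ m; have f := qQ n.
  have := nr_tri (u N) (u m) (u n); rewrite [nr (u N - _)]nr_subC; lra.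
have [l hl] := cauchy_cvg_nr cu; exists l, Q; split => //.
  by apply: ge_sup; [exists (q 0%N), 0%N|move=> _ [n _ <-]].
move=> n; apply/ler_addgt0Pl => e e0; have [N hN] := hl _ e0.
have a := hN _ (leq_addl n N); have b := incr n N; have c := qQ (n + N)%N.
have := nr_tri (u (n + N)%N) l (u n); lra.
Qed.

End RealNorm.

(** * Hahn-Banach and C*-algebra identities *)

Section LinearExpressions.
Variables (K : comNzRingType) (V : lmodType K).

(* Reflection: a linear identity in a module reduces to identities between the
   coefficients of its atoms. *)
Inductive lexp := LVar of nat | LAdd of lexp & lexp | LOpp of lexp | LScale of K & lexp | LZero.

Fixpoint leval (env : seq V) e := match e with
  | LVar n => nth 0 env n
  | LAdd a b => leval env a + leval env b
  | LOpp a => - leval env a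
  | LScale k a => k *: leval env a
  | LZero => 0 end.

Fixpoint lcoef e (i : nat) : K := match e with
  | LVar n => if Nat.eqb n i then 1 else 0
  | LAdd a b => lcoef a i + lcoef b i
  | LOpp a => - lcoef a i
  | LScale k a => k * lcoef a i
  | LZero => 0 end.

Lemma levalE env e : leval env e = \sum_(i < size env) lcoef e i *: nth 0 env i.
Proof.
elim: e => [n|a IHa b IHb|a IHa|k a IHa|] /=.
- have E i : Nat.eqb n i = (n == i) by [].
  case: (ltnP n (size env)) => h.
    rewrite (bigD1 (Ordinal h)) //= E eqxx scale1r big1 ?addr0 // => i /eqP ni.
    rewrite E; case: eqP => [e|]; last by rewrite scale0r.
    by case: ni; apply/val_inj.
  rewrite nth_default // big1 // => i _; rewrite E; case: eqP => [e|]; last by rewrite scale0r.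
  by move: h; rewrite e leqNgt ltn_ord.
- by rewrite IHa IHb -big_split; apply: eq_bigr => i _; rewrite scalerDl.
- by rewrite IHa -sumrN; apply: eq_bigr => i _; rewrite scaleNr.
- by rewrite IHa scaler_sumr; apply: eq_bigr => i _; rewrite scalerA.
- by rewrite big1 // => i _; rewrite scale0r.
Qed.

Fixpoint lcheck n a b : Prop :=
  match n with 0%N => True | n'.+1 => lcoef a n' = lcoef b n' /\ lcheck n' a b end.

Lemma lcheckP env a b : lcheck (size env) a b -> leval env a = leval env b.
Proof.
move=> h; rewrite !levalE; apply: eq_bigr => i _; congr (_ *: _).
have H : forall n, (n <= size env)%N -> lcheck n a b -> forall j, (j < n)%N -> lcoef a j = lcoef b j.
  elim=> [|n IH] // nn [e ch] j; rewrite ltnS leq_eqVlt => /orP[/eqP->//|]; apply: IH => //.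
  exact: ltnW.
exact: (H _ (leqnn _) h i (ltn_ord i)).
Qed.

End LinearExpressions.

Ltac lm_mem x l := lazymatch l with
  | nil => constr:(false) | x :: _ => constr:(true) | _ :: ?l' => lm_mem x l' end.
Ltac lm_atoms l t := lazymatch t with
  | @GRing.add _ ?a ?b => let l' := lm_atoms l a in lm_atoms l' b
  | @GRing.opp _ ?a => lm_atoms l a
  | @GRing.scale _ _ _ ?a => lm_atoms l a
  | @GRing.zero _ => l
  | _ => lazymatch lm_mem t l with true => l | false => constr:(t :: l) end end.
Ltac lm_idx x l := lazymatch l with
  | x :: _ => constr:(0%N) | _ :: ?l' => let n := lm_idx x l' in constr:(S n) end.
Ltac lm_reify K l t := lazymatch t with
  | @GRing.add _ ?a ?b => let a' := lm_reify K l a in let b' := lm_reify K l b in constr:(LAdd a' b')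
  | @GRing.opp _ ?a => let a' := lm_reify K l a in constr:(LOpp a')
  | @GRing.scale _ _ ?k ?a => let a' := lm_reify K l a in constr:(@LScale K k a')
  | @GRing.zero _ => constr:(@LZero K)
  | _ => let n := lm_idx t l in constr:(@LVar K n) end.
Ltac lmod_over K V := lazymatch goal with |- @eq ?T ?a ?b =>
  let l := lm_atoms (@nil T) a in let l := lm_atoms l b in
  let a' := lm_reify K l a in let b' := lm_reify K l b in
  refine (@lcheckP K V l a' b' _);
  cbn [lcheck size lcoef Nat.eqb]; repeat split; try by field end.
Tactic Notation "lmod" constr(K) constr(V) := lmod_over K V.

Section HahnBanach.
Variables (R : realType) (V : normedModType R[i]).

(** Hahn-Banach is proved through minimal sublinear functionals below the norm, which Zorn's lemma
    provides and which turn out to be additive. The bound by [nr] also bounds each of them from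
    below, so that chains have finite infima. *)
Record sublinear := Sublinear {
  sublin :> V -> R;
  sublinD : forall x y, sublin (x + y) <= sublin x + sublin y;
  sublinZ : forall (a : R) x, 0 <= a -> sublin (a%:C *: x) = a * sublin x;
  sublin_nr : forall x, sublin x <= nr x }.

Lemma sublin_inj (p q : sublinear) : (forall x, p x = q x) -> p = q.
Proof.
case: p q => [p p1 p2 p3] [q q1 q2 q3] /= /funext e; subst q.
by congr Sublinear; exact: Prop_irrelevance.
Qed.

Lemma sublin0 (p : sublinear) : p 0 = 0.
Proof. by have := @sublinZ p 0 0 (lexx _); rewrite mul0r scaler0. Qed.

Lemma sublin_lb (p : sublinear) x : - nr x <= p x.
Proof.
have := sublinD p x (- x); have := sublin_nr p (- x); rewrite nrN subrr sublin0; lra.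
Qed.

Section Shift.
Variables (p : sublinear) (z : V).

(** The infimum of [p (x + t z) - t p z] over [t >= 0] is again sublinear and lies below [p] (take t
    = 0), while t = 1 gives [shift x <= p (x + z) - p z]. For a minimal [p] the two functionals
    coincide, which yields [p x + p z <= p (x + z)]. *)
Definition shift_set (x : V) : set R := [set p (x + t%:C *: z) - t * p z | t in [set t | 0 <= t]].
Definition shift (x : V) : R := inf (shift_set x).

Lemma shift_lb x t : 0 <= t -> - p (- x) <= p (x + t%:C *: z) - t * p z.
Proof.
move=> t0; have := sublinD p (x + t%:C *: z) (- x).
rewrite addrAC subrr add0r (sublinZ p) //; lra.
Qed.
Lemma shift_inf x : has_inf (shift_set x).
Proof.
split; first by exists (p (x + (0 : R)%:C *: z) - 0 * p z), 0 => //=.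
by exists (- p (- x)) => _ [t t0 <-]; exact: shift_lb.
Qed.
Lemma shift_le x t : 0 <= t -> shift x <= p (x + t%:C *: z) - t * p z.
Proof. by move=> t0; apply: ge_inf; [case: (shift_inf x)|exists t]. Qed.
Lemma le_shift x m : (forall t, 0 <= t -> m <= p (x + t%:C *: z) - t * p z) -> m <= shift x.
Proof.
move=> h; apply: lb_le_inf; first by case: (shift_inf x).
by move=> _ [t t0 <-]; exact: h.
Qed.

Lemma shiftD x y : shift (x + y) <= shift x + shift y.
Proof.
rewrite -lerBlDr; apply: le_shift => t t0; rewrite lerBlDr [leRHS]addrC -lerBlDr.
apply: le_shift => s s0; rewrite lerBlDr.
apply: le_trans (shift_le _ (addr_ge0 s0 t0)) _.
have := sublinD p (y + s%:C *: z) (x + t%:C *: z).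
rewrite addrACA -scalerDl -rmorphD /= [y + x]addrC mulrDl; lra.
Qed.
Lemma shiftZ_le (a : R) x : 0 < a -> shift (a%:C *: x) <= a * shift x.
Proof.
move=> a0; rewrite -ler_pdivrMl //; apply: le_shift => t t0.
rewrite ler_pdivrMl //; apply: le_trans (shift_le _ (mulr_ge0 (ltW a0) t0)) _.
by rewrite rmorphM /= -scalerA -scalerDr (sublinZ p) ?(ltW a0) // mulrBr mulrA.
Qed.
Lemma shift_nr x : shift x <= nr x.
Proof.
apply: le_trans (shift_le _ (lexx 0)) _.
by rewrite scale0r addr0 mul0r subr0 sublin_nr.
Qed.
Lemma shiftZ (a : R) x : 0 <= a -> shift (a%:C *: x) = a * shift x.
Proof.
rewrite le_eqVlt => /orP[/eqP<-|a0].
  rewrite mul0r scale0r; apply/eqP; rewrite eq_le; apply/andP; split.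
    by rewrite (le_trans (shift_nr _)) // nr0.
  by apply: le_shift => t t0; rewrite add0r (sublinZ p) // subrr.
apply/eqP; rewrite eq_le shiftZ_le //=; rewrite -ler_pdivlMl //.
have := @shiftZ_le a^-1 (a%:C *: x).
by rewrite scalerA -rmorphM /= mulVf ?gt_eqF // scale1r invr_gt0; apply.
Qed.
Definition shiftp := Sublinear shiftD shiftZ shift_nr.
End Shift.

Let below (p q : sublinear) := forall x, q x <= p x.

(** The infimum is finite because of [sublin_lb]. Its subadditivity involves two members of the
    chain, one for each argument; by totality the smaller one serves for both. *)
Lemma chain_inf (A : set sublinear) (p0 : sublinear) : A p0 -> total_on A below ->
  exists q, forall p, A p -> below p q.
Proof.
move=> A0 tot.
pose E x : set R := [set p x | p in A].
have Einf x : has_inf (E x).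
  by split; [exists (p0 x), p0|exists (- nr x) => _ [p _ <-]; exact: sublin_lb].
pose q x := inf (E x).
have qle p x : A p -> q x <= p x by move=> Ap; apply: ge_inf; [case: (Einf x)|exists p].
have qlb x m : (forall p, A p -> m <= p x) -> m <= q x.
  by move=> h; apply: lb_le_inf; [case: (Einf x)|move=> _ [p Ap <-]; exact: h].
have qD x y : q (x + y) <= q x + q y.
  rewrite -lerBlDr; apply: (qlb) => p Ap; suff : q (x + y) - p x <= q y by lra.
  apply: qlb => p' Ap'; rewrite lerBlDr.
  case: (tot _ _ Ap Ap') => h.
    by have := qle _ (x + y) Ap'; have := h x; have := sublinD p' x y; lra.
  by have := qle _ (x + y) Ap; have := h y; have := sublinD p x y; lra.
have qZ (a : R) x : 0 <= a -> q (a%:C *: x) = a * q x.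
  rewrite le_eqVlt => /orP[/eqP<-|a0].
    rewrite mul0r scale0r; apply/eqP; rewrite eq_le; apply/andP; split.
      by rewrite (le_trans (qle _ _ A0)) // sublin0.
    by apply: qlb => p _; rewrite sublin0.
  apply/eqP; rewrite eq_le; apply/andP; split.
    rewrite -ler_pdivrMl //; apply: (qlb) => p Ap; rewrite ler_pdivrMl // -(sublinZ p) ?(ltW a0) //.
    exact: qle.
  by apply: (qlb) => p Ap; rewrite (sublinZ p) ?(ltW a0) // ler_pM2l //; exact: qle.
have qn x : q x <= nr x by apply: le_trans (qle _ _ A0) (sublin_nr _ _).
by exists (Sublinear qD qZ qn) => p Ap x; exact: qle.
Qed.

Lemma hahn_banach (x0 : V) : exists f : V -> R,
  [/\ forall x y, f (x + y) = f x + f y, forall (a : R) x, f (a%:C *: x) = a * f x,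
      forall x, f x <= nr x & f x0 = nr x0].
Proof.
have nD : forall x y : V, nr (x + y) <= nr x + nr y by move=> x y; exact: nrD.
have nZ : forall (a : R) (x : V), 0 <= a -> nr (a%:C *: x) = a * nr x.
  by move=> a x a0; rewrite nrZ ca_real ger0_norm.
(* Starting below the norm shifted along [x0] forces the value at [x0]: t = 1 gives
   [p0 (- x0) <= nr 0 - nr x0], and the final functional is odd. *)
pose p0 := shiftp (Sublinear nD nZ (fun x => lexx _)) x0.
pose T := {p : sublinear | below p0 p}.
have [||||p pmin] := @Zorn T (fun p q => `[< below (sval p) (sval q) >]).
- by move=> p; apply/asboolP => x.
- by move=> p q r /asboolP h /asboolP h'; apply/asboolP => x; exact: le_trans (h' x) (h x).
- move=> [p hp] [q hq] /asboolP h /asboolP h'; have e : p = q by apply: sublin_inj => x; apply/eqP; rewrite eq_le h h'.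
  by subst q; congr exist; exact: Prop_irrelevance.
- move=> A tot; case: (pselect (exists t, A t)) => [[t At]|nA]; last first.
    by exists (exist _ p0 (fun x => lexx _)) => s As; case: nA; exists s.
  have [||q hq] := @chain_inf [set sval s | s in A] (sval t); first by exists t.
    by move=> _ _ [s As <-] [s' As' <-]; case: (tot _ _ As As') => /asboolP; [left|right].
  have q0 : below p0 q by move=> x; apply: le_trans (hq (sval t) _ x) (svalP t x); exists t.
  by exists (exist _ q q0) => s As; apply/asboolP => /=; apply: hq; exists s.
case: p pmin => [p hp] pmin.
have add x y : p (x + y) = p x + p y.
  have spp z : shift p y z <= p z.
    apply: le_trans (shift_le _ _ _ (lexx 0)) _.
    by rewrite scale0r addr0 mul0r subr0.
  have sp0 : below p0 (shiftp p y) by move=> z; exact: le_trans (spp z) (hp z).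
  have e : shift p y x = p x.
    have := pmin (exist _ (shiftp p y) sp0); rewrite /= => /(_ (asboolT spp)).
    by move=> /(congr1 sval) /= /(congr1 (fun q : sublinear => q x)).
  have := shift_le p y x ler01; rewrite e mul1r scale1r.
  by have := sublinD p x y => a b; apply/eqP; rewrite eq_le a /=; lra.
have pN x : p (- x) = - p x by have := add x (- x); rewrite subrr sublin0; lra.
exists p; split => //.
- move=> a x; case: (leP 0 a) => a0; first by rewrite (sublinZ p).
  have := @sublinZ p (- a) x; rewrite oppr_ge0 ltW // rmorphN scaleNr pN mulNr => /(_ isT) /oppr_inj //.
- exact: sublin_nr.
- apply/eqP; rewrite eq_le sublin_nr /=; have := hp (- x0).
  rewrite pN => h; have := shift_le (Sublinear nD nZ (fun x => lexx _)) x0 (- x0) ler01.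
  rewrite /= scale1r addNr nr0 mul1r; rewrite /p0 /= in h; lra.
Qed.

End HahnBanach.

Section CStarTheory.
Variables (R : realType) (A : cstarAlgType R).
Implicit Types x y z : A.
Local Notation C := R[i].

Lemma cmul0l z : (0 : A) ** z = 0.
Proof. by have := cmulPl (-1) z z z; rewrite !scaleN1r !addNr. Qed.
Lemma cmul0r z : z ** (0 : A) = 0.
Proof. by have := cmulPr (-1) z z z; rewrite !scaleN1r !addNr. Qed.
Lemma cmulDl x y z : (x + y) ** z = x ** z + y ** z.
Proof. by have := cmulPl 1 x y z; rewrite !scale1r. Qed.
Lemma cmulDr x y z : z ** (x + y) = z ** x + z ** y.
Proof. by have := cmulPr 1 x y z; rewrite !scale1r. Qed.
Lemma cmulZl a x z : (a *: x) ** z = a *: (x ** z).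
Proof. by have := cmulPl a x 0 z; rewrite !addr0 cmul0l addr0. Qed.
Lemma cmulZr a x z : z ** (a *: x) = a *: (z ** x).
Proof. by have := cmulPr a x 0 z; rewrite !addr0 cmul0r addr0. Qed.
Lemma cmulNl x z : (- x) ** z = - (x ** z).
Proof. by rewrite -scaleN1r cmulZl scaleN1r. Qed.
Lemma cmulNr x z : z ** (- x) = - (z ** x).
Proof. by rewrite -scaleN1r cmulZr scaleN1r. Qed.
Lemma star0 : star (0 : A) = 0.
Proof. by have := starP (-1) (0 : A) 0; rewrite !scaler0 addr0 rmorphN1 scaleN1r addNr. Qed.
Lemma starD x y : star (x + y) = star x + star y.
Proof. by have := starP 1 x y; rewrite rmorph1 !scale1r. Qed.
Lemma starZ a x : star (a *: x) = a^* *: star x.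
Proof. by have := starP a x 0; rewrite star0 !addr0. Qed.
Lemma starN x : star (- x) = - star x.
Proof. by rewrite -scaleN1r starZ rmorphN1 scaleN1r. Qed.
Lemma star1 : star (cone : A) = cone.
Proof. by rewrite -[LHS]cmul1r -[X in _ ** X]starK -starM cmul1r starK. Qed.
Definition cE := (cmulDl, cmulDr, cmulZl, cmulZr, cmulNl, cmulNr, @cmul1l R A, @cmul1r R A,
  cmul0l, cmul0r).
Definition sE := (starD, starZ, starN, star1, star0, @starM R A, @starK R A).
Lemma cmul_suml (I : Type) (r : seq I) (P : pred I) (F : I -> A) z :
  (\sum_(i <- r | P i) F i) ** z = \sum_(i <- r | P i) F i ** z.
Proof. by elim/big_rec2: _ => [|i a b _ <-]; rewrite ?cmul0l // cmulDl. Qed.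
Lemma cmul_sumr (I : Type) (r : seq I) (P : pred I) (F : I -> A) z :
  z ** (\sum_(i <- r | P i) F i) = \sum_(i <- r | P i) z ** F i.
Proof. by elim/big_rec2: _ => [|i a b _ <-]; rewrite ?cmul0r // cmulDr. Qed.
Lemma star_sum (I : Type) (r : seq I) (P : pred I) (F : I -> A) :
  star (\sum_(i <- r | P i) F i) = \sum_(i <- r | P i) star (F i).
Proof. by elim/big_rec2: _ => [|i a b _ <-]; rewrite ?star0 // starD. Qed.

Lemma nrM x y : nr (x ** y) <= nr x * nr y.
Proof. by rewrite -lecR rmorphM /= -!nrE cstar_normM. Qed.
Lemma nr_starM x : nr (star x ** x) = nr x ^+ 2.
Proof. by apply: complexI; rewrite rmorphXn /= -!nrE cstar_norm. Qed.
Lemma nr_star x : nr (star x) = nr x.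
Proof.
have h y : nr y <= nr (star y).
  have [->|y0] := eqVneq (nr y) 0; first exact: nr_ge0.
  have := nrM (star y) y; rewrite nr_starM expr2 ler_pM2r //.
  by rewrite lt0r y0 nr_ge0.
by apply/eqP; rewrite eq_le h -{2}[x]starK h.
Qed.
Lemma nr_sqr_sa x : star x = x -> nr (x ** x) = nr x ^+ 2.
Proof. by move=> e; rewrite -nr_starM e. Qed.
Lemma nr1_le : nr (cone : A) <= 1.
Proof.
have := nr_starM cone; rewrite star1 cmul1l; have := nr_ge0 (cone : A).
rewrite expr2 => h e; rewrite leNgt; apply/negP => h1.
by move: e => /eqP; rewrite eq_sym -subr_eq0 -{3}[nr _]mulr1 -mulrBr mulf_eq0 subr_eq0 !gt_eqF // (lt_trans _ h1).
Qed.

Lemma lim_cmul (u v : nat -> A) x y : lim_nr u x -> lim_nr v y ->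
  lim_nr (fun n => u n ** v n) (x ** y).
Proof.
move=> hu hv e e0; pose M := nr x + nr y + 1.
have M0 : 0 < M by have := nr_ge0 x; have := nr_ge0 y; rewrite /M; lra.
pose d := Num.min 1 (e / (2 * M)).
have d0 : 0 < d by rewrite lt_min ltr01 divr_gt0 // mulr_gt0.
have [N hN] := hu _ d0; have [N' hN'] := hv _ d0.
exists (maxn N N') => n; rewrite geq_max => /andP[/hN a /hN' b].
have E : x ** y - u n ** v n = (x - u n) ** y + u n ** (y - v n).
  by rewrite !cE addrA subrK.
have vn : nr (u n) <= nr x + 1.
  have := nr_tri x (u n) 0; rewrite !subr0 [nr (u n - x)]nr_subC.
  have : d <= 1 by rewrite ge_min lexx.
  lra.
rewrite E (le_lt_trans (nrD _ _)) // (le_lt_trans (lerD (nrM _ _) (nrM _ _))) //.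
have de : d * M <= e / 2.
  have : d <= e / (2 * M) by rewrite ge_min lexx orbT.
  rewrite -(ler_pM2r M0) => /le_trans; apply.
  by rewrite invfM mulrA divfK // gt_eqF.
have : nr (x - u n) * nr y <= d * nr y by rewrite ler_wpM2r ?nr_ge0 // ltW.
have : nr (u n) * nr (y - v n) <= (nr x + 1) * d.
  by rewrite ler_pM ?nr_ge0 // ltW.
move: de; rewrite /M; nra.
Qed.

Lemma lim_star (u : nat -> A) x : lim_nr u x -> lim_nr (fun n => star (u n)) (star x).
Proof.
move=> h e e0; have [N hN] := h _ e0; exists N => n Nn.
by rewrite -starN -starD nr_star hN.
Qed.

End CStarTheory.

(** * Positive elements and states *)

Section Limits.
Variables (R : realType) (V : normedModType R[i]).
Implicit Types (u v : nat -> V) (x y : V).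
Lemma limD u v x y : lim_nr u x -> lim_nr v y -> lim_nr (fun n => u n + v n) (x + y).
Proof.
move=> hu hv e e0; have e2 : 0 < e / 2 by rewrite divr_gt0.
have [N hN] := hu _ e2; have [N' hN'] := hv _ e2.
exists (maxn N N') => n; rewrite geq_max => /andP[/hN a /hN' b].
have -> : x + y - (u n + v n) = (x - u n) + (y - v n) by lmod R[i] V.
by have := nrD (x - u n) (y - v n); lra.
Qed.
Lemma limZ a u x : lim_nr u x -> lim_nr (fun n => a *: u n) (a *: x).
Proof.
move=> hu e e0; have d0 : 0 < e / (ca a + 1) by rewrite divr_gt0 // ltr_wpDl ?ca_ge0.
have [N hN] := hu _ d0; exists N => n /hN h.
rewrite -scalerBr nrZ; have a1 : 0 < ca a + 1 by rewrite ltr_wpDl ?ca_ge0.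
move: h; rewrite ltr_pdivlMr // mulrDr mulr1 mulrC => h.
by have := nr_ge0 (x - u n); lra.
Qed.
Lemma limB u v x y : lim_nr u x -> lim_nr v y -> lim_nr (fun n => u n - v n) (x - y).
Proof.
move=> hu hv; have := limD hu (limZ (-1) hv); rewrite scaleN1r.
by congr (lim_nr _ _); apply/funext => n; rewrite scaleN1r.
Qed.
Lemma lim_shift u x : lim_nr u x -> lim_nr (fun n => u n.+1) x.
Proof. by move=> h e /h [N hN]; exists N => n Nn; apply: hN; exact: leqW. Qed.
Lemma lim_cst x : lim_nr (fun=> x) x.
Proof. by move=> e e0; exists 0%N => n _; rewrite subrr nr0. Qed.
Lemma lim_le u x (M : R) : lim_nr u x -> (forall n, nr (u n) <= M) -> nr x <= M.
Proof.
move=> h hM; apply/ler_addgt0Pl => e /h [N /(_ _ (leqnn _)) hN].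
have := hM N; have := nrD (x - u N) (u N); rewrite subrK; lra.
Qed.
Lemma lim_ext u v x : (forall n, u n = v n) -> lim_nr u x -> lim_nr v x.
Proof. by move=> /funext ->. Qed.
End Limits.

(** * Square roots, positivity of [star x ** x] and norming states *)

Section Kaplansky.
Variables (R : realType) (A : cstarAlgType R).
Local Notation C := R[i].
Implicit Types h k w x y a b c : A.
Local Notation one := (cone : A).
Local Notation "x # y" := (x ** y = y ** x) (at level 70).

Lemma conj_half : ((2^-1 : C)^*) = 2^-1.
Proof. by rewrite fmorphV /= rmorph_nat. Qed.
Lemma ca_half : ca (2^-1 : C) = 2^-1.
Proof. by rewrite caV -[2%:R](rmorph_nat (real_complex R)) ca_real normr_nat. Qed.

Lemma commM x y z : x # y -> x # z -> x # (y ** z).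
Proof. by move=> e f; rewrite cmulA e -cmulA f cmulA. Qed.
Lemma commD x y z : x # y -> x # z -> x # (y + z).
Proof. by move=> e f; rewrite !cE e f. Qed.
Lemma commZ x y (s : C) : x # y -> x # (s *: y).
Proof. by move=> e; rewrite !cE e. Qed.
Lemma commN x y : x # y -> x # (- y).
Proof. by move=> e; rewrite !cE e. Qed.
Lemma comm1 x : x # one. Proof. by rewrite cmul1l cmul1r. Qed.

(** The iteration [y' = (h + y y) / 2] converges to some [l] with [l = (h + l l) / 2], so that
    [1 - l] squares to [1 - h]. All iterates commute, which factors the increments; they are
    dominated by those of the scalar iteration [q] for [h = 1], which stays in [0, 1]. *)
Lemma sqrt_one_minus h : star h = h -> nr h <= 1 -> exists b,
  [/\ star b = b, b ** b = one - h, nr (one - b) <= 1 & forall c, c # h -> c # b].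
Proof.
move=> sh h1.
pose y := fix y n := if n is n'.+1 then (2^-1 : C) *: (h + y n' ** y n') else 0 : A.
pose q := fix q n := if n is n'.+1 then (2^-1 : R) * (1 + q n' ^+ 2) else 0 : R.
have ys n : star (y n) = y n.
  by elim: n => [|n IH] /=; rewrite ?star0 // !sE conj_half sh IH.
have yc n c : c # h -> c # y n.
  move=> ch; elim: n => [|n IH] /=; first by rewrite !cE.
  by apply: commZ; apply: commD => //; apply: commM.
have yy m n : y m # y n by apply: (yc); apply/esym; apply: (yc).
have q01 n : 0 <= q n <= 1.
  by elim: n => [|n /andP[a b]] /=; [rewrite lexx ler01|apply/andP; split; nra].
have yq n : nr (y n) <= q n.
  elim: n => [|n IH] /=; first by rewrite nr0.
  rewrite nrZ ca_half ler_pM2l //; apply: le_trans (nrD _ _) _; apply: lerD => //.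
  by apply: le_trans (nrM _ _) _; rewrite expr2 ler_pM ?nr_ge0.
have inc n : nr (y n.+1 - y n) <= q n.+1 - q n.
  elim: n => [|n IH]; first by rewrite /= subr0 nrZ ca_half subr0 cmul0l addr0 expr0n addr0 ler_pM2l.
  have -> : y n.+2 - y n.+1 = (2^-1 : C) *: ((y n.+1 + y n) ** (y n.+1 - y n)).
    have G a b : a # b -> (2^-1 : C) *: (h + a ** a) - (2^-1 : C) *: (h + b ** b) =
        (2^-1 : C) *: ((a + b) ** (a - b)) by move=> ab; rewrite !cE ab; lmod C A.
    exact: (G _ _ (yy n.+1 n)).
  have -> : q n.+2 - q n.+1 = 2^-1 * ((q n.+1 + q n) * (q n.+1 - q n)).
    have G (a b : R) : 2^-1 * (1 + a ^+ 2) - 2^-1 * (1 + b ^+ 2) = 2^-1 * ((a + b) * (a - b)) by ring.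
    exact: G.
  rewrite nrZ ca_half ler_pM2l //; apply: le_trans (nrM _ _) _.
  by rewrite ler_pM ?nr_ge0 //; apply: le_trans (nrD _ _) _; exact: lerD.
have [l [Q [hl Q1 lQ _]]] := @dominated_cvg R A y q 1 inc (fun n => proj2 (andP (q01 n))).
exists (one - l).
have E : l = (2^-1 : C) *: (h + l ** l).
  apply: lim_uniq (lim_shift hl) _; apply: lim_ext (_ : forall n, _ = y n.+1) _; last first.
    by apply: limZ; apply: limD (lim_cst h) (lim_cmul hl hl).
  by [].
split.
- rewrite !sE; congr (_ - _); apply: (lim_uniq _ hl).
  by apply: lim_ext (lim_star hl).
- have {}E : l + l = h + l ** l.
    have := congr1 (fun z => (2%:R : C) *: z) E.
    by rewrite scalerA divff ?pnatr_eq0 // scale1r scaler_nat mulr2n.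
  have -> : (one - l) ** (one - l) = one - (l + l) + l ** l by rewrite !cE; lmod C A.
  by rewrite E; lmod C A.
- rewrite opprB addrC subrK; have := lQ 0%N; rewrite /= !subr0 => /le_trans; exact.
- move=> c ch; apply: commD; first exact: comm1.
  apply: commN; apply: (@lim_uniq _ _ (fun n => c ** y n)).
    exact: lim_cmul (lim_cst c) hl.
  by apply: lim_ext (lim_cmul hl (lim_cst c)) => n /=; rewrite yc.
Qed.

Definition invertible x := exists c, c ** x = one /\ x ** c = one.

Lemma neumann1 h : nr h < 1 -> invertible (one - h).
Proof.
move=> h1.
pose x := fix x n := if n is n'.+1 then one + h ** x n' else 0 : A.
pose t := nr h; have t0 : 0 <= t := nr_ge0 h; have t1 : 0 < 1 - t by rewrite subr_gt0.
pose q n := (1 - t ^+ n) / (1 - t).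
have qE n : q n.+1 - q n = t ^+ n by rewrite /q -mulrBl exprS; field; rewrite gt_eqF.
have hx n : h # x n.
  by elim: n => [|n IH] /=; rewrite ?cE // -cmulA -IH.
have inc n : nr (x n.+1 - x n) <= q n.+1 - q n.
  rewrite qE; elim: n => [|n IH]; first by rewrite /= !cE addr0 subr0 nr1_le.
  have -> : x n.+2 - x n.+1 = h ** (x n.+1 - x n).
    have G a b : (one + h ** a) - (one + h ** b) = h ** (a - b) by rewrite !cE; lmod C A.
    exact: G.
  by apply: le_trans (nrM _ _) _; rewrite exprS ler_pM ?nr_ge0.
have [|l [Q [hl _ _ _]]] := @dominated_cvg R A x q ((1 - t)^-1) inc.
  move=> n; rewrite ler_pdivrMr // mulVf ?gt_eqF // gerBl exprn_ge0 //.
have E : l = one + h ** l.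
  apply: lim_uniq (lim_shift hl) _.
  by apply: lim_ext (limD (lim_cst _) (lim_cmul (lim_cst _) hl)).
have hl' : h # l.
  apply: lim_uniq (lim_cmul (lim_cst _) hl) _.
  by apply: lim_ext (lim_cmul hl (lim_cst _)) => n /=; rewrite hx.
have E' : l - h ** l = one by rewrite {1}E addrK.
by exists l; rewrite !cE -hl' E'.
Qed.

Lemma invertibleZ (s : C) x : s != 0 -> invertible x -> invertible (s *: x).
Proof.
move=> s0 [c [e f]]; exists (s^-1 *: c).
by rewrite !cE !scalerA e f mulVf // divff // scale1r.
Qed.

Lemma neumann (s : R) h : nr h < s -> invertible (s%:C *: one - h).
Proof.
move=> hs; have s0 : 0 < s := le_lt_trans (nr_ge0 h) hs.
have sC : s%:C != 0 :> C by rewrite (inj_eq (@complexI R)) gt_eqF.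
have -> : s%:C *: one - h = s%:C *: (one - (s%:C)^-1 *: h).
  by rewrite scalerBr scalerA divff // scale1r.
apply: invertibleZ => //; apply: neumann1.
by rewrite nrZ caV ca_real gtr0_norm // mulrC ltr_pdivrMr // mul1r.
Qed.

(* Positivity in the metric form [|t - x| <= t], for which sums and square roots
   need no functional calculus. *)
Definition positive x := star x = x /\ exists2 t : R, 0 <= t & nr (t%:C *: one - x) <= t.

Lemma positiveD x y : positive x -> positive y -> positive (x + y).
Proof.
move=> [sx [t t0 ht]] [sy [s s0 hs]]; split; first by rewrite sE sx sy.
exists (t + s); first exact: addr_ge0.
have -> : (t + s)%:C *: one - (x + y) = (t%:C *: one - x) + (s%:C *: one - y).
  by rewrite rmorphD /=; lmod C A.
by rewrite (le_trans (nrD _ _)) // lerD.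
Qed.

Lemma positiveZ (r : R) x : 0 <= r -> positive x -> positive (r%:C *: x).
Proof.
move=> r0 [sx [t t0 ht]]; split; first by rewrite sE sx conj_real.
exists (r * t); first exact: mulr_ge0.
by rewrite rmorphM /= -scalerA -scalerBr nrZ ca_real ger0_norm // ler_wpM2l.
Qed.

Lemma positive_inv (s : R) x : 0 < s -> positive x -> invertible (s%:C *: one + x).
Proof.
move=> s0 [sx [t t0 ht]].
have -> : s%:C *: one + x = (s + t)%:C *: one - (t%:C *: one - x).
  by rewrite rmorphD /=; lmod C A.
by apply: neumann; rewrite (le_lt_trans ht) // ltrDr.
Qed.

(** If [t - x] has norm at most [t], then [1 - x / t] lies in the unit ball and [sqrt_one_minus]
    applies to it. Its estimate on [1 - b] is what makes the root positive in the metric sense. *)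
Lemma positive_sqrt x : positive x -> exists k,
  [/\ star k = k, k ** k = x, positive k & forall c, c # x -> c # k].
Proof.
move=> [sx [t t0 ht]]; have [t_eq0|tn0] := eqVneq t 0.
  have x0 : x = 0.
    apply: nr_eq0; apply/eqP; rewrite eq_le nr_ge0 andbT.
    by move: ht; rewrite t_eq0 rmorph0 scale0r sub0r nrN.
  exists 0; rewrite x0; split=> [|||c _]; rewrite ?star0 ?cE //.
  by split; [rewrite star0|exists 0; rewrite // scale0r subrr nr0].
have tp : 0 < t by rewrite lt0r tn0.
have tC : t%:C != 0 :> C by rewrite (inj_eq (@complexI R)).
have [||b [sb bb b1 bc]] := @sqrt_one_minus (one - (t%:C)^-1 *: x).
- by rewrite !sE sx -fmorphV conj_real.
- have -> : one - (t%:C)^-1 *: x = (t%:C)^-1 *: (t%:C *: one - x).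
    by rewrite scalerBr scalerA mulVf // scale1r.
  by rewrite nrZ caV ca_real gtr0_norm // ler_pdivrMl // mulr1.
exists ((Num.sqrt t)%:C *: b); split.
- by rewrite sE sb conj_real.
- rewrite !cE scalerA -rmorphM -expr2 sqr_sqrtr // bb opprB addrC subrK scalerA divff //.
  by rewrite scale1r.
- split; first by rewrite sE sb conj_real.
  exists (Num.sqrt t); first exact: sqrtr_ge0.
  by rewrite -scalerBr nrZ ca_real ger0_norm ?sqrtr_ge0 // -[leRHS]mulr1 ler_wpM2l ?sqrtr_ge0.
- by move=> c cx; apply: commZ; apply: bc; apply: commD; [exact: comm1|apply/commN/commZ].
Qed.

Lemma conj_i : ('i : C)^* = - 'i. Proof. exact: conjCi. Qed.

Lemma mul_ii : ('i : C) * 'i = -1. Proof. by rewrite -expr2 sqrCi. Qed.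

Lemma normal_norm k w : star k = k -> star w = w -> k # w ->
  nr (k + 'i *: w) ^+ 2 = nr (k ** k + w ** w).
Proof.
move=> sk sw kw; rewrite -nr_starM !sE sk sw conj_i; congr nr.
rewrite !cE kw; lmod C A.
all: have := mul_ii => ii; ring: ii.
Qed.

(** [k] is the real part of the normal element [k + i w], whose squared norm is the right side. *)
Lemma addsq k w : star k = k -> star w = w -> k # w -> nr k ^+ 2 <= nr (k ** k + w ** w).
Proof.
move=> sk sw kw; rewrite -normal_norm //; rewrite ler_pXn2r ?nnegrE ?nr_ge0 //.
have E : k = (2^-1 : C) *: ((k + 'i *: w) + star (k + 'i *: w)).
  by rewrite !sE sk sw conj_i; lmod C A.
rewrite {1}E nrZ ca_half; have := nrD (k + 'i *: w) (star (k + 'i *: w)).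
by rewrite nr_star; lra.
Qed.

(** With [b] the square root of [1 - a a], the element [u = a + i b] has norm at most 1, and
    [1 - a a = 1/2 - (u u + star (u u)) / 4]. *)
Lemma sq_sub_norm a : star a = a -> nr a <= 1 -> nr (one - a ** a) <= 1.
Proof.
move=> sa a1.
have n2 : nr (a ** a) <= 1 by rewrite nr_sqr_sa // expr_le1 ?nr_ge0.
have [|b [sb bb _ bc]] := @sqrt_one_minus (a ** a) _ n2; first by rewrite !sE sa.
have ab : a # b by apply: bc; rewrite cmulA.
pose u := a + 'i *: b.
have u1 : nr u ^+ 2 <= 1 by rewrite normal_norm // bb addrC subrK nr1_le.
have E : one - a ** a = (2^-1 : C) *: one + (- 4^-1 : C) *: (u ** u + star (u ** u)).
  have -> : u ** u + star (u ** u) = (2 : C) *: (a ** a - b ** b).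
    rewrite /u !sE sa sb conj_i !cE ab; lmod C A; have := mul_ii => ii; ring: ii.
  by rewrite bb; lmod C A.
have c4 : ca (- 4^-1 : C) = 4^-1.
  by rewrite caN caV -[4%:R](rmorph_nat (real_complex R)) ca_real normr_nat.
rewrite E; apply: le_trans (nrD _ _) _; rewrite !nrZ ca_half c4.
have := nrD (u ** u) (star (u ** u)); rewrite nr_star; have := nrM u u.
by have := nr1_le A; rewrite -expr2; lra.
Qed.

Lemma positive_sq a : star a = a -> positive (a ** a).
Proof.
move=> sa; split; first by rewrite sE sa.
exists (nr a ^+ 2); first by rewrite exprn_ge0 // nr_ge0.
have [e|n0] := eqVneq (nr a) 0.
  by rewrite (nr_eq0 e) cE subr0 nr0 expr0n scale0r nr0.
have p : 0 < nr a by rewrite lt0r n0 nr_ge0.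
have pC : (nr a)%:C != 0 :> C by rewrite (inj_eq (@complexI R)).
pose b := ((nr a)^-1)%:C *: a.
have := @sq_sub_norm b; rewrite /b sE sa conj_real nrZ ca_real gtr0_norm ?invr_gt0 // mulVf //.
move=> /(_ erefl (lexx _)) h.
have -> : (nr a ^+ 2)%:C *: one - a ** a =
    (nr a ^+ 2)%:C *: (one - (((nr a)^-1)%:C *: a) ** (((nr a)^-1)%:C *: a)).
  rewrite !cE rmorphXn fmorphV /=; lmod C A.
rewrite nrZ ca_real ger0_norm ?exprn_ge0 ?nr_ge0 // -[leRHS]mulr1 ler_wpM2l // exprn_ge0 //.
exact: nr_ge0.
Qed.

(* The top of the spectrum of a square is its norm. *)
Lemma not_invertible_top k (s : R) : star k = k -> 0 < s -> nr (k ** k) = s ->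
  ~ invertible (s%:C *: one - k ** k).
Proof.
have N1 k1 : star k1 = k1 -> nr (k1 ** k1) = 1 -> ~ invertible (one - k1 ** k1).
  move=> sk n1 [c [cm mc]]; set m := one - k1 ** k1 in cm mc.
  have sm : star m = m by rewrite /m !sE sk.
  have sc : star c = c.
    have := congr1 star cm; rewrite starM sm star1 => /(congr1 (cmul c)).
    by rewrite cmulA cm cmul1l cmul1r.
  have [||d [sd dd _ dc]] := @sqrt_one_minus (k1 ** k1); rewrite ?n1 // ?sE ?sk //.
  have cinv x : x # m -> x # c.
    move=> xm; rewrite -[x ** c]cmul1l -cm -cmulA [m ** _]cmulA -xm.
    by rewrite -[_ ** m ** c]cmulA mc cmul1r.
  have comm_k x : x # k1 -> x # m.
    by move=> xk; apply: commD; [exact: comm1|apply: commN; exact: commM].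
  have km : k1 # m by apply: comm_k.
  have kd : k1 # d by apply: dc; rewrite cmulA.
  have kc : k1 # c by exact: cinv.
  have dm : d # m by apply: comm_k; rewrite kd.
  have dcc : d # c by exact: cinv.
  (* Let [d] and [f] be the roots of [m] and of [1 - e c]. Then [d f] squares to [m - e], so [k1 k1]
     and the square of [d f] add up to [1 - e], of norm below 1, whereas [addsq] bounds that norm
     from below by 1. *)
  pose e := (nr c + 1)^-1.
  have c1 : 0 < nr c + 1 by rewrite ltr_wpDl // nr_ge0.
  have e0 : 0 < e by rewrite invr_gt0.
  have [||f [sf ff _ fc]] := @sqrt_one_minus (e%:C *: c).
  - by rewrite sE sc conj_real.
  - by rewrite nrZ ca_real gtr0_norm // ler_pdivrMl // mulr1 lerDl.
  have kf : k1 # f by apply: fc; exact: commZ.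
  have df : d # f by apply: fc; exact: commZ.
  have := @addsq k1 (d ** f) sk; rewrite sE sd sf -df => /(_ erefl (commM kd kf)).
  have -> : d ** f ** (d ** f) = m - e%:C *: one.
    rewrite -cmulA [f ** (d ** f)]cmulA -df -cmulA ff !cmulA dd -/m.
    by rewrite cmulDr cmulNr cmulZr cmul1r mc.
  have -> : k1 ** k1 + (m - e%:C *: one) = (1 - e)%:C *: one.
    by rewrite /m rmorphB rmorph1; lmod C A.
  rewrite -nr_sqr_sa // n1 nrZ ca_real ger0_norm; last first.
    by rewrite subr_ge0 invf_le1 // lerDr nr_ge0.
  have e1 : e <= 1 by rewrite invf_le1 // lerDr nr_ge0.
  have := nr1_le A; have := nr_ge0 one; nra.
move=> sk s0 ns inv.
have sC : s%:C != 0 :> C by rewrite (inj_eq (@complexI R)) gt_eqF.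
pose k1 := ((Num.sqrt s)^-1)%:C *: k.
have kk : k1 ** k1 = (s%:C)^-1 *: (k ** k).
  rewrite /k1 !cE scalerA -rmorphM -invfM -expr2 sqr_sqrtr ?ltW // fmorphV //.
apply: (N1 k1); first by rewrite sE sk conj_real.
  by rewrite kk nrZ caV ca_real gtr0_norm // ns mulVf // gt_eqF.
have -> : one - k1 ** k1 = (s%:C)^-1 *: (s%:C *: one - k ** k).
  by rewrite scalerBr scalerA mulVf // scale1r kk.
by apply: invertibleZ => //; rewrite invr_eq0.
Qed.

(* A Jordan decomposition [x* x = r - m] with [r m = m^2 / 2 >= 0] reduces this
   to the case where [y* y] is negative, [y = x m]; then [y y*] is positive, while
   [y* y] and [y y*] have the same nonzero spectrum, so [y = 0]. *)
Lemma positive_star_mul x : positive (star x ** x).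
Proof.
set h := star x ** x; have sh : star h = h by rewrite !sE.
have [r [sr rr [_ pr] rc]] := positive_sqrt (positive_sq sh).
have hr : h # r by apply: rc; rewrite cmulA.
pose m := r - h; have sm : star m = m by rewrite starD starN sr sh.
have hm : h # m by apply: commD => //; apply: commN.
have rm : r # m by apply: commD => //; apply: commN.
have mm : m ** m = (- 2 : C) *: (h ** m).
  by rewrite /m !cE rr hr; lmod C A.
have rmE : r ** m = (2^-1 : C) *: (m ** m).
  by rewrite mm /m !cE rr hr; lmod C A.
have [q [sq qq _ qc]] := positive_sqrt (conj sr pr : positive r).
have qm : q # m by apply/esym/qc.
pose y := x ** m; pose k := q ** m.
have sk : star k = k by rewrite starM sq sm -qm.
have kk : k ** k = r ** (m ** m).
  by rewrite /k -cmulA [m ** (q ** m)]cmulA -qm -cmulA [q ** (q ** _)]cmulA qq.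
have yy : star y ** y = - (k ** k).
  rewrite /y sE sm -cmulA [star x ** _]cmulA -/h cmulA -hm -cmulA kk.
  have -> : h ** (m ** m) = (- 2^-1 : C) *: (m ** m ** m).
    by rewrite cmulA mm cmulZl; lmod C A.
  by rewrite cmulA rmE !cE; lmod C A.
(* For [y = a + i b] one has [y ** star y + star y ** y = 2 (a a + b b)]; as [star y ** y] equals
   [- k k], this writes [y ** star y] as a sum of squares. *)
have py : positive (y ** star y).
  pose a := (2^-1 : C) *: (y + star y); pose b := (2^-1 : C) *: ('i *: (star y - y)).
  have sa : star a = a by rewrite starZ starD starK conj_half addrC.
  have sb : star b = b.
    by rewrite !starZ starD starN starK conj_half conj_i scaleNr -scalerN opprB.
  have -> : y ** star y = (2%:R%:C : C) *: (a ** a + b ** b) + k ** k.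
    rewrite -[k ** k]opprK -yy /a /b rmorph_nat !cE; lmod C A; have := mul_ii => ii; by field: ii.
  apply: positiveD; last exact: positive_sq.
  by apply: positiveZ; [exact: ler0n|apply: positiveD; exact: positive_sq].
clearbody y.
have y0 : y = 0.
  apply: contrapT => /nr_gt0 yp.
  have nk : nr (k ** k) = nr y ^+ 2 by rewrite -nr_starM yy nrN.
  apply: (@not_invertible_top k (nr y ^+ 2)) => //; first exact: exprn_gt0.
  set s := nr y ^+ 2; have s0 : 0 < s by exact: exprn_gt0.
  have [c [e f]] := positive_inv s0 py.
  have sC : s%:C != 0 :> C by rewrite (inj_eq (@complexI R)) gt_eqF.
  have -> : s%:C *: one - k ** k = s%:C *: one + star y ** y by rewrite yy.
  (* The inverse [c] of [s + y ** star y] yields one of [s + star y ** y], by the identity behind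
     the equality of the nonzero spectra. *)
  exists ((s%:C)^-1 *: (one - star y ** c ** y)); split.
    have h1 : c ** y ** star y = one - s%:C *: c.
      by rewrite -e -cmulA !cE; lmod C A.
    have h2 : star y ** c ** y ** star y ** y = star y ** y - s%:C *: (star y ** c ** y).
      have -> : star y ** c ** y ** star y ** y = star y ** (c ** y ** star y) ** y.
        by rewrite !cmulA.
      by rewrite h1 !cE.
    by rewrite !cE !cmulA h2; lmod C A.
  have h1 : y ** star y ** c = one - s%:C *: c.
    by rewrite -f !cE; lmod C A.
  rewrite !cE !cmulA.
  have -> : star y ** y ** star y ** c ** y = star y ** (y ** star y ** c) ** y.
    by rewrite !cmulA.
  by rewrite h1 !cE; lmod C A.
have m4 : m = 0.
  have e : m ** m ** m = 0.
    have : star y ** y = 0 by rewrite y0 cE.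
    rewrite yy kk cmulA rmE cmulZl => /eqP; rewrite oppr_eq0 scaler_eq0 invr_eq0 pnatr_eq0 /=.
    by move=> /eqP.
  have e2 : nr (m ** m) = 0.
    have : nr ((m ** m) ** (m ** m)) = 0 by rewrite cmulA e cE nr0.
    by rewrite nr_sqr_sa ?starM ?sm // => /eqP; rewrite sqrf_eq0 => /eqP.
  by apply: nr_eq0; apply/eqP; rewrite -sqrf_eq0 -nr_sqr_sa // e2.
have -> : h = r by apply/eqP; rewrite eq_sym -subr_eq0 -/m m4.
exact: (conj sr pr).
Qed.

(** The real functional comes from Hahn-Banach at [h + s], where [h = star a ** a] and [s] is its
    norm. That element has norm [2 s], since otherwise [s - h] would be invertible; the bounds
    [f h <= s] and [f 1 <= 1] are therefore equalities. Positivity follows from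
    [1 - f (b b) <= nr (1 - b b) <= 1] for self-adjoint [b] in the unit ball. *)
Lemma exists_state a : exists f : A -> C,
  [/\ forall (s : C) x y, f (s *: x + y) = s * f x + f y,
      forall x, 0 <= f (star x ** x),
      f (star a ** a) = (nr a ^+ 2)%:C &
      f one = 1 \/ a = 0 ].
Proof.
have [->|/nr_gt0 a0] := pselect (a = 0).
  exists (fun=> 0); split; rewrite ?nr0 ?expr0n //; last by right.
  by move=> s x y; rewrite mulr0 addr0.
pose s := nr a ^+ 2; have s0 : 0 < s by exact: exprn_gt0.
set h := star a ** a; have sh : star h = h by rewrite !sE.
have nh : nr h = s by rewrite nr_starM.
have [k [sk kk _ _]] := positive_sqrt (positive_star_mul a); rewrite -/h in kk.
have [f [fD fZ fn fs]] := hahn_banach (h + s%:C *: one).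
have n2 : nr (h + s%:C *: one) = 2 * s.
  apply/eqP; rewrite eq_le; apply/andP; split.
    rewrite (le_trans (nrD _ _)) // nrZ ca_real gtr0_norm // nh.
    by have := nr1_le A; nra.
  rewrite leNgt; apply/negP => /neumann inv.
  apply: (@not_invertible_top k s sk s0); first by rewrite kk nh.
  rewrite kk; move: inv; congr invertible.
  by rewrite rmorphM rmorph_nat; lmod C A.
have f1 : f one <= 1 := le_trans (fn _) (nr1_le A).
have [fh f1e] : f h = s /\ f one = 1.
  have := fn h; rewrite nh; move: fs; rewrite n2 fD fZ; split; nra.
have f0 : f 0 = 0 by have := fD 0 0; rewrite addr0; lra.
have fN x : f (- x) = - f x by have := fD x (- x); rewrite subrr f0; lra.
(* Composing with the real part gives a functional that vanishes on [i x] for self-adjoint [x]; [F]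
   is its complexification and agrees with [f] on self-adjoint elements. *)
pose g x := f ((2^-1 : C) *: (x + star x)).
have gD x y : g (x + y) = g x + g y.
  by rewrite /g -fD; congr f; rewrite sE; lmod C A.
have gZ (r : R) x : g (r%:C *: x) = r * g x.
  by rewrite /g -fZ; congr f; rewrite sE conj_real; lmod C A.
have gsa x : star x = x -> g x = f x.
  by move=> e; rewrite /g e; congr f; lmod C A.
have gi x : star x = x -> g ('i *: x) = 0.
  by move=> e; rewrite /g sE e conj_i scaleNr subrr scaler0 f0.
pose F (x : A) : C := (g x)%:C - 'i * (g ('i *: x))%:C.
have FD x y : F (x + y) = F x + F y.
  by rewrite /F scalerDr !gD !rmorphD /=; ring.
have FR (r : R) x : F (r%:C *: x) = r%:C * F x.
  by rewrite /F scalerA [_ * r%:C]mulrC -scalerA !gZ !rmorphM /=; ring.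
have Fi x : F ('i *: x) = 'i * F x.
  rewrite /F scalerA -expr2 sqrCi scaleN1r.
  have -> : g (- x) = - g x by have := gZ (-1) x; rewrite rmorphN1 scaleN1r mulN1r.
  have := sqrCi C; rewrite expr2 rmorphN /= mulrBr mulrA => ->; ring.
have Fsa x : star x = x -> F x = (f x)%:C.
  by move=> e; rewrite /F gsa // gi // rmorph0 mulr0 subr0.
exists F; split.
- move=> z x y; rewrite FD {1}[z]complexE scalerDl FD FR -scalerA complexiE Fi FR -complexiE.
  by rewrite {3}[z]complexE; ring.
- move=> x; rewrite Fsa ?sE // ler0c.
  have [t [st tt _ _]] := positive_sqrt (positive_star_mul x); rewrite -tt.
  have [e|n0] := eqVneq (nr t) 0; first by rewrite (nr_eq0 e) cE f0.
  have p : 0 < nr t by rewrite lt0r n0 nr_ge0.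
  pose b := ((nr t)^-1)%:C *: t.
  have sb : star b = b by rewrite sE st conj_real.
  have := @sq_sub_norm b sb; rewrite nrZ ca_real gtr0_norm ?invr_gt0 // mulVf // => /(_ (lexx _)) b1.
  have := le_trans (fn _) b1; rewrite fD f1e fN => h2.
  have : 0 <= f (b ** b) by lra.
  rewrite /b !cE scalerA -rmorphM fZ pmulr_rge0 // mulr_gt0 // invr_gt0 //.
- by rewrite Fsa // fh.
- by left; rewrite Fsa ?star1 // f1e.
Qed.

End Kaplansky.

(** * Square-summable families *)

Section RealSeq.
Variable R : realType.
(** The limit is the supremum of the eventual lower bounds of the sequence. *)
Lemma real_cauchy (u : nat -> R) :
  (forall e, 0 < e -> exists N, forall m n, (N <= m)%N -> (N <= n)%N -> `|u m - u n| < e) ->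
  exists l, forall e, 0 < e -> exists N, forall n, (N <= n)%N -> `|l - u n| < e.
Proof.
move=> cu; pose E := [set x | exists N, forall n, (N <= n)%N -> x <= u n].
have main e : 0 < e -> exists N, (forall n, (N <= n)%N -> `|u N - u n| < e) /\
    E (u N - e) /\ ubound E (u N + e).
  move=> /cu [N hN]; exists N; split; first by move=> n; exact: hN.
  split; first by exists N => n /(hN _ _ (leqnn _)); rewrite ltr_norml => /andP[]; lra.
  move=> x [N' hN']; have := hN' _ (leq_maxr N N').
  have := hN _ _ (leqnn _) (leq_maxl N N'); rewrite ltr_norml => /andP[]; lra.
have [N0 [_ [E0 E1]]] := main 1 ltr01.
have hs : has_sup E by split; [exists (u N0 - 1)|exists (u N0 + 1)].
exists (sup E) => e e0; have e2 : 0 < e / 2 by rewrite divr_gt0.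
have [N [hN [a b]]] := main _ e2; exists N => n /hN.
have := ub_le_sup hs.2 a; have := ge_sup hs.1 b.
rewrite !ltr_norml => h1 h2 /andP[h3 h4]; apply/andP; split; lra.
Qed.

Lemma complex_cauchy (u : nat -> R[i]) :
  (forall e, 0 < e -> exists N, forall m n, (N <= m)%N -> (N <= n)%N -> ca (u m - u n) < e) ->
  exists l, forall e, 0 < e -> exists N, forall n, (N <= n)%N -> ca (l - u n) < e.
Proof.
move=> cu.
have [|a ha] := @real_cauchy (fun n => complex.Re (u n)).
  move=> e /cu [N hN]; exists N => m n Nm Nn; apply: le_lt_trans (hN m n Nm Nn).
  by rewrite (le_trans _ (ca_Re _)) // ReD ReN.
have [|b hb] := @real_cauchy (fun n => complex.Im (u n)).
  move=> e /cu [N hN]; exists N => m n Nm Nn; apply: le_lt_trans (hN m n Nm Nn).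
  rewrite (le_trans _ (ca_Im _)) // ImD; case: (u n) => [x y] //=.
exists (Complex a b) => e e0; have e2 : 0 < e / 2 by rewrite divr_gt0.
have [N hN] := ha _ e2; have [N' hN'] := hb _ e2.
exists (maxn N N') => n; rewrite geq_max => /andP[/hN h /hN' h'].
by apply: le_lt_trans (ca_ReIm _) _; move: h h'; case: (u n) => [x y] /=; lra.
Qed.
End RealSeq.

Section Sums.
Variables (R : realType) (X : choiceType).
Local Notation C := R[i].
Implicit Types (A B : {fset X}).

Lemma sum_sub (K : numDomainType) (F : X -> K) (s t : seq X) : uniq s -> uniq t -> {subset s <= t} ->
  (forall x, 0 <= F x) -> \sum_(x <- s) F x <= \sum_(x <- t) F x.
Proof.
move=> us ut st F0; rewrite [leRHS](bigID (mem s)) /=.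
have -> : \sum_(x <- t | x \in s) F x = \sum_(x <- s) F x.
  rewrite -big_filter; apply: perm_big; apply: uniq_perm => //; first exact: filter_uniq.
  by move=> x; rewrite mem_filter andb_idr //; exact: st.
by rewrite lerDl sumr_ge0.
Qed.

Lemma fsum_le (F : X -> R) A B : fsubset A B -> (forall x, 0 <= F x) ->
  \sum_(x <- A) F x <= \sum_(x <- B) F x.
Proof. by move=> /fsubsetP AB F0; apply: sum_sub => //; exact: fset_uniq. Qed.

(** Convergence along the net of finite subsets, that is, unconditional summation over an index set
    without order. *)
Definition has_sum (a : X -> C) (l : C) := forall e : R, 0 < e ->
  exists A, forall B, fsubset A B -> ca (\sum_(x <- B) a x - l) < e.

Lemma has_sum_uniq a l l' : has_sum a l -> has_sum a l' -> l = l'.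
Proof.
move=> h h'; apply/eqP; rewrite -subr_eq0; apply/eqP/ca_eq0/eqP.
rewrite eq_le ca_ge0 andbT; apply/ler_addgt0Pl => e e0; rewrite addr0.
have e2 : 0 < e / 2 by rewrite divr_gt0.
have [A hA] := h _ e2; have [A' hA'] := h' _ e2.
have a1 := hA _ (fsubsetUl A A'); have a2 := hA' _ (fsubsetUr A A').
set S := \sum_(x <- _) _ in a1 a2.
have := caD (- (S - l)) (S - l'); rewrite caN.
have -> : - (S - l) + (S - l') = l - l' by ring.
lra.
Qed.

Lemma has_sumD a b l m : has_sum a l -> has_sum b m -> has_sum (fun x => a x + b x) (l + m).
Proof.
move=> h h' e e0; have e2 : 0 < e / 2 by rewrite divr_gt0.
have [A hA] := h _ e2; have [A' hA'] := h' _ e2.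
exists (fsetU A A') => B; rewrite fsubUset => /andP[/hA a1 /hA' a2].
rewrite big_split /=; set S := \sum_(x <- _) _ in a1 *; set T := \sum_(x <- _) _ in a2 *.
have -> : S + T - (l + m) = (S - l) + (T - m) by ring.
by have := caD (S - l) (T - m); lra.
Qed.

Lemma has_sumZ c a l : has_sum a l -> has_sum (fun x => c * a x) (c * l).
Proof.
move=> h e e0; have c1 : 0 < ca c + 1 by rewrite ltr_wpDl ?ca_ge0.
have [A hA] := h _ (divr_gt0 e0 c1); exists A => B /hA.
rewrite -mulr_sumr -mulrBr caM ltr_pdivlMr // mulrDr mulr1 mulrC.
have := ca_ge0 (\sum_(x <- B) a x - l); lra.
Qed.

Lemma has_sum_conj a l : has_sum a l -> has_sum (fun x => (a x)^*) l^*.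
Proof.
move=> h e /h [A hA]; exists A => B /hA.
by rewrite -rmorph_sum -rmorphB ca_conj.
Qed.


Definition nsup (F : X -> R) : R := sup [set \sum_(x <- B) F x | B in [set: {fset X}]].

Section NonnegSum.
Variables (F : X -> R) (M : R).
Hypotheses (F0 : forall x, 0 <= F x) (FM : forall B, \sum_(x <- B) F x <= M).
Lemma nsup_has : has_sup [set \sum_(x <- B) F x | B in [set: {fset X}]].
Proof. by split; [exists (\sum_(x <- fset0) F x), fset0|exists M => _ [B _ <-]; exact: FM]. Qed.
Lemma le_nsup B : \sum_(x <- B) F x <= nsup F.
Proof. by apply: ub_le_sup; [exact: nsup_has.2|exists B]. Qed.
Lemma nsup_le : nsup F <= M.
Proof. by apply: ge_sup; [exact: nsup_has.1|move=> _ [B _ <-]; exact: FM]. Qed.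
Lemma nsup_adh e : 0 < e -> exists A, forall B, fsubset A B -> nsup F - e < \sum_(x <- B) F x.
Proof.
move=> e0; have [_ [A _ <-] h] := sup_adherent e0 nsup_has.
by exists A => B AB; apply: lt_le_trans h _; exact: fsum_le.
Qed.
Lemma has_sum_nsup : has_sum (fun x => (F x)%:C) (nsup F)%:C.
Proof.
move=> e /nsup_adh [A hA]; exists A => B /hA h.
rewrite -(rmorph_sum (real_complex R)) -rmorphB /= ca_real ltr_norml.
by have := le_nsup B; lra.
Qed.
End NonnegSum.

Definition abs_sum (a : X -> C) := exists M : R, forall B, \sum_(x <- B) ca (a x) <= M.

(** For a real [F] with [|F| <= |a|], both [|a|] and [|a| + F] are nonnegative with bounded finite
    sums, and the sum of [F] is the difference of theirs. This is applied to the real and imaginary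
    parts. *)
Lemma has_sum_exists a : abs_sum a -> exists l, has_sum a l.
Proof.
move=> [M hM].
have c0 x : 0 <= ca (a x) by exact: ca_ge0.
have h0 := has_sum_nsup c0 hM.
have pos (F : X -> R) : (forall x, `|F x| <= ca (a x)) ->
    exists l, has_sum (fun x => (F x)%:C) l.
  move=> hF.
  have F0 x : 0 <= ca (a x) + F x by have := hF x; rewrite ler_norml; lra.
  have FM B : \sum_(x <- B) (ca (a x) + F x) <= M + M.
    rewrite (le_trans _ (lerD (hM B) (hM B))) // -big_split /= ler_sum // => x _.
    by have := hF x; rewrite ler_norml; lra.
  have h1 := has_sum_nsup F0 FM.
  eexists; have := has_sumD h1 (has_sumZ (-1) h0).
  by congr has_sum; apply/funext => x; rewrite rmorphD /=; ring.
have [l hl] := pos _ (fun x => ca_Re (a x)); have [m hm] := pos _ (fun x => ca_Im (a x)).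
exists (l + 'i * m); have := has_sumD hl (has_sumZ 'i hm).
by congr has_sum; apply/funext => x; rewrite [RHS]complexE complexiE.
Qed.

End Sums.

(** * Positive semidefinite forms and the Cauchy-Schwarz inequality *)

Section InnerProduct.
Variables (R : realType) (V : lmodType R[i]) (ip : V -> V -> R[i]).
Hypotheses (ipP : forall (a : R[i]) x y z, ip (a *: x + y) z = a * ip x z + ip y z)
  (ipC : forall x y, ip y x = (ip x y)^*)
  (ip_ge0 : forall x, 0 <= ip x x).

Lemma ip0l z : ip 0 z = 0.
Proof. by have := ipP (-1) 0 0 z; rewrite scaler0 addr0 mulN1r addNr. Qed.
Lemma ipDl x y z : ip (x + y) z = ip x z + ip y z.
Proof. by have := ipP 1 x y z; rewrite scale1r mul1r. Qed.
Lemma ipZl a x z : ip (a *: x) z = a * ip x z.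
Proof. by have := ipP a x 0 z; rewrite addr0 ip0l addr0. Qed.
Lemma ipDr x y z : ip z (x + y) = ip z x + ip z y.
Proof. by rewrite [LHS]ipC ipDl rmorphD /= -!ipC. Qed.
Lemma ipZr a x z : ip z (a *: x) = a^* * ip z x.
Proof. by rewrite [LHS]ipC ipZl rmorphM /= -!ipC. Qed.
Definition ipE := (ipDl, ipZl, ipDr, ipZr).

(** Only a seminorm: [ip] may be degenerate, so the same estimates serve for Hilbert spaces and for
    the form attached to a state. *)
Definition ipn x : R := Num.sqrt (complex.Re (ip x x)).
Lemma ipn_ge0 x : 0 <= ipn x. Proof. exact: sqrtr_ge0. Qed.
Lemma ip_self x : ip x x = (ipn x ^+ 2)%:C.
Proof.
rewrite /ipn sqr_sqrtr; first exact: nonneg_Re.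
by rewrite -ler0c -nonneg_Re.
Qed.
Lemma ipnZ a x : ipn (a *: x) = ca a * ipn x.
Proof.
apply/eqP; rewrite -(eqrXn2 (n := 2)) // ?mulr_ge0 ?ipn_ge0 ?ca_ge0 //; apply/eqP/(@complexI R).
by rewrite -ip_self !ipE mulrA ca_sqr ip_self -rmorphM exprMn.
Qed.

Lemma cauchy_schwarz x y : ca (ip x y) <= ipn x * ipn y.
Proof.
have [xy0|xy0] := eqVneq (ip x y) 0; first by rewrite xy0 ca0 mulr_ge0 ?ipn_ge0.
set c := ip x y; set p := ca c.
have p0 : 0 < p by rewrite lt0r ca_ge0 andbT; apply/eqP => /ca_eq0 /eqP; rewrite (negbTE xy0).
pose X := ipn x; pose Y := ipn y.
(* positivity of |t u x - y|^2, where u = c^* / |c| *)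
have key (t : R) : 0 <= t ^+ 2 * X ^+ 2 - 2 * t * p + Y ^+ 2.
  pose u : R[i] := c^* / p%:C.
  have pC : p%:C != 0 :> R[i] by rewrite (inj_eq (@complexI R)) gt_eqF.
  have cc : c * c^* = p%:C * p%:C by rewrite ca_sqr expr2 rmorphM.
  have cu : u * c = p%:C by rewrite /u mulrAC [c^* * c]mulrC cc mulfK.
  have uu : u * u^* = 1.
    by rewrite /u rmorphM fmorphV /= conjCK conj_real mulrACA [c^* * c]mulrC cc; field.
  have cu' : u^* * c^* = p%:C by rewrite -[RHS]conj_real -cu; exact/esym/rmorphM.
  have E : ip ((t%:C * u) *: x + (-1) *: y) ((t%:C * u) *: x + (-1) *: y) =
      (t ^+ 2 * X ^+ 2 - 2 * t * p + Y ^+ 2)%:C.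
    rewrite !ipE (ipC x y) -/c (ip_self x) (ip_self y) rmorphM rmorphN1 /= conj_real -/X -/Y.
    transitivity (t%:C * t%:C * (u * u^*) * (X ^+ 2)%:C - t%:C * (u^* * c^*) - t%:C * (u * c) + (Y ^+ 2)%:C).
      by ring.
    by rewrite uu cu cu' !rmorphD !rmorphN !rmorphM /= rmorph_nat; ring.
  by have := ip_ge0 ((t%:C * u) *: x + (-1) *: y); rewrite E ler0c.
have X0 : 0 <= X := ipn_ge0 x; have Y0 : 0 <= Y := ipn_ge0 y.
rewrite leNgt; apply/negP => h.
(* For [X = 0] the expression is affine in [t] and becomes negative; otherwise its minimum is at
   [p / X^2]. *)
have [e|Xn] := eqVneq X 0.
  have := key ((Y ^+ 2 + 1) / p); rewrite e expr0n mulr0 add0r.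
  have -> : 2 * ((Y ^+ 2 + 1) / p) * p = 2 * (Y ^+ 2 + 1) by field; rewrite gt_eqF.
  have := sqr_ge0 Y; lra.
have Xp : 0 < X by rewrite lt0r Xn.
have := key (p / X ^+ 2).
have -> : (p / X ^+ 2) ^+ 2 * X ^+ 2 - 2 * (p / X ^+ 2) * p + Y ^+ 2 = (X ^+ 2 * Y ^+ 2 - p ^+ 2) / X ^+ 2.
  by field.
rewrite pmulr_lge0 ?invr_gt0 ?exprn_gt0 //.
have : (X * Y) ^+ 2 < p ^+ 2 by rewrite ltr_pXn2r // ?nnegrE ?mulr_ge0 // ltW.
rewrite exprMn; lra.
Qed.

Lemma ipnD x y : ipn (x + y) <= ipn x + ipn y.
Proof.
rewrite -(ler_pXn2r (n := 2)) // ?nnegrE ?addr_ge0 ?ipn_ge0 //.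
have : (ipn (x + y) ^+ 2)%:C = (ipn x ^+ 2)%:C + (ipn y ^+ 2)%:C + (ip x y + (ip x y)^*).
  by rewrite -!ip_self !ipE (ipC x y); ring.
move=> /(congr1 (@complex.Re R)); rewrite !ReD Re_conj /= => ->.
have := cauchy_schwarz x y; have := ca_Re (ip x y); rewrite ler_norml.
by have := ipn_ge0 x; have := ipn_ge0 y; nra.
Qed.
End InnerProduct.

(** * The Hilbert space of square-summable functions *)

Section L2.
Variables (R : realType) (X : choiceType).
Local Notation C := R[i].
Definition sq_summable (f : X -> C) := exists M : R, forall B : {fset X}, \sum_(x <- B) ca (f x) ^+ 2 <= M.

Record l2 := L2 { l2f :> X -> C; l2P : sq_summable l2f }.

HB.instance Definition _ := gen_eqMixin l2.
HB.instance Definition _ := gen_choiceMixin l2.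

Lemma l2_ext (f g : l2) : (forall x, f x = g x) -> f = g.
Proof.
case: f g => [f hf] [g hg] /= /funext e; subst g.
by congr L2; exact: Prop_irrelevance.
Qed.

Lemma sqZ_subproof a (f : l2) : sq_summable (fun x => a * f x).
Proof.
have [M hM] := l2P f; exists (ca a ^+ 2 * M) => B.
under eq_bigr do rewrite caM exprMn.
by rewrite -mulr_sumr ler_wpM2l ?sqr_ge0.
Qed.
Lemma sqD_subproof (f g : l2) : sq_summable (fun x => f x + g x).
Proof.
have [M hM] := l2P f; have [N hN] := l2P g; exists (2 * M + 2 * N) => B.
have := hM B; have := hN B => a b.
apply: le_trans (_ : \sum_(x <- B) (2 * ca (f x) ^+ 2 + 2 * ca (g x) ^+ 2) <= _); last first.
  by rewrite big_split /= -!mulr_sumr; lra.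
apply: ler_sum => x _; have := caD (f x) (g x); have := ca_ge0 (f x + g x).
have := sqr_ge0 (ca (f x) - ca (g x)); nra.
Qed.
Lemma sq0_subproof : sq_summable (fun=> 0).
Proof. by exists 0 => B; rewrite big1 // => x _; rewrite ca0 expr0n. Qed.

Definition l2scale a f := L2 (sqZ_subproof a f).
Definition l2add f g := L2 (sqD_subproof f g).
Definition l2zero := L2 sq0_subproof.
Definition l2opp f := l2scale (-1) f.

Lemma l2addA : associative l2add. Proof. by move=> f g h; apply: l2_ext => x /=; rewrite addrA. Qed.
Lemma l2addC : commutative l2add. Proof. by move=> f g; apply: l2_ext => x /=; rewrite addrC. Qed.
Lemma l2add0 : left_id l2zero l2add. Proof. by move=> f; apply: l2_ext => x /=; rewrite add0r. Qed.
Lemma l2addN : left_inverse l2zero l2opp l2add.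
Proof. by move=> f; apply: l2_ext => x /=; rewrite mulN1r addNr. Qed.
HB.instance Definition _ := GRing.isZmodule.Build l2 l2addA l2addC l2add0 l2addN.

Lemma l2scaleA a b (f : l2) : l2scale a (l2scale b f) = l2scale (a * b) f.
Proof. by apply: l2_ext => x /=; rewrite mulrA. Qed.
Lemma l2scale1 : left_id 1 l2scale. Proof. by move=> f; apply: l2_ext => x /=; rewrite mul1r. Qed.
Lemma l2scaleDr : right_distributive l2scale +%R.
Proof. by move=> a f g; apply: l2_ext => x /=; rewrite mulrDr. Qed.
Lemma l2scaleDl (f : l2) : {morph l2scale^~ f : a b / a + b}.
Proof. by move=> a b; apply: l2_ext => x /=; rewrite mulrDl. Qed.
HB.instance Definition _ := GRing.Zmodule_isLmodule.Build C l2 l2scaleA l2scale1 l2scaleDr l2scaleDl.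

Lemma l2E_D (f g : l2) x : (f + g) x = f x + g x. Proof. by []. Qed.
Lemma l2E_Z a (f : l2) x : (a *: f) x = a * f x. Proof. by []. Qed.
Lemma l2E_0 x : (0 : l2) x = 0. Proof. by []. Qed.
Lemma l2E_N (f : l2) x : (- f) x = - f x. Proof. by rewrite -[LHS]/(-1 * f x) mulN1r. Qed.
Lemma l2E_sum (I : Type) (r : seq I) (P : pred I) (F : I -> l2) x :
  (\sum_(i <- r | P i) F i) x = \sum_(i <- r | P i) F i x.
Proof. by elim/big_rec2: _ => [|i a b _ <-]. Qed.

Lemma l2_abs (f g : l2) : abs_sum (fun x => f x * (g x)^*).
Proof.
have [M hM] := l2P f; have [N hN] := l2P g; exists (M + N) => B.
apply: le_trans (lerD (hM B) (hN B)); rewrite -big_split /=; apply: ler_sum => x _.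
rewrite caM ca_conj; have := sqr_ge0 (ca (f x) - ca (g x)).
by have := sqr_ge0 (ca (f x)); have := sqr_ge0 (ca (g x)); nra.
Qed.

Definition l2ip (f g : l2) : C := xget 0 [set l | has_sum (fun x => f x * (g x)^*) l].
Lemma l2ipP (f g : l2) : has_sum (fun x => f x * (g x)^*) (l2ip f g).
Proof. by have [l hl] := has_sum_exists (l2_abs f g); apply: (@xgetPex _ 0); exists l. Qed.
Lemma l2ip_eq (f g : l2) l : has_sum (fun x => f x * (g x)^*) l -> l2ip f g = l.
Proof. exact: has_sum_uniq (l2ipP f g). Qed.

Definition l2sq (f : l2) : R := nsup (fun x => ca (f x) ^+ 2).
Lemma l2sq_le (f : l2) (B : {fset X}) : \sum_(x <- B) ca (f x) ^+ 2 <= l2sq f.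
Proof. by have [M hM] := l2P f; apply: le_nsup hM _. Qed.
Lemma l2sq_sup (f : l2) M : (forall B : {fset X}, \sum_(x <- B) ca (f x) ^+ 2 <= M) -> l2sq f <= M.
Proof. exact: nsup_le. Qed.
Lemma l2ip_self (f : l2) : l2ip f f = (l2sq f)%:C.
Proof.
have [M hM] := l2P f; apply: l2ip_eq.
have := has_sum_nsup (fun x => sqr_ge0 (ca (f x))) hM.
by congr has_sum; apply/funext => x; rewrite ca_sqr.
Qed.
Lemma l2sq_ge0 (f : l2) : 0 <= l2sq f.
Proof. by apply: le_trans (l2sq_le f fset0); rewrite sumr_ge0 // => x _; exact: sqr_ge0. Qed.
Lemma l2ipPl (a : C) (f g h : l2) : l2ip (a *: f + g) h = a * l2ip f h + l2ip g h.
Proof.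
apply: l2ip_eq; have := has_sumD (has_sumZ a (l2ipP f h)) (l2ipP g h).
by congr has_sum; apply/funext => x; rewrite l2E_D l2E_Z; ring.
Qed.
Lemma l2ipC (f g : l2) : l2ip g f = (l2ip f g)^*.
Proof.
apply: l2ip_eq; have := has_sum_conj (l2ipP f g).
by congr has_sum; apply/funext => x; rewrite rmorphM /= conjCK mulrC.
Qed.
Lemma l2ip_ge0 (f : l2) : 0 <= l2ip f f. Proof. by rewrite l2ip_self ler0c l2sq_ge0. Qed.

Definition l2norm (f : l2) : C := (ipn l2ip f)%:C.
Lemma l2norm_sq (f : l2) : ipn l2ip f ^+ 2 = l2sq f.
Proof. by rewrite /ipn l2ip_self /= sqr_sqrtr // l2sq_ge0. Qed.
Lemma l2normD (f g : l2) : l2norm (f + g) <= l2norm f + l2norm g.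
Proof. by rewrite -rmorphD lecR (ipnD l2ipPl l2ipC l2ip_ge0). Qed.
Lemma l2normZ a (f : l2) : l2norm (a *: f) = `|a| * l2norm f.
Proof. by rewrite /l2norm (ipnZ l2ipPl l2ipC l2ip_ge0) rmorphM caE. Qed.
Lemma l2norm_eq0 (f : l2) : l2norm f = 0 -> f = 0.
Proof.
move=> /(@complexI R) h; apply: l2_ext => x; apply: ca_eq0; apply/eqP.
rewrite -sqrf_eq0 eq_le sqr_ge0 andbT.
by have := l2sq_le f [fset x]%fset; rewrite big_seq_fset1 -l2norm_sq h expr0n.
Qed.
HB.instance Definition _ := @Lmodule_isNormed.Build C l2 l2norm l2normD l2normZ l2norm_eq0.

Lemma nr_l2 (f : l2) : nr f ^+ 2 = l2sq f. Proof. by rewrite -l2norm_sq. Qed.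
Lemma ca_l2 (f : l2) x : ca (f x) <= nr f.
Proof.
rewrite -(ler_pXn2r (n := 2)) ?nnegrE ?ca_ge0 ?nr_ge0 // nr_l2.
by have := l2sq_le f [fset x]%fset; rewrite big_seq_fset1.
Qed.
Lemma nr_l2_le (f : l2) (M : R) : 0 <= M ->
  (forall B : {fset X}, \sum_(x <- B) ca (f x) ^+ 2 <= M ^+ 2) -> nr f <= M.
Proof. by move=> M0 h; rewrite -(ler_pXn2r (n := 2)) ?nnegrE ?nr_ge0 // nr_l2 l2sq_sup. Qed.

Lemma l2_complete (u : nat -> l2) : cauchy_nr u -> exists l, lim_nr u l.
Proof.
move=> cu.
have /choice[f hf] x : exists l, forall e : R, 0 < e -> exists N, forall n, (N <= n)%N -> ca (l - u n x) < e.
  apply: complex_cauchy => e /cu [N hN]; exists N => m n Nm Nn.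
  by apply: le_lt_trans (hN m n Nm Nn); rewrite -l2E_N -l2E_D; exact: ca_l2.
have tail e : 0 < e -> exists N, forall n, (N <= n)%N -> forall B : {fset X},
    \sum_(x <- B) ca (f x - u n x) ^+ 2 <= e ^+ 2.
  move=> e0; have [N hN] := cu _ e0; exists N => n Nn B.
  apply/ler_addgt0Pl => d d0.
  pose k : R := (size B)%:R + 1; have k0 : 0 < k by rewrite ltr_wpDl.
  (* For [r <= 1], adding [r] to a number at most [e] adds at most [r (1 + 2 e)] to its square; this
     [r] keeps the total excess over [B] below [d]. *)
  pose r := Num.min 1 (d / (k * (1 + 2 * e))).
  have den : 0 < k * (1 + 2 * e) by apply: mulr_gt0 => //; lra.
  have r0 : 0 < r by rewrite lt_min ltr01 divr_gt0.
  have [m [Nm hm]] : exists m, (N <= m)%N /\ forall x, x \in B -> ca (f x - u m x) < r.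
    have [m hm] : exists m, forall x, x \in B -> forall n, (m <= n)%N -> ca (f x - u n x) < r.
      suff H (s : seq X) : exists m, forall x, x \in s -> forall n, (m <= n)%N -> ca (f x - u n x) < r.
        exact: (H (enum_fset B)).
      elim: s => [|y s [m hm]]; first by exists 0%N.
      have [m' hm'] := hf y _ r0; exists (maxn m m') => x; rewrite inE => /orP[/eqP->|xs] p.
        by rewrite geq_max => /andP[_]; exact: hm'.
      by rewrite geq_max => /andP[+ _]; exact: hm.
    by exists (maxn m N); split; [exact: leq_maxr|move=> x /hm; apply; exact: leq_maxl].
  have mn : nr (u m - u n) <= e by apply/ltW/hN.
  have S1 : \sum_(x <- B) ca ((u m - u n) x) ^+ 2 <= e ^+ 2.
    by apply: le_trans (l2sq_le _ _) _; rewrite -nr_l2 ler_pXn2r ?nnegrE ?nr_ge0 ?(ltW e0).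
  have S2 : \sum_(x <- B) ca (f x - u n x) ^+ 2 <= \sum_(x <- B) (ca ((u m - u n) x) ^+ 2 + r * (1 + 2 * e)).
    rewrite big_seq [leRHS]big_seq; apply: ler_sum => x xB.
    have a1 := hm x xB; have a2 : ca ((u m - u n) x) <= e := le_trans (ca_l2 _ _) mn.
    have a3 := caD (f x - u m x) ((u m - u n) x).
    rewrite [in X in ca X <= _]l2E_D l2E_N addrA subrK in a3.
    have a4 : r <= 1 by rewrite ge_min lexx.
    have := ca_ge0 (f x - u n x); have := ca_ge0 (f x - u m x); have := ca_ge0 ((u m - u n) x).
    nra.
  apply: le_trans S2 _; rewrite big_split /= addrC; apply: lerD => //.
  rewrite big_const_seq count_predT iter_addr addr0 -mulr_natl.
  have : r <= d / (k * (1 + 2 * e)) by rewrite ge_min lexx orbT.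
  rewrite ler_pdivlMr // /k => h.
  have : 0 <= r * (1 + 2 * e) by apply: mulr_ge0; [exact: ltW|lra].
  have : (0 : R) <= (size B)%:R by [].
  nra.
have sqf : sq_summable f.
  have [N /(_ _ (leqnn _)) hN] := tail 1 ltr01; have [M hM] := l2P (u N).
  exists (2 * 1 ^+ 2 + 2 * M) => B.
  apply: le_trans (_ : \sum_(x <- B) (2 * ca (f x - u N x) ^+ 2 + 2 * ca (u N x) ^+ 2) <= _).
    apply: ler_sum => x _; have := caD (f x - u N x) (u N x); rewrite subrK.
    have := ca_ge0 (f x); have := sqr_ge0 (ca (f x - u N x) - ca (u N x)); nra.
  by rewrite big_split /= -!mulr_sumr; have := hN B; have := hM B; lra.
exists (L2 sqf) => e e0; have e2 : 0 < e / 2 by rewrite divr_gt0.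
have [N hN] := tail _ e2; exists N => n /hN h; apply: le_lt_trans (_ : e / 2 < e); last by lra.
apply: nr_l2_le; first exact: ltW.
by move=> B; apply: le_trans (h B); apply: ler_sum => x _; rewrite l2E_D l2E_N.
Qed.
HB.instance Definition _ := Uniform_isComplete.Build l2 (seq_complete l2_complete).
Lemma l2_inner_norm (f : l2) : l2ip f f = `|f| ^+ 2.
Proof. by rewrite nrE l2ip_self -nr_l2 rmorphXn. Qed.
HB.instance Definition _ := @isHilbert.Build R l2 l2ip l2ipPl l2ipC l2_inner_norm.

End L2.

(** * Algebras of operator families *)

Section Hilb.
Variables (R : realType) (H : hilbertType R).
Local Notation C := R[i].
Implicit Types x y z v w : H.

Lemma inner0l z : inner (0 : H) z = 0. Proof. exact: (ip0l (@innerP R H)). Qed.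
Lemma innerDl x y z : inner (x + y) z = inner x z + inner y z.
Proof. exact: (ipDl (@innerP R H)). Qed.
Lemma innerZl (a : C) x z : inner (a *: x) z = a * inner x z.
Proof. exact: (ipZl (@innerP R H)). Qed.
Lemma innerDr x y z : inner z (x + y) = inner z x + inner z y.
Proof. exact: (ipDr (@innerP R H) (@inner_conj R H)). Qed.
Lemma innerZr (a : C) x z : inner z (a *: x) = a^* * inner z x.
Proof. exact: (ipZr (@innerP R H) (@inner_conj R H)). Qed.
Lemma inner0r z : inner z (0 : H) = 0.
Proof. by rewrite inner_conj inner0l rmorph0. Qed.
Lemma innerNl x z : inner (- x) z = - inner x z.
Proof. by rewrite -scaleN1r innerZl mulN1r. Qed.
Lemma innerNr x z : inner z (- x) = - inner z x.
Proof. by rewrite -scaleN1r innerZr rmorphN1 mulN1r. Qed.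
Definition iE := (innerDl, innerDr, innerZl, innerZr, innerNl, innerNr, inner0l, inner0r).
Lemma inner_suml (I : Type) (r : seq I) (P : pred I) (F : I -> H) z :
  inner (\sum_(i <- r | P i) F i) z = \sum_(i <- r | P i) inner (F i) z.
Proof. by elim/big_rec2: _ => [|i a b _ <-]; rewrite ?inner0l // innerDl. Qed.
Lemma inner_self x : inner x x = (nr x ^+ 2)%:C.
Proof. by rewrite inner_norm nrE rmorphXn. Qed.
Lemma inner_CS x y : ca (inner x y) <= nr x * nr y.
Proof.
have e z : nr z = ipn (@inner R H) z.
  by rewrite /ipn inner_self /= sqrtr_sqr ger0_norm // nr_ge0.
rewrite !e; apply: cauchy_schwarz; [exact: innerP|exact: inner_conj|].
by move=> z; rewrite inner_self ler0c sqr_ge0.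
Qed.
Lemma inner_eq0 x : (forall w, inner x w = 0) -> x = 0.
Proof.
move=> /(_ x); rewrite inner_self => /(@complexI R _ 0) /eqP.
by rewrite sqrf_eq0 => /eqP /nr_eq0.
Qed.
Lemma inner_ext x y : (forall w, inner x w = inner y w) -> x = y.
Proof.
move=> h; apply/eqP; rewrite -subr_eq0; apply/eqP/inner_eq0 => w.
by rewrite innerDl innerNl h subrr.
Qed.
End Hilb.

(** * Total sets and bounded linear maps *)

Section Total.
Variables (R : realType).
Local Notation C := R[i].

Definition closed_subspace (V : normedModType C) (P : set V) :=
  [/\ P 0, forall a x y, P x -> P y -> P (a *: x + y) &
      forall x, (forall e : R, 0 < e -> exists2 y, P y & nr (x - y) < e) -> P x].
(* [S] spans a dense subspace, as an induction principle. *)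
Definition total (V : normedModType C) (S : set V) :=
  forall P, closed_subspace P -> S `<=` P -> forall x, P x.

Section V.
Variable V : normedModType C.
Implicit Types (S P : set V).

Lemma lin_spanP S a x y : lin_span S x -> lin_span S y -> lin_span S (a *: x + y).
Proof.
move=> [n [c [s [hs ->]]]] [m [d [t [ht ->]]]].
exists (n + m)%N,
  (fun k : 'I_(n + m) => match fintype.split k with inl i => a * c i | inr j => d j end),
  (fun k : 'I_(n + m) => match fintype.split k with inl i => s i | inr j => t j end); split.
  by move=> k; case: fintype.split.
rewrite big_split_ord /= scaler_sumr; congr (_ + _); apply: eq_bigr => i _.
  by rewrite (unsplitK (inl i)) scalerA.
by rewrite (unsplitK (inr i)).
Qed.
Lemma lin_span0 S : lin_span S 0.
Proof. by exists 0%N, (fun=> 0), (fun=> 0); split; [case|rewrite big_ord0]. Qed.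
Lemma lin_span_in S x : S x -> lin_span S x.
Proof. by move=> Sx; exists 1%N, (fun=> 1), (fun=> x); split => //; rewrite big_ord1 scale1r. Qed.
Lemma lin_spanD S x y : lin_span S x -> lin_span S y -> lin_span S (x + y).
Proof. by move=> hx hy; rewrite -[x]scale1r; exact: lin_spanP. Qed.
Lemma lin_spanZ S a x : lin_span S x -> lin_span S (a *: x).
Proof. by move=> hx; rewrite -[_ *: _]addr0; apply: lin_spanP => //; exact: lin_span0. Qed.
Lemma lin_span_sum S (I : Type) (r : seq I) (Q : pred I) (F : I -> V) :
  (forall i, Q i -> lin_span S (F i)) -> lin_span S (\sum_(i <- r | Q i) F i).
Proof.
move=> h; elim/big_ind: _ => //; first exact: lin_span0.
by move=> x y; exact: lin_spanD.
Qed.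
Lemma lin_span_ind S P x : P 0 -> (forall a x y, P x -> P y -> P (a *: x + y)) ->
  S `<=` P -> lin_span S x -> P x.
Proof.
move=> P0 PL SP [n [c [s [hs ->]]]]; elim/big_ind: _ => //.
  by move=> u v Pu Pv; rewrite -[u]scale1r; exact: PL.
by move=> i _; rewrite -[_ *: _]addr0; apply: PL => //; exact/SP/hs.
Qed.

Lemma closed_subspace_closure S : closed_subspace (closure (lin_span S)).
Proof.
split.
- by apply: subset_closure; exact: lin_span0.
- move=> a x y /closure_nr hx /closure_nr hy; apply/closure_nr => e e0.
  have k0 : 0 < ca a + 1 by rewrite ltr_wpDl ?ca_ge0.
  have [x' Sx xx] := hx _ (divr_gt0 e0 (mulr_gt0 (ltr0Sn _ 1) k0)).
  have e2 : 0 < e / 2 by rewrite divr_gt0.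
  have [y' Sy yy] := hy _ e2; exists (a *: x' + y'); first exact: lin_spanP.
  have -> : a *: x + y - (a *: x' + y') = a *: (x - x') + (y - y') by lmod C V.
  apply: le_lt_trans (nrD _ _) _; rewrite nrZ.
  have : ca a * nr (x - x') <= e / 2.
    move: xx; rewrite ltr_pdivlMr ?mulr_gt0 // => xx.
    by have := nr_ge0 (x - x'); have := ca_ge0 a; nra.
  lra.
- move=> x h; apply/closure_nr => e e0; have e2 : 0 < e / 2 by rewrite divr_gt0.
  have [y /closure_nr /(_ _ e2) [z Sz yz] xy] := h _ e2.
  by exists z => //; apply: le_lt_trans (nr_tri y _ _) _; lra.
Qed.

Lemma total_closure S : total S -> closure (lin_span S) = [set: V].
Proof.
move=> h; apply/seteqP; split => // x _; apply: h; first exact: closed_subspace_closure.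
by move=> y Sy; apply: subset_closure; exact: lin_span_in.
Qed.



Lemma subspace_sum P (I : Type) (r : seq I) (F : I -> V) : closed_subspace P ->
  (forall i, P (F i)) -> P (\sum_(i <- r) F i).
Proof.
move=> [P0 PL _] h; elim/big_ind: _ => // u v Pu Pv.
by rewrite -[u]scale1r; exact: PL.
Qed.
Lemma closure_span_sub S P x : closed_subspace P -> S `<=` P -> closure (lin_span S) x -> P x.
Proof.
move=> [P0 PL PC] SP /closure_nr h; apply: PC => e /h [y hy xy]; exists y => //.
exact: lin_span_ind hy.
Qed.
End V.

Definition blin (V W : normedModType C) (f : V -> W) :=
  (forall a x y, f (a *: x + y) = a *: f x + f y) /\
  exists2 M : R, 0 <= M & forall x, nr (f x) <= M * nr x.

Section Blin.
Variables (V W : normedModType C).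
Implicit Types f g : V -> W.
Lemma lin0 f : (forall a x y, f (a *: x + y) = a *: f x + f y) -> f 0 = 0.
Proof. by move=> h; have := h (-1) 0 0; rewrite scaler0 addr0 scaleN1r addNr. Qed.
Lemma linD f : (forall a x y, f (a *: x + y) = a *: f x + f y) -> forall x y, f (x + y) = f x + f y.
Proof. by move=> h x y; have := h 1 x y; rewrite !scale1r. Qed.
Lemma linZ f : (forall a x y, f (a *: x + y) = a *: f x + f y) -> forall a x, f (a *: x) = a *: f x.
Proof. by move=> h a x; have := h a x 0; rewrite !addr0 (lin0 h) addr0. Qed.
Lemma linN f : (forall a x y, f (a *: x + y) = a *: f x + f y) -> forall x, f (- x) = - f x.
Proof. by move=> h x; rewrite -scaleN1r linZ // scaleN1r. Qed.
Lemma linB f : (forall a x y, f (a *: x + y) = a *: f x + f y) -> forall x y, f (x - y) = f x - f y.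
Proof. by move=> h x y; rewrite linD // linN. Qed.
Lemma lin_sum f (I : Type) (r : seq I) (P : pred I) (F : I -> V) :
  (forall a x y, f (a *: x + y) = a *: f x + f y) ->
  f (\sum_(i <- r | P i) F i) = \sum_(i <- r | P i) f (F i).
Proof. by move=> h; elim/big_rec2: _ => [|i a b _ <-]; rewrite ?(lin0 h) // (linD h). Qed.

Lemma blin_eq_subspace f g : blin f -> blin g -> closed_subspace [set x | f x = g x].
Proof.
move=> [fl [M M0 fM]] [gl [N N0 gN]]; split => /=.
- by rewrite !lin0.
- by move=> a x y fx fy; rewrite fl gl fx fy.
- move=> x h; apply/eqP; rewrite -subr_eq0; apply/eqP/nr_le_eq0 => e e0.
  have k0 : 0 < M + N + 1 by lra.
  have [y /= fy xy] := h _ (divr_gt0 e0 k0).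
  have -> : f x - g x = f (x - y) - g (x - y).
    by rewrite !linB // fy; lmod C W.
  apply: le_trans (nrB _ _) _; have := fM (x - y); have := gN (x - y).
  by move: xy; rewrite ltr_pdivlMr //; have := nr_ge0 (x - y); nra.
Qed.
Lemma blin_ext f g S : total S -> blin f -> blin g -> (forall x, S x -> f x = g x) -> f =1 g.
Proof. by move=> tS bf bg h x; apply: (tS _ (blin_eq_subspace bf bg)). Qed.
Lemma blin_cont f : blin f -> continuous f.
Proof.
move=> [fl [M M0 fM]] x A /nbhs_nr [e e0 eA]; apply/nbhs_nr.
have k0 : 0 < M + 1 by lra.
exists (e / (M + 1)); first by rewrite divr_gt0.
move=> y; rewrite ltr_pdivlMr // => xy; apply: eA; rewrite -(linB fl).
by apply: le_lt_trans (fM _) _; have := nr_ge0 (x - y); nra.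
Qed.
End Blin.
Lemma blinB (V W : normedModType C) (f g : V -> W) a : blin f -> blin g -> blin (fun x => a *: f x + g x).
Proof.
move=> [fl [M M0 fM]] [gl [N N0 gN]]; split.
  by move=> b x y; rewrite fl gl; lmod C W.
exists (ca a * M + N); first by rewrite addr_ge0 // mulr_ge0 // ca_ge0.
move=> x; apply: le_trans (nrD _ _) _; rewrite nrZ.
by have := fM x; have := gN x; have := ca_ge0 a; have := nr_ge0 x; nra.
Qed.
Lemma blin_comp (U V W : normedModType C) (f : V -> W) (g : U -> V) : blin f -> blin g -> blin (f \o g).
Proof.
move=> [fl [M M0 fM]] [gl [N N0 gN]]; split; first by move=> a x y /=; rewrite gl fl.
exists (M * N); first exact: mulr_ge0.
move=> x /=; apply: le_trans (fM _) _; rewrite -mulrA ler_wpM2l //.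
Qed.
Lemma blin_id (V : normedModType C) : blin (fun x : V => x).
Proof. by split => //; exists 1 => // x; rewrite mul1r. Qed.

(** Linear combinations are lists of coefficients and indices, so well-definedness is part of the
    Lipschitz estimate. The value at [x] is the only point of [W] at distance at most [M] times the
    distance of [x], from every matching pair of combinations; linearity is read off from this
    property. *)
Lemma blin_extension (V : normedModType C) (W : completeNormedModType C) (X : Type)
  (v : X -> V) (w : X -> W) (M : R) : 0 <= M -> total (range v) ->
  (forall s : seq (C * X), nr (\sum_(p <- s) p.1 *: w p.2) <= M * nr (\sum_(p <- s) p.1 *: v p.2)) ->
  exists f : V -> W, [/\ forall a x y, f (a *: x + y) = a *: f x + f y,
    forall x, nr (f x) <= M * nr x & forall k, f (v k) = w k].
Proof.
move=> M0 tot h.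
pose ev (U : normedModType C) (u : X -> U) (s : seq (C * X)) := \sum_(p <- s) p.1 *: u p.2.
pose sc (a : C) (s : seq (C * X)) := [seq (a * p.1, p.2) | p <- s].
have evZ U u a s : ev U u (sc a s) = a *: ev U u s.
  by rewrite /ev big_map scaler_sumr; apply: eq_bigr => p _; rewrite scalerA.
have evD U u s t : ev U u (s ++ t) = ev U u s + ev U u t by rewrite /ev big_cat.
have lip s t : nr (ev W w s - ev W w t) <= M * nr (ev V v s - ev V v t).
  have := h (s ++ sc (-1) t); rewrite -/(ev W w _) -/(ev V v _) !evD !evZ !scaleN1r //.
have approx x e : 0 < e -> exists s, nr (x - ev V v s) < e.
  move: x e; apply: (tot [set x | forall e : R, 0 < e -> exists s, nr (x - ev V v s) < e]).
    split.
    - by move=> e e0; exists [::]; rewrite /ev big_nil subrr nr0.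
    - move=> a x y hx hy e e0; have k0 : 0 < ca a + 1 by rewrite ltr_wpDl ?ca_ge0.
      have e2 : 0 < e / 2 by rewrite divr_gt0.
      have [s hs] := hx _ (divr_gt0 e2 k0); have [t ht] := hy _ e2.
      exists (sc a s ++ t); rewrite evD evZ.
      have -> : a *: x + y - (a *: ev V v s + ev V v t) = a *: (x - ev V v s) + (y - ev V v t) by lmod C V.
      apply: le_lt_trans (nrD _ _) _; rewrite nrZ; move: hs; rewrite ltr_pdivlMr //.
      by have := nr_ge0 (x - ev V v s); nra.
    - move=> x hx e e0; have e2 : 0 < e / 2 by rewrite divr_gt0.
      have [y hy xy] := hx _ e2; have [s hs] := hy _ e2.
      by exists s; apply: le_lt_trans (nr_tri y _ _) _; lra.
  by move=> _ [k _ <-] e e0; exists [:: (1, k)]; rewrite /ev big_seq1 scale1r subrr nr0.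
have /choice[f hf] x : exists l : W, forall s, nr (l - ev W w s) <= M * nr (x - ev V v s).
  have /choice[u hu] (n : nat) : exists s, nr (x - ev V v s) < n.+1%:R^-1.
    by apply: approx; rewrite invr_gt0.
  have near s t : nr (ev W w s - ev W w t) <= M * (nr (x - ev V v s) + nr (x - ev V v t)).
    apply: le_trans (lip s t) _; rewrite ler_wpM2l // [nr (x - ev V v s)]nr_subC.
    exact: nr_tri.
  have [|l hl] := @cauchy_cvg_nr R W (fun n => ev W w (u n)).
    move=> e e0; have k0 : 0 < 2 * (M + 1) by lra.
    have [N hN] := half_pow_lt (divr_gt0 e0 k0); exists N => m n Nm Nn.
    have a1 := lt_trans (hu m) (hN _ Nm); have a2 := lt_trans (hu n) (hN _ Nn).
    apply: le_lt_trans (near _ _) _; move: a1 a2; rewrite !ltr_pdivlMr //.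
    have := nr_ge0 (x - ev V v (u m)); have := nr_ge0 (x - ev V v (u n)); nra.
  exists l => s; apply/ler_addgt0Pl => e e0.
  have k0 : 0 < 2 * (M + 1) by lra.
  have e2 : 0 < e / 2 by rewrite divr_gt0.
  have [N hN] := hl _ e2; have [N' hN'] := half_pow_lt (divr_gt0 e0 k0).
  pose n := maxn N N'; have a1 := hN n (leq_maxl _ _).
  have a2 := lt_trans (hu n) (hN' n (leq_maxr _ _)).
  have := nr_tri (ev W w (u n)) l (ev W w s); have := near (u n) s.
  move: a2; rewrite ltr_pdivlMr //; have := nr_ge0 (x - ev V v (u n)); nra.
have uniq x l : (forall s, nr (l - ev W w s) <= M * nr (x - ev V v s)) -> f x = l.
  move=> hl; apply/eqP; rewrite -subr_eq0; apply/eqP/nr_le_eq0 => e e0.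
  have k0 : 0 < 2 * (M + 1) by lra.
  have [s hs] := approx x _ (divr_gt0 e0 k0).
  have := nr_tri (ev W w s) (f x) l; rewrite [nr (ev W w s - l)]nr_subC.
  have := hf x s; have := hl s; move: hs; rewrite ltr_pdivlMr //.
  have := nr_ge0 (x - ev V v s); nra.
have fl a x y : f (a *: x + y) = a *: f x + f y.
  apply/eqP; rewrite -subr_eq0; apply/eqP/nr_le_eq0 => e e0.
  have k1 : 0 < 4 * (M + 1) by lra.
  have k2 : 0 < ca a + 1 by rewrite ltr_wpDl ?ca_ge0.
  have d1 := divr_gt0 e0 k1.
  have [s hs] := approx x _ (divr_gt0 d1 k2); have [t ht] := approx y _ d1.
  have := hf (a *: x + y) (sc a s ++ t); rewrite !evD !evZ.
  set X1 := f (a *: x + y); set Y1 := f x; set Z1 := f y; set p := ev _ _ s; set q := ev _ _ t.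
  set p' := ev V v s; set q' := ev V v t.
  have -> : a *: x + y - (a *: p' + q') = a *: (x - p') + (y - q') by lmod C V.
  have -> : X1 - (a *: Y1 + Z1) = (X1 - (a *: p + q)) - a *: (Y1 - p) - (Z1 - q) by lmod C W.
  have := nrD (a *: (x - p')) (y - q'); rewrite nrZ.
  have := nrB (X1 - (a *: p + q) - a *: (Y1 - p)) (Z1 - q).
  have := nrB (X1 - (a *: p + q)) (a *: (Y1 - p)); rewrite nrZ.
  have := hf x s; have := hf y t; rewrite -/p -/q -/p' -/q' -/Y1 -/Z1.
  have c0 := ca_ge0 a.
  have m1 : ca a * nr (x - p') <= e / (4 * (M + 1)).
    by move: hs; rewrite ltr_pdivlMr // => hs; have := nr_ge0 (x - p'); nra.
  have m3 : M * (e / (4 * (M + 1))) <= e / 4.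
    by rewrite mulrA ler_pdivrMr //; nra.
  have m2 : nr (y - q') <= e / (4 * (M + 1)) by exact: ltW.
  move=> b1 b2 b3 b4 b5 b6.
  have b7 : ca a * nr (Y1 - p) <= M * (ca a * nr (x - p')).
    by rewrite mulrCA ler_wpM2l.
  have b8 : M * (ca a * nr (x - p')) <= e / 4 by apply: le_trans m3; rewrite ler_wpM2l.
  have b9 : M * nr (y - q') <= e / 4 by apply: le_trans m3; rewrite ler_wpM2l.
  have b10 : M * nr (a *: (x - p') + (y - q')) <= e / 4 + e / 4.
    apply: le_trans (lerD b8 b9); rewrite -mulrDr ler_wpM2l //.
  lra.
exists f; split => //.
- by move=> x; have := hf x [::]; rewrite /ev !big_nil !subr0.
- move=> k; apply: uniq => s; have := lip [:: (1, k)] s.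
  by rewrite {1 3}/ev !big_seq1 !scale1r.
Qed.
End Total.

(** * C*-algebras of operator families *)

Section Families.
Variables (R : realType) (Y : Type) (K : hilbertType R).
Local Notation C := R[i].
Implicit Types a b : Y -> K -> K.

Definition fam_bound a (M : R) := forall y v, nr (a y v) <= M * nr v.
Definition fam_adj a b := forall y v w, inner (a y v) w = inner v (b y w).
Definition fam_lin a := forall y (c : C) v w, a y (c *: v + w) = c *: a y v + a y w.

(* Uniformly bounded families of operators on [K] that form a unital C*-algebra
   for the pointwise operations. *)
Record famsub := FamSub {
  fmem :> set (Y -> K -> K);
  fmem_lin : forall a, fmem a -> fam_lin a;
  fmem_bd : forall a, fmem a -> exists2 M, 0 <= M & fam_bound a M;
  fmem_adj : forall a, fmem a -> exists2 b, fmem b & fam_adj a b;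
  fmemP : forall (c : C) a b, fmem a -> fmem b -> fmem (fun y v => c *: a y v + b y v);
  fmemM : forall a b, fmem a -> fmem b -> fmem (fun y v => a y (b y v));
  fmem1 : fmem (fun y v => v);
  fmem_closed : forall a, fam_lin a -> (exists b, fam_adj a b) ->
    (forall e : R, 0 < e -> exists2 b, fmem b & fam_bound (fun y v => a y v - b y v) e) -> fmem a }.

Variable D : famsub.
Record fam := Fam { ff :> Y -> K -> K; ffP : fmem D ff }.
HB.instance Definition _ := gen_eqMixin fam.
HB.instance Definition _ := gen_choiceMixin fam.
Implicit Types f g h : fam.

Lemma fam_ext f g : (forall y v, f y v = g y v) -> f = g.
Proof.
case: f g => [f hf] [g hg] /= e; have E : f = g by apply/funext => y; apply/funext => v.
by subst g; congr Fam; exact: Prop_irrelevance.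
Qed.

Lemma ff_lin f : fam_lin f. Proof. exact: fmem_lin (ffP f). Qed.
Lemma fam_sub0 : fmem D (fun y v => 0).
Proof.
have := fmemP (-1) (fmem1 D) (fmem1 D); congr (fmem D _).
by apply/funext => y; apply/funext => v; rewrite scaleN1r addNr.
Qed.
Definition fam0 := Fam fam_sub0.
Definition famL c f g := Fam (fmemP c (ffP f) (ffP g)).
Definition famadd f g := famL 1 f g.
Definition famscale c f := famL c f fam0.
Definition famopp f := famscale (-1) f.

Lemma famaddA : associative famadd.
Proof. by move=> f g h; apply: fam_ext => y v /=; rewrite !scale1r addrA. Qed.
Lemma famaddC : commutative famadd.
Proof. by move=> f g; apply: fam_ext => y v /=; rewrite !scale1r addrC. Qed.
Lemma famadd0 : left_id fam0 famadd.
Proof. by move=> f; apply: fam_ext => y v /=; rewrite scaler0 add0r. Qed.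
Lemma famaddN : left_inverse fam0 famopp famadd.
Proof. by move=> f; apply: fam_ext => y v /=; rewrite !scale1r addr0 scaleN1r addNr. Qed.
HB.instance Definition _ := GRing.isZmodule.Build fam famaddA famaddC famadd0 famaddN.
Lemma famscaleA (a b : C) f : famscale a (famscale b f) = famscale (a * b) f.
Proof. by apply: fam_ext => y v /=; rewrite !addr0 scalerA. Qed.
Lemma famscale1 : left_id 1 famscale.
Proof. by move=> f; apply: fam_ext => y v /=; rewrite addr0 scale1r. Qed.
Lemma famscaleDr : right_distributive famscale +%R.
Proof. by move=> a f g; apply: fam_ext => y v /=; rewrite !scale1r !addr0 scalerDr. Qed.
Lemma famscaleDl f : {morph famscale^~ f : a b / a + b}.
Proof. by move=> a b; apply: fam_ext => y v /=; rewrite !addr0 scale1r scalerDl. Qed.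
HB.instance Definition _ := GRing.Zmodule_isLmodule.Build C fam famscaleA famscale1 famscaleDr famscaleDl.

Lemma famE_D f g y v : (f + g) y v = f y v + g y v.
Proof. by rewrite -[LHS]/(1 *: f y v + g y v) scale1r. Qed.
Lemma famE_Z c f y v : (c *: f) y v = c *: f y v.
Proof. by rewrite -[LHS]/(c *: f y v + 0) addr0. Qed.
Lemma famE_0 y v : (0 : fam) y v = 0. Proof. by []. Qed.
Lemma famE_N f y v : (- f) y v = - f y v.
Proof. by rewrite -scaleN1r famE_Z scaleN1r. Qed.
Definition famE := (famE_D, famE_Z, famE_0, famE_N).
Lemma famE_sum (I : Type) (r : seq I) (P : pred I) (F : I -> fam) y v :
  (\sum_(i <- r | P i) F i) y v = \sum_(i <- r | P i) F i y v.
Proof. by elim/big_rec2: _ => [|i a b _ <-]; rewrite ?famE_0 // famE_D. Qed.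

Definition famN f : R := inf [set M | 0 <= M /\ fam_bound f M].
Lemma famN_inf f : has_inf [set M | 0 <= M /\ fam_bound f M].
Proof.
split; last by exists 0 => M [].
by have [M M0 hM] := fmem_bd (ffP f); exists M.
Qed.
Lemma famN_le f M : 0 <= M -> fam_bound f M -> famN f <= M.
Proof. by move=> M0 hM; apply: ge_inf; [case: (famN_inf f)|split]. Qed.
Lemma famN_ge0 f : 0 <= famN f.
Proof. by apply: lb_le_inf; [case: (famN_inf f)|move=> M []]. Qed.
Lemma famN_bound f : fam_bound f (famN f).
Proof.
move=> y v; apply/ler_addgt0Pl => e e0.
have k0 : 0 < nr v + 1 by rewrite ltr_wpDl // nr_ge0.
have [M [M0 hM] h] := inf_adherent (divr_gt0 e0 k0) (famN_inf f).
apply: le_trans (hM y v) _; rewrite -/(famN f) in h.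
have : e / (nr v + 1) * nr v <= e.
  by rewrite mulrAC ler_pdivrMr // ler_wpM2l ?(ltW e0) // lerDl.
have := nr_ge0 v; nra.
Qed.

Definition famnorm f : C := (famN f)%:C.
Lemma famnormD f g : famnorm (f + g) <= famnorm f + famnorm g.
Proof.
rewrite -rmorphD lecR; apply: famN_le; first by rewrite addr_ge0 ?famN_ge0.
move=> y v; rewrite famE_D mulrDl; apply: le_trans (nrD _ _) _.
by apply: lerD; exact: famN_bound.
Qed.
Lemma famnormZ c f : famnorm (c *: f) = `|c| * famnorm f.
Proof.
rewrite caE -rmorphM; congr _%:C.
have le k h : famN (k *: h) <= ca k * famN h.
  apply: famN_le; first by rewrite mulr_ge0 ?famN_ge0 ?ca_ge0.
  by move=> y v; rewrite famE_Z nrZ -mulrA ler_wpM2l ?ca_ge0 //; exact: famN_bound.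
apply/eqP; rewrite eq_le le /=.
have [->|c0] := eqVneq c 0; first by rewrite ca0 mul0r famN_ge0.
have cp : 0 < ca c by rewrite lt0r ca_ge0 andbT; apply: contra c0 => /eqP/ca_eq0->.
have := le c^-1 (c *: f); rewrite scalerA mulVf // scale1r caV.
by rewrite -ler_pdivlMl ?invr_gt0 // invrK.
Qed.
Lemma famnorm_eq0 f : famnorm f = 0 -> f = 0.
Proof.
move=> /(@complexI R _ 0) h; apply: fam_ext => y v; apply: nr_eq0; apply/eqP.
by rewrite eq_le nr_ge0 andbT; have := famN_bound f y v; rewrite h mul0r.
Qed.
HB.instance Definition _ := @Lmodule_isNormed.Build C fam famnorm famnormD famnormZ famnorm_eq0.

Lemma nr_fam_bound f y v : nr (f y v) <= nr f * nr v. Proof. exact: famN_bound. Qed.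
Lemma nr_fam_le f M : 0 <= M -> fam_bound f M -> nr f <= M. Proof. exact: famN_le. Qed.

Definition famstar_fun f : Y -> K -> K := sval (cid2 (fmem_adj (ffP f))).
Lemma famstar_subproof f : fmem D (famstar_fun f).
Proof. by rewrite /famstar_fun; case: cid2. Qed.
Definition famstar f := Fam (famstar_subproof f).
Lemma famstarP f : fam_adj f (famstar f).
Proof. by rewrite /famstar /= /famstar_fun; case: cid2. Qed.
Lemma famstarP' f y v w : inner (famstar f y v) w = inner v (f y w).
Proof. by rewrite inner_conj -famstarP -inner_conj. Qed.
Lemma famstar_uniq f g : fam_adj f g -> famstar f = g.
Proof.
move=> h; apply: fam_ext => y v; apply: inner_ext => w.
by rewrite inner_conj -famstarP h -inner_conj.
Qed.

Lemma famN_star f : nr (famstar f) <= nr f.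
Proof.
apply: nr_fam_le; first exact: nr_ge0.
move=> y v; have [->|/nr_gt0 n0] := pselect (famstar f y v = 0).
  by rewrite nr0 mulr_ge0 ?nr_ge0.
rewrite -(ler_pM2r n0) -expr2.
have : ((nr (famstar f y v)) ^+ 2)%:C = inner v (f y (famstar f y v)).
  by rewrite -inner_self famstarP'.
move=> /(congr1 (@ca R)); rewrite ca_real ger0_norm ?sqr_ge0 // => ->.
apply: le_trans (inner_CS _ _) _; rewrite mulrAC [leRHS]mulrC ler_wpM2l ?nr_ge0 //.
exact: nr_fam_bound.
Qed.

(** Limits are taken pointwise. The adjoints form a Cauchy sequence as well, and their limit is the
    adjoint of the limit, as [fmem_closed] requires. *)
Lemma fam_complete (u : nat -> fam) : cauchy_nr u -> exists l, lim_nr u l.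
Proof.
move=> cu.
have pt (s : nat -> fam) : cauchy_nr s -> exists a : Y -> K -> K, forall y v, lim_nr (fun n => s n y v) (a y v).
  move=> cs; have /choice[a ha] (p : Y * K) : exists l, lim_nr (fun n => s n p.1 p.2) l.
    apply: cauchy_cvg_nr => e e0; have k0 : 0 < nr p.2 + 1 by rewrite ltr_wpDl // nr_ge0.
    have [N hN] := cs _ (divr_gt0 e0 k0); exists N => m n Nm Nn.
    have := hN m n Nm Nn; rewrite ltr_pdivlMr // => h.
    have := nr_fam_bound (s m - s n) p.1 p.2; rewrite famE_D famE_N.
    by have := nr_ge0 (s m - s n); have := nr_ge0 p.2; nra.
  by exists (fun y v => a (y, v)) => y v; exact: (ha (y, v)).
have cu' : cauchy_nr (fun n => famstar (u n)).
  move=> e /cu [N hN]; exists N => m n Nm Nn; apply: le_lt_trans (hN m n Nm Nn).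
  apply: le_trans (famN_star (u m - u n)); rewrite le_eqVlt; apply/orP; left; apply/eqP; congr nr.
  apply/esym/famstar_uniq => y v w; rewrite !famE !iE.
  by rewrite (famstarP (u m)) (famstarP (u n)) rmorphN1 mulN1r.
have [a ha] := pt _ cu; have [b hb] := pt _ cu'.
have lin : fam_lin a.
  move=> y c v w; apply: lim_uniq (ha _ _) _.
  apply: lim_ext (limD (limZ c (ha y v)) (ha y w)) => n; by rewrite ff_lin.
have ipl (s : nat -> K) x z : lim_nr s x -> forall e, 0 < e -> exists N, forall n, (N <= n)%N ->
    ca (inner x z - inner (s n) z) < e.
  move=> hs e e0; have k0 : 0 < nr z + 1 by rewrite ltr_wpDl // nr_ge0.
  have [N hN] := hs _ (divr_gt0 e0 k0); exists N => n /hN; rewrite ltr_pdivlMr // => h.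
  rewrite -innerNl -innerDl; apply: le_lt_trans (inner_CS _ _) _.
  by have := nr_ge0 (x - s n); nra.
have adj : fam_adj a b.
  move=> y v w; apply/eqP; rewrite -subr_eq0; apply/eqP/ca_eq0/eqP.
  rewrite eq_le ca_ge0 andbT; apply/ler_addgt0Pl => e e0; rewrite addr0.
  have e2 : 0 < e / 2 by rewrite divr_gt0.
  have [N hN] := ipl _ _ w (ha y v) _ e2; have [N' hN'] := ipl _ _ v (hb y w) _ e2.
  have h1 := hN _ (leq_maxl N N'); have h2 := hN' _ (leq_maxr N N').
  set n := maxn N N' in h1 h2.
  have -> : inner (a y v) w - inner v (b y w) = (inner (a y v) w - inner (u n y v) w)
      - (inner (b y w) v - inner (famstar (u n) y w) v)^*.
    rewrite rmorphB /= -!inner_conj famstarP; ring.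
  by have := caD (inner (a y v) w - inner (u n y v) w)
      (- (inner (b y w) v - inner (famstar (u n) y w) v)^*); rewrite caN ca_conj; lra.
have close e : 0 < e -> exists N, forall n, (N <= n)%N -> fam_bound (fun y v => a y v - u n y v) e.
  move=> /cu [N hN]; exists N => n Nn y v.
  apply: lim_le (_ : lim_nr (fun m => u (m + N)%N y v - u n y v) _) _.
    apply: limB (lim_cst _); move=> d d0; have [N' hN'] := ha y v _ d0.
    by exists N' => m N'm; apply: hN'; exact: leq_trans (leq_addr _ _).
  move=> m; rewrite -famE_N -famE_D; apply: le_trans (nr_fam_bound _ _ _) _.
  by rewrite ler_wpM2r ?nr_ge0 // ltW // hN // leq_addl.
have Da : fmem D a.
  apply: fmem_closed => //; first by exists b.
  by move=> e /close [N /(_ _ (leqnn _)) h]; exists (u N) => //; exact: ffP.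
exists (Fam Da) => e e0; have e2 : 0 < e / 2 by rewrite divr_gt0.
have [N hN] := close _ e2; exists N => n /hN h.
apply: le_lt_trans (_ : e / 2 < e); last by lra.
apply: nr_fam_le; first exact: ltW.
by move=> y v; rewrite famE_D famE_N; exact: h.
Qed.
HB.instance Definition _ := Uniform_isComplete.Build fam (seq_complete fam_complete).

Definition fammul f g := Fam (fmemM (ffP f) (ffP g)).
Definition famone := Fam (fmem1 D).
Lemma fammulA : associative fammul. Proof. by move=> f g h; exact: fam_ext. Qed.
Lemma fammul1l : left_id famone fammul. Proof. by move=> f; exact: fam_ext. Qed.
Lemma fammul1r : right_id famone fammul. Proof. by move=> f; exact: fam_ext. Qed.
Lemma fammulPl (a : C) f g h : fammul (a *: f + g) h = a *: fammul f h + fammul g h.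
Proof. by apply: fam_ext => y v; rewrite -[LHS]/((a *: f + g) y (h y v)) !famE. Qed.
Lemma fammulPr (a : C) f g h : fammul h (a *: f + g) = a *: fammul h f + fammul h g.
Proof. by apply: fam_ext => y v; rewrite -[LHS]/(h y ((a *: f + g) y v)) !famE ff_lin. Qed.
Lemma famstarK : involutive famstar.
Proof. by move=> f; apply: famstar_uniq => y v w; rewrite famstarP'. Qed.
Lemma famstarL (a : C) f g : famstar (a *: f + g) = a^* *: famstar f + famstar g.
Proof. by apply: famstar_uniq => y v w; rewrite !famE !iE conjCK !famstarP. Qed.
Lemma famstarM f g : famstar (fammul f g) = fammul (famstar g) (famstar f).
Proof. by apply: famstar_uniq => y v w /=; rewrite !famstarP. Qed.
Lemma fam_normM f g : `|fammul f g| <= `|f| * `|g|.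
Proof.
rewrite !nrE -rmorphM lecR; apply: nr_fam_le; first by rewrite mulr_ge0 ?nr_ge0.
move=> y v /=; apply: le_trans (nr_fam_bound _ _ _) _.
by rewrite -mulrA ler_wpM2l ?nr_ge0 // nr_fam_bound.
Qed.
Lemma fam_cstar_norm f : `|fammul (famstar f) f| = `|f| ^+ 2.
Proof.
rewrite !nrE -rmorphXn; congr _%:C; apply/eqP; rewrite eq_le; apply/andP; split.
  have := fam_normM (famstar f) f; rewrite !nrE -rmorphM lecR => /le_trans; apply.
  by rewrite expr2 ler_wpM2r ?nr_ge0 ?famN_star.
set s := nr (fammul _ _); have s0 : 0 <= s := nr_ge0 _.
have : nr f <= Num.sqrt s.
  apply: nr_fam_le; first exact: sqrtr_ge0.
  move=> y v; rewrite -(ler_pXn2r (n := 2)) ?nnegrE ?mulr_ge0 ?sqrtr_ge0 ?nr_ge0 //.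
  rewrite exprMn sqr_sqrtr //.
  have : (nr (f y v) ^+ 2)%:C = inner (fammul (famstar f) f y v) v by rewrite -inner_self /= famstarP'.
  move=> /(congr1 (@ca R)); rewrite ca_real ger0_norm ?sqr_ge0 // => ->.
  apply: le_trans (inner_CS _ _) _; rewrite expr2 mulrA ler_wpM2r ?nr_ge0 //.
  exact: nr_fam_bound.
by rewrite -(ler_pXn2r (n := 2)) ?nnegrE ?sqrtr_ge0 ?nr_ge0 // sqr_sqrtr.
Qed.
HB.instance Definition _ := @isCStarAlgebra.Build R fam fammul famone famstar fammulA
  fammul1l fammul1r fammulPl fammulPr famstarK famstarL famstarM fam_normM fam_cstar_norm.

Lemma famE_M f g y v : (f ** g) y v = f y (g y v). Proof. by []. Qed.
Lemma famE_1 y v : (cone : fam) y v = v. Proof. by []. Qed.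
Lemma fam_starl f y v w : inner (f y v) w = inner v (star f y w). Proof. exact: famstarP. Qed.
Lemma fam_starr f y v w : inner (star f y v) w = inner v (f y w). Proof. exact: famstarP'. Qed.
End Families.

(** * Slices and tensor products *)

Section Basis.
Variables (R : realType) (X : choiceType).
Local Notation C := R[i].
Local Notation l2X := (l2 R X).

Lemma l2sq_le_seq (f : l2X) (s : seq X) : uniq s -> \sum_(x <- s) ca (f x) ^+ 2 <= l2sq f.
Proof.
move=> us; apply: le_trans (l2sq_le f [fset x in s]%fset).
apply: sum_sub => // [x xs|x]; first by rewrite inE.
exact: sqr_ge0.
Qed.

Lemma sq_summable_seq (f : X -> C) (M : R) :
  (forall s : seq X, uniq s -> \sum_(x <- s) ca (f x) ^+ 2 <= M) -> sq_summable f.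
Proof. by move=> h; exists M => B; apply: h; exact: fset_uniq. Qed.

Lemma dlt_sq (x : X) : sq_summable (fun y => (x == y)%:R : C).
Proof.
apply: (@sq_summable_seq _ 1) => s us.
rewrite (eq_bigr (fun y => if y == x then 1 else 0)); last first.
  by move=> y _; rewrite eq_sym; case: eqP; rewrite ?ca1 ?ca0 ?expr1n ?expr0n.
rewrite -big_mkcond /=; have [xs|xs] := boolP (x \in s).
  by rewrite big_const_seq iter_addr addr0 (count_uniq_mem x us) xs.
by rewrite big1_seq // => y /andP[/eqP-> ys]; rewrite ys in xs.
Qed.
Definition dlt x : l2X := L2 (dlt_sq x).
Lemma dltE x y : dlt x y = (x == y)%:R. Proof. by []. Qed.

Lemma inner_dlt (f : l2X) x : inner f (dlt x) = f x.
Proof.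
apply: l2ip_eq => e e0; exists [fset x]%fset => B xB.
rewrite (big_fsetD1 x) /=; last by apply: (fsubsetP xB); rewrite inE.
rewrite eqxx rmorph1 mulr1 big_seq big1 ?addr0 ?subrr ?ca0 // => y.
by rewrite !inE /= eq_sym => /andP[/negPf->]; rewrite rmorph0 mulr0.
Qed.
Lemma inner_dltl (f : l2X) x : inner (dlt x) f = (f x)^*.
Proof. by rewrite inner_conj inner_dlt. Qed.
Lemma inner_dd x y : inner (dlt x) (dlt y) = (x == y)%:R.
Proof. by rewrite inner_dlt. Qed.
Lemma nr_dlt x : nr (dlt x) = 1.
Proof.
have := inner_self (dlt x); rewrite inner_dd eqxx => /(@complexI R 1) /esym/eqP.
by rewrite sqrf_eq1 => /orP[/eqP//|/eqP h]; have := nr_ge0 (dlt x); rewrite h; lra.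
Qed.

Lemma l2_trunc (f : l2X) (B : {fset X}) :
  nr (f - \sum_(x <- B) f x *: dlt x) ^+ 2 <= l2sq f - \sum_(x <- B) ca (f x) ^+ 2.
Proof.
have E y : (f - \sum_(x <- B) f x *: dlt x) y = if y \in B then 0 else f y.
  rewrite l2E_D l2E_N l2E_sum; case: ifPn => yB.
    rewrite (big_fsetD1 y) //= eqxx mulr1 big_seq big1 ?addr0 ?subrr // => x.
    by rewrite !inE /= => /andP[/negPf-> _]; rewrite mulr0.
  rewrite big_seq big1 ?subr0 // => x xB; rewrite l2E_Z dltE.
  by case: eqP => [e|]; [rewrite -e xB in yB|rewrite mulr0].
rewrite nr_l2; apply: l2sq_sup => B'; under eq_bigr do rewrite E; rewrite lerBrDr.
pose s := [seq x <- B' | x \notin B] ++ B.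
have us : uniq s.
  rewrite cat_uniq filter_uniq ?fset_uniq //= andbT.
  by apply/hasPn => x xB; rewrite mem_filter xB.
apply: le_trans (l2sq_le_seq f us); rewrite big_cat /= lerD2r big_filter.
rewrite (bigID (fun x => x \in B)) /= big1 ?add0r; last first.
  by move=> x ->; rewrite ca0 expr0n.
rewrite [leLHS](eq_bigr (fun x => ca (f x) ^+ 2)); first exact: lexx.
by move=> x /negPf ->.
Qed.

Lemma total_dlt : total (range dlt).
Proof.
move=> P cP hP f; have [P0 PL PC] := cP; apply: PC => e e0.
have [M hM] := l2P f.
have [B /(_ _ (fsubset_refl _)) hB] := nsup_adh (fun x => sqr_ge0 (ca (f x))) hM (exprn_gt0 2 e0).
exists (\sum_(x <- B) f x *: dlt x).
  elim/big_ind: _ => //; first by move=> u v Pu Pv; rewrite -[u]scale1r; exact: PL.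
  by move=> x _; rewrite -[_ *: _]addr0; apply: PL => //; apply: hP; exists x.
rewrite -(ltr_pXn2r (n := 2)) ?nnegrE ?nr_ge0 ?(ltW e0) //.
by apply: le_lt_trans (l2_trunc _ _) _; rewrite /l2sq; lra.
Qed.
End Basis.

Section Mask.
Variables (R : realType) (X : choiceType).
Local Notation C := R[i].
Lemma mask_sq (f : l2 R X) (b : X -> bool) : sq_summable (fun k => (b k)%:R * f k).
Proof.
have [M hM] := l2P f; exists M => s; apply: le_trans (hM s); apply: ler_sum => k _.
by rewrite caM exprMn; case: (b k); rewrite ?ca1 ?ca0 ?expr1n ?expr0n ?mul1r ?mul0r // sqr_ge0.
Qed.
Definition mask (b : X -> bool) (f : l2 R X) := L2 (mask_sq f b).
Lemma maskE b f x : mask b f x = (b x)%:R * f x. Proof. by []. Qed.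
Lemma maskP b (d : C) f g : mask b (d *: f + g) = d *: mask b f + mask b g.
Proof. by apply: l2_ext => k; rewrite !(l2E_D, l2E_Z) /=; ring. Qed.
Lemma mask_bound b f : nr (mask b f) <= nr f.
Proof.
apply: nr_l2_le; first exact: nr_ge0.
move=> s; rewrite nr_l2; apply: le_trans (l2sq_le f s); apply: ler_sum => k _ /=.
by rewrite caM exprMn; case: (b k); rewrite ?ca1 ?ca0 ?expr1n ?expr0n ?mul1r ?mul0r // sqr_ge0.
Qed.
Lemma mask_dlt b k : mask b (dlt R k) = (b k)%:R *: dlt R k.
Proof.
apply: l2_ext => j; rewrite l2E_Z /=.
by case: (eqVneq k j) => [->|]; rewrite ?mulr0.
Qed.
End Mask.

Section BlinInner.
Variables (R : realType).
Lemma bounded_adjoint_ext (X : choiceType) (f g : l2 R X -> l2 R X) : blin f -> blin g ->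
  (forall x y, inner (f (dlt R x)) (dlt R y) = inner (dlt R x) (g (dlt R y))) ->
  forall v w, inner (f v) w = inner v (g w).
Proof.
move=> bf bg h v w.
have inner_bl (z : l2 R X) : blin (fun v => (inner v z : Cplx R)).
  split; first by move=> a x y; exact: innerP.
  by exists (nr z); [exact: nr_ge0|move=> x; rewrite mulrC; exact: inner_CS].
have h1 x : inner (f v) (dlt R x) = inner v (g (dlt R x)).
  have E := @blin_ext R _ _ (fun v => inner (f v) (dlt R x) : Cplx R)
    (fun v => inner v (g (dlt R x)) : Cplx R) _ (@total_dlt R X) (blin_comp (inner_bl _) bf) (inner_bl _).
  by apply: E => _ [y _ <-]; exact: h.
suff : inner w (f v) = inner (g w) v by move=> E; rewrite inner_conj E -inner_conj.
have E := @blin_ext R _ _ (fun w => inner w (f v) : Cplx R)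
  (fun w => inner (g w) v : Cplx R) _ (@total_dlt R X) (inner_bl _) (blin_comp (inner_bl _) bg).
by apply: E => _ [y _ <-]; rewrite inner_conj h1 -inner_conj.
Qed.
End BlinInner.

(* Tensor products are taken along a bijection of index sets, so that the products
   of three factors need no reassociation. *)
Record pairing (X Y Z : Type) := Pairing {
  pe : X -> Y -> Z; p1 : Z -> X; p2 : Z -> Y;
  peK : forall z, pe (p1 z) (p2 z) = z;
  p1K : forall x y, p1 (pe x y) = x;
  p2K : forall x y, p2 (pe x y) = y }.

Section Slices.
Variables (R : realType) (X Y Z : choiceType) (e : pairing X Y Z).
Local Notation C := R[i].
Local Notation l2X := (l2 R X).
Local Notation l2Z := (l2 R Z).
Implicit Types (y : Y).

Lemma pe_inj1 y : injective (fun x => pe e x y).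
Proof. by move=> x x' h; rewrite -(p1K e x y) h p1K. Qed.

Lemma slice_sq (f : l2Z) y : sq_summable (fun x => f (pe e x y)).
Proof.
apply: (@sq_summable_seq R X _ (l2sq f)) => s us.
have := @l2sq_le_seq R Z f (map (fun x => pe e x y) s).
by rewrite big_map map_inj_uniq ?us //; [apply|exact: pe_inj1].
Qed.
Definition slice y (f : l2Z) : l2X := L2 (slice_sq f y).
Lemma sliceE y (f : l2Z) x : slice y f x = f (pe e x y). Proof. by []. Qed.

Lemma slice_sum (f : l2Z) (t : seq Y) : uniq t -> \sum_(y <- t) l2sq (slice y f) <= l2sq f.
Proof.
move=> ut.
(* The bound becomes an arbitrary [M] valid for finite sets lying over [t], so that in the induction
   removing [y] from [t] only lowers [M]. *)
suff H (M : R) : (forall s : seq Z, uniq s -> {subset map (p2 e) s <= t} ->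
    \sum_(z <- s) ca (f z) ^+ 2 <= M) -> \sum_(y <- t) l2sq (slice y f) <= M.
  by apply: H => s us _; exact: l2sq_le_seq.
elim: t ut M => [|y t IH] /= ut M hM.
  by rewrite big_nil; have := hM [::] isT; rewrite big_nil; apply.
have {ut} [yt ut] := andP ut.
rewrite big_cons -lerBrDr; apply: l2sq_sup => B; rewrite lerBrDr addrC -lerBrDr.
apply: IH => // s us st; rewrite lerBrDr.
have := hM (s ++ map (fun x => pe e x y) B); rewrite big_cat big_map; apply.
  rewrite cat_uniq us map_inj_uniq ?fset_uniq; last exact: pe_inj1.
  rewrite andbT; apply/hasPn => _ /mapP[x _ ->]; apply/negP => h.
  have := st y; rewrite (negbTE yt) => /(_ _) h'; have : y \in map (p2 e) s.
    by apply/mapP; exists (pe e x y) => //; rewrite p2K.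
  by move=> /h'.
move=> y'; rewrite map_cat mem_cat inE => /orP[/st->|]; first by rewrite orbT.
by move=> /mapP[_ /mapP[x _ ->] ->]; rewrite p2K eqxx.
Qed.

Lemma sum_rect (F : Z -> R) (s : seq Z) : uniq s -> (forall z, 0 <= F z) ->
  \sum_(z <- s) F z <=
  \sum_(y <- undup (map (p2 e) s)) \sum_(x <- undup (map (p1 e) s)) F (pe e x y).
Proof.
move=> us F0; set t1 := undup _; set t2 := undup _.
have -> : \sum_(y <- t1) \sum_(x <- t2) F (pe e x y) =
  \sum_(z <- map (fun p => pe e p.2 p.1) [seq (y, x) | y <- t1, x <- t2]) F z.
  by rewrite big_map big_allpairs.
apply: sum_sub => //.
  rewrite map_inj_in_uniq; first by rewrite allpairs_uniq ?undup_uniq // => [[a b] [c d]] _ _.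
  move=> [y x] [y' x'] _ _ /= h; congr (_, _).
    by rewrite -(p2K e x y) h p2K.
  by rewrite -(p1K e x y) h p1K.
move=> z zs; apply/mapP; exists (p2 e z, p1 e z); last by rewrite /= peK.
by apply/allpairsP; exists (p2 e z, p1 e z); split=> //=; rewrite mem_undup; apply/mapP; exists z.
Qed.

Definition Sl_fun (a : Y -> l2X -> l2X) (f : l2Z) z : C := a (p2 e z) (slice (p2 e z) f) (p1 e z).

Lemma Sl_sum (a : Y -> l2X -> l2X) (M : R) (f : l2Z) (s : seq Z) : 0 <= M ->
  (forall y v, nr (a y v) <= M * nr v) -> uniq s ->
  \sum_(z <- s) ca (Sl_fun a f z) ^+ 2 <= (M * nr f) ^+ 2.
Proof.
move=> M0 hM us.
apply: le_trans (sum_rect us (fun z => sqr_ge0 (ca (Sl_fun a f z)))) _.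
rewrite exprMn nr_l2; set t := undup (map (p2 e) s).
have ut : uniq t by exact: undup_uniq.
apply: le_trans (_ : \sum_(y <- t) (M ^+ 2 * l2sq (slice y f)) <= _); last first.
  by rewrite -mulr_sumr ler_wpM2l ?sqr_ge0 ?slice_sum.
apply: ler_sum => y _; rewrite -nr_l2 -exprMn.
apply: le_trans (_ : nr (a y (slice y f)) ^+ 2 <= _); last first.
  by rewrite ler_pXn2r ?nnegrE ?mulr_ge0 ?nr_ge0.
rewrite nr_l2; under eq_bigr do rewrite /Sl_fun p1K p2K.
by apply: l2sq_le_seq; exact: undup_uniq.
Qed.

(** The direct sum of the operators [a y] on l2(Z), seen as a sum of copies of l2(X) indexed by [y].
    The default value 0 does not occur for uniformly bounded families, by [Sl_sum]. *)
Definition Sl (a : Y -> l2X -> l2X) (f : l2Z) : l2Z :=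
  match pselect (sq_summable (Sl_fun a f)) with left h => L2 h | right _ => 0 end.

Section Bounded.
Variables (a : Y -> l2X -> l2X) (M : R).
Hypotheses (M0 : 0 <= M) (aM : fam_bound a M).
Lemma SlE (f : l2Z) z : Sl a f z = a (p2 e z) (slice (p2 e z) f) (p1 e z).
Proof.
rewrite /Sl; case: pselect => // h; case: h.
by apply: sq_summable_seq => s us; apply: (@Sl_sum a M f).
Qed.
Lemma slice_Sl (f : l2Z) y : slice y (Sl a f) = a y (slice y f).
Proof. by apply: l2_ext => x; rewrite sliceE SlE p1K p2K. Qed.
Lemma Sl_bound (f : l2Z) : nr (Sl a f) <= M * nr f.
Proof.
apply: nr_l2_le; first by rewrite mulr_ge0 ?nr_ge0.
move=> B; under eq_bigr do rewrite SlE.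
by apply: (@Sl_sum a M f) => //; exact: fset_uniq.
Qed.
End Bounded.

Lemma slice_lin y (c : C) (f g : l2Z) : slice y (c *: f + g) = c *: slice y f + slice y g.
Proof. exact: l2_ext. Qed.

Lemma slice_dlt y z : slice y (dlt R z) = if p2 e z == y then dlt R (p1 e z) else 0.
Proof.
apply: l2_ext => x; rewrite sliceE dltE; have [zy|zy] := eqVneq (p2 e z) y.
  rewrite dltE; congr (nat_of_bool _)%:R.
  by apply/eqP/eqP => [->|<-]; [rewrite p1K|rewrite -zy peK].
by case: eqP => // E; move: zy; rewrite E p2K eqxx.
Qed.

Definition ok_fam (a : Y -> l2X -> l2X) := fam_lin a /\ exists2 M : R, 0 <= M & fam_bound a M.

Lemma Sl_lin a : ok_fam a -> forall (c : C) f g, Sl a (c *: f + g) = c *: Sl a f + Sl a g.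
Proof.
move=> [al [M M0 aM]] c f g; apply: l2_ext => z.
by rewrite (l2E_D, l2E_Z) l2E_Z !(SlE M0 aM) slice_lin al l2E_D l2E_Z.
Qed.
Lemma Sl_blin a : ok_fam a -> blin (Sl a).
Proof.
move=> ha; split; first exact: Sl_lin.
by case: ha => _ [M M0 aM]; exists M => // f; exact: Sl_bound.
Qed.
Lemma Sl_comp a b : ok_fam a -> ok_fam b -> forall f, Sl (fun y v => a y (b y v)) f = Sl a (Sl b f).
Proof.
move=> [al [M M0 aM]] [bl [N N0 bN]] f; apply: l2_ext => z.
have h : fam_bound (fun y v => a y (b y v)) (M * N).
  by move=> y v; apply: le_trans (aM _ _) _; rewrite -mulrA ler_wpM2l.
by rewrite (SlE (mulr_ge0 M0 N0) h) (SlE M0 aM) (slice_Sl N0 bN).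
Qed.
Lemma Sl_add a b (c : C) : ok_fam a -> ok_fam b ->
  forall f, Sl (fun y v => c *: a y v + b y v) f = c *: Sl a f + Sl b f.
Proof.
move=> [al [M M0 aM]] [bl [N N0 bN]] f; apply: l2_ext => z.
have h : fam_bound (fun y v => c *: a y v + b y v) (ca c * M + N).
  move=> y v; apply: le_trans (nrD _ _) _; rewrite nrZ mulrDl -mulrA lerD // ler_wpM2l ?ca_ge0 //.
have h0 : 0 <= ca c * M + N by rewrite addr_ge0 ?mulr_ge0 ?ca_ge0.
by rewrite (SlE h0 h) !l2E_D !l2E_Z (SlE M0 aM) (SlE N0 bN).
Qed.
Lemma Sl_id (f : l2Z) : Sl (fun y v => v) f = f.
Proof.
apply: l2_ext => z; have h : fam_bound (fun (y : Y) (v : l2X) => v) 1 by move=> y v; rewrite mul1r.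
by rewrite (SlE ler01 h) sliceE peK.
Qed.
Lemma Sl_adj a b : ok_fam a -> ok_fam b -> fam_adj a b ->
  forall f g, inner (Sl a f) g = inner f (Sl b g).
Proof.
move=> ha hb ab f g; apply: (bounded_adjoint_ext (Sl_blin ha) (Sl_blin hb)).
case: ha hb => [al [M M0 aM]] [bl [N N0 bN]] z z'.
have a0 y : a y 0 = 0 by apply: lin0 => c v w; exact: al.
have b0 y : b y 0 = 0 by apply: lin0 => c v w; exact: bl.
rewrite inner_dlt inner_dltl (SlE M0 aM) (SlE N0 bN) !slice_dlt [p2 e z' == _]eq_sym.
case: eqP => [<-|_]; last by rewrite a0 b0 !l2E_0 rmorph0.
by rewrite -inner_dlt -inner_dltl ab.
Qed.

Definition ins_fun y (v : l2X) z : C := if p2 e z == y then v (p1 e z) else 0.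
Lemma ins_sq y (v : l2X) : sq_summable (ins_fun y v).
Proof.
apply: (@sq_summable_seq R Z _ (l2sq v)) => s us; rewrite /ins_fun.
rewrite (eq_bigr (fun z => if p2 e z == y then ca (v (p1 e z)) ^+ 2 else 0)); last first.
  by move=> z _; case: ifP; rewrite ?ca0 ?expr0n.
rewrite -big_mkcond -big_filter -(big_map (p1 e) xpredT (fun x => ca (v x) ^+ 2)).
apply: l2sq_le_seq; rewrite map_inj_in_uniq ?filter_uniq // => z z'.
rewrite !mem_filter => /andP[/eqP h _] /andP[/eqP h' _] E.
by rewrite -(peK e z) -(peK e z') E h h'.
Qed.
Definition ins y (v : l2X) : l2Z := L2 (ins_sq y v).
Lemma slice_ins y (v : l2X) : slice y (ins y v) = v.
Proof. by apply: l2_ext => x; rewrite sliceE /= /ins_fun p1K p2K eqxx. Qed.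

Lemma Sl_inj a : ok_fam a -> (forall f, Sl a f = 0) -> forall y v, a y v = 0.
Proof.
move=> [_ [M M0 aM]] h y v; have := slice_Sl M0 aM (ins y v) y.
by rewrite h slice_ins => <-; exact: l2_ext.
Qed.

Lemma tv_sq (f : l2X) (g : l2 R Y) : sq_summable (fun z => f (p1 e z) * g (p2 e z)).
Proof.
apply: (@sq_summable_seq R Z _ (l2sq g * l2sq f)) => s us.
apply: le_trans (sum_rect us (fun z => sqr_ge0 (ca _))) _.
apply: le_trans (_ : \sum_(y <- undup (map (p2 e) s)) (ca (g y) ^+ 2 * l2sq f) <= _); last first.
  by rewrite -mulr_suml ler_wpM2r ?l2sq_ge0 ?l2sq_le_seq ?undup_uniq.
apply: ler_sum => y _; under eq_bigr do rewrite p1K p2K caM exprMn mulrC.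
by rewrite -mulr_sumr ler_wpM2l ?sqr_ge0 ?l2sq_le_seq ?undup_uniq.
Qed.
Definition tv (f : l2X) (g : l2 R Y) : l2Z := L2 (tv_sq f g).
Lemma tvE (f : l2X) (g : l2 R Y) z : tv f g z = f (p1 e z) * g (p2 e z). Proof. by []. Qed.
Lemma tvPl (c : C) (f f' : l2X) (g : l2 R Y) : tv (c *: f + f') g = c *: tv f g + tv f' g.
Proof. by apply: l2_ext => z; rewrite (l2E_D, l2E_Z) !(tvE, l2E_D, l2E_Z); ring. Qed.
Lemma tvPr (c : C) (f : l2X) (g g' : l2 R Y) : tv f (c *: g + g') = c *: tv f g + tv f g'.
Proof. by apply: l2_ext => z; rewrite (l2E_D, l2E_Z) !(tvE, l2E_D, l2E_Z); ring. Qed.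
Lemma tv_bound (f : l2X) (g : l2 R Y) : nr (tv f g) <= nr f * nr g.
Proof.
apply: nr_l2_le; first by rewrite mulr_ge0 ?nr_ge0.
move=> B; rewrite exprMn !nr_l2.
apply: le_trans (sum_rect (fset_uniq B) (fun z => sqr_ge0 (ca _))) _.
apply: le_trans (_ : \sum_(y <- undup (map (p2 e) B)) (ca (g y) ^+ 2 * l2sq f) <= _); last first.
  by rewrite -mulr_suml mulrC ler_wpM2l ?l2sq_ge0 ?l2sq_le_seq ?undup_uniq.
apply: ler_sum => y _; under eq_bigr do rewrite tvE p1K p2K caM exprMn mulrC.
by rewrite -mulr_sumr ler_wpM2l ?sqr_ge0 ?l2sq_le_seq ?undup_uniq.
Qed.
Lemma tv_blinl (g : l2 R Y) : blin (fun f => tv f g).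
Proof.
split; first by move=> c f f'; exact: tvPl.
by exists (nr g); [exact: nr_ge0|move=> f; rewrite mulrC; exact: tv_bound].
Qed.
Lemma tv_blinr (f : l2X) : blin (fun g => tv f g).
Proof.
split; first by move=> c g g'; exact: tvPr.
by exists (nr f); [exact: nr_ge0|exact: tv_bound].
Qed.
Lemma tv_dlt x y : tv (dlt R x) (dlt R y) = dlt R (pe e x y).
Proof.
apply: l2_ext => z; rewrite tvE !dltE -natrM mulnb; congr (_%:R); congr nat_of_bool.
by apply/andP/eqP => [[/eqP-> /eqP->]|<-]; rewrite ?peK // p1K p2K.
Qed.
Lemma total_tv : total [set tv f g | f in [set: l2X] & g in [set: l2 R Y]].
Proof.
move=> P cP hP; apply: (@total_dlt R Z) => // _ [z _ <-]; apply: hP.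
by exists (dlt R (p1 e z)) => //; exists (dlt R (p2 e z)); rewrite // tv_dlt peK.
Qed.
Lemma inner_tv (f f' : l2X) (g g' : l2 R Y) : inner (tv f g) (tv f' g') = inner f f' * inner g g'.
Proof.
have bl (H : hilbertType R) (z : H) : blin (fun v => (inner v z : Cplx R)).
  split; first by move=> a x y; exact: innerP.
  by exists (nr z); [exact: nr_ge0|move=> x; rewrite mulrC; exact: inner_CS].
have sc (c : C) : blin (fun v : Cplx R => (c * v : Cplx R)).
  split; first by move=> a x y; rewrite mulrDr mulrCA.
  by exists (ca c); [exact: ca_ge0|move=> x; rewrite -caM].
have dd x y : inner (dlt R (pe e x y)) (tv f' g') = inner (dlt R x) f' * inner (dlt R y) g'.
  by rewrite !inner_dltl tvE p1K p2K rmorphM.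
have d1 x : inner (tv (dlt R x) g) (tv f' g') = inner (dlt R x) f' * inner g g'.
  have E := @blin_ext R _ _ (fun g => inner (tv (dlt R x) g) (tv f' g') : Cplx R)
    (fun g => inner (dlt R x) f' * inner g g' : Cplx R) _ (@total_dlt R Y)
    (blin_comp (bl _ _) (tv_blinr (dlt R x))) (blin_comp (sc _) (bl _ _)).
  by apply: E => _ [y _ <-]; rewrite tv_dlt dd.
rewrite mulrC.
have E := @blin_ext R _ _ (fun f => inner (tv f g) (tv f' g') : Cplx R)
    (fun f => inner g g' * inner f f' : Cplx R) _ (@total_dlt R X)
    (blin_comp (bl _ _) (tv_blinl g)) (blin_comp (sc _) (bl _ _)).
by apply: E => _ [x _ <-]; rewrite d1 mulrC.
Qed.
End Slices.

Section OpTensor.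
Variables (R : realType) (X Y Z : choiceType) (e : pairing X Y Z).
Definition swap_pairing : pairing Y X Z :=
  @Pairing Y X Z (fun y x => pe e x y) (p2 e) (p1 e) (peK e) (fun y x => p2K e x y) (fun y x => p1K e x y).

(* [a (x) b] as [(a (x) 1) (1 (x) b)]. *)
Definition otens (a : l2 R X -> l2 R X) (b : l2 R Y -> l2 R Y) (f : l2 R Z) : l2 R Z :=
  Sl e (fun=> a) (Sl swap_pairing (fun=> b) f).
End OpTensor.

Section ClosedSubspaces.
Variable R : realType.
Local Notation C := R[i].

Lemma closed_subspace_preim (V W : normedModType C) (f : V -> W) (P : set W) :
  blin f -> closed_subspace P -> closed_subspace (f @^-1` P).
Proof.
move=> [fl [M M0 fM]] [P0 PL PC]; split => /=; first by rewrite /= lin0.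
  by move=> a x y Px Py /=; rewrite /= fl; exact: PL.
move=> x h; apply: PC => e e0; have k0 : 0 < M + 1 by lra.
have [y Py xy] := h _ (divr_gt0 e0 k0); exists (f y) => //.
rewrite -(linB fl); apply: le_lt_trans (fM _) _; move: xy; rewrite ltr_pdivlMr //.
by have := nr_ge0 (x - y); nra.
Qed.


Section A.
Variable A : cstarAlgType R.
Lemma blin_mull (x : A) : blin (fun y => x ** y).
Proof. by split; [move=> a y z; rewrite cmulPr|exists (nr x); [exact: nr_ge0|move=> y; exact: nrM]]. Qed.
Lemma blin_mulr (x : A) : blin (fun y => y ** x).
Proof.
split; first by move=> a y z; rewrite cmulPl.
by exists (nr x); [exact: nr_ge0|move=> y; rewrite mulrC; exact: nrM].
Qed.
Lemma closed_subspace_star (P : set A) : closed_subspace P -> closed_subspace [set x | P (star x)].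
Proof.
move=> [P0 PL PC]; split => /=; first by rewrite star0.
  by move=> a x y Px Py; rewrite starP; exact: PL.
move=> x h; apply: PC => e /h [y Py xy]; exists (star y) => //.
by rewrite -starN -starD nr_star.
Qed.
End A.

Lemma star_hom_total (A B : cstarAlgType R) (f : A -> B) (S : set A) : blin f -> total S ->
  (forall x y, S x -> S y -> f (x ** y) = f x ** f y) ->
  (forall x, S x -> f (star x) = star (f x)) -> f cone = cone -> star_hom f.
Proof.
move=> bf tS fM fs f1; have [fl _] := bf; split => //.
- move=> x y.
  have h1 z : S z -> forall x, f (x ** z) = f x ** f z.
    move=> Sz; apply: (blin_ext tS (blin_comp bf (blin_mulr z)) (blin_comp (blin_mulr (f z)) bf)).
    by move=> w Sw; exact: fM.
  apply: (blin_ext tS (blin_comp bf (blin_mull x)) (blin_comp (blin_mull (f x)) bf)).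
  by move=> w Sw; exact: h1.
- have [M M0 fb] := proj2 bf; pose P : set A := [set x | f (star x) = star (f x)].
  apply: (tS P) => //; split; rewrite /P /=.
  + by rewrite star0 !(lin0 fl) star0.
  + by move=> a x y hx hy; rewrite starP !fl starP hx hy.
  + move=> x h; apply/eqP; rewrite -subr_eq0; apply/eqP/nr_le_eq0 => e e0.
    have k0 : 0 < 2 * (M + 1) by lra.
    have [y hy xy] := h _ (divr_gt0 e0 k0).
    have -> : f (star x) - star (f x) = f (star (x - y)) - star (f (x - y)).
      by rewrite starD starN !(linB fl) starD starN hy; lmod C B.
    apply: le_trans (nrB _ _) _; rewrite nr_star.
    have := fb (star (x - y)); have := fb (x - y); rewrite nr_star.
    by move: xy; rewrite ltr_pdivlMr //; have := nr_ge0 (x - y); nra.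
Qed.
End ClosedSubspaces.

Section AllFamilies.
Variables (R : realType) (Y : Type) (K : hilbertType R).
Local Notation C := R[i].

Lemma adj_lin (a b : Y -> K -> K) : fam_adj a b -> fam_lin b.
Proof.
move=> h y c v w; apply: inner_ext => z.
by rewrite inner_conj -h !iE !h rmorphD rmorphM /= conjCK -!inner_conj.
Qed.
Lemma adj_bound (a b : Y -> K -> K) M : fam_adj a b -> fam_bound a M -> 0 <= M -> fam_bound b M.
Proof.
move=> h aM M0 y v; have [->|/nr_gt0 n0] := pselect (b y v = 0).
  by rewrite nr0 mulr_ge0 ?nr_ge0.
rewrite -(ler_pM2r n0) -expr2.
have : ((nr (b y v)) ^+ 2)%:C = inner (a y (b y v)) v by rewrite -inner_self h.
move=> /(congr1 (@ca R)); rewrite ca_real ger0_norm ?sqr_ge0 // => ->.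
apply: le_trans (inner_CS _ _) _; rewrite mulrAC ler_wpM2r ?nr_ge0 //; exact: aM.
Qed.

Definition all_ok (a : Y -> K -> K) :=
  [/\ fam_lin a, exists2 M, 0 <= M & fam_bound a M & exists b, fam_adj a b].

Lemma adj_sym (a b : Y -> K -> K) : fam_adj a b -> fam_adj b a.
Proof. by move=> h y v w; rewrite inner_conj -h -inner_conj. Qed.
Lemma all_adj a : all_ok a -> exists2 b, all_ok b & fam_adj a b.
Proof.
move=> [al [M M0 aM] [b ab]]; exists b => //; split; first exact: adj_lin ab.
  by exists M => //; exact: adj_bound ab aM M0.
by exists a; exact: adj_sym.
Qed.
Lemma allP (c : C) a b : all_ok a -> all_ok b -> all_ok (fun y v => c *: a y v + b y v).
Proof.
move=> [al [M M0 aM] [a' aa]] [bl [N N0 bN] [b' bb]]; split.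
- by move=> y d v w; rewrite al bl; lmod C K.
- exists (ca c * M + N); first by rewrite addr_ge0 ?mulr_ge0 ?ca_ge0.
  move=> y v; apply: le_trans (nrD _ _) _; rewrite nrZ mulrDl -mulrA lerD // ler_wpM2l ?ca_ge0 //.
- by exists (fun y v => c^* *: a' y v + b' y v) => y v w; rewrite !iE conjCK aa bb.
Qed.
Lemma allM a b : all_ok a -> all_ok b -> all_ok (fun y v => a y (b y v)).
Proof.
move=> [al [M M0 aM] [a' aa]] [bl [N N0 bN] [b' bb]]; split.
- by move=> y d v w; rewrite bl al.
- exists (M * N); first exact: mulr_ge0.
  by move=> y v; apply: le_trans (aM _ _) _; rewrite -mulrA ler_wpM2l.
- by exists (fun y v => b' y (a' y v)) => y v w; rewrite aa bb.
Qed.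
Lemma all1 : all_ok (fun y v => v).
Proof.
by split => //; [exists 1; rewrite ?ler01 // => y v; rewrite mul1r|exists (fun y v => v)].
Qed.
Lemma all_closed a : fam_lin a -> (exists b, fam_adj a b) ->
  (forall e : R, 0 < e -> exists2 b, all_ok b & fam_bound (fun y v => a y v - b y v) e) -> all_ok a.
Proof.
move=> al ab /(_ 1 ltr01) [b [_ [M M0 bM] _] h]; split => //.
exists (1 + M); first by rewrite addr_ge0.
move=> y v; have := nrD (a y v - b y v) (b y v); rewrite subrK => /le_trans; apply.
by rewrite mulrDl lerD.
Qed.
Definition allfam := @FamSub R Y K all_ok (fun a h => let: And3 x _ _ := h in x)
  (fun a h => let: And3 _ x _ := h in x) all_adj allP allM all1 all_closed.

Section Generated.
Variable S : set (fam allfam).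
Hypotheses (SM : forall x y, S x -> S y -> lin_span S (x ** y))
  (Ss : forall x, S x -> lin_span S (star x)) (S1 : lin_span S cone).
Local Notation cl := (closure (lin_span S)).

Lemma cl_span x : lin_span S x -> cl x. Proof. exact: subset_closure. Qed.
Lemma clP : closed_subspace cl. Proof. exact: closed_subspace_closure. Qed.
Lemma clM x y : cl x -> cl y -> cl (x ** y).
Proof.
move=> hx hy.
have h1 s : S s -> cl (s ** y).
  move=> Ss'; apply: (closure_span_sub (closed_subspace_preim (blin_mull s) clP) _ hy).
  by move=> t St /=; apply/cl_span/SM.
apply: (closure_span_sub (closed_subspace_preim (blin_mulr y) clP) _ hx).
by move=> s Ss' /=; exact: h1.
Qed.
Lemma cl_star x : cl x -> cl (star x).
Proof.
move=> hx; apply: (closure_span_sub (closed_subspace_star clP) _ hx).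
by move=> s Ss' /=; apply/cl_span/Ss.
Qed.

Definition gen_set : set (Y -> K -> K) := [set ff f | f in cl].
Lemma gen_adj a : gen_set a -> exists2 b, gen_set b & fam_adj a b.
Proof.
move=> [f hf <-]; exists (ff (star f)); first by exists (star f) => //; exact: cl_star.
by move=> y v w; exact: fam_starl.
Qed.
Lemma genP (c : C) a b : gen_set a -> gen_set b -> gen_set (fun y v => c *: a y v + b y v).
Proof.
move=> [f hf <-] [g hg <-]; exists (c *: f + g); first by case: clP => _ + _; apply.
by apply/funext => y; apply/funext => v; rewrite !famE.
Qed.
Lemma genM a b : gen_set a -> gen_set b -> gen_set (fun y v => a y (b y v)).
Proof. by move=> [f hf <-] [g hg <-]; exists (f ** g) => //; exact: clM. Qed.
Lemma gen1 : gen_set (fun y v => v).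
Proof. by exists cone => //; exact: cl_span. Qed.
Lemma gen_closed a : fam_lin a -> (exists b, fam_adj a b) ->
  (forall e : R, 0 < e -> exists2 b, gen_set b & fam_bound (fun y v => a y v - b y v) e) -> gen_set a.
Proof.
move=> al ab h.
have aa : all_ok a.
  apply: all_closed => // e /h [b [f _ <-] hb]; exists (ff f) => //; exact: (ffP f).
exists (@Fam R Y K allfam a aa) => //; case: clP => _ _; apply => e e0.
have e2 : 0 < e / 2 by rewrite divr_gt0.
have [_ [f hf <-] hb] := h _ e2; exists f => //.
apply: le_lt_trans (_ : e / 2 < e); last by lra.
by apply: nr_fam_le; [exact: ltW|move=> y v; rewrite famE_D famE_N; exact: hb].
Qed.
Definition gen_sub := @FamSub R Y K gen_set
  (fun a h => let: ex_intro2 f _ E := h in let: erefl := E in ff_lin f)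
  (fun a h => let: ex_intro2 f _ E := h in let: erefl := E in fmem_bd (ffP f))
  gen_adj genP genM gen1 gen_closed.

Lemma gen_sub_in x : S x -> fmem gen_sub (ff x).
Proof. by move=> Sx; exists x => //; apply/cl_span/lin_span_in. Qed.

(** Density holds by construction inside [allfam]. In both algebras the norm is the least uniform
    bound of the family, so density carries over; the predicate [ok] takes the proof of membership
    along. *)
Lemma total_gen : total [set x : fam gen_sub | exists2 s, S s & forall y v, x y v = s y v].
Proof.
move=> P cP hP x; have [s hs E] := ffP x.
pose ok (f : fam allfam) := exists h : fmem gen_sub (ff f), P (Fam h).
have : ok s.
  apply: (closure_span_sub _ _ hs); last first.
    by move=> f Sf; exists (gen_sub_in Sf); apply: hP; exists f.
  have [P0 PL PC] := cP; split.
  - exists (fam_sub0 gen_sub); congr P: P0; exact: fam_ext.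
  - move=> a f g [hf Pf] [hg Pg].
    have h : fmem gen_sub (ff (a *: f + g)).
      have := fmemP a hf hg; congr (fmem gen_sub _).
      by apply/funext => y; apply/funext => v; rewrite !famE.
    exists h; have := PL a _ _ Pf Pg; congr P; apply: fam_ext => y v.
    by transitivity (a *: f y v + g y v); [rewrite !famE|rewrite -[RHS]/((a *: f + g) y v) !famE].
  - move=> f hf.
    have h : fmem gen_sub (ff f).
      apply: gen_closed; [exact: ff_lin|by exists (ff (star f)) => y v w; exact: fam_starl|].
      move=> e /hf [g [hg _] fg]; exists (ff g) => // y v.
      rewrite -famE_N -famE_D; apply: le_trans (nr_fam_bound _ _ _) _.
      by rewrite ler_wpM2r ?nr_ge0 // ltW.
    exists h; apply: PC => e e0; have e2 : 0 < e / 2 by rewrite divr_gt0.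
    have [g [hg Pg] fg] := hf _ e2; exists (Fam hg) => //.
    apply: le_lt_trans (_ : e / 2 < e); last by lra.
    apply: nr_fam_le; first exact: ltW.
    move=> y v; rewrite famE_D famE_N /=; rewrite -famE_N -famE_D.
    by apply: le_trans (nr_fam_bound _ _ _) _; rewrite ler_wpM2r ?nr_ge0 // ltW.
by move=> [h Ph]; congr P: Ph; apply: fam_ext => y v /=; rewrite E.
Qed.
End Generated.
End AllFamilies.

Section OpTensorTheory.
Variables (R : realType) (X Y Z : choiceType) (e : pairing X Y Z).
Local Notation C := R[i].
Implicit Types (a : l2 R X -> l2 R X) (b : l2 R Y -> l2 R Y).

Lemma const_ok (I J : choiceType) (a : l2 R I -> l2 R I) : blin a -> ok_fam (fun _ : J => a).
Proof. by move=> [al [M M0 aM]]; split; [move=> y; exact: al|exists M => // y v; exact: aM]. Qed.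

Lemma otens_blin a b : blin a -> blin b -> blin (otens e a b).
Proof. by move=> ha hb; apply: (blin_comp (Sl_blin _ (const_ok _ ha)) (Sl_blin _ (const_ok _ hb))). Qed.

Lemma otens_bound a b M N : 0 <= M -> 0 <= N -> (forall v, nr (a v) <= M * nr v) ->
  (forall v, nr (b v) <= N * nr v) -> forall v, nr (otens e a b v) <= M * N * nr v.
Proof.
move=> M0 N0 aM bN v; apply: le_trans (Sl_bound _ M0 _ _) _; first by move=> y; exact: aM.
by rewrite -mulrA ler_wpM2l //; apply: (Sl_bound _ N0) => y; exact: bN.
Qed.

Lemma otens_tv a b f g : blin a -> blin b -> otens e a b (tv e f g) = tv e (a f) (b g).
Proof.
move=> ha hb; have [al [M M0 aM]] := ha; have [bl [N N0 bN]] := hb.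
have aM' : fam_bound (fun _ : Y => a) M by move=> y; exact: aM.
have bN' : fam_bound (fun _ : X => b) N by move=> y; exact: bN.
have E : Sl (swap_pairing e) (fun=> b) (tv e f g) = tv e f (b g).
  apply: l2_ext => z; rewrite (SlE _ N0 bN') /=.
  have -> : slice (swap_pairing e) (p1 e z) (tv e f g) = f (p1 e z) *: g.
    by apply: l2_ext => y; rewrite sliceE /= p1K p2K.
  by rewrite (linZ bl).
rewrite /otens E; apply: l2_ext => z; rewrite (SlE _ M0 aM') /=.
have -> : slice e (p2 e z) (tv e f (b g)) = b g (p2 e z) *: f.
  by apply: l2_ext => x; rewrite sliceE /= p1K p2K mulrC.
by rewrite (linZ al) l2E_Z mulrC.
Qed.
Lemma otens_dlt a b x y : blin a -> blin b ->
  otens e a b (dlt R (pe e x y)) = tv e (a (dlt R x)) (b (dlt R y)).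
Proof. by move=> ha hb; rewrite -tv_dlt otens_tv. Qed.

Lemma otens_ext (f : l2 R Z -> l2 R Z) a b : blin f -> blin a -> blin b ->
  (forall x y, f (dlt R (pe e x y)) = tv e (a (dlt R x)) (b (dlt R y))) -> f =1 otens e a b.
Proof.
move=> bf ha hb h; apply: (blin_ext (@total_dlt R Z) bf (otens_blin ha hb)) => _ [z _ <-].
by rewrite -(peK e z) h otens_dlt.
Qed.

Lemma otens_comp a a' b b' : blin a -> blin a' -> blin b -> blin b' -> forall v,
  otens e (a \o a') (b \o b') v = otens e a b (otens e a' b' v).
Proof.
move=> ha ha' hb hb' v; apply/esym; have E := otens_ext (blin_comp (otens_blin ha hb) (otens_blin ha' hb'))
  (blin_comp ha ha') (blin_comp hb hb').
by apply: E => x y /=; rewrite otens_dlt // otens_tv.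
Qed.
Lemma otens_id (v : l2 R Z) : otens e (fun v => v) (fun v => v) v = v.
Proof. by rewrite /otens !Sl_id. Qed.
Lemma otens_linl (c : C) a a' b : blin a -> blin a' -> blin b -> forall v,
  otens e (fun w => c *: a w + a' w) b v = c *: otens e a b v + otens e a' b v.
Proof.
move=> ha ha' hb v; apply/esym.
have E := otens_ext (blinB c (otens_blin ha hb) (otens_blin ha' hb)) (blinB c ha ha') hb.
by apply: E => x y; rewrite !otens_dlt // tvPl.
Qed.
Lemma otens_linr (c : C) a b b' : blin a -> blin b -> blin b' -> forall v,
  otens e a (fun w => c *: b w + b' w) v = c *: otens e a b v + otens e a b' v.
Proof.
move=> ha hb hb' v; apply/esym.
have E := otens_ext (blinB c (otens_blin ha hb) (otens_blin ha hb')) ha (blinB c hb hb').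
by apply: E => x y; rewrite !otens_dlt // tvPr.
Qed.
Lemma otens_adj a a' b b' : blin a -> blin a' -> blin b -> blin b' ->
  (forall v w, inner (a v) w = inner v (a' w)) -> (forall v w, inner (b v) w = inner v (b' w)) ->
  forall v w, inner (otens e a b v) w = inner v (otens e a' b' w).
Proof.
move=> ha ha' hb hb' aa bb; apply: (bounded_adjoint_ext (otens_blin ha hb) (otens_blin ha' hb')).
move=> z z'; rewrite -(peK e z) -(peK e z') !otens_dlt // -!tv_dlt !inner_tv.
by rewrite aa bb.
Qed.
End OpTensorTheory.

Lemma fam_blin (R : realType) (Y : Type) (K : hilbertType R) (D : famsub Y K) (f : fam D) y : blin (f y).
Proof.
split; first by move=> a v w; exact: ff_lin.
by exists (nr f); [exact: nr_ge0|exact: nr_fam_bound].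
Qed.
Lemma eval_blin (R : realType) (Y : Type) (K : hilbertType R) (D : famsub Y K) y v :
  blin (fun f : fam D => f y v).
Proof.
split; first by move=> a f g; rewrite !famE.
by exists (nr v); [exact: nr_ge0|move=> f; rewrite mulrC; exact: nr_fam_bound].
Qed.

(** * Spatial tensor products of family algebras *)

Section Tensor.
Variables (R : realType) (X X' Z Y Y' Z' : choiceType).
Variables (e : pairing X X' Z) (ye : pairing Y Y' Z').
Variables (D : famsub Y (l2 R X)) (D' : famsub Y' (l2 R X')).
Local Notation C := R[i].
Local Notation allZ := (allfam Z' (l2 R Z)).

Definition tnf (a : fam D) (b : fam D') : Z' -> l2 R Z -> l2 R Z :=
  fun p => otens e (a (p1 ye p)) (b (p2 ye p)).

Lemma tnf_ok a b : all_ok (tnf a b).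
Proof.
split.
- by move=> y c v w; apply: (proj1 (otens_blin e (fam_blin a (p1 ye y)) (fam_blin b (p2 ye y)))).
- exists (nr a * nr b); first by rewrite mulr_ge0 ?nr_ge0.
  by move=> y; apply: otens_bound; rewrite ?nr_ge0 //; exact: nr_fam_bound.
- exists (tnf (star a) (star b)) => y; apply: otens_adj; try exact: fam_blin.
    by move=> v w; exact: fam_starl.
  by move=> v w; exact: fam_starl.
Qed.
Definition tna a b : fam allZ := Fam (tnf_ok a b : fmem allZ _).

Lemma tnaM a a' b b' : tna a b ** tna a' b' = tna (a ** a') (b ** b').
Proof.
apply: fam_ext => y v; rewrite famE_M /= /tnf -otens_comp //; exact: fam_blin.
Qed.
Lemma tna_star a b : star (tna a b) = tna (star a) (star b).
Proof.
apply: famstar_uniq => y; apply: otens_adj; try exact: fam_blin.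
  by move=> v w; exact: fam_starl.
by move=> v w; exact: fam_starl.
Qed.
Lemma tna1 : tna cone cone = cone.
Proof. by apply: fam_ext => y v /=; rewrite /tnf otens_id. Qed.

Definition tset := [set tna a b | a in [set: fam D] & b in [set: fam D']].
Lemma tset_in a b : tset (tna a b). Proof. by exists a => //; exists b. Qed.
Lemma tsetM x y : tset x -> tset y -> lin_span tset (x ** y).
Proof.
move=> [a _ [b _ <-]] [a' _ [b' _ <-]]; rewrite tnaM; apply: lin_span_in; exact: tset_in.
Qed.
Lemma tset_star x : tset x -> lin_span tset (star x).
Proof. by move=> [a _ [b _ <-]]; rewrite tna_star; apply: lin_span_in; exact: tset_in. Qed.
Lemma tset1 : lin_span tset cone.
Proof. by rewrite -tna1; apply: lin_span_in; exact: tset_in. Qed.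

Definition tsub := gen_sub tsetM tset_star tset1.
Lemma tn_subproof a b : fmem tsub (tnf a b).
Proof. by have := gen_sub_in tsetM tset_star tset1 (tset_in a b). Qed.
Definition tn a b : fam tsub := Fam (tn_subproof a b).

Lemma total_tn : total [set tn a b | a in [set: fam D] & b in [set: fam D']].
Proof.
have := @total_gen R Z' (l2 R Z) tset tsetM tset_star tset1.
move=> tg P cP hP; apply: (tg P cP) => x [_ [a _ [b _ <-]] E].
by apply: hP; exists a => //; exists b => //; apply: fam_ext => y v; rewrite E.
Qed.
End Tensor.

(* [X x Y x X' x Y'] as [(X x X') x (Y x Y')]. *)
Definition shuffle (X X' Z Y Y' Z' : Type) (e : pairing X X' Z) (ye : pairing Y Y' Z') :
  pairing Z Z' ((X * Y) * (X' * Y')).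
refine (@Pairing Z Z' ((X * Y) * (X' * Y'))
  (fun z z' => ((p1 e z, p1 ye z'), (p2 e z, p2 ye z')))
  (fun q => pe e q.1.1 q.2.1) (fun q => pe ye q.1.2 q.2.2) _ _ _).
- by move=> [[x y] [x' y']] /=; rewrite !p1K !p2K.
- by move=> z z' /=; rewrite peK.
- by move=> z z' /=; rewrite peK.
Defined.

Definition prod_pairing (X Y : Type) : pairing X Y (X * Y).
by refine (@Pairing X Y (X * Y) pair fst snd _ _ _) => // -[].
Defined.

Section FamRep.
Variables (R : realType) (X Y Z : choiceType) (e : pairing X Y Z) (D : famsub Y (l2 R X)).
Lemma fam_ok (a : fam D) : ok_fam a.
Proof. by split; [exact: ff_lin|exists (nr a); [exact: nr_ge0|exact: nr_fam_bound]]. Qed.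
Lemma Sl_rep : representation (fun a : fam D => Sl e a).
Proof.
split.
- move=> a; split; first exact: (Sl_lin e (fam_ok a)).
  by apply: blin_cont; apply: Sl_blin; exact: fam_ok.
- move=> c a b v; rewrite -(Sl_add e c (fam_ok a) (fam_ok b)).
  by congr (Sl e _ v); apply/funext => y; apply/funext => w; rewrite !famE.
- by move=> a b v; rewrite -(Sl_comp e (fam_ok a) (fam_ok b)).
- exact: Sl_id.
- move=> a v w; apply: Sl_adj; try exact: fam_ok.
  by move=> y v' w'; exact: fam_starr.
Qed.
Lemma Sl_faithful : faithful (fun a : fam D => Sl e a).
Proof. by move=> a h; apply: fam_ext => y v; exact: (Sl_inj (fam_ok a) h). Qed.
End FamRep.

Section Spatial.
Variables (R : realType) (X X' Z Y Y' Z' : choiceType).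
Variables (e : pairing X X' Z) (ye : pairing Y Y' Z').
Variables (D : famsub Y (l2 R X)) (D' : famsub Y' (l2 R X')) (D'' : famsub Z' (l2 R Z)).
(** The direct sum over all indices, realised by [Sl] on l2(X x Y), is a faithful representation of
    a family algebra. The direct sum for [t] acts on the tensor product of two such spaces after the
    reordering [shuffle] of the index sets. *)
Lemma spatialP (t : fam D -> fam D' -> fam D'') :
  (forall a b y v, t a b y v = tnf e ye a b y v) ->
  total [set t a b | a in [set: fam D] & b in [set: fam D']] -> spatial_tensor t.
Proof.
move=> tE tot; split; first exact: total_closure.
exists (l2 R (X * Y)%type), (l2 R (X' * Y')%type), (l2 R ((X * Y) * (X' * Y'))%type),
  (@tv R _ _ _ (prod_pairing (X * Y) (X' * Y'))), (fun a => Sl (prod_pairing X Y) (ff a)),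
  (fun b => Sl (prod_pairing X' Y') (ff b)), (fun x => Sl (shuffle e ye) (ff x)).
split; try by split; [exact: Sl_rep|exact: Sl_faithful].
- split; [by move=> k c f g; exact: tvPl|by move=> h c f g; exact: tvPr|by move=> *; exact: inner_tv|].
  by apply: total_closure; exact: total_tv.
- move=> a b h k; apply: l2_ext => -[[x y] [x' y']].
  have [_ [M M0 tM]] := fam_ok (t a b); have [_ [N N0 aN]] := fam_ok a; have [_ [L L0 bL]] := fam_ok b.
  rewrite (SlE _ M0 tM) tvE /= (SlE _ N0 aN) (SlE _ L0 bL) tE /tnf /= p1K p2K.
  have -> : slice (shuffle e ye) (pe ye y y') (tv (prod_pairing (X * Y) (X' * Y')) h k) =
      tv e (slice (prod_pairing X Y) y h) (slice (prod_pairing X' Y') y' k).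
    by apply: l2_ext => z; rewrite sliceE /= p1K p2K.
  by rewrite otens_tv ?tvE ?p1K ?p2K //; exact: fam_blin.
Qed.
End Spatial.

(** * Covariant representations *)

(* [t g = al t g . be g t] in the ambient group, for [t] in the discrete group and
   [g] in the finite group. *)
Record mpair := MPair {
  mT : groupType; mK : finGroupType;
  mal : mT -> mK -> mK; mbe : mK -> mT -> mT;
  mal1 : forall g, mal 1%g g = g;
  malM : forall s t g, mal (s * t)%g g = mal s (mal t g);
  mal_1 : forall s, mal s 1%g = 1%g;
  mbe1 : forall s, mbe 1%g s = s;
  mbeM : forall g h s, mbe (g * h)%g s = mbe h (mbe g s);
  mbe_1 : forall g, mbe g 1%g = 1%g;
  mal_mul : forall s g h, mal s (g * h)%g = (mal s g * mal (mbe g s) h)%g;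
  mbe_mul : forall g s t, mbe g (s * t)%g = (mbe (mal t g) s * mbe g t)%g;
  mT_enum : exists x : nat -> mT, forall t, exists n, x n = t }.

Section Representations.
Variables (R : realType) (m : mpair).
Local Notation T := (mT m).
Local Notation K := (mK m).
Local Notation al := (@mal m).
Local Notation be := (@mbe m).
Local Notation C := R[i].

Lemma malK (t : T) g : al t^-1%g (al t g) = g.
Proof. by rewrite -malM mulVg mal1. Qed.
Lemma malVK (t : T) g : al t (al t^-1%g g) = g.
Proof. by rewrite -malM mulgV mal1. Qed.
Lemma mal_inj (t : T) : injective (al t).
Proof. exact: can_inj (malK t). Qed.

(** Over a finite group a representation of C(G) amounts to orthogonal projections [E g] with sum 1,
    the images of the indicators of points. *)
Record isrep (H : hilbertType R) (U : T -> H -> H) (E : K -> H -> H) : Prop := IsRep {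
  rU_b : forall t, blin (U t);
  rE_b : forall g, blin (E g);
  rU_adj : forall t v w, inner (U t v) w = inner v (U t^-1%g w);
  rU1 : forall v, U 1%g v = v;
  rUM : forall s t v, U (s * t)%g v = U s (U t v);
  rE_adj : forall g v w, inner (E g v) w = inner v (E g w);
  rEM : forall g h v, E g (E h v) = if g == h then E h v else 0;
  rE1 : forall v, \sum_g E g v = v;
  rUE : forall t g v, U t (E g v) = E (al t g) (U t v) }.

Lemma rU_nr (H : hilbertType R) U E : @isrep H U E -> forall t v, nr (U t v) = nr v.
Proof.
move=> h t v; have : inner (U t v) (U t v) = inner v v.
  by rewrite (rU_adj h) -(rUM h) mulVg (rU1 h).
rewrite !inner_self => /(@complexI R) /eqP; rewrite eqrXn2 ?nr_ge0 //.
by move=> /eqP.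
Qed.
Lemma rE_nr (H : hilbertType R) U E : @isrep H U E -> forall g v, nr (E g v) <= nr v.
Proof.
move=> h g v; have [->|/nr_gt0 n0] := pselect (E g v = 0); first by rewrite nr0 nr_ge0.
rewrite -(ler_pM2r n0) -expr2.
have : (nr (E g v) ^+ 2)%:C = inner v (E g v) by rewrite -inner_self (rE_adj h) (rEM h) eqxx.
move=> /(congr1 (@ca R)); rewrite ca_real ger0_norm ?sqr_ge0 // => ->.
exact: inner_CS.
Qed.
Lemma rEU (H : hilbertType R) U E : @isrep H U E ->
  forall t g v, E g (U t v) = U t (E (al t^-1%g g) v).
Proof. by move=> h t g v; rewrite (rUE h) malVK. Qed.

Record brep (B : cstarAlgType R) (u : T -> B) (p : K -> B) : Prop := BRep {
  bU_star : forall t, star (u t) = u t^-1%g;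
  bU1 : u 1%g = cone;
  bUM : forall s t, u (s * t)%g = u s ** u t;
  bE_star : forall g, star (p g) = p g;
  bEM : forall g h, p g ** p h = if g == h then p h else 0;
  bE1 : \sum_g p g = cone;
  bUE : forall t g, u t ** p g = p (al t g) ** u t }.

(** * The GNS construction on l2(nat) *)

Section GNS.
Variables (B : cstarAlgType R) (u : T -> B) (p : K -> B).
Hypothesis up : brep u p.
Variable phi : B -> C.
Hypotheses (phiL : forall (s : C) x y, phi (s *: x + y) = s * phi x + phi y)
  (phi0 : forall x, 0 <= phi (star x ** x)) (phi1 : phi cone = 1).

(** For self-adjoint [h] both [phi (h h)] and [phi ((1 + h) (1 + h))] are real, hence so is [phi h];
    the general case splits [x] into real and imaginary parts. *)
Lemma phi_star x : phi (star x) = (phi x)^*.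
Proof.
have pD y z : phi (y + z) = phi y + phi z by have := phiL 1 y z; rewrite scale1r mul1r.
have p0' : phi 0 = 0 by have := pD 0 0; rewrite addr0 => /eqP; rewrite -subr_eq0 opprD addrA subrr sub0r oppr_eq0 => /eqP.
have pZ c y : phi (c *: y) = c * phi y by have := phiL c y 0; rewrite !addr0 p0' addr0.
have real y : 0 <= y -> y^* = y :> C by move=> /ger0_real /CrealP.
have sa h : star h = h -> (phi h)^* = phi h.
  move=> sh; have := real _ (phi0 (cone + h)); have := real _ (phi0 h).
  rewrite !sE sh !cE !pD phi1 !rmorphD rmorph1 /= => -> /eqP.
  rewrite -!addrA (inj_eq (addrI _)) !addrA (inj_eq (addIr _)) => /eqP h2.
  have E2 (z : C) : z + z = 2%:R * z by ring.
  move: h2; rewrite !E2 => /mulfI; apply; by rewrite pnatr_eq0.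
pose a := (2^-1 : C) *: (x + star x); pose b := (2^-1 : C) *: ('i *: (star x - x)).
have ea : x = a + 'i *: b.
  rewrite /a /b; lmod C B; have := mul_ii R => ii; by field: ii.
have eb : star x = a - 'i *: b.
  rewrite /a /b; lmod C B; have := mul_ii R => ii; by field: ii.
have sta : star a = a by rewrite starZ starD starK conj_half addrC.
have stb : star b = b by rewrite !starZ starD starN starK conj_half conj_i scaleNr -scalerN opprB.
have e1 : phi (star x) = phi a - 'i * phi b by rewrite eb -scaleNr (pD a) (pZ (- 'i) b) mulNr.
have e2 : phi x = phi a + 'i * phi b by rewrite {1}ea (pD a) (pZ 'i b).
by rewrite e1 e2 rmorphD rmorphM /= conj_i !sa // mulNr.
Qed.

Definition gip (x y : B) : C := phi (star y ** x).
Lemma gipP (a : C) x y z : gip (a *: x + y) z = a * gip x z + gip y z.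
Proof. by rewrite /gip cmulPr phiL. Qed.
Lemma gipC x y : gip y x = (gip x y)^*.
Proof. by rewrite /gip -phi_star starM starK. Qed.
Lemma gip_ge0 x : 0 <= gip x x. Proof. exact: phi0. Qed.
Local Notation N := (ipn gip).
Let gD := ipDl gipP.
Let gZ := ipZl gipP.
Let gDr := ipDr gipP gipC.
Let gZr := ipZr gipP gipC.
Let CS := cauchy_schwarz gipP gipC gip_ge0.
Let gself := ip_self gip_ge0.
Let NZ := ipnZ gipP gipC gip_ge0.

Lemma gip_null x y : N x = 0 -> gip x y = 0.
Proof. by move=> h; apply/ca_eq0/eqP; rewrite eq_le ca_ge0 andbT; have := CS x y; rewrite h mul0r. Qed.

Definition bw (k : T * K) : B := u k.1 ** p k.2.
Definition bspan (x : B) := lin_span (range bw) x.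

Variable num : nat -> T * K.
Hypothesis num_surj : forall k, exists n, num n = k.
Let x n := bw (num n).

(** Gram-Schmidt for a possibly degenerate form. If what remains of [x n] is a null vector, the
    convention [0^-1 = 0] gives [gs n = 0]; so the [gs n] with [gd n] are orthonormal, the others
    vanish, and the GNS space is spanned by the basis vectors of l2(nat) whose index satisfies
    [gd]. *)
Fixpoint gsl (n : nat) : seq B := match n with 0%N => [::] | n'.+1 =>
  let l := gsl n' in
  let w := x n' - \sum_(e <- l) gip (x n') e *: e in
  rcons l (((N w)^-1)%:C *: w) end.
Definition gs_w n := x n - \sum_(e <- gsl n) gip (x n) e *: e.
Definition gs n : B := ((N (gs_w n))^-1)%:C *: gs_w n.
Lemma gslE n : gsl n = [seq gs k | k <- iota 0 n].
Proof.
elim: n => [//|n IH]; rewrite -addn1 iotaD map_cat -IH /= addn1 /= -cats1.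
by rewrite add0n.
Qed.
Lemma gs_wE n : gs_w n = x n - \sum_(0 <= k < n) gip (x n) (gs k) *: gs k.
Proof. by rewrite /gs_w gslE big_map /index_iota subn0. Qed.
Definition gd n : bool := N (gs_w n) != 0.

Lemma gs_nd n : ~~ gd n -> gs n = 0.
Proof. by rewrite negbK => /eqP h; rewrite /gs h invr0 scale0r. Qed.
Lemma gs_unit n : gip (gs n) (gs n) = (gd n)%:R.
Proof.
rewrite gself NZ ca_real ger0_norm ?invr_ge0 ?ipn_ge0 // /gd.
by case: eqP => [->|/eqP h]; rewrite ?invr0 ?mul0r ?expr0n // mulVf // expr1n.
Qed.
Lemma gs_orth_lt k n : (k < n)%N -> gip (gs n) (gs k) = 0.
Proof.
elim/ltn_ind: n k => n IH k kn.
suff h : gip (gs_w n) (gs k) = 0 by rewrite /gs gZ h mulr0.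
have [dk|ndk] := boolP (gd k); last by rewrite (gs_nd ndk) -(scale0r (gs k)) gZr rmorph0 mul0r.
rewrite gs_wE gD -scaleN1r gZ mulN1r.
have sum (r : seq nat) (F : nat -> B) z : gip (\sum_(i <- r) F i) z = \sum_(i <- r) gip (F i) z.
  by elim/big_rec2: _ => [|i a b _ <-]; [exact: (ip0l gipP)|rewrite gD].
rewrite sum (bigD1_seq k) ?mem_index_iota ?iota_uniq //= gZ gs_unit dk mulr1.
rewrite big_seq_cond big1 ?addr0 ?subrr // => j; rewrite mem_index_iota => /andP[/andP[_ jn] jk].
rewrite gZ; have [jk'|] := ltnP j k; last first.
  by rewrite leq_eqVlt eq_sym (negbTE jk) /= => kj; rewrite (IH j) ?mulr0.
by rewrite [gip (gs j) (gs k)]gipC (IH k) // rmorph0 mulr0.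
Qed.
Lemma gs_orth j k : gip (gs j) (gs k) = ((j == k) && gd j)%:R.
Proof.
have [->|jk] := eqVneq j k; first exact: gs_unit.
have [kj|] := ltnP k j; first exact: gs_orth_lt.
by rewrite leq_eqVlt (negbTE jk) /= => h; rewrite gipC gs_orth_lt // rmorph0.
Qed.

Lemma gip_suml (I : Type) (r : seq I) (F : I -> B) z :
  gip (\sum_(i <- r) F i) z = \sum_(i <- r) gip (F i) z.
Proof. by elim/big_rec2: _ => [|i a b _ <-]; [exact: (ip0l gipP)|rewrite gD]. Qed.

Lemma bessel v (s : seq nat) : uniq s -> \sum_(k <- s) ca (gip v (gs k)) ^+ 2 <= N v ^+ 2.
Proof.
move=> us; pose y := \sum_(k <- s) gip v (gs k) *: gs k.
have yv : gip y v = (\sum_(k <- s) ca (gip v (gs k)) ^+ 2)%:C.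
  rewrite gip_suml rmorph_sum; apply: eq_bigr => k _.
  by rewrite gZ (gipC v) ca_sqr.
have yk k : k \in s -> gip y (gs k) = gip v (gs k).
  move=> ks; rewrite gip_suml (bigD1_seq k) //= big1 ?addr0; last first.
    by move=> j jk; rewrite gZ gs_orth (negbTE jk) mulr0.
  rewrite gZ gs_orth eqxx /=; case dk : (gd k); first by rewrite mulr1.
  by rewrite (@gs_nd k) ?dk // mulr0 -(scale0r (0 : B)) gZr rmorph0 mul0r.
have yy : gip y y = (\sum_(k <- s) ca (gip v (gs k)) ^+ 2)%:C.
  rewrite {1}/y gip_suml rmorph_sum !big_seq; apply: eq_bigr => k ks.
  by rewrite gZ (gipC y) yk // ca_sqr.
have := gip_ge0 (v + (-1) *: y).
rewrite gD !gDr !gZ !gZr (gipC y v) yv yy rmorphN1 conj_real gself.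
set S := \sum_(k <- s) _.
have -> : (N v ^+ 2)%:C + -1 * S%:C + (-1 * S%:C + -1 * (-1 * S%:C)) = (N v ^+ 2 - S)%:C.
  by rewrite rmorphB /=; ring.
by rewrite ler0c subr_ge0.
Qed.

Lemma gvec_sq v : sq_summable (fun k => gip v (gs k)).
Proof. by apply: sq_summable_seq; exact: (@bessel v). Qed.
Definition gvec v : l2 R nat := L2 (gvec_sq v).
Lemma gvecE v k : gvec v k = gip v (gs k). Proof. by []. Qed.
Lemma gvecP (a : C) v w : gvec (a *: v + w) = a *: gvec v + gvec w.
Proof. by apply: l2_ext => k; rewrite !(l2E_D, l2E_Z) !gvecE gipP. Qed.
Lemma gvec_null v : N v = 0 -> gvec v = 0.
Proof. by move=> h; apply: l2_ext => k; rewrite gvecE gip_null. Qed.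
Lemma gvec_bound v : nr (gvec v) <= N v.
Proof. apply: nr_l2_le; [exact: ipn_ge0|by move=> s; apply: bessel; exact: fset_uniq]. Qed.
Lemma gvec_gs k : gvec (gs k) = (gd k)%:R *: dlt R k.
Proof.
apply: l2_ext => j; rewrite l2E_Z gvecE gs_orth dltE -natrM mulnb andbC.
by case: eqP.
Qed.

(** The span of the [gs n] and of the null vectors, as an induction principle. It contains every
    [bw k], and [gvec] is isometric on it. *)
Definition gclass (v : B) := forall P : set B, (forall (a : C) x y, P x -> P y -> P (a *: x + y)) ->
  (forall k, P (gs k)) -> (forall w, N w = 0 -> P w) -> P v.
Lemma gclassP (a : C) v w : gclass v -> gclass w -> gclass (a *: v + w).
Proof. by move=> hv hw P PL Pe Pn; apply: (PL); [exact: hv|exact: hw]. Qed.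
Lemma N0 : N 0 = 0.
Proof. by rewrite -(scale0r (0 : B)) NZ ca0 mul0r. Qed.
Lemma gclass_x n : gclass (x n).
Proof.
move=> P PL Pe Pn.
have PD v w : P v -> P w -> P (v + w) by move=> hv hw; rewrite -[v]scale1r; exact: PL.
have -> : x n = gs_w n + \sum_(0 <= k < n) gip (x n) (gs k) *: gs k by rewrite gs_wE subrK.
apply: (PD).
  have [/eqP dn|dn] := boolP (N (gs_w n) == 0); first exact: Pn.
  have -> : gs_w n = (N (gs_w n))%:C *: gs n + 0.
    by rewrite addr0 /gs scalerA -rmorphM divff // scale1r.
  by apply: PL => //; apply: Pn; exact: N0.
apply: (big_ind P); [by apply: Pn; exact: N0|exact: PD|].
by move=> k _; rewrite -[X in P X]addr0; apply: (PL) => //; apply: Pn; exact: N0.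
Qed.
Lemma gclass_span v : bspan v -> gclass v.
Proof.
move=> hv; apply: (lin_span_ind _ _ _ hv).
- by move=> P PL Pe Pn; apply: Pn; exact: N0.
- exact: gclassP.
- by move=> _ [k _ <-]; have [n <-] := num_surj k; exact: gclass_x.
Qed.
Lemma span_gs n : bspan (gs n).
Proof.
elim/ltn_ind: n => n IH; apply: lin_spanZ; rewrite gs_wE -scaleN1r addrC.
apply: lin_spanP; last by apply: lin_span_in; exists (num n).
rewrite big_seq; apply: lin_span_sum => k; rewrite mem_index_iota => /andP[_ kn].
by apply: lin_spanZ; exact: IH.
Qed.
Lemma gvec_iso v w : gclass v -> inner (gvec v) (gvec w) = gip v w.
Proof.
move=> hv; apply: (hv [set v | inner (gvec v) (gvec w) = gip v w]) => /=.
- by move=> a y z hy hz; rewrite gvecP innerP gipP hy hz.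
- move=> k; rewrite gvec_gs innerZl inner_dltl gvecE -gipC.
  by case dk : (gd k); rewrite ?mul1r // gs_nd ?dk // mul0r (ip0l gipP).
- by move=> z hz; rewrite gvec_null // inner0l gip_null.
Qed.

(* The operator on l2 which is [a] on the GNS space and the scalar [c] on its
   orthogonal complement. *)
Section Operator.
Variables (a : B) (c : bool).
Hypothesis aN : forall v, N (a ** v) <= N v.

Definition gop_w k : l2 R nat := gvec (a ** gs k) + (c && ~~ gd k)%:R *: dlt R k.

(** A combination [y] of basis vectors corresponds to an element [z] of [B] with
    [gvec z = mask gd y]; the part on the GNS space and the part on its complement contribute 1 each
    to the constant. *)
Lemma gop_bound (s : seq (C * nat)) :
  nr (\sum_(q <- s) q.1 *: gop_w q.2) <= 2 * nr (\sum_(q <- s) q.1 *: dlt R q.2).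
Proof.
pose y := \sum_(q <- s) q.1 *: dlt R q.2; pose z := \sum_(q <- s) q.1 *: gs q.2.
have sz : bspan z by apply: lin_span_sum => q _; apply: lin_spanZ; exact: span_gs.
have E : \sum_(q <- s) q.1 *: gop_w q.2 = gvec (a ** z) + mask (fun k => c && ~~ gd k) y.
  rewrite /y /z cmul_sumr (lin_sum _ _ _ gvecP) (lin_sum _ _ _ (@maskP _ _ _)) -big_split /=.
  by apply: eq_bigr => j _; rewrite /gop_w scalerDr (cmulZr j.1) (linZ gvecP j.1) (linZ (@maskP _ _ _) j.1) mask_dlt.
have vz : gvec z = mask gd y.
  rewrite /y /z (lin_sum _ _ _ gvecP) (lin_sum _ _ _ (@maskP _ _ _)); apply: eq_bigr => j _.
  by rewrite (linZ gvecP) (linZ (@maskP _ _ _)) mask_dlt gvec_gs.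
have Nz : N z <= nr y.
  rewrite -(ler_pXn2r (n := 2)) ?nnegrE ?ipn_ge0 ?nr_ge0 //.
  have := gvec_iso z (gclass_span sz); rewrite inner_self gself => /(@complexI R) <-.
  by rewrite ler_pXn2r ?nnegrE ?nr_ge0 // vz; exact: mask_bound.
rewrite E; apply: le_trans (nrD _ _) _.
have := mask_bound (fun k => c && ~~ gd k) y; have := gvec_bound (a ** z); have := aN z.
rewrite -/y; lra.
Qed.

Lemma gop_exists : exists f : l2 R nat -> l2 R nat, blin f /\ forall k, f (dlt R k) = gop_w k.
Proof.
have [f [fl fb fk]] := @blin_extension R _ _ nat (@dlt R nat) gop_w 2 (ler0n _ 2) (@total_dlt R nat) gop_bound.
by exists f; split => //; split => //; exists 2.
Qed.
Definition gop : l2 R nat -> l2 R nat := sval (cid gop_exists).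
Lemma gop_blin : blin gop. Proof. by rewrite /gop; case: cid => f []. Qed.
Lemma gop_dlt k : gop (dlt R k) = gop_w k. Proof. by rewrite /gop; case: cid => f []. Qed.
Lemma gop_vec v : gclass v -> gop (gvec v) = gvec (a ** v).
Proof.
have [gl _] := gop_blin.
move=> hv; apply: (hv [set v | gop (gvec v) = gvec (a ** v)]) => /=.
- by move=> d y z hy hz; rewrite gvecP gl hy hz cmulPr gvecP.
- move=> k; rewrite gvec_gs (linZ gl) gop_dlt /gop_w.
  case dk : (gd k); first by rewrite andbF scale1r scale0r addr0.
  by rewrite scale0r gs_nd ?dk // cmul0r gvec_null // N0.
- move=> z hz; rewrite !gvec_null ?(lin0 gl) //.
  by apply/eqP; rewrite eq_le ipn_ge0 andbT -hz.
Qed.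
Lemma gop_d1 k : gd k -> gop (dlt R k) = gvec (a ** gs k).
Proof. by move=> dk; rewrite gop_dlt /gop_w dk andbF scale0r addr0. Qed.
Lemma gop_d0 k : ~~ gd k -> gop (dlt R k) = c%:R *: dlt R k.
Proof.
by move=> dk; rewrite gop_dlt /gop_w dk andbT gs_nd // cmul0r gvec_null ?N0 // add0r.
Qed.
End Operator.

Lemma NE v : N v = Num.sqrt (complex.Re (phi (star v ** v))). Proof. by []. Qed.
Lemma u_iso t v : N (u t ** v) <= N v.
Proof.
by rewrite !NE starM -cmulA [star (u t) ** _]cmulA (bU_star up) -(bUM up) mulVg (bU1 up) cmul1l.
Qed.
Lemma p_contr g v : N (p g ** v) <= N v.
Proof.
have h : gip v v = gip (p g ** v) (p g ** v) + gip (v - p g ** v) (v - p g ** v).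
  have pD y z : phi (y + z) = phi y + phi z by have := phiL 1 y z; rewrite scale1r mul1r.
  rewrite /gip -pD; congr phi.
  have pp : p g ** p g = p g by rewrite (bEM up) eqxx.
  rewrite !sE (bE_star up) !cE !cmulA -[star v ** p g ** p g]cmulA pp; lmod C B.
move: h; rewrite !gself -rmorphD => /(@complexI R) h.
rewrite -(ler_pXn2r (n := 2)) ?nnegrE ?ipn_ge0 // h lerDl sqr_ge0 //.
Qed.
Lemma u_span t v : bspan v -> bspan (u t ** v).
Proof.
move=> hv; apply: (@lin_span_ind _ _ (range bw) [set v | bspan (u t ** v)] _ _ _ _ hv) => /=.
- by rewrite cmul0r; exact: lin_span0.
- by move=> a y z hy hz; rewrite cmulPr; exact: lin_spanP.
- move=> _ [k _ <-] /=; apply: lin_span_in; exists ((t * k.1)%g, k.2) => //.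
  by rewrite /bw /= (bUM up) cmulA.
Qed.
Lemma p_span g v : bspan v -> bspan (p g ** v).
Proof.
move=> hv; apply: (@lin_span_ind _ _ (range bw) [set v | bspan (p g ** v)] _ _ _ _ hv) => /=.
- by rewrite cmul0r; exact: lin_span0.
- by move=> a y z hy hz; rewrite cmulPr; exact: lin_spanP.
- move=> _ [k _ <-] /=; rewrite /bw cmulA -[g](malVK k.1) -(bUE up) -cmulA (bEM up).
  case: ifP => _; first by apply: lin_span_in; exists k.
  by rewrite cmul0r; exact: lin_span0.
Qed.

(** On the complement of the GNS space the unitaries act as 1 and [gE g] as the scalar [g = 1]. This
    is itself covariant because alpha fixes the unit, so all relations hold on the whole of
    l2(nat). *)
Definition gU t := gop true (u_iso t).
Definition gE g := gop (g == 1%g) (p_contr g).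

Lemma gns_rep : isrep gU gE.
Proof.
have bU t : blin (gU t) by exact: gop_blin.
have bE g : blin (gE g) by exact: gop_blin.
have cu t k : gclass (u t ** gs k) by apply: gclass_span; apply: u_span; exact: span_gs.
have cp g k : gclass (p g ** gs k) by apply: gclass_span; apply: p_span; exact: span_gs.
have ext (f g : l2 R nat -> l2 R nat) : blin f -> blin g -> (forall k, f (dlt R k) = g (dlt R k)) -> f =1 g.
  by move=> bf bg h; apply: (blin_ext (@total_dlt R nat) bf bg) => _ [k _ <-].
have d_gs k : gd k -> dlt R k = gvec (gs k) by move=> dk; rewrite gvec_gs dk scale1r.
have gvN k : ~~ gd k -> forall v, gvec v k = 0.
  by move=> dk v; rewrite gvecE gs_nd // -(scale0r (0 : B)) gZr rmorph0 mul0r.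
(* Adjointness on basis vectors: on the GNS part it is [star a = b], on the complement both
   operators are the same real scalar [c], and the mixed terms vanish. *)
have adj (f g : l2 R nat -> l2 R nat) a b (c : bool) : blin f -> blin g -> star a = b ->
    (forall k, gclass (a ** gs k)) ->
    (forall k, gd k -> f (dlt R k) = gvec (a ** gs k)) -> (forall k, gd k -> g (dlt R k) = gvec (b ** gs k)) ->
    (forall k, ~~ gd k -> f (dlt R k) = c%:R *: dlt R k) -> (forall k, ~~ gd k -> g (dlt R k) = c%:R *: dlt R k) ->
    forall v w, inner (f v) w = inner v (g w).
  move=> bf bg ab ca fd gdd f0 g0; apply: (bounded_adjoint_ext bf bg) => j k.
  have [dj|dj] := boolP (gd j); have [dk|dk] := boolP (gd k).
  - rewrite fd // gdd // (d_gs k dk) (d_gs j dj) gvec_iso // gvec_iso; last by apply: gclass_span; exact: span_gs.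
    by rewrite /gip starM -ab starK cmulA.
  - rewrite fd // g0 // inner_dlt gvN // innerZr inner_dd.
    have -> : (j == k) = false by apply/eqP => e; rewrite e (negbTE dk) in dj.
    by rewrite mulr0.
  - rewrite f0 // gdd // innerZl inner_dd inner_dltl gvN // rmorph0.
    have -> : (j == k) = false by apply/eqP => e; rewrite e dk in dj.
    by rewrite mulr0.
  - by rewrite f0 // g0 // innerZl innerZr inner_dd; case: c {f0 g0} => /=; rewrite ?rmorph1 ?rmorph0 //.
split.
- exact: bU.
- exact: bE.
- move=> t; apply: (adj _ _ (u t) (u t^-1%g) true) => //; first exact: (bU_star up).
  + by move=> k dk; exact: gop_d1.
  + by move=> k dk; exact: gop_d1.
  + by move=> k dk; exact: gop_d0.
  + by move=> k dk; exact: gop_d0.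
- apply: ext => //; first exact: blin_id.
  move=> k; have [dk|dk] := boolP (gd k); first by rewrite /gU gop_d1 // (bU1 up) cmul1l -d_gs.
  by rewrite /gU gop_d0 // scale1r.
- move=> s t; apply: ext => //; first exact: (blin_comp (bU s) (bU t)).
  move=> k; have [dk|dk] := boolP (gd k); rewrite /gU.
    by rewrite !(gop_d1 _ _ dk) gop_vec // (bUM up) cmulA.
  by rewrite !(gop_d0 _ _ dk) !scale1r (gop_d0 _ _ dk) scale1r.
- move=> g; apply: (adj _ _ (p g) (p g) (g == 1%g)) => //; first exact: (bE_star up).
  + by move=> k dk; exact: gop_d1.
  + by move=> k dk; exact: gop_d1.
  + by move=> k dk; exact: gop_d0.
  + by move=> k dk; exact: gop_d0.
- move=> g h; apply: ext; first exact: (blin_comp (bE g) (bE h)).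
    case: (g == h); first exact: bE.
    split; first by move=> *; rewrite scaler0 addr0.
    by exists 0 => // v; rewrite nr0 mul0r.
  move=> k; have [dk|dk] := boolP (gd k); rewrite /gE /=.
    rewrite !(gop_d1 _ _ dk) gop_vec // cmulA (bEM up).
    case: ifP => _; first by rewrite ?(gop_d1 _ _ dk).
    by rewrite cmul0l gvec_null // N0.
  have L := linZ (proj1 (bE g)); rewrite /gE in L.
  rewrite !(gop_d0 _ _ dk) L (gop_d0 _ _ dk) scalerA.
  case: (eqVneq g h) => [->|gh]; first by case: (h == 1%g); rewrite ?mulr1 // mul0r.
  case: (eqVneq h 1%g) => [h1|]; last by rewrite mul0r scale0r.
  by rewrite h1 in gh; rewrite (negbTE gh) mulr0 scale0r.
- have bsum (r : seq K) : blin (fun v => \sum_(g <- r) gE g v).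
    elim: r => [|g r IH].
      split; first by move=> *; rewrite !big_nil scaler0 addr0.
      by exists 0 => // v; rewrite big_nil nr0 mul0r.
    have := blinB 1 (bE g) IH; congr blin; apply/funext => v; by rewrite big_cons scale1r.
  apply: ext; [exact: bsum|exact: blin_id|].
  move=> k; have [dk|dk] := boolP (gd k).
    under eq_bigr do rewrite /gE (gop_d1 _ _ dk).
    by rewrite -(lin_sum _ _ _ gvecP) -cmul_suml (bE1 up) cmul1l -d_gs.
  under eq_bigr do rewrite /gE (gop_d0 _ _ dk).
  rewrite (bigD1 (1%g : K)) //= eqxx scale1r big1 ?addr0 // => g /negbTE->.
  by rewrite scale0r.
- move=> t g; apply: ext; [exact: (blin_comp (bU t) (bE g))|exact: (blin_comp (bE _) (bU t))|].
  move=> k; have [dk|dk] := boolP (gd k); rewrite /gE /gU /=.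
    by rewrite !(gop_d1 _ _ dk) !gop_vec // !cmulA (bUE up).
  have L := linZ (proj1 (bU t)); rewrite /gU in L.
  rewrite (gop_d0 _ _ dk) L !(gop_d0 _ _ dk) !scale1r (gop_d0 _ _ dk).
  by rewrite -{2}(mal_1 t) (inj_eq (mal_inj (t := t))).
Qed.

(** A finite combination sends the cyclic unit vector [gvec cone] to a vector of squared norm
    [phi (star y ** y)], which for a norming state of [y] is the squared norm of [y]. *)
Lemma gns_vec (s : seq (C * (T * K))) :
  let y := \sum_(q <- s) q.1 *: bw q.2 in
  \sum_(q <- s) q.1 *: gU q.2.1 (gE q.2.2 (gvec cone)) = gvec y /\
  (nr (gvec y) ^+ 2)%:C = phi (star y ** y) /\ nr (gvec cone) = 1.
Proof.
move=> y.
have c1 : bspan cone.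
  rewrite -(bE1 up); apply: lin_span_sum => g _; apply: lin_span_in; exists (1%g, g) => //.
  by rewrite /bw (bU1 up) cmul1l.
have sy : bspan y.
  by apply: lin_span_sum => q _; apply: lin_spanZ; apply: lin_span_in; exists q.2.
split; [|split].
- rewrite /y (lin_sum _ _ _ gvecP); apply: eq_bigr => q _; rewrite (linZ gvecP); congr (_ *: _).
  have hp g : gclass (p g ** cone) by apply: gclass_span; exact: (p_span g c1).
  by rewrite /gU /gE (gop_vec _ _ (gclass_span c1)) (gop_vec _ _ (hp _)) cmulA cmul1r.
- by rewrite -inner_self gvec_iso //; exact: gclass_span.
- have := gvec_iso cone (gclass_span c1); rewrite inner_self /gip star1 cmul1l phi1.
  move=> /(@complexI R _ 1) /eqP; rewrite sqrf_eq1 => /orP[/eqP//|/eqP h].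
  by have := nr_ge0 (gvec cone); rewrite h; lra.
Qed.
End GNS.
End Representations.

(** * The full crossed product *)

Section Relabel.
Variables (R : realType) (X Z : choiceType) (e : pairing X unit Z).
Local Notation C := R[i].
(** A pairing with [unit] is a bijection of [X] with [Z], so conjugation by it is a special case of
    the calculus of slices. *)
Definition rel (a : l2 R X -> l2 R X) : l2 R Z -> l2 R Z := Sl e (fun=> a).
Lemma relE a f z : blin a -> rel a f z = a (slice e tt f) (p1 e z).
Proof.
move=> [al [M M0 aM]]; have h : fam_bound (fun _ : unit => a) M by move=> y; exact: aM.
by rewrite /rel (SlE e M0 h); case: (p2 e z).
Qed.
Lemma slice_rel a f : blin a -> slice e tt (rel a f) = a (slice e tt f).
Proof.
move=> [al [M M0 aM]]; have h : fam_bound (fun _ : unit => a) M by move=> y; exact: aM.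
exact: (slice_Sl e M0 h).
Qed.
Lemma rel_ext f g : slice e tt f = slice e tt g -> f = g :> l2 R Z.
Proof.
move=> h; apply: l2_ext => z; rewrite -(peK e z); case: (p2 e z).
exact: (congr1 (fun v : l2 R X => v (p1 e z)) h).
Qed.
Lemma rel_blin a : blin a -> blin (rel a).
Proof. by move=> ha; apply: Sl_blin; exact: const_ok. Qed.
Lemma rel_bound a M : 0 <= M -> (forall v, nr (a v) <= M * nr v) -> forall v, nr (rel a v) <= M * nr v.
Proof. by move=> M0 h v; apply: Sl_bound => // y; exact: h. Qed.
Lemma rel_comp a b f : blin a -> blin b -> rel (a \o b) f = rel a (rel b f).
Proof. by move=> ha hb; apply: rel_ext; rewrite !slice_rel //; exact: blin_comp. Qed.
Lemma rel_adj a b : blin a -> blin b -> (forall v w, inner (a v) w = inner v (b w)) ->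
  forall v w, inner (rel a v) w = inner v (rel b w).
Proof. by move=> ha hb h; apply: Sl_adj; [exact: const_ok|exact: const_ok|move=> y; exact: h]. Qed.
Lemma slice_dltu x : slice e tt (dlt R (pe e x tt)) = dlt R x.
Proof. by rewrite slice_dlt p1K; case: (p2 e _). Qed.
Lemma slice_sum_unit (I : Type) (r : seq I) (F : I -> l2 R Z) :
  slice e tt (\sum_(i <- r) F i) = \sum_(i <- r) slice e tt (F i).
Proof. by apply: (lin_sum (f := slice e tt)) => c f g; exact: slice_lin. Qed.
End Relabel.

Section Pull.
Variables (R : realType) (X Z : choiceType) (Y Y' : Type) (e : pairing X unit Z) (F : Y' -> Y).
Variables (D : famsub Y (l2 R X)) (D' : famsub Y' (l2 R Z)) (S : set (fam D)).
(** Reindexing along [F] combined with a change of basis. It is contractive, so membership in the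
    target has to be checked on a total set only. The comultiplication and the two maps that iterate
    it arise in this way. *)
Definition pullf (a : fam D) : Y' -> l2 R Z -> l2 R Z := fun y => rel e (a (F y)).
Hypotheses (tS : total S) (hS : forall a, S a -> fmem D' (pullf a)).
Lemma pullf_lin (c : R[i]) a b y v : pullf (c *: a + b) y v = c *: pullf a y v + pullf b y v.
Proof.
apply: (@rel_ext _ _ _ e); rewrite slice_lin !slice_rel ?famE //; exact: fam_blin.
Qed.
Lemma pullf_adj a : fam_adj (pullf a) (pullf (star a)).
Proof. by move=> y; apply: rel_adj; try exact: fam_blin; move=> v w; exact: fam_starl. Qed.
Lemma pullf_flin a : fam_lin (pullf a).
Proof. by move=> y c v w; apply: (proj1 (rel_blin e (fam_blin a _))). Qed.
Lemma pull_mem a : fmem D' (pullf a).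
Proof.
apply: (tS (P := [set a | fmem D' (pullf a)])) => //; split => /=.
- have := fam_sub0 D'; congr (fmem D' _); apply/funext => y; apply/funext => v.
  by apply: (@rel_ext _ _ _ e); rewrite slice_rel; [apply: l2_ext|exact: (fam_blin (0 : fam D))].
- move=> c x y hx hy; have := fmemP c hx hy; congr (fmem D' _).
  by apply/funext => z; apply/funext => v; rewrite pullf_lin.
- move=> x hx; apply: fmem_closed; first exact: pullf_flin.
    by exists (pullf (star x)); exact: pullf_adj.
  move=> d d0; have [y hy xy] := hx _ d0; exists (pullf y) => // z v.
  have -> : pullf x z v - pullf y z v = pullf (x - y) z v.
    have := pullf_lin (-1) y x z v; rewrite scaleN1r [- y + x]addrC => ->.
    by rewrite scaleN1r addrC.
  apply: le_trans (rel_bound e (nr_ge0 (x - y)) _ v) _; first exact: nr_fam_bound.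
  by rewrite ler_wpM2r ?nr_ge0 // ltW.
Qed.
Definition pull a : fam D' := Fam (pull_mem a).
Lemma pull_lin (c : R[i]) a b : pull (c *: a + b) = c *: pull a + pull b.
Proof. by apply: fam_ext => y v; rewrite !famE; exact: pullf_lin. Qed.
Lemma pull_hom : star_hom pull.
Proof.
split; first exact: pull_lin.
- move=> a b; apply: fam_ext => y v; rewrite famE_M /= /pullf -rel_comp //; exact: fam_blin.
- by apply: fam_ext => y v; apply: (@rel_ext _ _ _ e); rewrite slice_rel; [|exact: fam_blin].
- by move=> a; apply/esym/famstar_uniq; exact: pullf_adj.
Qed.
Lemma pull_blin : blin pull.
Proof.
split; first exact: pull_lin.
exists 1 => // a; rewrite mul1r; apply: nr_fam_le; first exact: nr_ge0.
by move=> y; apply: rel_bound; [exact: nr_ge0|exact: nr_fam_bound].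
Qed.
End Pull.

Section Compress.
Variables (R : realType) (X X' Z : choiceType) (Y' Z' : Type) (e : pairing X X' Z) (F : Y' -> Z').
Variables (D2 : famsub Z' (l2 R Z)) (D : famsub Y' (l2 R X')) (x0 : X) (S : set (fam D2)).
Local Notation d0 := (dlt R x0).
Local Notation sl := (@slice R _ _ _ (swap_pairing e) x0).
(** Compression by the basis vector at [x0] in the first factor, a slice map. By [hS], elements of
    [S] act on that vector through a scalar in the first leg; in the limit the operators preserve
    it, which is why the compression is multiplicative. *)
Definition cmpf (t : fam D2) : Y' -> l2 R X' -> l2 R X' := fun p v => sl (t (F p) (tv e d0 v)).
Hypotheses (tS : total S)
  (hS : forall t, S t -> exists c (b : fam D), forall p v, t (F p) (tv e d0 v) = c *: tv e d0 (b p v)).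
Lemma sl_tv v : sl (tv e d0 v) = v.
Proof. by apply: l2_ext => y; rewrite sliceE tvE /= p1K p2K eqxx mul1r. Qed.
Lemma sl_blin : blin sl.
Proof.
split; first by move=> c f g; exact: slice_lin.
exists 1 => // f; rewrite mul1r; apply: nr_l2_le; first exact: nr_ge0.
move=> B; rewrite nr_l2; have := slice_sum (swap_pairing e) f (t := [:: x0]) isT.
by rewrite big_seq1; apply: le_trans; exact: l2sq_le.
Qed.
Lemma sl_adj f v : inner (sl f) v = inner f (tv e d0 v).
Proof.
rewrite inner_conj [RHS]inner_conj; congr (_^*).
have bl (H : hilbertType R) (z : H) : blin (fun v => (inner v z : Cplx R)).
  split; first by move=> a x y; exact: innerP.
  by exists (nr z); [exact: nr_ge0|move=> x; rewrite mulrC; exact: inner_CS].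
have E := @blin_ext R _ _ (fun v => inner v (sl f) : Cplx R) (fun v => inner (tv e d0 v) f : Cplx R) _
  (@total_dlt R X') (bl _ _) (blin_comp (bl _ _) (tv_blinr e d0)).
by apply: E => _ [y _ <-]; rewrite tv_dlt !inner_dltl.
Qed.
Lemma cmpf_lin (c : R[i]) a b y v : cmpf (c *: a + b) y v = c *: cmpf a y v + cmpf b y v.
Proof. by rewrite /cmpf !famE (proj1 sl_blin). Qed.
Lemma cmpf_adj a : fam_adj (cmpf a) (cmpf (star a)).
Proof. by move=> y v w; rewrite /cmpf sl_adj fam_starl [RHS]inner_conj sl_adj -inner_conj. Qed.
Lemma cmpf_bound a : fam_bound (cmpf a) (nr a).
Proof.
move=> y v; have := slice_sum (swap_pairing e) (a (F y) (tv e d0 v)) (t := [:: x0]) isT.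
rewrite big_seq1 -!nr_l2 ler_pXn2r ?nnegrE ?nr_ge0 // => /le_trans; apply.
apply: le_trans (nr_fam_bound _ _ _) _; rewrite ler_wpM2l ?nr_ge0 //.
by have := tv_bound e d0 v; rewrite nr_dlt mul1r.
Qed.
Lemma cmpf_mem a : fmem D (cmpf a).
Proof.
apply: (tS (P := [set a | fmem D (cmpf a)])) => //; last first.
  move=> t /hS [c [b h]] /=; have := ffP (c *: b); congr (fmem D _).
  by apply/funext => p; apply/funext => v; rewrite /cmpf h (linZ (proj1 sl_blin)) sl_tv famE.
split => /=.
- have := fam_sub0 D; congr (fmem D _); apply/funext => y; apply/funext => v.
  exact: l2_ext.
- move=> c x y hx hy; have := fmemP c hx hy; congr (fmem D _).
  by apply/funext => z; apply/funext => v; rewrite cmpf_lin.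
- move=> x hx; apply: fmem_closed; first by apply: adj_lin (adj_sym (cmpf_adj x)).
    by exists (cmpf (star x)); exact: cmpf_adj.
  move=> d dp; have [y hy xy] := hx _ dp; exists (cmpf y) => // z v.
  have -> : cmpf x z v - cmpf y z v = cmpf (x - y) z v.
    have := cmpf_lin (-1) y x z v; rewrite scaleN1r [- y + x]addrC => ->.
    by rewrite scaleN1r addrC.
  by apply: le_trans (cmpf_bound _ _ _) _; rewrite ler_wpM2r ?nr_ge0 // ltW.
Qed.
Definition cmp a : fam D := Fam (cmpf_mem a).
Lemma cmp_tv (t : fam D2) p v : t (F p) (tv e d0 v) = tv e d0 (cmp t p v).
Proof.
rewrite /= /cmpf.
apply: (blin_ext tS (eval_blin _ _ _) (blin_comp (tv_blinr e d0) (blin_comp sl_blin (eval_blin D2 (F p) (tv e d0 v))))).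
by move=> {}t /hS [c [b h]] /=; rewrite h (linZ (proj1 sl_blin)) sl_tv (linZ (proj1 (tv_blinr e d0))).
Qed.
Lemma cmp_blin : blin cmp.
Proof.
split; first by move=> c a b; apply: fam_ext => y v; rewrite !famE; exact: cmpf_lin.
by exists 1 => // a; rewrite mul1r; apply: nr_fam_le; [exact: nr_ge0|exact: cmpf_bound].
Qed.
Lemma cmp_hom : star_hom cmp.
Proof.
split; first exact: (proj1 cmp_blin).
- move=> a b; apply: fam_ext => y v; rewrite famE_M.
  by rewrite [LHS]/= /cmpf famE_M (cmp_tv b) (cmp_tv a) sl_tv.
- by apply: fam_ext => y v; rewrite /= /cmpf sl_tv.
- by move=> a; apply/esym/famstar_uniq; exact: cmpf_adj.
Qed.
End Compress.

Section CrossedProduct.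
Variables (R : realType) (m : mpair).
Local Notation T := (mT m).
Local Notation K := (mK m).
Local Notation al := (@mal m).
Local Notation be := (@mbe m).
Local Notation C := R[i].
Local Notation ell := (l2 R nat).

(* A separable algebra has enough representations on one Hilbert space, which makes
   the maximal crossed product a concrete algebra of families indexed by [rep]. *)
Record rep := Rep { rpU : T -> ell -> ell; rpE : K -> ell -> ell; rpP : isrep rpU rpE }.
HB.instance Definition _ := gen_eqMixin rep.
HB.instance Definition _ := gen_choiceMixin rep.

Definition gW (t : T) (g : K) : rep -> ell -> ell := fun p v => rpU p t (rpE p g v).
Lemma gW_adj t g : fam_adj (gW t g) (gW t^-1%g (al t g)).
Proof.
by move=> p v w; rewrite /gW (rU_adj (rpP p)) (rE_adj (rpP p)) (rUE (rpP p)) malK.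
Qed.
Lemma gW_blin t g p : blin (gW t g p).
Proof. exact: blin_comp (rU_b (rpP p) t) (rE_b (rpP p) g). Qed.
Lemma gW_ok t g : all_ok (gW t g).
Proof.
split; first by move=> p; case: (gW_blin t g p).
  exists 1 => // p v; rewrite mul1r /gW (rU_nr (rpP p)); exact: (rE_nr (rpP p)).
by exists (gW t^-1%g (al t g)); exact: gW_adj.
Qed.
Definition wA t g : fam (allfam rep ell) := Fam (gW_ok t g : fmem (allfam rep ell) _).
Definition wset := range (fun k : T * K => wA k.1 k.2).
Lemma wA_in t g : wset (wA t g). Proof. by exists (t, g). Qed.
Lemma wA_mul s g t h : wA s g ** wA t h = if al t h == g then wA (s * t)%g h else 0.
Proof.
apply: fam_ext => p v; rewrite famE_M /= /gW (rEU (rpP p)) -(rUM (rpP p)) (rEM (rpP p)).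
rewrite -(inj_eq (mal_inj (t := t))) malVK eq_sym; case: ifP => // _.
by rewrite (lin0 (proj1 (rU_b (rpP p) _))).
Qed.
Lemma wA_star t g : star (wA t g) = wA t^-1%g (al t g).
Proof. by apply: famstar_uniq; exact: gW_adj. Qed.
Lemma wA_one : \sum_g wA 1%g g = cone.
Proof.
apply: fam_ext => p v; rewrite famE_sum famE_1 -[RHS](rE1 (rpP p)).
by apply: eq_bigr => g _; rewrite /= /gW (rU1 (rpP p)).
Qed.
Lemma wsetM x y : wset x -> wset y -> lin_span wset (x ** y).
Proof.
move=> [[s g] _ <-] [[t h] _ <-]; rewrite wA_mul /=.
by case: ifP => _; [apply: lin_span_in; exact: wA_in|exact: lin_span0].
Qed.
Lemma wset_star x : wset x -> lin_span wset (star x).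
Proof. by move=> [[s g] _ <-]; rewrite wA_star; apply: lin_span_in; exact: wA_in. Qed.
Lemma wset1 : lin_span wset cone.
Proof. by rewrite -wA_one; apply: lin_span_sum => g _; apply: lin_span_in; exact: wA_in. Qed.

Definition D1 := gen_sub wsetM wset_star wset1.
Local Notation A := (fam D1).
Definition W t g : A := Fam (gen_sub_in wsetM wset_star wset1 (wA_in t g)).
Lemma W_E t g p v : W t g p v = rpU p t (rpE p g v). Proof. by []. Qed.
Lemma W_mul s g t h : W s g ** W t h = if al t h == g then W (s * t)%g h else 0.
Proof.
apply: fam_ext => p v; have := congr1 (fun f : fam (allfam rep ell) => f p v) (wA_mul s g t h).
by case: ifP.
Qed.
Lemma W_star t g : star (W t g) = W t^-1%g (al t g).
Proof. by apply: famstar_uniq; exact: gW_adj. Qed.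
Lemma W_one : \sum_g W 1%g g = cone.
Proof.
apply: fam_ext => p v; rewrite famE_sum famE_1 -[RHS](rE1 (rpP p)).
by apply: eq_bigr => g _; rewrite W_E (rU1 (rpP p)).
Qed.
Lemma total_W : total (range (fun k : T * K => W k.1 k.2)).
Proof.
have tg := @total_gen R rep ell wset wsetM wset_star wset1.
move=> P cP hP; apply: (tg P cP) => x [_ [[t g] _ <-] E].
by apply: hP; exists (t, g) => //; apply: fam_ext => y v; rewrite E.
Qed.

Definition Ug t : A := \sum_g W t g.
Definition Eg g : A := W 1%g g.
Lemma WE t g : Ug t ** Eg g = W t g.
Proof.
rewrite /Ug cmul_suml (bigD1 g) //= W_mul mal1 eqxx mulg1 big1 ?addr0 // => h hg.
by rewrite W_mul mal1 eq_sym (negbTE hg).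
Qed.
Lemma A_brep : brep Ug Eg.
Proof.
split.
- move=> t; rewrite star_sum; under eq_bigr do rewrite W_star.
  by rewrite /Ug [RHS](reindex_inj (mal_inj (t := t))).
- exact: W_one.
- move=> s t; rewrite {2}/Ug cmul_suml; rewrite (reindex_inj (mal_inj (t := t))) /=.
  apply: eq_bigr => g _; rewrite /Ug cmul_sumr (bigD1 g) //= W_mul eqxx big1 ?addr0 // => h hg.
  by rewrite W_mul (inj_eq (mal_inj (t := t))) (negbTE hg).
- by move=> g; rewrite W_star invg1 mal1.
- by move=> g h; rewrite W_mul mal1 mul1g [h == g]eq_sym.
- exact: W_one.
- move=> t g; rewrite WE /Ug cmul_sumr (bigD1 g) //= W_mul eqxx mul1g big1 ?addr0 // => h hg.
  by rewrite W_mul (inj_eq (mal_inj (t := t))) (negbTE hg).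
Qed.

Lemma num_exists : exists num : nat -> T * K, forall k, exists n, num n = k.
Proof.
have [x hx] := @mT_enum m.
exists (fun n => oapp (fun k : nat * K => (x k.1, k.2)) (1%g, 1%g) (@choice.unpickle (nat * K)%type n)).
by move=> [t g]; have [i <-] := hx t; exists (choice.pickle (i, g)); rewrite choice.pickleK.
Qed.

(* The GNS representation of a norming state of [B] is one of the [rep]. *)
Lemma A_norm (B : cstarAlgType R) (u : T -> B) (p : K -> B) : brep u p ->
  forall s : seq (C * (T * K)),
    nr (\sum_(q <- s) q.1 *: (u q.2.1 ** p q.2.2)) <= nr (\sum_(q <- s) q.1 *: W q.2.1 q.2.2).
Proof.
move=> up s; set y := \sum_(q <- s) _; set x := \sum_(q <- s) _.
have [phi [phiL phi0 phiy [phi1|->]]] := exists_state y; last by rewrite nr0 nr_ge0.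
have [num hnum] := num_exists.
have r := gns_rep up phiL phi0 phi1 hnum.
have [h1 [h2 h3]] := gns_vec up phiL phi0 phi1 hnum s.
rewrite -/y phiy in h2.
have := nr_fam_bound x (Rep r) (gvec u p phiL phi0 phi1 num cone); rewrite h3 mulr1.
apply: le_trans; rewrite /x famE_sum.
under eq_bigr do rewrite famE_Z W_E.
rewrite /= h1; move: h2 => /(@complexI R) /eqP; rewrite eqrXn2 ?nr_ge0 //.
by move=> /eqP ->.
Qed.

Lemma A_univ (B : cstarAlgType R) (u : T -> B) (p : K -> B) : brep u p ->
  exists f : A -> B, star_hom f /\ forall t g, f (W t g) = u t ** p g.
Proof.
move=> up.
have [f [fl fb fW]] := @blin_extension R A B (T * K)%type (fun k => W k.1 k.2)
  (fun k => u k.1 ** p k.2) 1 ler01 total_W (fun s => ltac:(rewrite mul1r; exact: (A_norm up s))).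
exists f; split; last by move=> t g; exact: (fW (t, g)).
have bf : blin f by split => //; exists 1.
have mul s g t h : (u s ** p g) ** (u t ** p h) = if al t h == g then u (s * t)%g ** p h else 0.
  rewrite -cmulA [p g ** _]cmulA -[g](malVK t) -(bUE up) -[u t ** _ ** p h]cmulA (bEM up).
  rewrite (inj_eq (mal_inj (t := t))) eq_sym; case: eqP => [->|_]; last by rewrite !cmul0r.
  by rewrite cmulA -(bUM up).
apply: (star_hom_total bf total_W).
- move=> _ _ [[s g] _ <-] [[t h] _ <-]; rewrite W_mul !fW /= mul.
  by case: ifP => _; [exact: (fW (_, _))|exact: lin0].
- move=> _ [[t g] _ <-]; rewrite W_star fW (fW (_, _)) /= starM (bU_star up) (bE_star up).
  by rewrite (bUE up) malK.
- rewrite -W_one (lin_sum _ _ _ fl) -(bE1 up); apply: eq_bigr => g _.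
  by rewrite (fW (_, _)) /= (bU1 up) cmul1l.
Qed.

Section Characters.
Variable g0 : K.
Hypothesis fixg : forall t, al t g0 = g0.
Lemma zero_blin (V W' : normedModType C) : blin (fun _ : V => 0 : W').
Proof. by split; [move=> *; rewrite scaler0 addr0|exists 0 => // v; rewrite nr0 mul0r]. Qed.
(** At a fixed point [g0] of alpha the unitaries may act as 1 and [E g] as the scalar [g = g0]. The
    algebra then acts by scalars, which gives the character [chi]; the counit is the case
    [g0 = 1]. *)
Lemma triv_isrep : @isrep R m ell (fun _ v => v) (fun g v => if g == g0 then v else 0).
Proof.
split => //.
- by move=> _; exact: blin_id.
- by move=> g; case: (g == g0); [exact: blin_id|exact: zero_blin].
- by move=> g v w; case: ifP; rewrite // inner0l inner0r.
- by move=> g h v; have [->|/negbTE hg] := eqVneq h g0; rewrite ?hg ?if_same ?eqxx.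
- by move=> v; rewrite -big_mkcond /= big_pred1_eq.
- by move=> t g v; rewrite -{2}(fixg t) (inj_eq (mal_inj (t := t))).
Qed.
Definition triv := Rep triv_isrep.
Definition chi (a : A) : C := inner (a triv (dlt R 0%N)) (dlt R 0%N).
Lemma inner_blin (H : hilbertType R) (z : H) : blin (fun v => (inner v z : Cplx R)).
Proof.
split; first by move=> a x y; exact: innerP.
by exists (nr z); [exact: nr_ge0|move=> x; rewrite mulrC; exact: inner_CS].
Qed.
Lemma chi_blin : blin (chi : A -> Cplx R).
Proof. exact: (blin_comp (inner_blin _) (eval_blin D1 triv (dlt R 0%N))). Qed.
Lemma chi_W t g : chi (W t g) = (g == g0)%:R.
Proof.
by rewrite /chi W_E /=; case: ifP; rewrite ?inner_dd // inner0l.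
Qed.
Lemma chi_scalar (a : A) v : a triv v = chi a *: v.
Proof.
have bs : blin (fun c : Cplx R => (c : C) *: v).
  split; first by move=> c x y; rewrite scalerDl -scalerA.
  by exists (nr v); [exact: nr_ge0|move=> c; rewrite nrZ mulrC].
apply: (blin_ext total_W (eval_blin D1 triv v) (blin_comp bs chi_blin)) => _ [[t g] _ <-] /=.
by rewrite chi_W /=; case: ifP; rewrite ?scale1r ?scale0r.
Qed.
Lemma chi_char : star_character chi.
Proof.
split.
- exact: (proj1 chi_blin).
- by move=> x y; rewrite {1}/chi famE_M (chi_scalar y) (linZ (proj1 (fam_blin x triv))) innerZl -/(chi x) mulrC.
- by rewrite /chi famE_1 inner_dd eqxx.
- by move=> x; rewrite /chi fam_starr inner_conj.
Qed.
End Characters.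
End CrossedProduct.

(** * The quantum group structure *)

(** The tensor product of two members of [rep] acts on l2(nat x nat) and has to be brought back to
    l2(nat) to be a member of [rep] again. *)
Lemma nat_pairing_exists : exists f : nat -> nat * nat, exists2 g, cancel f g & cancel g f.
Proof.
have /card_set_bijP[f hf] : ([set: nat * nat] #= [set: nat])%card := card_nat2.
case: hf => _ finj fsurj.
have /choice[g hg] n : exists q, f q = n by have [q _ <-] := fsurj n I; exists q.
exists g; exists f => // q; apply: finj; rewrite ?in_setT //; exact: hg.
Qed.
Definition unpair : nat -> nat * nat := sval (cid nat_pairing_exists).
Definition mkpair : nat * nat -> nat := sval (cid2 (svalP (cid nat_pairing_exists))).
Lemma unpairK : cancel unpair mkpair. Proof. by rewrite /unpair /mkpair; case: cid2. Qed.
Lemma mkpairK : cancel mkpair unpair. Proof. by rewrite /unpair /mkpair; case: cid2. Qed.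

Definition unit_pairing (X Z : Type) (f : X -> Z) (g : Z -> X) (fg : cancel f g) (gf : cancel g f) :
  pairing X unit Z.
by refine (@Pairing X unit Z (fun x _ => f x) g (fun _ => tt) _ _ _) => // x [].
Defined.
Definition assoc_pairing (X Y Z : Type) : pairing X (Y * Z) (X * Y * Z).
by refine (@Pairing X (Y * Z) (X * Y * Z) (fun x q => (x, q.1, q.2)) (fun q => q.1.1)
  (fun q => (q.1.2, q.2)) _ _ _) => [[[]]|x []|x []].
Defined.

Section TnLinear.
Variables (R : realType) (X X' Z Y Y' Z' : choiceType).
Variables (e : pairing X X' Z) (ye : pairing Y Y' Z').
Variables (D : famsub Y (l2 R X)) (D' : famsub Y' (l2 R X')).
Local Notation tn := (@tn R X X' Z Y Y' Z' e ye D D').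
Lemma tnf_linl (c : R[i]) (a a' : fam D) (b : fam D') y v :
  tnf e ye (c *: a + a') b y v = c *: tnf e ye a b y v + tnf e ye a' b y v.
Proof.
rewrite /tnf -otens_linl; try exact: fam_blin.
by congr (otens e _ _ v); apply/funext => w; rewrite !famE.
Qed.
Lemma tnf_linr (c : R[i]) (a : fam D) (b b' : fam D') y v :
  tnf e ye a (c *: b + b') y v = c *: tnf e ye a b y v + tnf e ye a b' y v.
Proof.
rewrite /tnf -otens_linr; try exact: fam_blin.
by congr (otens e _ _ v); apply/funext => w; rewrite !famE.
Qed.
Lemma tnf_bound (a : fam D) (b : fam D') : fam_bound (tnf e ye a b) (nr a * nr b).
Proof. by move=> y; apply: otens_bound; rewrite ?nr_ge0 //; exact: nr_fam_bound. Qed.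
Lemma tn_blinl b : blin (fun a => tn a b).
Proof.
split; first by move=> c a a'; apply: fam_ext => y v; rewrite !famE; exact: tnf_linl.
exists (nr b); [exact: nr_ge0|move=> a; apply: nr_fam_le; first by rewrite mulr_ge0 ?nr_ge0].
by rewrite mulrC; exact: tnf_bound.
Qed.
Lemma tn_blinr a : blin (tn a).
Proof.
split; first by move=> c b b'; apply: fam_ext => y v; rewrite !famE; exact: tnf_linr.
exists (nr a); [exact: nr_ge0|move=> b; apply: nr_fam_le; first by rewrite mulr_ge0 ?nr_ge0].
exact: tnf_bound.
Qed.
Lemma tnM a a' b b' : tn a b ** tn a' b' = tn (a ** a') (b ** b').
Proof.
apply: fam_ext => y v; exact: (congr1 (fun f : fam (allfam Z' (l2 R Z)) => f y v) (tnaM e ye a a' b b')).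
Qed.
Lemma tn_star a b : star (tn a b) = tn (star a) (star b).
Proof.
apply: famstar_uniq => y; apply: otens_adj; try exact: fam_blin.
  by move=> v w; exact: fam_starl.
by move=> v w; exact: fam_starl.
Qed.
Lemma tn1 : tn cone cone = cone.
Proof. by apply: fam_ext => y v /=; rewrite /tnf otens_id. Qed.
Lemma tn_eq0 a b : tn a b = 0 -> a <> 0 -> b = 0.
Proof.
move=> h a0; apply: contrapT => b0.
have nz (Y0 : Type) (K0 : hilbertType R) (D0 : famsub Y0 K0) (f : fam D0) : f <> 0 ->
    exists y v, f y v <> 0.
  move=> f0; apply: contrapT => H; apply: f0; apply: fam_ext => y v; rewrite famE_0.
  by apply: contrapT => fv; apply: H; exists y, v.
have nzx (X0 : choiceType) (f : l2 R X0) : f <> 0 -> exists x, f x <> 0.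
  by move=> f0; apply: contrapT => H; apply: f0; apply: l2_ext => x; apply: contrapT => fx; apply: H; exists x.
have [y [v /nzx [x av]]] := nz _ _ _ _ a0; have [y' [w /nzx [x' bw]]] := nz _ _ _ _ b0.
have := congr1 (fun f : fam _ => f (pe ye y y') (tv e v w) (pe e x x')) h.
rewrite /= [LHS](_ : _ = a y v x * b y' w x').
  by move=> /eqP; rewrite mulf_eq0 => /orP[/eqP|/eqP].
by rewrite /tnf p1K p2K otens_tv ?tvE ?p1K ?p2K //; exact: fam_blin.
Qed.
End TnLinear.

Section Bicrossed.
Variables (R : realType) (m : mpair).
Local Notation T := (mT m).
Local Notation K := (mK m).
Local Notation al := (@mal m).
Local Notation be := (@mbe m).
Local Notation C := R[i].
Local Notation ell := (l2 R nat).
Local Notation rep := (rep R m).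
Local Notation A := (fam (D1 R m)).
Local Notation W := (@W R m).
Local Notation NN := (nat * nat)%type.
Local Notation pNN := (prod_pairing nat nat).
Local Notation pRR := (prod_pairing rep rep).
Local Notation D2 := (tsub pNN pRR (D1 R m) (D1 R m)).
Local Notation A2 := (fam D2).
Local Notation tens2 := (@tn R nat nat NN rep rep (rep * rep)%type pNN pRR (D1 R m) (D1 R m)).

Lemma blin_bigsum (V V' : normedModType C) (I : Type) (r : seq I) (F : I -> V -> V') :
  (forall i, blin (F i)) -> blin (fun v => \sum_(i <- r) F i v).
Proof.
move=> h; elim: r => [|i r IH].
  split; first by move=> *; rewrite !big_nil scaler0 addr0.
  by exists 0 => // v; rewrite big_nil nr0 mul0r.
by have := blinB 1 (h i) IH; congr blin; apply/funext => v; rewrite big_cons scale1r.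
Qed.

Section TensorRep.
Variables p q : rep.
Local Notation U1 := (rpU p).
Local Notation E1 := (rpE p).
Local Notation U2 := (rpU q).
Local Notation E2 := (rpE q).
Local Notation ot := (@otens R nat nat NN pNN).
Let bU1 t := rU_b (rpP p) t.
Let bE1' g := rE_b (rpP p) g.
Let bU2 t := rU_b (rpP q) t.
Let bE2 g := rE_b (rpP q) g.

(** The operators that the comultiplication prescribes: u_t goes to the sum over [h] of
    [u_t 1_h (x) u_r] with [r = be h t], and 1_g to the sum of the tensors of 1_h with the indicator
    of [h^-1 * g]. *)
Definition tU t (v : l2 R NN) : l2 R NN := \sum_h ot (U1 t \o E1 h) (U2 (be h t)) v.
Definition tE g (v : l2 R NN) : l2 R NN := \sum_h ot (E1 h) (E2 (h^-1 * g)%g) v.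

Lemma tU_blin t : blin (tU t).
Proof. by apply: blin_bigsum => h; apply: otens_blin; [exact: (blin_comp (bU1 t) (bE1' h))|exact: bU2]. Qed.
Lemma tE_blin g : blin (tE g).
Proof. by apply: blin_bigsum => h; apply: otens_blin; [exact: bE1'|exact: bE2]. Qed.

Lemma ot_ext (f g : l2 R NN -> l2 R NN) : blin f -> blin g ->
  (forall x y, f (tv pNN x y) = g (tv pNN x y)) -> f =1 g.
Proof.
move=> bf bg h; apply: (blin_ext (@total_dlt R NN) bf bg) => _ [z _ <-].
by rewrite -(peK pNN z) -tv_dlt h.
Qed.
Lemma tU_tv t x y : tU t (tv pNN x y) = \sum_h tv pNN (U1 t (E1 h x)) (U2 (be h t) y).
Proof. by apply: eq_bigr => h _; rewrite (otens_tv _ _ _ (blin_comp (bU1 t) (bE1' h)) (bU2 _)). Qed.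
Lemma tE_tv g x y : tE g (tv pNN x y) = \sum_h tv pNN (E1 h x) (E2 (h^-1 * g)%g y).
Proof. by apply: eq_bigr => h _; rewrite (otens_tv _ _ _ (bE1' h) (bE2 _)). Qed.

Lemma E1_sum k (F : K -> ell) (G : K -> ell -> ell) x : (forall h, blin (G h)) ->
  \sum_h tv pNN (G h (E1 h (E1 k x))) (F h) = tv pNN (G k (E1 k x)) (F k).
Proof.
move=> bG; rewrite (bigD1 k) //= (rEM (rpP p)) eqxx big1 ?addr0 // => h hk.
by rewrite (rEM (rpP p)) (negbTE hk) (lin0 (proj1 (bG h))) (lin0 (proj1 (tv_blinl _ _))).
Qed.

(** Orthogonality of the projections collapses the double sums ([E1_sum]); what remains in each
    relation is an identity of the matched pair, such as [mbe_mul] for products of unitaries and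
    [mal_mul] for covariance. *)
Lemma tens_isrep : isrep tU tE.
Proof.
split.
- exact: tU_blin.
- exact: tE_blin.
- move=> t; apply: (bounded_adjoint_ext (tU_blin t) (tU_blin _)) => z z'.
  rewrite -(peK pNN z) -(peK pNN z') -!tv_dlt !tU_tv inner_suml.
  set x := dlt R _; set y := dlt R _; set x' := dlt R _; set y' := dlt R _.
  rewrite [RHS]inner_conj inner_suml rmorph_sum /= [RHS](reindex_inj (mal_inj (t := t))) /=.
  apply: eq_bigr => h _; rewrite -inner_conj !inner_tv; congr (_ * _).
    by rewrite (rU_adj (rpP p)) (rE_adj (rpP p)) (rUE (rpP p)) malK.
  rewrite (rU_adj (rpP q)); congr (inner _ (U2 _ _)); apply: (mulIg (be h t)).
  by rewrite mulVg -mbe_mul mulVg mbe_1.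
- apply: ot_ext; [exact: tU_blin|exact: blin_id|move=> x y; rewrite tU_tv].
  under eq_bigr do rewrite (rU1 (rpP p)) mbe_1 (rU1 (rpP q)).
  by rewrite -(lin_sum _ _ _ (proj1 (tv_blinl pNN y))) (rE1 (rpP p)).
- move=> s t; apply: ot_ext; [exact: tU_blin|exact: (blin_comp (tU_blin s) (tU_blin t))|move=> x y].
  rewrite tU_tv [RHS]/= tU_tv (lin_sum _ _ _ (proj1 (tU_blin s))); apply: eq_bigr => k _.
  rewrite tU_tv (rUE (rpP p) t).
  have /= -> := E1_sum (al t k) (fun h => U2 (be h s) (U2 (be k t) y)) (U1 t x) (fun h => bU1 s).
  by rewrite -(rUE (rpP p)) -(rUM (rpP p)) -(rUM (rpP q)) -mbe_mul.
- move=> g; apply: (bounded_adjoint_ext (tE_blin g) (tE_blin _)) => z z'.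
  rewrite -(peK pNN z) -(peK pNN z') -!tv_dlt !tE_tv inner_suml.
  rewrite [RHS]inner_conj inner_suml rmorph_sum /=.
  apply: eq_bigr => h _; rewrite -inner_conj !inner_tv; congr (_ * _).
    by rewrite (rE_adj (rpP p)).
  by rewrite (rE_adj (rpP q)).
- move=> g h; apply: ot_ext; first exact: (blin_comp (tE_blin g) (tE_blin h)).
    by case: (g == h); [exact: tE_blin|exact: zero_blin].
  move=> x y; rewrite /= tE_tv (lin_sum _ _ _ (proj1 (tE_blin g))).
  have E k : tE g (tv pNN (E1 k x) (E2 (k^-1 * h)%g y)) =
      if g == h then tv pNN (E1 k x) (E2 (k^-1 * h)%g y) else 0.
    rewrite tE_tv; have /= -> := E1_sum k (fun j => E2 (j^-1 * g)%g (E2 (k^-1 * h)%g y)) x (fun j => blin_id ell).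
    rewrite (rEM (rpP q)) (inj_eq (mulgI _)); case: ifP => // _.
    by rewrite (lin0 (proj1 (tv_blinr _ _))).
  under eq_bigr do rewrite E.
  by case: ifP => // _; rewrite big1.
- apply: ot_ext; [by apply: blin_bigsum; exact: tE_blin|exact: blin_id|move=> x y].
  under eq_bigr do rewrite tE_tv.
  rewrite exchange_big /=.
  under eq_bigr => h _.
    rewrite -(lin_sum _ _ _ (proj1 (tv_blinr pNN _))).
    rewrite (reindex_inj (mulgI h)) /=.
    under eq_bigr do rewrite mulKg.
    rewrite (rE1 (rpP q)).
  over.
  by rewrite -(lin_sum _ _ _ (proj1 (tv_blinl pNN y))) (rE1 (rpP p)).
- move=> t g; apply: ot_ext.
  + exact: (blin_comp (tU_blin t) (tE_blin g)).
  + exact: (blin_comp (tE_blin _) (tU_blin t)).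
  move=> x y; rewrite /= tE_tv tU_tv (lin_sum _ _ _ (proj1 (tU_blin t))) (lin_sum _ _ _ (proj1 (tE_blin _))).
  apply: eq_bigr => h _; rewrite tU_tv tE_tv.
  have /= -> := E1_sum h (fun k => U2 (be k t) (E2 (h^-1 * g)%g y)) x (fun k => bU1 t).
  rewrite (rUE (rpP p)).
  have /= -> := E1_sum (al t h) (fun k => E2 (k^-1 * al t g)%g (U2 (be h t) y)) (U1 t x)
    (fun k => blin_id ell).
  rewrite (rUE (rpP q)); congr (tv _ _ (E2 _ _)).
  by apply: (mulgI (al t h)); rewrite -mal_mul !mulKVg.
Qed.

Lemma tUE t g v : tU t (tE g v) = \sum_h ot (U1 t \o E1 h) (U2 (be h t) \o E2 (h^-1 * g)%g) v.
Proof.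
have bs : blin (fun v => \sum_h ot (U1 t \o E1 h) (U2 (be h t) \o E2 (h^-1 * g)%g) v).
  by apply: blin_bigsum => h; apply: otens_blin;
    [exact: (blin_comp (bU1 t) (bE1' h))|exact: (blin_comp (bU2 _) (bE2 _))].
apply: (ot_ext (blin_comp (tU_blin t) (tE_blin g)) bs) => x y.
rewrite /= tE_tv (lin_sum _ _ _ (proj1 (tU_blin t))); apply: eq_bigr => h _.
rewrite tU_tv; have /= -> := E1_sum h (fun k => U2 (be k t) (E2 (h^-1 * g)%g y)) x (fun k => bU1 t).
by rewrite (otens_tv _ _ _ (blin_comp (bU1 t) (bE1' h)) (blin_comp (bU2 _) (bE2 _))).
Qed.
End TensorRep.

Definition eFwd : pairing NN unit nat := unit_pairing mkpairK unpairK.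
Definition eBwd : pairing nat unit NN := unit_pairing unpairK mkpairK.
Lemma bwd_fwd (f : l2 R NN -> l2 R NN) v : blin f -> rel eBwd (rel eFwd f) v = f v.
Proof.
move=> bf; apply: l2_ext => z; rewrite relE ?relE //; last exact: rel_blin.
rewrite /= mkpairK; congr (l2f (f _) _).
by apply: l2_ext => x; rewrite !sliceE /= mkpairK.
Qed.
Lemma rel_isrep (X Z : choiceType) (e : pairing X unit Z) U E :
  @isrep R m (l2 R X) U E -> @isrep R m (l2 R Z) (fun t => rel e (U t)) (fun g => rel e (E g)).
Proof.
move=> r; have bU := rU_b r; have bE := rE_b r.
have sU t v : slice e tt (rel e (U t) v) = U t (slice e tt v) by rewrite slice_rel; last exact: bU.
have sE g v : slice e tt (rel e (E g) v) = E g (slice e tt v) by rewrite slice_rel; last exact: bE.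
split.
- by move=> t; apply: rel_blin; exact: bU.
- by move=> g; apply: rel_blin; exact: bE.
- by move=> t; apply: rel_adj => //; exact: (rU_adj r).
- by move=> v; apply: (@rel_ext _ _ _ e); rewrite sU (rU1 r).
- by move=> s t v; apply: (@rel_ext _ _ _ e); rewrite !sU (rUM r).
- by move=> g; apply: rel_adj => //; exact: (rE_adj r).
- move=> g h v; apply: (@rel_ext _ _ _ e); rewrite !sE (rEM r).
  by case: ifP; rewrite ?sE // => _; apply: l2_ext.
- move=> v; apply: (@rel_ext _ _ _ e); rewrite slice_sum_unit.
  by under eq_bigr do rewrite sE; rewrite (rE1 r).
- by move=> t g v; apply: (@rel_ext _ _ _ e); rewrite !(sU, sE) (rUE r).
Qed.
Definition rho (p q : rep) : rep := Rep (rel_isrep eFwd (tens_isrep p q)).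

Lemma rho_W t g p q v :
  pullf eBwd (fun y => rho y.1 y.2) (W t g) (p, q) v =
  (\sum_h tens2 (W t h) (W (be h t) (h^-1 * g)%g)) (p, q) v.
Proof.
have bUE := blin_comp (tU_blin p q t) (tE_blin p q g).
have E : ff (W t g) (rho p q) = rel eFwd (tU p q t \o tE p q g).
  by apply/funext => w; rewrite W_E (rel_comp _ _ (tU_blin p q t) (tE_blin p q g)).
rewrite famE_sum -[LHS]/(rel eBwd (ff (W t g) (rho p q)) v) E bwd_fwd // [LHS]/= tUE.
by apply: eq_bigr => h _.
Qed.
Lemma delta_in a : range (fun k : T * K => W k.1 k.2) a ->
  fmem D2 (pullf eBwd (fun y : rep * rep => rho y.1 y.2) a).
Proof.
move=> [[t g] _ <-] /=.
have := ffP (\sum_h tens2 (W t h) (W (be h t) (h^-1 * g)%g)); congr (fmem D2 _).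
by apply/funext => -[p q]; apply/funext => v; rewrite rho_W.
Qed.
(* The component of [delta a] at [(p, q)] is that of [a] at the tensor product
   representation [rho p q], transported from [nat] to [nat * nat]. *)
Definition delta : A -> A2 := pull (@total_W R m) delta_in.
Lemma delta_W t g : delta (W t g) = \sum_h tens2 (W t h) (W (be h t) (h^-1 * g)%g).
Proof. by apply: fam_ext => -[p q] v; exact: rho_W. Qed.
Lemma delta_hom : star_hom delta. Proof. exact: pull_hom. Qed.
Lemma delta_blin : blin delta. Proof. exact: pull_blin. Qed.

Local Notation NNN := (nat * nat * nat)%type.
Local Notation R3 := (rep * rep * rep)%type.
Local Notation D3 := (tsub (prod_pairing NN nat) (prod_pairing (rep * rep) rep) D2 (D1 R m)).
Local Notation A3 := (fam D3).
Local Notation tl := (@tn R NN nat NNN (rep * rep)%type rep R3 (prod_pairing NN nat)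
  (prod_pairing (rep * rep) rep) D2 (D1 R m)).
Local Notation e3 := (assoc_pairing nat nat nat).
Local Notation y3 := (assoc_pairing rep rep rep).

Lemma otens_assoc (a b c : ell -> ell) : blin a -> blin b -> blin c -> forall v,
  otens e3 a (otens pNN b c) v = otens (prod_pairing NN nat) (otens pNN a b) c v.
Proof.
move=> ha hb hc; have bt := otens_blin pNN ha hb; have bt' := otens_blin pNN hb hc.
apply: (otens_ext (otens_blin e3 ha bt') bt hc) => -[x y] z.
have -> : pe (prod_pairing NN nat) (x, y) z = pe e3 x (y, z) by [].
rewrite otens_dlt // -[(y, z)]/(pe pNN y z) -[(x, y)]/(pe pNN x y) !otens_dlt //.
by apply: l2_ext => -[[i j] k]; rewrite !tvE /= mulrA.
Qed.
Lemma tr_tens (a b c : A) y v : tnf e3 y3 a (tens2 b c) y v = tl (tens2 a b) c y v.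
Proof. by case: y => [[p q] r]; apply: otens_assoc; exact: fam_blin. Qed.
(** Both bracketings of the triple tensor product have to land in one algebra. On elementary tensors
    this is [otens_assoc], and membership passes to limits. *)
Lemma tr_mem (a : A) (t : A2) : fmem D3 (tnf e3 y3 a t).
Proof.
apply: (@total_tn R nat nat NN rep rep (rep * rep)%type pNN pRR (D1 R m) (D1 R m)
  [set t : A2 | fmem D3 (tnf e3 y3 a t)]) => //.
  split => /=.
  - have := fam_sub0 D3; congr (fmem D3 _); apply/funext => y; apply/funext => v.
    by have := tnf_linr e3 y3 (-1) a (0 : A2) 0 y v; rewrite scaler0 addr0 scaleN1r addNr.
  - move=> c s t' hs ht; have := @fmemP R _ _ D3 c _ _ hs ht; congr (fmem D3 _).
    by apply/funext => y; apply/funext => v; rewrite tnf_linr.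
  - move=> x hx; have [fl _ fa] := tnf_ok e3 y3 a x; apply: (@fmem_closed R _ _ D3 _ fl fa) => d dp.
    have k0 : 0 < nr a + 1 by rewrite ltr_wpDl // nr_ge0.
    have [y hy xy] := hx _ (divr_gt0 dp k0); exists (tnf e3 y3 a y) => // z v.
    have -> : tnf e3 y3 a x z v - tnf e3 y3 a y z v = tnf e3 y3 a (x - y) z v.
      have := tnf_linr e3 y3 (-1) a y x z v; rewrite scaleN1r [- y + x]addrC => ->.
      by rewrite scaleN1r addrC.
    apply: le_trans (tnf_bound e3 y3 a (x - y) z v) _; rewrite ler_wpM2r ?nr_ge0 //.
    move: xy; rewrite ltr_pdivlMr //; have := nr_ge0 (x - y); nra.
move=> _ [b _ [c _ <-]] /=; have := ffP (tl (tens2 a b) c); congr (fmem D3 _).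
by apply/funext => y; apply/funext => v; rewrite tr_tens.
Qed.
Definition tr (a : A) (t : A2) : A3 := Fam (tr_mem a t).
Lemma tr_E (a b c : A) : tr a (tens2 b c) = tl (tens2 a b) c.
Proof. by apply: fam_ext => y v; exact: tr_tens. Qed.
Lemma tr_blinr (a : A) : blin (tr a).
Proof.
split; first by move=> c b b'; apply: fam_ext => y v; rewrite !famE; exact: tnf_linr.
exists (nr a); [exact: nr_ge0|move=> b; apply: nr_fam_le; first by rewrite mulr_ge0 ?nr_ge0].
exact: tnf_bound.
Qed.
Lemma total_tr : total [set tr a t | a in [set: A] & t in [set: A2]].
Proof.
move=> P cP hP.
apply: (@total_tn R NN nat NNN (rep * rep)%type rep R3 (prod_pairing NN nat)
  (prod_pairing (rep * rep) rep) D2 (D1 R m) P cP) => _ [t _ [c _ <-]].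
apply: (@total_tn R nat nat NN rep rep (rep * rep)%type pNN pRR (D1 R m) (D1 R m)
  [set t : A2 | P (tl t c)]).
  exact: (closed_subspace_preim (tn_blinl _ _ _ _) cP).
by move=> _ [a _ [b _ <-]] /=; rewrite -tr_E; apply: hP; exists a => //; exists (tens2 b c).
Qed.

Lemma rel_dlt (X Z : choiceType) (e : pairing X unit Z) a x z : blin a ->
  rel e a (dlt R (pe e x tt)) z = a (dlt R x) (p1 e z).
Proof. by move=> ha; rewrite relE // slice_dltu. Qed.

Definition dl_f (v : nat * nat) : NNN := (unpair v.1, v.2).
Definition dl_g (v : NNN) : nat * nat := (mkpair v.1, v.2).
Lemma dl_fK : cancel dl_f dl_g. Proof. by move=> [i j]; rewrite /dl_g /= unpairK. Qed.
Lemma dl_gK : cancel dl_g dl_f. Proof. by move=> [i j]; rewrite /dl_f /= mkpairK. Qed.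
Definition eDl : pairing NN unit NNN := unit_pairing dl_fK dl_gK.
Definition dr_f (v : nat * nat) : NNN := (v.1, (unpair v.2).1, (unpair v.2).2).
Definition dr_g (v : NNN) : nat * nat := (v.1.1, mkpair (v.1.2, v.2)).
Lemma dr_fK : cancel dr_f dr_g.
Proof. by move=> [i j]; rewrite /dr_g /= -surjective_pairing unpairK. Qed.
Lemma dr_gK : cancel dr_g dr_f. Proof. by move=> [[i j] k]; rewrite /dr_f /= mkpairK. Qed.
Definition eDr : pairing NN unit NNN := unit_pairing dr_fK dr_gK.

(** As [delta] is a pullback along [rho], the map [delta (x) id] is the pullback along (p, q, r) ->
    (rho p q, r), the basis bijection being [mkpair] on the first two coordinates. *)
Lemma dl_tens (a b : A) : pullf eDl (fun y : R3 => (rho y.1.1 y.1.2, y.2)) (tens2 a b) =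
  ff (tl (delta a) b).
Proof.
apply/funext => -[[p q] r]; have bo := otens_blin pNN (fam_blin a (rho p q)) (fam_blin b r).
have br : blin (rel eBwd (a (rho p q))) by apply: rel_blin; exact: fam_blin.
apply/funext; apply: (otens_ext (rel_blin eDl bo) br (fam_blin b r)) => x y.
have -> : pe (prod_pairing NN nat) x y = pe eDl (mkpair x, y) tt by rewrite /= /dl_f /= mkpairK.
have -> : dlt R x = dlt R (pe eBwd (mkpair x) tt) by rewrite /= mkpairK.
apply: l2_ext => -[[i j] k]; rewrite rel_dlt // tvE -[(mkpair x, y)]/(pe pNN (mkpair x) y).
rewrite otens_dlt ?tvE; try exact: fam_blin.
by rewrite rel_dlt //; exact: fam_blin.
Qed.
Lemma dr_tens (a b : A) : pullf eDr (fun y : R3 => (y.1.1, rho y.1.2 y.2)) (tens2 a b) =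
  ff (tr a (delta b)).
Proof.
apply/funext => -[[p q] r]; have bo := otens_blin pNN (fam_blin a p) (fam_blin b (rho q r)).
have br : blin (rel eBwd (b (rho q r))) by apply: rel_blin; exact: fam_blin.
apply/funext; apply: (otens_ext (rel_blin eDr bo) (fam_blin a p) br) => x y.
have -> : pe e3 x y = pe eDr (x, mkpair y) tt by rewrite /= /dr_f /= mkpairK.
have -> : dlt R y = dlt R (pe eBwd (mkpair y) tt) by rewrite /= mkpairK.
apply: l2_ext => -[[i j] k]; rewrite rel_dlt // tvE -[(x, mkpair y)]/(pe pNN x (mkpair y)).
rewrite otens_dlt ?tvE; try exact: fam_blin.
by rewrite rel_dlt //; exact: fam_blin.
Qed.
Local Notation tot2 := (@total_tn R nat nat NN rep rep (rep * rep)%type pNN pRR (D1 R m) (D1 R m)).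
Lemma dl_in (x : A2) : [set tens2 a b | a in [set: A] & b in [set: A]] x ->
  fmem D3 (pullf eDl (fun y : R3 => (rho y.1.1 y.1.2, y.2)) x).
Proof. by move=> [a _ [b _ <-]]; rewrite dl_tens; exact: ffP. Qed.
Lemma dr_in (x : A2) : [set tens2 a b | a in [set: A] & b in [set: A]] x ->
  fmem D3 (pullf eDr (fun y : R3 => (y.1.1, rho y.1.2 y.2)) x).
Proof. by move=> [a _ [b _ <-]]; rewrite dr_tens; exact: ffP. Qed.
Definition dl : A2 -> A3 := pull tot2 dl_in.
Definition dr : A2 -> A3 := pull tot2 dr_in.
Lemma dl_E (a b : A) : dl (tens2 a b) = tl (delta a) b.
Proof. by apply: fam_ext => y v; exact: (congr1 (fun f => f y v) (dl_tens a b)). Qed.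
Lemma dr_E (a b : A) : dr (tens2 a b) = tr a (delta b).
Proof. by apply: fam_ext => y v; exact: (congr1 (fun f => f y v) (dr_tens a b)). Qed.

Lemma delta_coassoc x : dl (delta x) = dr (delta x).
Proof.
have bl := pull_blin tot2 dl_in; have br := pull_blin tot2 dr_in.
apply: (blin_ext (@total_W R m) (blin_comp bl delta_blin) (blin_comp br delta_blin)) => _ [[t g] _ <-] /=.
rewrite delta_W (lin_sum _ _ _ (proj1 bl)) (lin_sum _ _ _ (proj1 br)).
under eq_bigr do rewrite -/dl dl_E delta_W (lin_sum _ _ _ (proj1 (tn_blinl _ _ _ _))).
under [RHS]eq_bigr do rewrite -/dr dr_E delta_W (lin_sum _ _ _ (proj1 (tr_blinr _))).
rewrite exchange_big /=; apply: eq_bigr => k _.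
rewrite (reindex_inj (mulgI k)) /=; apply: eq_bigr => h _.
by rewrite tr_E mulKg mbeM invMg mulgA.
Qed.

Lemma fix1 (t : T) : al t 1%g = 1%g. Proof. exact: mal_1. Qed.
Local Notation eps := (chi fix1).
Local Notation reps := (triv R fix1).
Lemma el_in (x : A2) : [set tens2 a b | a in [set: A] & b in [set: A]] x ->
  exists c (b : A), forall p v, x (reps, p) (tv pNN (dlt R 0%N) v) = c *: tv pNN (dlt R 0%N) (b p v).
Proof.
move=> [a _ [b _ <-]]; exists (eps a), b => p v.
rewrite /= /tnf otens_tv; try exact: fam_blin.
by rewrite /= chi_scalar (linZ (proj1 (tv_blinl _ _))).
Qed.
Lemma er_in (x : A2) : [set tens2 a b | a in [set: A] & b in [set: A]] x ->
  exists c (b : A), forall p v,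
    x (p, reps) (tv (swap_pairing pNN) (dlt R 0%N) v) = c *: tv (swap_pairing pNN) (dlt R 0%N) (b p v).
Proof.
move=> [a _ [b _ <-]]; exists (eps b), a => p v.
have sw f g : tv (swap_pairing pNN) f g = tv pNN g f.
  by apply: l2_ext => z; rewrite !tvE mulrC.
rewrite !sw /= /tnf otens_tv; try exact: fam_blin.
by rewrite /= chi_scalar (linZ (proj1 (tv_blinr _ _))).
Qed.
(** The slice map [eps (x) id]: in the representation [reps] the algebra acts by the counit, so the
    first leg acts on the basis vector by a scalar. *)
Definition el : A2 -> A := @cmp R nat nat NN rep (rep * rep)%type pNN (fun p => (reps, p)) D2 (D1 R m) 0%N
  [set tens2 a b | a in [set: A] & b in [set: A]] tot2 el_in.
Definition er : A2 -> A := @cmp R nat nat NN rep (rep * rep)%type (swap_pairing pNN) (fun p => (p, reps)) D2 (D1 R m) 0%N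
  [set tens2 a b | a in [set: A] & b in [set: A]] tot2 er_in.
Lemma el_E (a b : A) : el (tens2 a b) = eps a *: b.
Proof.
apply: fam_ext => p v; rewrite famE_Z /= /cmpf /= /tnf otens_tv; try exact: fam_blin.
by rewrite /= chi_scalar (linZ (proj1 (tv_blinl _ _))) (linZ (proj1 (sl_blin _ _ _))) sl_tv.
Qed.
Lemma er_E (a b : A) : er (tens2 a b) = eps b *: a.
Proof.
apply: fam_ext => p v; rewrite famE_Z /= /cmpf /=.
have sw f g : tv (swap_pairing pNN) f g = tv pNN g f.
  by apply: l2_ext => z; rewrite !tvE mulrC.
rewrite sw /tnf otens_tv; try exact: fam_blin.
by rewrite /= chi_scalar (linZ (proj1 (tv_blinr _ _))) -sw (linZ (proj1 (sl_blin _ _ _))) sl_tv.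
Qed.
Lemma el_hom : star_hom el. Proof. exact: cmp_hom. Qed.
Lemma er_hom : star_hom er. Proof. exact: cmp_hom. Qed.
Lemma el_delta x : el (delta x) = x.
Proof.
have bl : blin el by exact: cmp_blin.
apply: (blin_ext (@total_W R m) (blin_comp bl delta_blin) (blin_id A)) => _ [[t g] _ <-] /=.
rewrite delta_W (lin_sum _ _ _ (proj1 bl)); under eq_bigr do rewrite el_E chi_W.
rewrite (bigD1 (1%g : K)) //= eqxx scale1r mbe1 invg1 mul1g big1 ?addr0 // => h /negbTE ->.
by rewrite scale0r.
Qed.
Lemma er_delta x : er (delta x) = x.
Proof.
have bl : blin er by exact: cmp_blin.
apply: (blin_ext (@total_W R m) (blin_comp bl delta_blin) (blin_id A)) => _ [[t g] _ <-] /=.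
rewrite delta_W (lin_sum _ _ _ (proj1 bl)); under eq_bigr do rewrite er_E chi_W.
rewrite (bigD1 (g : K)) //= mulVg eqxx scale1r big1 ?addr0 // => h hg.
by rewrite -(inj_eq (mulgI h)) mulKVg mulg1 eq_sym (negbTE hg) scale0r.
Qed.

Lemma W_star_ne s k s' k' : k != k' -> W s k ** star (W s' k') = 0.
Proof.
move=> kk; rewrite W_star W_mul malK; case: eqP => // e.
by rewrite e eqxx in kk.
Qed.
Lemma W_star_eq s k : W s k ** star (W s k) = W 1%g (al s k).
Proof. by rewrite W_star W_mul malK eqxx mulgV. Qed.

(** In [delta (W t' (h * g))] with [t' = be h^-1 t], the summand at [h] has second leg [W t g];
    multiplying the first leg by the adjoint of [W t' h] kills the other summands. The remaining
    projections sum over [h] to the unit, because [al t' h] is the inverse of [al t h^-1] and runs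
    through the group. *)
Lemma cancel_l_W (a : A) t g : tens2 a (W t g) =
  \sum_h delta (W (be h^-1%g t) (h * g)%g) ** tens2 (star (W (be h^-1%g t) h) ** a) cone.
Proof.
have E h : delta (W (be h^-1%g t) (h * g)%g) ** tens2 (star (W (be h^-1%g t) h) ** a) cone =
    tens2 (W 1%g (al (be h^-1%g t) h) ** a) (W t g).
  rewrite delta_W cmul_suml (bigD1 h) //= tnM cmulA W_star_eq cmul1r -mbeM mulVg mbe1 mulKg.
  rewrite big1 ?addr0 // => k kh; rewrite tnM cmulA W_star_ne // cmul0l.
  exact: lin0 (proj1 (tn_blinl _ _ _ _)).
under eq_bigr do rewrite E.
rewrite -(lin_sum (f := fun a => tens2 a (W t g)) _ _ _ (proj1 (tn_blinl _ _ _ _))) -cmul_suml.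
have inj : injective (fun h : K => (al t h^-1%g)^-1%g).
  by move=> h k /invg_inj /mal_inj /invg_inj.
rewrite (eq_bigr (fun h => W 1%g (al t h^-1%g)^-1%g)).
  by rewrite -(reindex_inj inj (P := xpredT) (F := fun h => W 1%g h)) W_one cmul1l.
move=> h _; congr (W _ _); apply: (mulgI (al t h^-1%g)).
by rewrite -mal_mul mulVg mal_1 mulgV.
Qed.
(** For every [h] the summand at [g] is isolated by orthogonality in the second leg, and
    [al (be g t) (g^-1 * h)] runs through the group with [h]. *)
Lemma cancel_r_W t g (b : A) : tens2 (W t g) b =
  \sum_h delta (W t h) ** tens2 cone (star (W (be g t) (g^-1 * h)%g) ** b).
Proof.
have E h : delta (W t h) ** tens2 cone (star (W (be g t) (g^-1 * h)%g) ** b) =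
    tens2 (W t g) (W 1%g (al (be g t) (g^-1 * h)%g) ** b).
  rewrite delta_W cmul_suml (bigD1 g) //= tnM cmulA W_star_eq cmul1r.
  rewrite big1 ?addr0 // => k kg; rewrite tnM cmulA W_star_ne ?cmul0l; last first.
    by rewrite (inj_eq (mulIg h)) (inj_eq invg_inj).
  exact: lin0 (proj1 (tn_blinr _ _ _ _)).
under eq_bigr do rewrite E.
rewrite -(lin_sum _ _ _ (proj1 (tn_blinr _ _ _ _))) -cmul_suml.
have inj : injective (fun h : K => al (be g t) (g^-1 * h)%g) by move=> h k /mal_inj /mulgI.
by rewrite -(reindex_inj inj (P := xpredT) (F := fun h => W 1%g h)) W_one cmul1l.
Qed.

Lemma delta_cancel_l :
  closure (lin_span [set delta a ** tens2 b cone | a in [set: A] & b in [set: A]]) = [set: A2].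
Proof.
set Q := [set _ | _ in _ & _ in _]; have cQ := closed_subspace_closure Q.
apply/seteqP; split => // x _; apply: (tot2 cQ) => _ [a _ [b _ <-]].
apply: (total_W (closed_subspace_preim (tn_blinr _ _ _ a) cQ)) => _ [[t g] _ <-] /=.
rewrite cancel_l_W; apply: (subspace_sum _ cQ) => h.
by apply: subset_closure; apply: lin_span_in; eexists => //; eexists.
Qed.
Lemma delta_cancel_r :
  closure (lin_span [set delta a ** tens2 cone b | a in [set: A] & b in [set: A]]) = [set: A2].
Proof.
set Q := [set _ | _ in _ & _ in _]; have cQ := closed_subspace_closure Q.
apply/seteqP; split => // x _; apply: (tot2 cQ) => _ [a _ [b _ <-]].
apply: (total_W (closed_subspace_preim (tn_blinl _ _ _ b) cQ)) => _ [[t g] _ <-] /=.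
rewrite cancel_r_W; apply: (subspace_sum _ cQ) => h.
by apply: subset_closure; apply: lin_span_in; eexists => //; eexists.
Qed.

Lemma coassoc_ex :
    exists (Cm3 : cstarAlgType R) (tl : A2 -> A -> Cm3) (tr : A -> A2 -> Cm3) (Dl Dr : A2 -> Cm3),
      [/\ spatial_tensor tl /\ spatial_tensor tr,
          forall a b c, tl (tens2 a b) c = tr a (tens2 b c),
          star_hom Dl /\ (forall a b, Dl (tens2 a b) = tl (delta a) b),
          star_hom Dr /\ (forall a b, Dr (tens2 a b) = tr a (delta b)) &
          forall x, Dl (delta x) = Dr (delta x)].
Proof.
exists A3, tl, tr, dl, dr; split.
- split; first by apply: (spatialP (e := prod_pairing NN nat) (ye := prod_pairing (rep * rep) rep)) => //; exact: total_tn.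
  by apply: (spatialP (e := e3) (ye := y3)) => //; exact: total_tr.
- by move=> a b c; rewrite tr_E.
- by split; [exact: pull_hom|exact: dl_E].
- by split; [exact: pull_hom|exact: dr_E].
- exact: delta_coassoc.
Qed.
Lemma tens2_spatial : spatial_tensor tens2.
Proof. by apply: (spatialP (e := pNN) (ye := pRR)) => //; exact: total_tn. Qed.
Lemma counit_ex : exists El Er : A2 -> A,
      [/\ star_hom El /\ (forall a b, El (tens2 a b) = eps a *: b),
          star_hom Er /\ (forall a b, Er (tens2 a b) = eps b *: a) &
          forall x, El (delta x) = x /\ Er (delta x) = x].
Proof.
exists el, er; split; [by split; [exact: el_hom|exact: el_E]|by split; [exact: er_hom|exact: er_E]|].
by move=> x; rewrite el_delta er_delta.
Qed.
Definition bicrossed : compactQuantumGroup R :=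
  @CompactQuantumGroup R A A2 tens2 tens2_spatial delta delta_hom coassoc_ex
    delta_cancel_l delta_cancel_r eps (chi_char R fix1) counit_ex.
End Bicrossed.

(** * The regular representation *)

Section Regular.
Variables (R : realType) (m : mpair).
Local Notation T := (mT m).
Local Notation K := (mK m).
Local Notation al := (@mal m).
Local Notation be := (@mbe m).
Local Notation C := R[i].
Local Notation A := (fam (D1 R m)).
Local Notation W := (@W R m).
Local Notation X := (K * T)%type.
Local Notation LX := (l2 R X).

(** Left multiplication by [t] on the ambient group, in the coordinates (g, s) of the product of [g]
    and [s]. The resulting representation separates the elements [W t g]. *)
Definition act (t : T) (z : X) : X := (al t z.1, (be z.1 t * z.2)%g).
Lemma act1 z : act 1%g z = z.
Proof. by case: z => h s; rewrite /act /= mal1 mbe_1 mul1g. Qed.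
Lemma actM s t z : act (s * t)%g z = act s (act t z).
Proof. by rewrite /act /= malM mbe_mul mulgA. Qed.
Lemma actK t : cancel (act t) (act t^-1%g).
Proof. by move=> z; rewrite -actM mulVg act1. Qed.
Lemma actVK t : cancel (act t^-1%g) (act t).
Proof. by move=> z; rewrite -actM mulgV act1. Qed.

Definition translate (t : T) : LX -> LX := slice (unit_pairing (actVK t) (actK t)) tt.
Lemma translateE t f z : translate t f z = f (act t^-1%g z). Proof. by []. Qed.
Lemma translate_blin t : blin (translate t).
Proof.
split; first by move=> c f g; exact: slice_lin.
exists 1 => // f; rewrite mul1r; apply: nr_l2_le; first exact: nr_ge0.
move=> B; rewrite nr_l2; have := slice_sum (unit_pairing (actVK t) (actK t)) f (t := [:: tt]) isT.
by rewrite big_seq1; apply: le_trans; exact: l2sq_le.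
Qed.
Lemma translate_dlt t z : translate t (dlt R z) = dlt R (act t z).
Proof.
apply: l2_ext => x; rewrite translateE !dltE.
by rewrite (can2_eq (actK t) (actVK t)).
Qed.
Definition at_point (g : K) : LX -> LX := mask (fun z => z.1 == g).
Lemma at_point_blin g : blin (at_point g).
Proof. by split; [exact: maskP|exists 1 => // v; rewrite mul1r; exact: mask_bound]. Qed.

Lemma regular_isrep : isrep translate at_point.
Proof.
split.
- exact: translate_blin.
- exact: at_point_blin.
- move=> t; apply: bounded_adjoint_ext; try exact: translate_blin.
  move=> x y; rewrite !translate_dlt !inner_dd; congr (nat_of_bool _)%:R.
  by rewrite (can2_eq (actK t) (actVK t)).
- by move=> v; apply: l2_ext => z; rewrite translateE invg1 act1.
- by move=> s t v; apply: l2_ext => z; rewrite !translateE invMg actM.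
- move=> g; apply: bounded_adjoint_ext; try exact: at_point_blin.
  move=> x y; rewrite /at_point !mask_dlt innerZl innerZr !inner_dd.
  by have [->|_] := eqVneq x y; rewrite ?mulr0 // rmorph_nat.
- move=> g h v; apply: l2_ext => z; rewrite /at_point !maskE.
  have [->|gh] := eqVneq g h; first by rewrite maskE; case: eqP; rewrite ?mul1r ?mul0r.
  by rewrite l2E_0; have [->|_] := eqVneq z.1 g; rewrite ?mul0r // (negbTE gh) mul0r mulr0.
- move=> v; apply: l2_ext => z; rewrite l2E_sum (bigD1 z.1) //= eqxx mul1r big1 ?addr0 // => g gz.
  by rewrite eq_sym (negbTE gz) mul0r.
- move=> t g v; apply: l2_ext => z; rewrite translateE /at_point !maskE translateE.
  by rewrite -(inj_eq (mal_inj (t := t))) /act /= malVK.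
Qed.
End Regular.

Section FamRep.
Variables (R : realType) (m : mpair) (H : hilbertType R).
Variables (U : mT m -> H -> H) (E : mK m -> H -> H).
Hypothesis r : isrep U E.
Local Notation B := (fam (@allfam R unit H)).
Lemma isrep_okU t : all_ok (fun _ : unit => U t).
Proof.
split; [by move=> _; exact: (proj1 (rU_b r t))|exists 1 => // y v; rewrite mul1r (rU_nr r) //|].
by exists (fun _ => U t^-1%g) => y v w; exact: (rU_adj r).
Qed.
Lemma isrep_okE g : all_ok (fun _ : unit => E g).
Proof.
split; [by move=> _; exact: (proj1 (rE_b r g))|exists 1 => // y v; rewrite mul1r; exact: (rE_nr r)|].
by exists (fun _ => E g) => y v w; exact: (rE_adj r).
Qed.
(** A representation on an arbitrary Hilbert space is a family with index set [unit], and the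
    algebra of such families is a target for the universal property. *)
Lemma isrep_hom : exists f : fam (D1 R m) -> B, star_hom f /\ forall t g v, f (W R t g) tt v = U t (E g v).
Proof.
pose u t : B := Fam (isrep_okU t : fmem (@allfam R unit H) _).
pose p g : B := Fam (isrep_okE g : fmem (@allfam R unit H) _).
have up : brep u p.
  split.
  - by move=> t; apply: famstar_uniq => y v w; exact: (rU_adj r).
  - by apply: fam_ext => y v; exact: (rU1 r).
  - by move=> s t; apply: fam_ext => y v; exact: (rUM r).
  - by move=> g; apply: famstar_uniq => y v w; exact: (rE_adj r).
  - by move=> g h; apply: fam_ext => y v; rewrite famE_M /= (rEM r); case: ifP.
  - by apply: fam_ext => y v; rewrite famE_sum famE_1 -[RHS](rE1 r).
  - by move=> t g; apply: fam_ext => y v; exact: (rUE r).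
by have [f [hf fW]] := A_univ up; exists f; split => // t g v; rewrite fW.
Qed.
End FamRep.

(** * Non-commutativity, non-cocommutativity and infinite dimension *)

Section Facts.
Variables (R : realType) (m : mpair).
Local Notation T := (mT m).
Local Notation K := (mK m).
Local Notation al := (@mal m).
Local Notation be := (@mbe m).
Local Notation C := R[i].
Local Notation A := (fam (D1 R m)).
Local Notation W := (@W R m).
Local Notation X := (K * T)%type.
Local Notation tens2 := (@tn R nat nat (nat * nat)%type (rep R m) (rep R m) (rep R m * rep R m)%type
  (prod_pairing nat nat) (prod_pairing (rep R m) (rep R m)) (D1 R m) (D1 R m)).

(** The functionals are matrix coefficients of the regular representation at the points (g, 1).
    Distinct [t] move (g, 1) to distinct points, since [be g] is injective. *)
Lemma W_coef : exists c : T -> K -> A -> C,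
  (forall t g (z : C) a b, c t g (z *: a + b) = z * c t g a + c t g b) /\
  forall s h t g, c t g (W s h) = ((s == t) && (h == g))%:R.
Proof.
have [f [[fl _ _ _] fW]] := isrep_hom (regular_isrep R m).
exists (fun t g a => inner (f a tt (dlt R (g, 1%g))) (dlt R (act t (g, 1%g)))); split.
  by move=> t g z a b; rewrite fl !famE innerP.
move=> s h t g.
have fE : f (W s h) tt (dlt R (g, 1%g)) = (h == g)%:R *: dlt R (act s (g, 1%g)).
  rewrite fW /at_point mask_dlt (linZ (proj1 (translate_blin R s))) translate_dlt /=.
  by rewrite eq_sym.
rewrite fE innerZl inner_dd.
have -> : (act s (g, 1%g) == act t (g, 1%g)) = (s == t); last first.
  by case: (s == t); case: (h == g); rewrite /= ?mulr1 ?mulr0.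
apply/eqP/eqP => [|-> //]; rewrite /act /= !mulg1 => -[_].
by move/(congr1 (be g^-1%g)); rewrite -!mbeM mulgV !mbe1.
Qed.
Lemma W_inj t g s h : W t g = W s h -> t = s /\ g = h.
Proof.
have [c [cl cW]] := W_coef; move=> /(congr1 (c s h)); rewrite !cW !eqxx.
by case: eqP => [->|_] /=; [case: eqP => [->|_] //=|] => /eqP; rewrite eq_sym oner_eq0.
Qed.
Lemma W_neq0 t g : W t g <> 0.
Proof.
have [c [cl cW]] := W_coef; move=> /(congr1 (c t g)); rewrite cW !eqxx.
have := cl t g (-1) 0 0; rewrite scaler0 addr0 mulN1r addNr => -> /eqP.
by rewrite oner_eq0.
Qed.

Lemma Eg_free (F : K -> C) : \sum_g F g *: Eg R g = 0 -> forall g, F g = 0.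
Proof.
move=> h g; have := congr1 (fun x => Eg R g ** x) h; rewrite cmul_sumr cmul0r (bigD1 g) //=.
rewrite cmulZr W_mul mal1 eqxx mulg1 big1 ?addr0 => [/eqP|j jg].
  by rewrite scaler_eq0 => /orP[/eqP|/eqP/W_neq0].
by rewrite cmulZr W_mul mal1 (negbTE jg) scaler0.
Qed.

Lemma bicrossed_noncomm (s t : T) : (s * t)%g <> (t * s)%g -> ~ cqg_commutative (bicrossed R m).
Proof.
move=> st h; apply: st; have := h (W s 1%g) (W t 1%g).
by rewrite !W_mul !mal_1 eqxx => /W_inj[].
Qed.

Lemma star_W_mul s g t h : star (W s g) ** W t h = if al t h == al s g then W (s^-1 * t)%g h else 0.
Proof. by rewrite W_star W_mul. Qed.

(** After left multiplication by [star (W t h) (x) star (W t 1)], what remains of [delta (W t h)] is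
    [1_h (x) u_s 1_e] with [s = t^-1 * be h t], and of its flip [1_h (x) 1_e]; hence [s = 1]. *)
Lemma bicrossed_noncocomm h t : be h t <> t -> ~ cqg_cocommutative (bicrossed R m).
Proof.
move=> ht [flip [[fl fM f1 fs] ft fD]]; apply: ht.
have := fD (W t h); rewrite [Delta _]delta_W (lin_sum _ _ _ fl).
under eq_bigr do rewrite [flip _]ft.
move=> E; have {E} := congr1 (fun x => tens2 (star (W t h)) (star (W t 1%g)) ** x) E.
rewrite !cmul_sumr (bigD1 1%g) //= tnM !star_W_mul mbe1 invg1 mul1g !eqxx mulVg big1 ?addr0; last first.
  move=> k k1; rewrite tnM [X in tens2 _ X]star_W_mul (inj_eq (mal_inj (t := t))) (negbTE k1).
  exact: lin0 (proj1 (tn_blinr _ _ _ _)).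
rewrite (bigD1 h) //= tnM !star_W_mul mulVg !mal_1 !eqxx mulVg big1 ?addr0; last first.
  move=> k k1; rewrite tnM [X in tens2 X]star_W_mul (inj_eq (mal_inj (t := t))) (negbTE k1).
  exact: lin0 (proj1 (tn_blinl _ _ _ _)).
move=> /eqP; rewrite -subr_eq0 -(linB (proj1 (tn_blinr _ _ _ _))) => /eqP /tn_eq0 /(_ (@W_neq0 _ _)).
move=> /eqP; rewrite subr_eq0 mal_1 eqxx => /eqP /W_inj[/(congr1 (mulg t))].
by rewrite mulg1 mulKVg => <-.
Qed.

(** Against [n] spanning vectors, some nonzero combination of the [n + 1] coordinate functionals at
    [x 0, ..., x n] vanishes identically; yet its values at the elements [W (x i) 1] are its own
    coefficients. *)
Lemma bicrossed_infinite (x : nat -> T) : injective x -> cqg_infinite_dimensional (bicrossed R m).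
Proof.
move=> xi [n [s hs]]; have [c [cl cW]] := W_coef.
pose M := \matrix_(i < n.+1, j < n) c (x i) 1%g (s j).
have /rowV0Pn[v] : kermx M != 0.
  by rewrite -mxrank_eq0 mxrank_ker subn_eq0 -ltnNge ltnS rank_leq_col.
rewrite sub_kermx => /eqP vM /eqP; apply; apply/rowP => i; rewrite mxE.
pose d a := \sum_i v ord0 i * c (x i) 1%g a.
have dP (z : C) a b : d (z *: a + b) = z * d a + d b.
  by rewrite /d mulr_sumr -big_split; apply: eq_bigr => j _ /=; rewrite cl; ring.
have d0 : d 0 = 0 by rewrite /d big1 // => j _; have := cl (x j) 1%g (-1) 0 0;
  rewrite scaler0 addr0 mulN1r addNr => ->; rewrite mulr0.
have : d (W (x i) 1%g) = 0.
  have : lin_span (range s) (W (x i) 1%g) by rewrite hs.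
  apply: (lin_span_ind (P := [set a | d a = 0])) => //=.
    by move=> z a b; rewrite dP => -> ->; rewrite mulr0 addr0.
  move=> _ [j _ <-]; have := congr1 (fun u : 'rV_n => u ord0 j) vM; rewrite !mxE => e.
  apply: etrans e; by apply: eq_bigr => k _; rewrite mxE.
rewrite /d (bigD1 i) //= cW !eqxx mulr1 big1 ?addr0 // => j ji.
by rewrite cW [x i == _](inj_eq xi) eq_sym (inj_eq val_inj) (negbTE ji) mulr0.
Qed.
End Facts.

(** * Property (T) *)

Section Contractive.
Variables (R : realType) (A : cstarAlgType R).
Local Notation C := R[i].

(* The square root makes both representations and characters contractive without
   any spectral theory. *)
Lemma norm_defect (x : A) : exists k : A, star k = k /\ k ** k = (nr x ^+ 2)%:C *: cone - star x ** x.
Proof.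
have [|k [sk kk _ _]] := @positive_sqrt R A ((nr x ^+ 2)%:C *: cone - star x ** x); last by exists k.
split; first by rewrite !sE conj_real.
by exists (nr x ^+ 2); rewrite ?sqr_ge0 // opprB addrC subrK nr_starM.
Qed.

Lemma rep_contractive (H : hilbertType R) (p : A -> H -> H) : representation p ->
  forall x v, nr (p x v) <= nr x * nr v.
Proof.
move=> [_ pL pM p1 pS] x v; have [k [sk kk]] := norm_defect x.
have sq y : inner (p (star y ** y) v) v = (nr (p y v) ^+ 2)%:C.
  by rewrite pM pS inner_self.
have := sq k; rewrite sk kk.
have -> : (nr x ^+ 2)%:C *: cone - star x ** x = (-1) *: (star x ** x) + (nr x ^+ 2)%:C *: cone.
  by rewrite scaleN1r addrC.
have p0 : p 0 v = 0 by have := pL (-1) 0 0 v; rewrite scaler0 addr0 scaleN1r addNr.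
have -> : (nr x ^+ 2)%:C *: (cone : A) = (nr x ^+ 2)%:C *: cone + 0 by rewrite addr0.
rewrite !pL p1 p0 addr0 innerP sq innerZl inner_self mulN1r -rmorphM -rmorphN -rmorphD /=.
move=> /(@complexI R) e; rewrite -(ler_pXn2r (n := 2)) ?nnegrE ?mulr_ge0 ?nr_ge0 //.
by rewrite exprMn; have := sqr_ge0 (nr (p k v)); rewrite -e; lra.
Qed.

Lemma char_contractive (e : A -> C) : star_character e -> forall x, ca (e x) <= nr x.
Proof.
move=> [eL eM e1 eS] x; have [k [sk kk]] := norm_defect x.
have sq y : e (star y ** y) = (ca (e y) ^+ 2)%:C by rewrite eM eS mulrC ca_sqr.
have e0 : e 0 = 0 by have := eL (-1) 0 0; rewrite scaler0 addr0 mulN1r addNr.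
have := sq k; rewrite sk kk.
have -> : (nr x ^+ 2)%:C *: cone - star x ** x = (-1) *: (star x ** x) + ((nr x ^+ 2)%:C *: cone + 0).
  by rewrite scaleN1r addr0 addrC.
rewrite !eL e1 e0 addr0 sq mulr1 mulN1r -rmorphN -rmorphD /=.
move=> /(@complexI R) h; rewrite -(ler_pXn2r (n := 2)) ?nnegrE ?nr_ge0 ?ca_ge0 //.
by have := sqr_ge0 (ca (e k)); rewrite -h; lra.
Qed.
End Contractive.

Record unirep (R : realType) (T : groupType) (H : hilbertType R) (U : T -> H -> H) : Prop := UniRep {
  ur_b : forall t, blin (U t);
  ur_adj : forall t v w, inner (U t v) w = inner v (U t^-1%g w);
  ur1 : forall v, U 1%g v = v;
  urM : forall s t v, U (s * t)%g v = U s (U t v) }.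

(** Property (T) with an invariant vector at bounded distance from the given one, so that it
    survives the cut by a projection which almost fixes the given vector. *)
Definition kazhdan (R : realType) (T : groupType) := exists (F : seq T) (e : R), 0 < e /\
  forall (H : hilbertType R) (U : T -> H -> H), unirep U -> forall xi, nr xi = 1 ->
    (forall t, t \in F -> nr (U t xi - xi) <= e) ->
    exists eta, nr (xi - eta) <= 2^-1 /\ forall t, U t eta = eta.

Section PropertyT.
Variables (R : realType) (m : mpair).
Local Notation A := (fam (D1 R m)).
Local Notation W := (@W R m).
Local Notation eps := (@chi R m 1%g (@fix1 m)).

Lemma chi_Ug t : eps (Ug R t) = 1.
Proof.
rewrite /Ug (lin_sum _ _ _ (proj1 (chi_blin R (@fix1 m)))) (bigD1 1%g) //= chi_W eqxx.
by rewrite big1 ?addr0 // => g /negbTE g1; rewrite chi_W g1.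
Qed.

(** The cut vector is nonzero since 1/2 + 1/4 < 1. It transforms by the counit because u_t commutes
    with 1_e, alpha fixing the unit, and the other 1_g kill it. *)
Lemma bicrossed_T : kazhdan R (mT m) -> dual_property_T (bicrossed R m).
Proof.
move=> [F [e [e0 kaz]]] H p hp [xi [xi1 xic]].
have [pb pL pM p1 pS] := hp.
have pc := rep_contractive hp.
have close (x : A) d : 0 < d -> exists N, forall n, (N <= n)%N -> nr (p x (xi n) - eps x *: xi n) < d.
  move=> d0; have /cvg_nr := xic x; move=> /(_ _ d0)[N hN]; exists N => n /hN.
  by rewrite nr_subC subr0 /nr normr_id.
have xin n : nr (xi n) = 1 by rewrite /nr xi1.
have [n [nF nE]] : exists n, (forall t, t \in F -> nr (p (Ug R t) (xi n) - xi n) <= e) /\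
    nr (p (Eg R 1%g) (xi n) - xi n) < 4^-1.
  have [N0 hN0] := close (Eg R (1%g : mK m)) 4^-1 ltac:(by rewrite invr_gt0).
  have hE : eps (Eg R 1%g) = 1 by rewrite chi_W eqxx.
  rewrite hE in hN0.
  suff [N hN] : exists N, forall n, (N <= n)%N -> forall t, t \in F -> nr (p (Ug R t) (xi n) - xi n) <= e.
    exists (maxn N0 N); split; first exact: (hN _ (leq_maxr _ _)).
    by have := hN0 _ (leq_maxl N0 N); rewrite scale1r.
  elim: F {kaz} => [|t F [N hN]]; first by exists 0%N.
  have [N' hN'] := close (Ug R t) e e0; exists (maxn N N') => n hn s.
  rewrite geq_max in hn; have [h1 h2] := andP hn; rewrite inE => /orP[/eqP ->|/hN]; last exact.
  by have := hN' _ h2; rewrite chi_Ug scale1r => /ltW.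
have Ab := A_brep R m.
have pbl x : blin (p x).
  split; first by move=> a v w; exact: (proj1 (pb x)).
  by exists (nr x); [exact: nr_ge0|exact: pc].
have ur : unirep (fun t => p (Ug R (t : mT m))).
  split => //.
  - by move=> t v w; rewrite -pS (bU_star Ab) invgK.
  - by move=> v; rewrite (bU1 Ab) p1.
  - by move=> s t v; rewrite (bUM Ab) pM.
have [eta [ed einv]] := kaz H _ ur (xi n) (xin n) nF.
exists (p (Eg R 1%g) eta); split.
  move=> w0; have := nr_tri (p (Eg R 1%g) (xi n)) (xi n) (p (Eg R 1%g) eta).
  rewrite -(linB (proj1 (pbl _))) w0 subr0 xin [nr (xi n - _)]nr_subC.
  have : nr (p (Eg R 1%g) (xi n - eta)) <= 2^-1.
    apply: le_trans (pc _ _) _; apply: le_trans ed.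
    rewrite -[leRHS]mul1r ler_wpM2r ?nr_ge0 //.
    have h : nr (Eg R (1%g : mK m)) ^+ 2 = nr (Eg R (1%g : mK m)).
      by rewrite -nr_starM (bE_star Ab) (bEM Ab) eqxx.
    have := nr_ge0 (Eg R (1%g : mK m)); nra.
  move: nE; set a := nr _; set b := nr _; lra.
have b1 : blin (fun x : A => p x (p (Eg R 1%g) eta)).
  split; first by move=> a x y; exact: pL.
  exists (nr (p (Eg R 1%g) eta)); [exact: nr_ge0|by move=> x; rewrite mulrC; exact: pc].
have b2 : blin (fun x : A => eps x *: p (Eg R 1%g) eta).
  have [cl [M M0 cM]] := chi_blin R (@fix1 m).
  split; first by move=> a x y; rewrite cl scalerDl scalerA.
  exists (M * nr (p (Eg R 1%g) eta)); first by rewrite mulr_ge0 ?nr_ge0.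
  by move=> x; rewrite nrZ mulrAC ler_wpM2r ?nr_ge0 //; exact: cM.
apply: (blin_ext (@total_W R m) b1 b2) => _ [[t g] _ <-] /=.
rewrite chi_W -WE pM -[p (Eg R g) _]pM (bEM Ab) -pM.
case: eqP => _; rewrite ?cmul0r.
  by rewrite (bUE Ab) mal_1 pM einv scale1r.
have := pL (-1) 0 0 eta; rewrite scaler0 addr0 scaleN1r addNr => ->.
by rewrite scale0r.
Qed.
End PropertyT.

(** * Characters *)

Lemma card_le_injective (T U : Type) (A : set T) (B : set U) (f : T -> U) :
  (forall x, A x -> B (f x)) -> {in A &, injective f} -> (A #<= B)%card.
Proof.
move=> AB fi; have := inj_card_eq fi; rewrite card_eq_sym => e.
by rewrite (card_le_eql e); apply: subset_card_le => _ [x Ax <-]; exact: AB.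
Qed.

Definition star_characters (R : realType) (Q : compactQuantumGroup R) : set (Cm Q -> R[i]) :=
  [set e | star_character e].
Arguments star_characters {R} Q.

Lemma star_character_comp (R : realType) (A B : cstarAlgType R) (f : A -> B) (e : B -> R[i]) :
  star_hom f -> star_character e -> star_character (e \o f).
Proof.
move=> [fl fM f1 fs] [el eM e1 es]; split => /=.
- by move=> a x y; rewrite fl el.
- by move=> x y; rewrite fM eM.
- by rewrite f1 e1.
- by move=> x; rewrite fs es.
Qed.

Lemma cqg_isomorphic_characters (R : realType) (Q Q' : compactQuantumGroup R) :
  cqg_isomorphic Q Q' -> (star_characters Q #= star_characters Q')%card.
Proof.
move=> [f [_ [[hf [g fK gK]] _ _]]].
have hg : star_hom g.
  have [fl fM f1 fs] := hf; split.
  - by move=> a x y; rewrite -{1}[x]gK -{1}[y]gK -fl fK.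
  - by move=> x y; rewrite -{1}[x]gK -{1}[y]gK -fM fK.
  - by rewrite -f1 fK.
  - by move=> x; rewrite -{1}[x]gK -fs fK.
rewrite card_eq_le; apply/andP; split.
  apply: (card_le_injective (f := fun e : Cm Q -> R[i] => e \o g : Cm Q' -> R[i])) => [e|e e' _ _ /= h].
    exact: star_character_comp.
  by apply/funext => x; have := congr1 (fun k => k (f x)) h; rewrite /= fK.
apply: (card_le_injective (f := fun e : Cm Q' -> R[i] => e \o f : Cm Q -> R[i])) => [e|e e' _ _ /= h].
  exact: star_character_comp.
by apply/funext => x; have := congr1 (fun k => k (g x)) h; rewrite /= gK.
Qed.

Definition generates (T : groupType) (F : seq T) := forall P : T -> Prop,
  P 1%g -> (forall t, t \in F -> P t) -> (forall s t, P s -> P t -> P (s * t)%g) ->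
  (forall t, P t -> P t^-1%g) -> forall t, P t.

Section Characters.
Variables (R : realType) (m : mpair).
Local Notation T := (mT m).
Local Notation K := (mK m).
Local Notation C := R[i].
Local Notation A := (fam (D1 R m)).
Local Notation Q := (bicrossed R m).

Lemma characters_ge n (f : 'I_n -> K) : injective f -> (forall i t, mal t (f i) = f i) ->
  (`I_n #<= star_characters Q)%card.
Proof.
move=> fi ff.
case: n f fi ff => [|n] f fi ff; first by rewrite II0; exact: card_ge0.
pose g k := @chi R m (f (inord k)) (ff (inord k)).
apply: (card_le_injective (f := g)) => [k _|k k' hk hk' h]; first exact: chi_char.
have {}hk : (k < n.+1)%N by exact: (set_mem hk).
have {}hk' : (k' < n.+1)%N by exact: (set_mem hk').
have := congr1 (fun e => e (W R 1%g (f (inord k)))) h; rewrite /g !chi_W eqxx.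
case: eqP => [/fi /(congr1 val)|_ /eqP]; last by rewrite oner_eq0.
by rewrite /= !inordK.
Qed.

Lemma character_ext (e e' : A -> C) (F : seq T) : generates F ->
  star_character e -> star_character e' ->
  (forall t, t \in F -> e (Ug R t) = e' (Ug R t)) -> (forall g, e (Eg R g) = e' (Eg R g)) -> e = e'.
Proof.
move=> gF he he' hF hE.
have cb (d : A -> C) : star_character d -> blin (d : A -> Cplx R).
  move=> hd; have [dl _ _ _] := hd; split => //; exists 1 => // x; rewrite mul1r.
  exact: (char_contractive hd).
have [_ eM e1 es] := he; have [_ eM' e1' es'] := he'; have Ab := A_brep R m.
have hU : forall t, e (Ug R t) = e' (Ug R t).
  apply: gF => [|t /hF //|s t hs ht|t ht]; first by rewrite (bU1 Ab) e1 e1'.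
    by rewrite (bUM Ab) eM eM' hs ht.
  by rewrite -(bU_star Ab) es es' ht.
apply/funext; apply: (blin_ext (@total_W R m) (cb _ he) (cb _ he')) => _ [[t g] _ <-] /=.
by rewrite -WE eM eM' hU hE.
Qed.

Lemma characters_finite (F : seq T) N : generates F -> (0 < N)%N ->
  (forall t, t \in F -> (t ^+ N)%g = 1%g) -> finite_set (star_characters Q).
Proof.
move=> gF N0 FN; have Ab := A_brep R m.
(* Every value of a character on the generators is a root of [p]: an [N]-th root of unity on the
   unitaries, and 0 or 1 on the projections. *)
pose p : {poly C} := ('X^N - 1) * ('X * ('X - 1)).
have p0 : p != 0.
  rewrite !mulf_neq0 ?polyX_eq0 //; apply/eqP => /(congr1 (fun q : {poly C} => lead_coef q)).
    by rewrite lead_coef0 -polyC1 lead_coefXnsubC // => /eqP; rewrite oner_eq0.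
  by rewrite lead_coef0 -polyC1 lead_coefXsubC => /eqP; rewrite oner_eq0.
have [r pr] := closed_field_poly_normal p.
have in_r z : root p z -> z \in r.
  by rewrite pr rootZ ?lead_coef_eq0 // root_prod_XsubC.
pose J := ('I_(size F) + K)%type.
pose x (j : J) : A := match j with inl i => Ug R (tnth (in_tuple F) i) | inr g => Eg R g end.
have xr e j : star_character e -> e (x j) \in r.
  move=> [el eM e1 es]; apply: in_r; rewrite /p !rootM; case: j => [i|g] /=.
    apply/orP; left; rewrite /root !hornerE subr_eq0.
    have -> : e (Ug R (tnth (in_tuple F) i)) ^+ N = e (Ug R (tnth (in_tuple F) i ^+ N)%g).
      by elim: N {N0 FN p p0 pr} => [|n IH]; rewrite ?expr0 ?(bU1 Ab) ?e1 // exprS expgS (bUM Ab) eM IH.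
    by rewrite FN ?(bU1 Ab) ?e1 // mem_tnth.
  apply/orP; right; rewrite -rootM /root !hornerE; apply/eqP.
  have h : e (Eg R g) * e (Eg R g) = e (Eg R g) by rewrite -eM (bEM Ab) eqxx.
  transitivity (e (Eg R g) * e (Eg R g) - e (Eg R g)); first by ring.
  by rewrite h subrr.
pose f (e : A -> C) : {ffun J -> 'I_(size r).+1} := [ffun j => inord (index (e (x j)) r)].
apply: (card_le_finite (B := [set: {ffun J -> 'I_(size r).+1}])); last exact: finite_finset.
apply: (card_le_injective (f := f)) => // e e' /set_mem he /set_mem he' fe.
have xe j : e (x j) = e' (x j).
  have := congr1 (fun k : {ffun J -> 'I_(size r).+1} => val (k j)) fe; rewrite !ffunE /=.
  have h1 := xr e j he; have h2 := xr e' j he'.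
  rewrite !inordK ?ltnS ?index_size // => h.
  by rewrite -(nth_index 0 h1) h nth_index.
apply: (character_ext gF he he') => [t tF|g]; last exact: (xe (inr g)).
have ti : (index t F < size F)%N by rewrite index_mem.
by have := xe (inl (Ordinal ti)); rewrite /= (tnth_nth 1%g) /= nth_index.
Qed.
End Characters.

(** * Groups generated by Heisenberg pairs *)

Section RealInner.
Variables (R : realType) (H : hilbertType R).
Implicit Types v w : H.
Definition ri v w : R := complex.Re (inner v w).
Lemma riC v w : ri v w = ri w v.
Proof. by rewrite /ri inner_conj Re_conj. Qed.
Lemma riD u v w : ri (u + v) w = ri u w + ri v w.
Proof. by rewrite /ri innerDl ReD. Qed.
Lemma riN v w : ri (- v) w = - ri v w.
Proof. by rewrite /ri innerNl ReN. Qed.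
Lemma riZ (a : R) v w : ri (a%:C *: v) w = a * ri v w.
Proof. by rewrite /ri innerZl ReZ. Qed.
Lemma riDr u v w : ri w (u + v) = ri w u + ri w v.
Proof. by rewrite riC riD !(riC _ w). Qed.
Lemma riNr v w : ri w (- v) = - ri w v.
Proof. by rewrite riC riN riC. Qed.
Lemma riZr (a : R) v w : ri w (a%:C *: v) = a * ri w v.
Proof. by rewrite riC riZ riC. Qed.
Lemma ri_self v : ri v v = nr v ^+ 2.
Proof. by rewrite /ri inner_self. Qed.
Lemma ri_CS v w : `|ri v w| <= nr v * nr w.
Proof. exact: le_trans (ca_Re _) (inner_CS _ _). Qed.
Definition riE := (riD, riDr, riN, riNr, riZ, riZr).
End RealInner.

Section Projections.
Variables (R : realType) (T : groupType) (H : hilbertType R) (U : T -> H -> H).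
Hypothesis ur : unirep U.
Local Notation C := R[i].
Let bU t := ur_b ur t.
Let UL t := proj1 (bU t).

Lemma ur_inner t v w : inner (U t v) (U t w) = inner v w.
Proof. by rewrite (ur_adj ur) -(urM ur) mulVg (ur1 ur). Qed.
Lemma ur_nr t v : nr (U t v) = nr v.
Proof.
have := ur_inner t v v; rewrite !inner_self => /(@complexI R) /eqP.
by rewrite eqrXn2 ?nr_ge0 // => /eqP.
Qed.

(** The orthogonal projection onto the vectors fixed by [g], once the order of [g] divides 5. *)
Definition avg (g : T) (v : H) : H := (5^-1 : R)%:C *: \sum_(k < 5) U (g ^+ k)%g v.
Lemma avg5 (v : H) : (5^-1 : R)%:C *: (v *+ 5) = v.
Proof. by rewrite -scalerMnr scalerMnl -rmorphMn /= -(mulr_natr _ 5) mulVf ?scale1r // pnatr_eq0. Qed.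
Lemma avg_lin g (a : C) v w : avg g (a *: v + w) = a *: avg g v + avg g w.
Proof.
rewrite /avg; under eq_bigr do rewrite UL; rewrite big_split /= -scaler_sumr scalerDr !scalerA.
by rewrite mulrC.
Qed.
Let avgL g := @avg_lin g.

Section Order5.
Variable g : T.
Hypothesis g5 : (g ^+ 5)%g = 1%g.
Lemma ur_avg v : U g (avg g v) = avg g v.
Proof.
rewrite /avg (linZ (@UL g)) (lin_sum _ _ _ (@UL g)); congr (_ *: _).
under eq_bigr do rewrite -(urM ur) -expgS.
by rewrite big_ord_recr [RHS]big_ord_recl /= g5 expg0 addrC.
Qed.
Lemma ur_pow v : U g v = v -> forall k, U (g ^+ k)%g v = v.
Proof. by move=> h; elim=> [|k IH]; rewrite ?expg0 ?(ur1 ur) // expgS (urM ur) IH. Qed.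
Lemma avg_fix v : U g v = v -> avg g v = v.
Proof.
move=> h; rewrite /avg; under eq_bigr do rewrite ur_pow //.
by rewrite sumr_const card_ord avg5.
Qed.
Lemma avg_idem v : avg g (avg g v) = avg g v.
Proof. exact: avg_fix (ur_avg v). Qed.
Lemma expgV5 k : (k <= 5)%N -> ((g ^+ k)^-1)%g = (g ^+ (5 - k))%g.
Proof.
by move=> k5; apply: (mulgI (g ^+ k)%g); rewrite mulgV -expgnDr subnKC.
Qed.
Lemma avg_adj v w : inner (avg g v) w = inner v (avg g w).
Proof.
rewrite /avg innerZl innerZr conj_real; congr (_ * _).
rewrite inner_suml; under eq_bigr do rewrite (ur_adj ur).
rewrite [RHS]inner_conj inner_suml rmorph_sum /=; under [RHS]eq_bigr do rewrite -inner_conj.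
rewrite !big_ord_recr !big_ord0 /= !expgV5 // !subn0 expg0 g5.
by ring.
Qed.
Lemma avg_ri v w : ri (avg g v) w = ri v (avg g w).
Proof. by rewrite /ri avg_adj. Qed.
Lemma avg_sq v : ri (avg g v) v = nr (avg g v) ^+ 2.
Proof. by rewrite -ri_self -avg_ri avg_idem. Qed.
(** The factor 2 is the mean of 0, 1, 2, 3, 4, which bound the displacements under the powers of [g]
    in units of [e]. *)
Lemma avg_close v e : nr (U g v - v) <= e -> nr (avg g v - v) <= 2 * e.
Proof.
move=> h.
have hk k : nr (U (g ^+ k)%g v - v) <= k%:R * e.
  elim: k => [|k IH]; first by rewrite expg0 (ur1 ur) subrr nr0 mul0r.
  have := nr_tri (U g v) (U g (U (g ^+ k)%g v)) v; rewrite expgS (urM ur) -(linB (@UL g)) ur_nr.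
  by rewrite -natr1 mulrDl mul1r; lra.
have -> : avg g v - v = (5^-1 : R)%:C *: \sum_(k < 5) (U (g ^+ k)%g v - v).
  by rewrite sumrB scalerBr sumr_const card_ord avg5.
rewrite nrZ ca_real ger0_norm ?invr_ge0 // ler_pdivrMl //.
apply: le_trans (nr_sum _ _ _) _; rewrite !big_ord_recr big_ord0 /=.
have := hk 0%N; have := hk 1%N; have := hk 2%N; have := hk 3%N; have := hk 4%N; lra.
Qed.
End Order5.

Lemma avg_comm g h v : commute g h -> U h (avg g v) = avg g (U h v).
Proof.
move=> gh; rewrite /avg (linZ (@UL h)) (lin_sum _ _ _ (@UL h)); congr (_ *: _).
by apply: eq_bigr => k _; rewrite -!(urM ur) (commuteX _ (commute_sym gh)).
Qed.
Lemma avg_avg g h v : commute g h -> avg h (avg g v) = avg g (avg h v).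
Proof.
move=> gh; rewrite {1 4}/avg (linZ (@avgL g)) (lin_sum _ _ _ (@avgL g)); congr (_ *: _).
by apply: eq_bigr => k _; rewrite avg_comm //; apply: commuteX.
Qed.

Definition coavg g v := v - avg g v.
Lemma coavgE g v : coavg g v = v - avg g v. Proof. by []. Qed.
Lemma coavg_lin g (a : C) v w : coavg g (a *: v + w) = a *: coavg g v + coavg g w.
Proof. by rewrite /coavg avg_lin scalerBr; lmod C H. Qed.
Lemma coavg_sq g v : (g ^+ 5)%g = 1%g -> nr (coavg g v) ^+ 2 = nr v ^+ 2 - nr (avg g v) ^+ 2.
Proof.
move=> g5; rewrite /coavg; move: (avg_sq g5 v); move: (avg g v) => w hw.
by rewrite -ri_self !riE [ri v w]riC hw !ri_self; ring.
Qed.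
Lemma coavg_ri g v w : (g ^+ 5)%g = 1%g -> ri (coavg g v) w = ri v (coavg g w).
Proof. by move=> g5; rewrite /coavg riD riN riDr riNr (avg_ri g5). Qed.
Lemma coavg_idem g v : (g ^+ 5)%g = 1%g -> coavg g (coavg g v) = coavg g v.
Proof. by move=> g5; rewrite /coavg (linB (@avgL g)) avg_idem // subrr subr0. Qed.

Section Heisenberg.
Variables a b c : T.
Hypotheses (a5 : (a ^+ 5)%g = 1%g) (b5 : (b ^+ 5)%g = 1%g) (c5 : (c ^+ 5)%g = 1%g).
Hypotheses (ca : commute c a) (cb : commute c b) (ab : (a * b = b * a * c)%g).

Lemma heis_pow j k : (a ^+ j * b ^+ k = b ^+ k * (c ^+ (j * k) * a ^+ j))%g.
Proof.
have h1 n : (a * b ^+ n = b ^+ n * (c ^+ n * a))%g.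
  elim: n => [|n IH]; first by rewrite !expg0 !mulg1 !mul1g.
  rewrite expgS mulgA ab -(mulgA b) -(mulgA b) -ca -(mulgA c) IH.
  rewrite [RHS]mulgA -[RHS]mulgA expgS !mulgA; congr (_ * a)%g.
  by rewrite -!mulgA; congr (_ * _)%g; rewrite !mulgA; congr (_ * _)%g; exact: commuteX.
elim: j => [|j IH]; first by rewrite mul0n !expg0 mulg1 !mul1g mulg1.
rewrite expgS -mulgA IH mulgA h1 -!mulgA mulSn expgnDr -!mulgA; congr (_ * (_ * _))%g.
by rewrite !mulgA (commuteX (j * k) (commute_sym ca)).
Qed.

Lemma heis_avg w : (forall k, U (c ^+ k)%g w = w) -> avg a (avg b w) = avg b (avg a w).
Proof.
move=> wc; rewrite {1}/avg /(avg a w) (linZ (@avgL b)) (lin_sum _ _ _ (@avgL b)); congr (_ *: _).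
apply: eq_bigr => j _; rewrite /avg (linZ (@UL _)) (lin_sum _ _ _ (@UL _)); congr (_ *: _).
by apply: eq_bigr => k _; rewrite -(urM ur) heis_pow -(commuteX2 _ _ (commute_sym ca)) !(urM ur) wc.
Qed.

(* Conjugation by the powers of [a] turns [<b^k v, v>] into its average over the
   powers of [c], which vanishes for [k <> 0]. *)
Lemma heis_fixed v : U a v = v -> avg c v = 0 -> nr (avg b v) ^+ 2 = 5^-1 * nr v ^+ 2.
Proof.
move=> av cv.
have c0 : \sum_(k < 5) U (c ^+ k)%g v = 0.
  have := cv; rewrite /avg => /eqP; rewrite scaler_eq0 => /orP[|/eqP //].
  by rewrite fmorph_eq0 invr_eq0 pnatr_eq0.
have key k j : inner (U (b ^+ k)%g v) v = inner (U (b ^+ k)%g (U (c ^+ (j * k))%g v)) v.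
  rewrite -(ur_inner (a ^+ j)%g) -(urM ur) heis_pow !(urM ur) !(ur_pow av); reflexivity.
have cm n : (c ^+ (n + 5) = c ^+ n)%g by rewrite expgnDr c5 mulg1.
have zero k : (0 < k < 5)%N -> inner (U (b ^+ k)%g v) v = 0.
  move=> k5; have : \sum_(j < 5) inner (U (b ^+ k)%g (U (c ^+ (j * k))%g v)) v = 0.
    rewrite -inner_suml -(lin_sum _ _ _ (@UL _)).
    (* Multiplication by [k] permutes the residues modulo 5; the cases 2, 3 and 4 are written
       out. *)
    pose f n := U (c ^+ n)%g v; have fm n : f (n + 5)%N = f n by rewrite /f cm.
    suff -> : \sum_(j < 5) f (j * k)%N = \sum_(j < 5) f j.
      by rewrite c0 (lin0 (@UL _)) inner0l.
    clearbody f; rewrite !big_ord_recr !big_ord0 /=.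
    case: k k5 => [|[|[|[|[|k]]]]] // _.
    - rewrite -[(2 * 2)%N]/4%N -[(3 * 2)%N]/(1 + 5)%N -[(4 * 2)%N]/(3 + 5)%N !fm.
      by rewrite -[(0 * 2)%N]/0%N -[(1 * 2)%N]/2%N; lmod C H.
    - rewrite -[(2 * 3)%N]/(1 + 5)%N -[(3 * 3)%N]/(4 + 5)%N -[(4 * 3)%N]/(2 + 5 + 5)%N !fm.
      by rewrite -[(0 * 3)%N]/0%N -[(1 * 3)%N]/3%N; lmod C H.
    - rewrite -[(2 * 4)%N]/(3 + 5)%N -[(3 * 4)%N]/(2 + 5 + 5)%N -[(4 * 4)%N]/(1 + 5 + 5 + 5)%N !fm.
      by rewrite -[(0 * 4)%N]/0%N -[(1 * 4)%N]/4%N; lmod C H.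
  under eq_bigr do rewrite -key.
  by rewrite sumr_const card_ord => /eqP; rewrite mulrn_eq0 => /eqP.
rewrite -(avg_sq b5) /avg riZ /ri inner_suml (bigD1 ord0) //= expg0 (ur1 ur) big1 ?addr0 ?inner_self //.
by move=> k k0; apply: zero; rewrite ltn_ord andbT lt0n.
Qed.

(** As [c] commutes with [a], the projection [avg c] also kills [avg a v], so by [heis_fixed] the
    norm of [avg b (avg a v)] is 1/sqrt 5 < 9/20 times that of [avg a v]. Cauchy-Schwarz and the
    inequality of means then give the constant 9/40. *)
Lemma avg_angle v : avg c v = 0 ->
  `|ri (avg a v) (avg b v)| <= (9%:R / 40%:R) * (nr (avg a v) ^+ 2 + nr (avg b v) ^+ 2).
Proof.
move=> cv.
have ac : avg c (avg a v) = 0 by rewrite avg_avg ?cv ?(lin0 (@avgL a)) //; exact: commute_sym.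
have h := heis_fixed (ur_avg a5 v) ac.
have : `|ri (avg a v) (avg b v)| <= nr (avg b (avg a v)) * nr (avg b v).
  by rewrite -{1}(avg_idem b5) -(avg_ri b5); exact: ri_CS.
have := nr_ge0 (avg b (avg a v)); have := nr_ge0 (avg b v); have := nr_ge0 (avg a v).
move: h; set x := nr _; set y := nr _; set z := nr (avg b v) => h y0 z0 x0.
have xy : x <= 9%:R / 20%:R * y.
  rewrite -(ler_pXn2r (n := 2)) ?nnegrE ?mulr_ge0 // h exprMn.
  by have := sqr_ge0 y; lra.
have := sqr_ge0 (y - z); have := ler_wpM2r z0 xy; nra.
Qed.

(* On the vectors without [c]-fixed part the fixed spaces of [a] and [b] have cosine
   [1/sqrt 5 < 9/20]; on the [c]-fixed part the two projections commute. *)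
Lemma coavg_angle v :
  - (9%:R / 20%:R) * (nr (coavg a v) ^+ 2 + nr (coavg b v) ^+ 2) <= 2 * ri (coavg a v) (coavg b v).
Proof.
have cac := commute_sym ca; have cbc := commute_sym cb.
pose v0 := avg c v; pose v1 := coavg c v.
have ev : v = v0 + v1 by rewrite /v1 /coavg addrC subrK.
(* The projections of elements commuting with [c] respect the splitting of [v] into its [c]-fixed
   part [v0] and the rest [v1], so the form splits without mixed terms. *)
have Q0 g : commute g c -> coavg g v0 = avg c (coavg g v).
  move=> gc; rewrite /coavg /v0 (linB (@avgL c)) avg_avg //; exact: commute_sym.
have QD g : coavg g v = coavg g v0 + coavg g v1.
  by rewrite {1}ev (linD (@coavg_lin g)).
have Q1 g : commute g c -> avg c (coavg g v1) = 0.
  move=> gc; have := congr1 (avg c) (QD g).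
  rewrite (linD (@avgL c) (coavg g v0) (coavg g v1)) (Q0 g gc) (avg_idem c5).
  by move=> /eqP; rewrite -subr_eq0 opprD addrA subrr sub0r oppr_eq0 => /eqP.
have orth g h : commute g c -> commute h c -> ri (coavg g v0) (coavg h v1) = 0.
  by move=> gc hc; rewrite Q0 // avg_ri // Q1 // /ri inner0r.
have D g h : commute g c -> commute h c ->
    ri (coavg g v) (coavg h v) = ri (coavg g v0) (coavg h v0) + ri (coavg g v1) (coavg h v1).
  move=> gc hc; rewrite (QD g) (QD h) riD 2!riDr (orth g h) // [ri (coavg g v1) _]riC (orth h g) //.
  by rewrite addr0 add0r.
rewrite -!ri_self !D //.
have pos : 0 <= ri (coavg a v0) (coavg b v0).
  have Uc0 k : U (c ^+ k)%g v0 = v0 by rewrite ur_pow // ur_avg.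
  have Pab := heis_avg Uc0.
  have -> : ri (coavg a v0) (coavg b v0) = nr (coavg b (coavg a v0)) ^+ 2.
    rewrite -{1}(coavg_idem v0 a5) coavg_ri // -ri_self [RHS]coavg_ri // coavg_idem //.
    suff -> : coavg a (coavg b v0) = coavg b (coavg a v0) by [].
    rewrite (coavgE a (coavg b v0)) (coavgE b (coavg a v0)) !(coavgE _ v0).
    by rewrite (linB (@avgL a)) (linB (@avgL b)) Pab; lmod C H.
  exact: sqr_ge0.
have av1 : avg c v1 = 0 by rewrite /v1 /coavg (linB (@avgL c)) avg_idem // subrr.
have ang := avg_angle av1; clearbody v1.
rewrite !ri_self !(coavg_sq v1) //.
have := sqr_ge0 (nr (coavg a v0)); have := sqr_ge0 (nr (coavg b v0)).
suff : - (9%:R / 20%:R) * (2 * nr v1 ^+ 2 - nr (avg a v1) ^+ 2 - nr (avg b v1) ^+ 2) <=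
  2 * ri (coavg a v1) (coavg b v1) by lra.
have -> : ri (coavg a v1) (coavg b v1) =
    nr v1 ^+ 2 - nr (avg a v1) ^+ 2 - nr (avg b v1) ^+ 2 + ri (avg a v1) (avg b v1).
  rewrite /coavg; move: (avg_sq a5 v1) (avg_sq b5 v1); move: (avg a v1) (avg b v1) => w w' hw hw'.
  by rewrite !riE [ri v1 w']riC hw hw' !ri_self; ring.
(* The inner product of [avg a v1 + avg b v1] with [v1] is the sum of the two squared norms, so this
   is Cauchy-Schwarz. *)
have cs : (nr (avg a v1) ^+ 2 + nr (avg b v1) ^+ 2) ^+ 2 <=
    nr v1 ^+ 2 * (nr (avg a v1) ^+ 2 + nr (avg b v1) ^+ 2 + 2 * ri (avg a v1) (avg b v1)).
  have -> : nr (avg a v1) ^+ 2 + nr (avg b v1) ^+ 2 + 2 * ri (avg a v1) (avg b v1) =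
      nr (avg a v1 + avg b v1) ^+ 2.
    by move: (avg a v1) (avg b v1) => w w'; rewrite -!ri_self !riE [ri w' w]riC; ring.
  have := ri_CS (avg a v1 + avg b v1) v1; rewrite riD !avg_sq // -exprMn.
  set s := _ + _; set t := nr _ * nr _ => st.
  have s0 : 0 <= s by rewrite addr_ge0 ?sqr_ge0.
  rewrite [nr v1 * _]mulrC ler_pXn2r ?nnegrE ?mulr_ge0 ?nr_ge0 //.
  exact: le_trans (ler_norm _) st.
move: cs ang; have := sqr_ge0 (nr v1); have := sqr_ge0 (nr (avg a v1)); have := sqr_ge0 (nr (avg b v1)).
set V := nr v1 ^+ 2; set x := nr _ ^+ 2; set y := nr _ ^+ 2; set r := ri _ _.
move=> x0 y0 V0 cs; rewrite ler_norml => /andP[r1 r2].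
have [s0|sn] := eqVneq (x + y) 0.
  have -> : r = 0 by move: r1 r2; rewrite s0 mulr0 oppr0 => *; lra.
  lra.
have s0 : 0 < x + y by rewrite lt_neqAle eq_sym sn addr_ge0.
have [s es] : exists s, s = x + y by exists (x + y).
rewrite -es in cs r1 r2 s0.
have pr : 0 < s + 2 * r by lra.
rewrite -subr_ge0 -(pmulr_lge0 _ pr).
(* By [cs], after multiplication by [s + 2 r] the claim reduces to [(s - 2 r) (9/20 s - 2 r) >= 0],
   which the bounds on [r] give. *)
have : 0 <= (s - 2 * r) * (9%:R / 20%:R * s - 2 * r) by rewrite mulr_ge0 //; lra.
have -> : y = s - x by rewrite es addrAC subrr add0r.
move: cs; nra.
Qed.
End Heisenberg.
End Projections.

Definition kazhdan_linear (R : realType) (T : groupType) (F : seq T) (c : R) :=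
  forall (H : hilbertType R) (U : T -> H -> H), unirep U -> forall (xi : H) (e : R), 0 <= e ->
    (forall t, t \in F -> nr (U t xi - xi) <= e) ->
    exists eta, nr (xi - eta) <= c * e /\ forall t, U t eta = eta.

(** * Three generators in Heisenberg pairs: spectral gap and iteration *)

Section Heisenberg3.
Variables (R : realType) (T : groupType) (x y z p q r : T).
Hypotheses (x5 : (x ^+ 5)%g = 1%g) (y5 : (y ^+ 5)%g = 1%g) (z5 : (z ^+ 5)%g = 1%g).
Hypotheses (p5 : (p ^+ 5)%g = 1%g) (q5 : (q ^+ 5)%g = 1%g) (r5 : (r ^+ 5)%g = 1%g).
Hypotheses (px : commute p x) (py : commute p y) (xy : (x * y = y * x * p)%g).
Hypotheses (qy : commute q y) (qz : commute q z) (yz : (y * z = z * y * q)%g).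
Hypotheses (rx : commute r x) (rz : commute r z) (xz : (x * z = z * x * r)%g).
Hypothesis gen : generates [:: x; y; z].
Local Notation C := R[i].

Section Iteration.
Variables (H : hilbertType R) (U : T -> H -> H).
Hypothesis ur : unirep U.
Local Notation Q := (coavg U).
Let lap v := Q x v + Q y v + Q z v.
Let f v := nr (Q x v) ^+ 2 + nr (Q y v) ^+ 2 + nr (Q z v) ^+ 2.
Lemma lap_lin (a : C) v w : lap (a *: v + w) = a *: lap v + lap w.
Proof. by rewrite /lap !(coavg_lin ur); lmod C H. Qed.
Lemma lap_f v : ri (lap v) v = f v.
Proof.
have h g : (g ^+ 5)%g = 1%g -> ri (Q g v) v = nr (Q g v) ^+ 2.
  by move=> g5; rewrite -(coavg_idem ur v g5) (coavg_ri ur) // ri_self (coavg_idem ur).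
by rewrite /lap 2!riD !h.
Qed.
Lemma nr_lap v : nr (lap v) ^+ 2 <= 3 * f v.
Proof.
rewrite /lap /f; move: (Q x v) (Q y v) (Q z v) => a b c.
have := nrD (a + b) c; have := nrD a b; have := nr_ge0 a; have := nr_ge0 b; have := nr_ge0 c.
have := nr_ge0 (a + b + c).
have := sqr_ge0 (nr a - nr b); have := sqr_ge0 (nr a - nr c); have := sqr_ge0 (nr b - nr c).
nra.
Qed.
(* Each projection occurs in two of the three pairs: [1/10 = 1 - 2 * 9/20]. *)
Lemma lap_gap v : 10%:R^-1 * f v <= nr (lap v) ^+ 2.
Proof.
have := coavg_angle ur x5 y5 p5 px py xy v; have := coavg_angle ur y5 z5 q5 qy qz yz v.
have := coavg_angle ur x5 z5 r5 rx rz xz v.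
rewrite /lap /f; move: (Q x v) (Q y v) (Q z v) => a b c.
have -> : nr (a + b + c) ^+ 2 = nr a ^+ 2 + nr b ^+ 2 + nr c ^+ 2 + 2 * ri a b + 2 * ri a c + 2 * ri b c.
  by rewrite -!ri_self !riE [ri b a]riC [ri c a]riC [ri c b]riC; ring.
lra.
Qed.
Let step v := v - (3^-1 : R)%:C *: lap v.
Lemma f_le v : f v <= 3 * nr v ^+ 2.
Proof. by rewrite /f !(coavg_sq ur) //; have := sqr_ge0 (nr (avg U x v)); have := sqr_ge0 (nr (avg U y v)); have := sqr_ge0 (nr (avg U z v)); lra. Qed.
Lemma lap_sym v w : ri (lap v) w = ri v (lap w).
Proof. by rewrite /lap 2!riD 2!riDr !(coavg_ri ur). Qed.
(** With [D = lap], the left side is [f v - 2/3 |D v|^2 + 1/9 f (D v)]. As [f (D v) <= 3 |D v|^2],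
    it is at most [f v - 1/3 |D v|^2], and the gap 1/10 turns this into the factor 29/30. *)
Lemma step_f v : f (step v) <= 29%:R / 30%:R * f v.
Proof.
have -> : f (step v) = f v - 2 / 3 * nr (lap v) ^+ 2 + 9%:R^-1 * f (lap v).
  rewrite -!lap_f /step (linB lap_lin) (linZ lap_lin) -(ri_self (lap v)).
  have := lap_sym (lap v) v; move: (lap (lap v)) (lap v) => w2 w.
  by rewrite !riE => ->; field.
have := lap_gap v; have := f_le (lap v); lra.
Qed.
Lemma f_ge0 v : 0 <= f v.
Proof. by rewrite !addr_ge0 // sqr_ge0. Qed.
Let u v n := iter n step v.
(* [rho = 59/60] satisfies [29/30 <= rho^2]. *)
Lemma lap_converges (v : H) (D : R) : 0 <= D -> f v <= D ^+ 2 ->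
  exists l, nr (v - l) <= 60%:R * D /\ forall t, U t l = l.
Proof.
move=> D0 fD; pose rho : R := 59%:R / 60%:R.
have rho0 : 0 <= rho by rewrite /rho; lra.
have fu n : f (u v n) <= (rho ^+ n * D) ^+ 2.
  elim: n => [|n IH]; first by rewrite mul1r.
  apply: le_trans (step_f _) _; rewrite [rho ^+ n.+1]exprS -[rho * _ * D]mulrA exprMn.
  apply: ler_pM => //; [exact: f_ge0|rewrite /rho; lra].
have small g n : f (u v n) <= (rho ^+ n * D) ^+ 2 -> g \in [:: x; y; z] -> nr (Q g (u v n)) <= rho ^+ n * D.
  move=> h gF; rewrite -(ler_pXn2r (n := 2)) ?nnegrE ?nr_ge0 ?mulr_ge0 ?exprn_ge0 //.
  apply: le_trans h; rewrite /f.
  have := sqr_ge0 (nr (Q x (u v n))); have := sqr_ge0 (nr (Q y (u v n))).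
  have := sqr_ge0 (nr (Q z (u v n))).
  by move: gF; rewrite !inE => /or3P[] /eqP ->; lra.
(* Partial sums of the geometric series with ratio [rho] and first term [D]; 60 is
   [1 / (1 - rho)]. *)
pose qs n : R := 60%:R * D * (1 - rho ^+ n).
have dq n : qs n.+1 - qs n = rho ^+ n * D by rewrite /qs exprS /rho; field.
have hq n : qs n <= 60%:R * D.
  by rewrite /qs -[leRHS]mulr1 ler_wpM2l ?mulr_ge0 // lerBlDr lerDl exprn_ge0.
have du n : nr (u v n.+1 - u v n) <= qs n.+1 - qs n.
  rewrite dq /u iterS -/(u v n) /step addrAC subrr add0r nrN nrZ ca_real.
  rewrite -(ler_pXn2r (n := 2)) ?nnegrE ?mulr_ge0 ?nr_ge0 ?exprn_ge0 // exprMn.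
  apply: le_trans (fu n); rewrite ger0_norm ?invr_ge0 //.
  have -> : (3^-1 : R) ^+ 2 = 9%:R^-1 by field.
  by have := nr_lap (u v n); have := f_ge0 (u v n); lra.
have [l [L [ul LM lu Ln]]] := dominated_cvg du hq.
exists l; split.
  rewrite nr_subC; have := lu 0%N; rewrite /u /= /qs expr0 subrr mulr0 subr0.
  by move=> h; exact: le_trans h LM.
have Ql g : g \in [:: x; y; z] -> (g ^+ 5)%g = 1%g -> Q g l = 0.
  move=> gF g5; apply: nr_le_eq0 => e e0.
  have e2 : 0 < e / 2 by rewrite divr_gt0.
  have [N hN] := Ln _ e2; have := small g N (fu N) gF; rewrite -dq => h1.
  have h2 := hN N (leqnn N); have h3 := lu N; have h4 : qs N.+1 <= L.
    by have := lu N.+1; have := nr_ge0 (l - u v N.+1); lra.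
  have Qc w : nr (Q g w) <= nr w.
    rewrite -(ler_pXn2r (n := 2)) ?nnegrE ?nr_ge0 // (coavg_sq ur) //.
    by have := sqr_ge0 (nr (avg U g w)); lra.
  have -> : Q g l = Q g (l - u v N) + Q g (u v N) by rewrite -(linD (@coavg_lin _ _ _ _ ur g)) subrK.
  by have := nrD (Q g (l - u v N)) (Q g (u v N)); have := Qc (l - u v N); lra.
have fixl g : g \in [:: x; y; z] -> U g l = l.
  move=> gF; have g5 : (g ^+ 5)%g = 1%g by move: gF; rewrite !inE => /or3P[] /eqP ->.
  have := Ql g gF g5; rewrite /coavg => /eqP; rewrite subr_eq0 => /eqP ->.
  exact: ur_avg.
apply: gen => //; first exact: (ur1 ur).
  by move=> s t hs ht; rewrite (urM ur) ht hs.
by move=> t ht; rewrite -{1}ht -(urM ur) mulVg (ur1 ur).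
Qed.
End Iteration.

Lemma heisenberg3_kazhdan : kazhdan_linear [:: x; y; z] (420%:R : R).
Proof.
move=> H U ur v e e0 he.
(* [f v] has three terms of size at most [(2 e)^2], and [12 <= 7^2]; the constant 420 is
   [60 * 7]. *)
have [||l [vl li]] := @lap_converges H U ur v (7%:R * e).
- by rewrite mulr_ge0.
- have h g : (g ^+ 5)%g = 1%g -> g \in [:: x; y; z] -> nr (coavg U g v) ^+ 2 <= (2 * e) ^+ 2.
    move=> g5 gF; rewrite ler_pXn2r ?nnegrE ?nr_ge0 ?mulr_ge0 // /coavg nr_subC.
    by apply: avg_close => //; exact: he.
  have := h x x5; have := h y y5; have := h z z5; rewrite !inE !eqxx ?orbT => /(_ isT) h1 /(_ isT) h2 /(_ isT) h3.
  by have := sqr_ge0 e; lra.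
by exists l; split => //; apply: le_trans vl _; lra.
Qed.
End Heisenberg3.

(** * Discrete matched pairs *)

Record factorization := Factorization {
  fH : groupType; fT : groupType; fK : finGroupType;
  fi : fT -> fH; fj : fK -> fH; fpk : fH -> fK; fpt : fH -> fT;
  fiM : forall s t, fi (s * t)%g = (fi s * fi t)%g;
  fjM : forall g h, fj (g * h)%g = (fj g * fj h)%g;
  fE : forall x, x = (fj (fpk x) * fi (fpt x))%g;
  fpkE : forall g t, fpk (fj g * fi t)%g = g;
  fptE : forall g t, fpt (fj g * fi t)%g = t;
  fT_enum : exists x : nat -> fT, forall t, exists n, x n = t }.

Section Factorization.
Variable F : factorization.
Local Notation T := (fT F).
Local Notation K := (fK F).
Local Notation i := (@fi F).
Local Notation j := (@fj F).
Implicit Types (s t : T) (g h : K).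

Lemma fi1 : i 1%g = 1%g.
Proof. by apply: (mulgI (i 1%g)); rewrite -fiM !mulg1. Qed.
Lemma fj1 : j 1%g = 1%g.
Proof. by apply: (mulgI (j 1%g)); rewrite -fjM !mulg1. Qed.
Lemma fiV t : i t^-1%g = (i t)^-1%g.
Proof. by apply: (mulgI (i t)); rewrite -fiM !mulgV fi1. Qed.
Lemma fjV g : j g^-1%g = (j g)^-1%g.
Proof. by apply: (mulgI (j g)); rewrite -fjM !mulgV fj1. Qed.
Lemma f_uniq g h s t : (j g * i s)%g = (j h * i t)%g -> g = h /\ s = t.
Proof. by move=> e; rewrite -(fpkE g s) -{2}(fptE g s) e fpkE fptE. Qed.
Lemma fi_inj : injective i.
Proof. by move=> s t e; have [] := @f_uniq 1%g 1%g s t; rewrite // e. Qed.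
Lemma fj_inj : injective j.
Proof. by move=> g h e; have [] := @f_uniq g h 1%g 1%g; rewrite // e. Qed.

Definition fal t g : K := fpk (i t * j g)%g.
Definition fbe g t : T := fpt (i t * j g)%g.
Lemma f_swap t g : (i t * j g)%g = (j (fal t g) * i (fbe g t))%g.
Proof. exact: fE. Qed.
(** Both actions are determined by the uniqueness of the factorization, so each axiom of a matched
    pair is obtained by factoring one product in two ways. *)
Lemma f_swapP t g g' t' : (i t * j g)%g = (j g' * i t')%g -> fal t g = g' /\ fbe g t = t'.
Proof. by rewrite f_swap => /f_uniq. Qed.

Lemma fal_1 g : fal 1%g g = g /\ fbe g 1%g = 1%g.
Proof. by apply: f_swapP; rewrite fi1 mulg1 mul1g. Qed.
Lemma fbe_1 t : fal t 1%g = 1%g /\ fbe 1%g t = t.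
Proof. by apply: f_swapP; rewrite fj1 mulg1 mul1g. Qed.
Lemma fal_M s t g : fal (s * t)%g g = fal s (fal t g) /\ fbe g (s * t)%g = (fbe (fal t g) s * fbe g t)%g.
Proof. by apply: f_swapP; rewrite !fiM -mulgA f_swap mulgA f_swap mulgA. Qed.
Lemma fbe_M t g h : fal t (g * h)%g = (fal t g * fal (fbe g t) h)%g /\ fbe (g * h)%g t = fbe h (fbe g t).
Proof. by apply: f_swapP; rewrite !fjM mulgA f_swap -mulgA f_swap mulgA. Qed.

Definition mpair_of : mpair.
refine (@MPair T K fal fbe _ _ _ _ _ _ _ _ (@fT_enum F)).
- by move=> g; case: (fal_1 g).
- by move=> s t g; case: (fal_M s t g).
- by move=> s; case: (fbe_1 s).
- by move=> s; case: (fbe_1 s).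
- by move=> g h s; case: (fbe_M s g h).
- by move=> g; case: (fal_1 g).
- by move=> s g h; case: (fbe_M s g h).
- by move=> g s t; case: (fal_M s t g).
Defined.
End Factorization.

(** * Discrete groups and their counting measure *)

Definition discrete_group (G : groupType) : Type := G.
Section DiscreteGroup.
Variable G : groupType.
Local Notation D := (discrete_group G).
HB.instance Definition _ := Group.on D.
HB.instance Definition _ := isPointed.Build D (1%g : G).
HB.instance Definition _ := hasNbhs.Build D principal_filter.
HB.instance Definition _ := Discrete_ofNbhs.Build D erefl.
Lemma discrete_nbhs (x : D) (A : set D) : nbhs x A <-> A x.
Proof. by rewrite nbhs_principalE; split => [/principal_filterP|/principal_filterP]. Qed.
Lemma discrete_mulg_continuous : continuous (fun p : D * D => (p.1 * p.2)%g : D).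
Proof.
move=> [x y] A /discrete_nbhs Axy; exists ([set x], [set y]); first by split; exact/discrete_nbhs.
by move=> [a b] [/= -> ->].
Qed.
Lemma discrete_invg_continuous : continuous (fun x : D => (x^-1)%g : D).
Proof. by move=> x A /discrete_nbhs Ax; apply/discrete_nbhs. Qed.
HB.instance Definition _ := isTopologicalGroup.Build D discrete_mulg_continuous discrete_invg_continuous.
Lemma discrete_openE (A : set D) : open A.
Proof. by rewrite openE => x Ax; exact/discrete_nbhs. Qed.
Lemma discrete_closedE (A : set D) : closed A.
Proof. by rewrite -openC; exact: discrete_openE. Qed.
Lemma discrete_compactE (A : set D) : compact A <-> finite_set A.
Proof.
split; last exact: finite_compact.
rewrite compact_cover => /(_ D A (fun x => [set x])) [].
- by move=> x _; exact: discrete_openE.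
- by move=> x Ax; exists x.
move=> B _ AB; apply: (sub_finite_set AB); apply: bigcup_finite; first exact: finite_fset.
by move=> x _; exact: finite_set1.
Qed.
End DiscreteGroup.

Section CountingHaar.
Variables (R : realType) (G : groupType).
Local Notation D := (discrete_group G).
Local Notation B := (borel (discrete_group G)).
Lemma borel_measurable (A : set B) : measurable A.
Proof. by apply: sub_gen_smallest; exact: discrete_openE. Qed.
Definition counting_borel : {measure set B -> \bar R} := [the measure _ _ of counting].
Lemma counting_card (A A' : set B) : (A #= A')%card -> counting_borel A = counting_borel A'.
Proof.
move=> AA; rewrite /= /counting; have [fA|fA] := pselect (finite_set A); last first.
  by rewrite !asboolF // => fA'; apply: fA; rewrite (eq_finite_set AA).
have /finite_setP[n An] := fA; have A'n := card_eq_trans (card_esym AA) An.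
rewrite !asboolT //; last by rewrite -(eq_finite_set AA).
by rewrite (card_fset_set An) (card_fset_set A'n).
Qed.
Lemma counting_fset (E : {fset B}) : counting_borel [set` E] = (#|` E|%:R)%:E.
Proof. by rewrite /= /counting asboolT ?set_fsetK //; exact: finite_fset. Qed.
Lemma counting_mono (A A' : set B) : A `<=` A' -> (counting_borel A <= counting_borel A')%E.
Proof. by move=> AA; exact: (le_measure counting_borel (mem_set (borel_measurable A)) (mem_set (borel_measurable A')) AA). Qed.
(** Every set is open and Borel, which gives outer regularity. The compact sets are the finite ones,
    and an infinite set contains finite sets of every size, which gives inner regularity. *)
Lemma counting_haar : haar_measure counting_borel.
Proof.
split.
  move=> h; have := counting_mono (@subsetT _ [set` ([fset (1%g : B)])%fset]).
  by rewrite h counting_fset cardfs1 lee_fin ler10.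
split.
- move=> x A _; apply: counting_card; apply: inj_card_eq => y z _ _; exact: mulgI.
- by move=> K /discrete_compactE fK; rewrite /= /counting asboolT // ltry.
- move=> A _; apply/eqP; rewrite eq_le; apply/andP; split.
    by apply: le_ereal_inf_tmp => _ [U [_ AU] <-]; exact: counting_mono.
  by apply: ereal_inf_lbound; exists A => //; split => //; exact: discrete_openE.
- move=> U _; apply/eqP; rewrite eq_le; apply/andP; split; last first.
    by apply: ge_ereal_sup => _ [K [_ KU] <-]; exact: counting_mono.
  have [fU|iU] := pselect (finite_set U).
    by apply: ereal_sup_ubound; exists U => //; split => //; exact/discrete_compactE.
  have -> : counting_borel U = +oo%E by rewrite /= /counting asboolF.
  suff -> : ereal_sup [set counting_borel K | K in [set K | compact (K : set D) /\ K `<=` U]] = +oo%E by [].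
  apply/eqyP => r r0; have [E EU nE] := infinite_set_fset (Num.truncn r).+1 iU.
  apply: le_trans (_ : (#|` E|%:R)%:E <= _)%E; last first.
    apply: ereal_sup_ubound; exists [set` E]; last exact: counting_fset.
    by split => //; apply/discrete_compactE; exact: finite_fset.
  rewrite lee_fin; apply: le_trans (ltW (truncnS_gt r)) _.
  by rewrite ler_nat.
Qed.
End CountingHaar.

Section MatchedPair.
Variables (R : realType) (F : factorization).
Local Notation T := (fT F).
Local Notation K := (fK F).
Local Notation i := (@fi F).
Local Notation j := (@fj F).
Local Notation D := (discrete_group (fH F)).
Implicit Types (s t : T) (g h : K).
Local Notation C := R[i].

Lemma range_subgroup (L : groupType) (f : L -> D) :
  (forall x y, f (x * y)%g = (f x * f y)%g) -> subgroup (range f).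
Proof.
move=> fM; have f1 : f 1%g = 1%g by apply: (mulgI (f 1%g)); rewrite -fM !mulg1.
split; first by exists 1%g.
- by move=> _ _ [x _ <-] [y _ <-]; exists (x * y)%g.
- move=> _ [x _ <-]; exists x^-1%g => //.
  by apply: (mulgI (f x)); rewrite -fM !mulgV.
Qed.

Lemma discrete_locally_compact : locally_compact [set: D].
Proof.
move=> x _; rewrite withinET; exists [set x]; first exact/discrete_nbhs.
by split; [exact/discrete_compactE/finite_set1|exact: discrete_closedE].
Qed.
Lemma range_j_finite : finite_set (range (j : K -> D)).
Proof. by apply: finite_image; exact: finite_finset. Qed.

Definition pair_of : compactMatchedPair R.
refine (@CompactMatchedPair R D discrete_locally_compact discrete_hausdorff
  (range (i : T -> D)) (range_subgroup (@fiM F)) (@discrete_closedE _ _) _ _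
  (range (j : K -> D)) (range_subgroup (@fjM F)) (@discrete_closedE _ _) _ _ _).
- have [x xT] := @fT_enum F.
  have -> : range (i : T -> D) = range (fun n => i (x n) : D).
    apply/seteqP; split => _ [t _ <-]; last by exists (x t).
    by have [n <-] := xT t; exists n.
  exact: card_image_le.
- move=> x ix; exists [set x]; first exact/discrete_nbhs.
  by apply/seteqP; split => [y [] //|_ ->].
- exact/discrete_compactE/range_j_finite.
- apply/seteqP; split => [x [[t _ ti] [g _ gj]]|_ ->].
    have [] := @f_uniq F 1%g g t 1%g; first by rewrite fj1 fi1 mul1g mulg1 ti gj.
    by move=> g1 _; rewrite /= -gj -g1 fj1.
  by split; exists 1%g; rewrite ?fi1 ?fj1.
- exists (counting_borel R (fH F)); first exact: counting_haar.
  rewrite [X in _.-negligible (~` X)](_ : _ = setT); first by rewrite setCT; exact: negligible_set0.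
  (* [fE] puts the finite group on the left; factoring [x^-1] and inverting gives the opposite
     order. *)
  apply/seteqP; split => // x _; exists (i (fpt x^-1%g)^-1%g); first by exists (fpt x^-1%g)^-1%g.
  exists (j (fpk x^-1%g)^-1%g); first by exists (fpk x^-1%g)^-1%g.
  by rewrite fiV fjV -invMg -fE invgK.
Defined.

Lemma alphaE t g : alpha (P := pair_of) (i t) (j g) = j (fal t g).
Proof.
rewrite /alpha; apply: xget_unique => /=.
  by split; [exists (fal t g)|exists (fbe g t) => //; rewrite f_swap mulKg].
move=> _ [[g' _ <-] [t' _ e]]; congr j.
have e' : (i t * j g)%g = (j g' * i t')%g by rewrite e mulKVg.
by have [-> _] := f_swapP e'.
Qed.
Lemma betaE t g : beta (P := pair_of) (j g) (i t) = i (fbe g t).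
Proof. by rewrite /beta alphaE f_swap mulKg. Qed.

Lemma pair_of_nontrivial : (exists t g, fal t g <> g) -> (exists t g, fbe g t <> t) ->
  nontrivial_pair pair_of.
Proof.
move=> [t [g h]] [t' [g' h']]; split.
  exists (i t), (j g); split; [by exists t|by exists g|].
  by rewrite alphaE => /fj_inj.
exists (i t'), (j g'); split; [by exists t'|by exists g'|].
by rewrite betaE => /fi_inj.
Qed.
End MatchedPair.

(** * Bicrossed products of discrete matched pairs *)

Section Link.
Variables (R : realType) (F : factorization).
Local Notation m := (mpair_of F).
Local Notation T := (mT m).
Local Notation K := (mK m).
Local Notation i := (@fi F).
Local Notation j := (@fj F).
Local Notation D := (discrete_group (fH F)).
Local Notation P := (pair_of R F).
Local Notation A := (fam (D1 R m)).
Local Notation W := (@W R m).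
Local Notation Um := (@Ug R m).
Local Notation Eg := (@Eg R m).
Local Notation C := R[i].
Local Notation tens2 := (@tn R nat nat (nat * nat)%type (rep R m) (rep R m) (rep R m * rep R m)%type
  (prod_pairing nat nat) (prod_pairing (rep R m) (rep R m)) (D1 R m) (D1 R m)).
Local Notation A2 := (fam (tsub (prod_pairing nat nat) (prod_pairing (rep R m) (rep R m)) (D1 R m) (D1 R m))).
Local Notation fn := (D -> Cplx R).

Lemma discrete_continuous (X : topologicalType) (S : set D) (f : D -> X) : {within S, continuous f}.
Proof.
apply: continuous_subspaceT => x B Bx; apply/discrete_nbhs; exact: (nbhs_singleton Bx).
Qed.
Lemma fpt_i t : fpt (i t) = t.
Proof. by have := fptE (1%g : K) t; rewrite fj1 mul1g. Qed.

(* Orthogonal idempotents turn a function on a finite set into an element of a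
   C*-algebra. *)
Section Diagonal.
Variables (B : cstarAlgType R) (I : finType) (e : I -> B).
Hypotheses (eM : forall x y, e x ** e y = if x == y then e y else 0)
  (eS : forall x, star (e x) = e x) (e1 : \sum_x e x = cone).
Definition diag (f : I -> C) : B := \sum_x f x *: e x.
Lemma diag_lin (a : C) f g : diag (fun x => a * f x + g x) = a *: diag f + diag g.
Proof.
by rewrite /diag scaler_sumr -big_split; apply: eq_bigr => x _; rewrite scalerDl scalerA.
Qed.
Lemma diagM f g : diag (fun x => f x * g x) = diag f ** diag g.
Proof.
rewrite /diag cmul_suml; apply: eq_bigr => x _.
rewrite cmul_sumr (bigD1 x) //= cmulZl cmulZr eM eqxx scalerA big1 ?addr0 // => y yx.
by rewrite cmulZl cmulZr eM eq_sym (negbTE yx) !scaler0.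
Qed.
Lemma diag1 : diag (fun=> 1) = cone.
Proof. by rewrite -e1; apply: eq_bigr => x _; rewrite scale1r. Qed.
Lemma diag_star f : diag (fun x => (f x)^*) = star (diag f).
Proof. by rewrite star_sum; apply: eq_bigr => x _; rewrite starZ eS. Qed.
Lemma diag_hom (X : topologicalType) (S : set X) (k : I -> X) : (forall x, S (k x)) ->
  star_hom_on S (fun f : X -> Cplx R => diag (fun x => f (k x))).
Proof.
move=> Sk; split.
  by move=> f g _ _ fg; apply: eq_bigr => x _; rewrite fg //; exact/mem_set.
split => [a f g _ _|f g _ _||f _].
- exact: diag_lin.
- exact: diagM.
- exact: diag1.
- exact: diag_star.
Qed.
End Diagonal.

Lemma Eg_mul g h : Eg g ** Eg h = if g == h then Eg h else 0.
Proof. exact: (bEM (A_brep R m)). Qed.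
Definition al (f : fn) : A := diag Eg (fun g => f (j g)).
Definition u (x : D) : A := Um (fpt x).
Lemma u_i t : u (i t) = Um t. Proof. by rewrite /u fpt_i. Qed.
Lemma UgV t : Um t ** Um t^-1%g = cone.
Proof. by rewrite -(bUM (A_brep R m)) mulgV (bU1 (A_brep R m)). Qed.
Lemma UgK t : Um t^-1%g ** Um t = cone.
Proof. by rewrite -(bUM (A_brep R m)) mulVg (bU1 (A_brep R m)). Qed.

Lemma al_hom : star_hom_on (Gc P) al.
Proof.
apply: (diag_hom Eg_mul (bE_star (A_brep R m)) (bE1 (A_brep R m))) => g.
by exists g.
Qed.
Lemma al_covariant : covariant_pair (P := P) al u.
Proof.
have Ab := A_brep R m; split.
- exact: al_hom.
- by move=> _ [t _ <-]; rewrite u_i /unitary (bU_star Ab) UgV UgK.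
- by move=> _ _ [s _ <-] [t _ <-]; rewrite -fiM !u_i (bUM Ab).
- move=> _ f [t _ <-] _; rewrite u_i (bU_star Ab) /al /diag [X in X ** _]cmul_sumr [LHS]cmul_suml.
  rewrite [RHS](reindex_inj (@mal_inj m t)) /=; apply: eq_bigr => g _.
  rewrite -fiV alphaE -[fal t^-1%g _]/(@mal m t^-1%g (@mal m t g)) malK.
  by rewrite cmulZr (bUE Ab) cmulZl -cmulA UgV cmul1r.
Qed.

Definition point (g : K) : fn := fun x => (x == j g)%:R.
Lemma al_point g : al (point g) = Eg g.
Proof.
rewrite /al /diag (bigD1 g) //= /point eqxx scale1r big1 ?addr0 // => h hg.
by rewrite (inj_eq (@fj_inj F)) (negbTE hg) scale0r.
Qed.

Lemma al_generated : cstar_generated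
  ([set al f | f in [set f : fn | {within (Gc P), continuous f}]] `|` [set u x | x in Gam P]).
Proof.
move=> E cE SE E1 EL EM ES; apply/seteqP; split => // a _.
have E0 : E 0 by rewrite -[0](addNr (cone : A)) -scaleN1r; exact: EL.
have cl : closed_subspace E.
  split => // x hx; apply: cE; exact/closure_nr.
apply: (total_W cl) => _ [[t g] _ <-] /=; rewrite -WE; apply: EM; apply: SE.
  by right; exists (i t); [exists t|rewrite u_i].
left; exists (point g); last exact: al_point.
exact: discrete_continuous.
Qed.

Section Universal.
Variables (B : cstarAlgType R) (al' : fn -> B) (u' : D -> B).
Hypothesis cov : covariant_pair (P := P) al' u'.
Local Notation cont f := (@discrete_continuous _ (Gc P) f).

(** On the finite group every function agrees with a combination of indicators of points, and [al']
    sees only the values there. *)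
Lemma al'_diag (f : fn) : al' f = \sum_g f (j g) *: al' (point g).
Proof.
have [[hext [hL hM h1 hS]] _ _ _] := cov.
have h0 : al' (fun=> 0) = 0.
  have := hL (-1) (fun=> 1) (fun=> 1) (cont _) (cont _).
  rewrite scaleN1r addNr => <-; congr al'; apply/funext => x.
  by rewrite mulN1r addNr.
have hs (r : seq K) : al' (fun x => \sum_(g <- r) f (j g) * point g x) = \sum_(g <- r) f (j g) *: al' (point g).
  elim: r => [|g r IH].
    by rewrite big_nil -h0; congr al'; apply/funext => x; rewrite big_nil.
  rewrite big_cons -IH -hL; try exact: discrete_continuous.
  by congr al'; apply/funext => x; rewrite big_cons.
rewrite -hs; apply: hext; try exact: discrete_continuous.
move=> x /set_mem [g _ <-]; rewrite (bigD1 g) //= /point eqxx mulr1 big1 ?addr0 // => h hg.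
by rewrite (inj_eq (@fj_inj F)) eq_sym (negbTE hg) mulr0.
Qed.

Lemma cov_brep : brep (fun t : T => u' (i t)) (fun g : K => al' (point g)).
Proof.
have [[hext [hL hM h1 hS]] uU uM ual] := cov.
have iG t : Gam P (i t) by exists t.
have u1 : u' 1%g = cone.
  have [U1 U2] := uU _ (iG 1%g); rewrite fi1 in U1 U2.
  have := uM _ _ (iG 1%g) (iG 1%g); rewrite fi1 mulg1 => e.
  by rewrite -[LHS]cmul1l -U1 -cmulA -e.
have uV t : star (u' (i t)) = u' (i t^-1%g).
  have [U1 U2] := uU _ (iG t); rewrite -[LHS]cmul1r -u1 -(fi1 F) -(mulgV t) fiM uM //.
  by rewrite cmulA U1 cmul1l.
split.
- exact: uV.
- by rewrite fi1.
- by move=> s t; rewrite fiM uM.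
- move=> g; rewrite -hS; last exact: discrete_continuous.
  by congr al'; apply/funext => x; rewrite /point rmorph_nat.
- move=> g h; rewrite -hM; try exact: discrete_continuous.
  have [->|gh] := eqVneq g h.
    by congr al'; apply/funext => x; rewrite /point -natrM mulnb andbb.
  rewrite al'_diag big1 // => k _; rewrite /point !(inj_eq (@fj_inj F)).
  by have [->|] := eqVneq k g; rewrite ?(negbTE gh) ?mulr0 ?mul0r scale0r.
- rewrite -h1 al'_diag; apply: eq_bigr => g _; by rewrite scale1r.
- move=> t g; have [U1 U2] := uU _ (iG t).
  have := ual (i t) (point g) (iG t) (cont _) => e.
  rewrite -[LHS]cmul1r -U1 cmulA e; congr (_ ** _).
  rewrite al'_diag (bigD1 (fal t g)) //= -fiV alphaE /point.
  rewrite -[fal t^-1%g _]/(@mal m t^-1%g (@mal m t g)) malK eqxx scale1r big1 ?addr0 // => h hg.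
  rewrite alphaE (inj_eq (@fj_inj F)) -(inj_eq (@mal_inj m t)) malVK.
  by rewrite (negbTE hg) scale0r.
Qed.

Lemma cov_univ : exists f : A -> B, [/\ star_hom f,
  forall f' : fn, {within (Gc P), continuous f'} -> f (al f') = al' f' &
  forall x, Gam P x -> f (u x) = u' x].
Proof.
have cb := cov_brep; have [f [hf fW]] := A_univ cb; have [fl _ _ _] := hf.
exists f; split => //.
  move=> f' _; rewrite al'_diag /al /diag (lin_sum _ _ _ fl); apply: eq_bigr => g _.
  by rewrite (linZ fl) fW (bU1 cb) cmul1l.
move=> _ [t _ <-]; rewrite u_i /Ug (lin_sum _ _ _ fl); under eq_bigr do rewrite fW.
by rewrite -cmul_sumr (bE1 cb) cmul1r.
Qed.
End Universal.

Lemma crossed_product : full_crossed_product (P := P) al u.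
Proof.
split.
- exact: al_covariant.
- move=> f _ f0 x /set_mem[g _ <-]; exact: (Eg_free f0).
- exact: al_generated.
- exact: cov_univ.
Qed.

Definition al2 (f : D * D -> Cplx R) : A2 :=
  diag (fun k : K * K => tens2 (Eg k.1) (Eg k.2)) (fun k => f (j k.1, j k.2)).
Lemma al2_hom : star_hom_on (Gc P `*` Gc P) al2.
Proof.
have Ab := A_brep R m.
apply: (@diag_hom A2 (K * K)%type _ _ _ _ (D * D)%type _ (fun k => (j k.1, j k.2))).
- move=> [g h] [g' h'] /=; rewrite tnM !Eg_mul xpair_eqE.
  case: (g == g') => /=; last by rewrite (lin0 (proj1 (tn_blinl _ _ _ _))).
  by case: (h == h'); rewrite // (lin0 (proj1 (tn_blinr _ _ _ _))).
- by move=> [g h]; rewrite tn_star !(bE_star Ab).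
- rewrite -(pair_bigA _ (fun g h => tens2 (Eg g) (Eg h))) /=.
  under eq_bigr do rewrite -(lin_sum _ _ _ (proj1 (tn_blinr _ _ _ _))) (bE1 Ab).
  by rewrite -(lin_sum (f := fun a => tens2 a cone) _ _ _ (proj1 (tn_blinl _ _ _ _))) (bE1 Ab) tn1.
- by move=> [g h]; split; [exists g|exists h].
Qed.
Lemma al2_tens (f f' : fn) : al2 (fun p => f p.1 * f' p.2) = tens2 (al f) (al f').
Proof.
rewrite /al2 /diag -(pair_bigA _ (fun g h => (f (j g) * f' (j h)) *: tens2 (Eg g) (Eg h))) /=.
rewrite /al /diag (lin_sum (f := fun a => tens2 a _) _ _ _ (proj1 (tn_blinl _ _ _ _))).
apply: eq_bigr => g _; rewrite (linZ (f := fun a => tens2 a _) (proj1 (tn_blinl _ _ _ _))).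
rewrite (lin_sum _ _ _ (proj1 (tn_blinr _ _ _ _))) scaler_sumr; apply: eq_bigr => h _.
by rewrite (linZ (proj1 (tn_blinr _ _ _ _))) scalerA.
Qed.
Lemma deltaZ (c : C) (a : A) : delta (c *: a) = c *: delta a.
Proof. exact: (linZ (proj1 (delta_blin R m))). Qed.
Lemma delta_al (f : fn) : delta (al f) = al2 (fun p => f (p.1 * p.2)%g).
Proof.
rewrite /al2 /diag -(pair_bigA _ (fun g h => f (j g * j h)%g *: tens2 (Eg g) (Eg h))) /=.
rewrite /al /diag (lin_sum _ _ _ (proj1 (delta_blin R m))).
rewrite (eq_bigr (fun g => \sum_h f (j g) *: tens2 (Eg h) (Eg (h^-1 * g)%g))); last first.
  move=> g _; apply: etrans (deltaZ _ _) _; rewrite delta_W scaler_sumr.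
  by apply: eq_bigr => h _; rewrite (mbe_1 h).
rewrite exchange_big; apply: eq_bigr => h _ /=.
rewrite (reindex_inj (mulgI h)); apply: eq_bigr => g _ /=.
by rewrite -fjM mulKg.
Qed.
Lemma delta_u (x : D) : Gam P x -> delta (u x) = \sum_(r \in orbit_beta (P := P) x)
  tens2 (u x ** al (\1_[set g | Gc P g /\ beta (P := P) g x = r])) (u r).
Proof.
move=> [t _ <-]; rewrite u_i.
(* The orbit listed without repetition. Once its sum is exchanged with the sum over [K], only the
   term [r = be h t] survives for each [h]. *)
pose s := undup [seq i (fbe g t) | g <- enum K] : seq D.
have -> : orbit_beta (P := P) (i t) = [set` s].
  apply/seteqP; split => [_ [_ [g _ <-] <-]|r /=].
    by rewrite betaE /= mem_undup; apply/mapP; exists g; rewrite ?mem_enum.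
  rewrite mem_undup => /mapP[g _ ->]; exists (j g); first by exists g.
  exact: betaE.
rewrite -fsbig_seq ?undup_uniq //.
have E r : Um t ** al (\1_[set g | Gc P g /\ beta (P := P) g (i t) = r]) =
    \sum_g (i (fbe g t) == r :> D)%:R *: W t g.
  rewrite /al /diag cmul_sumr; apply: eq_bigr => g _; rewrite cmulZr WE indicE; congr (_ *: _).
  congr (nat_of_bool _)%:R; apply/idP/eqP => [/set_mem[_]|e]; first by rewrite betaE.
  by apply: mem_set; split; [exists g|rewrite betaE].
under eq_bigr => r _ do rewrite E (lin_sum (f := fun a => tens2 a _) _ _ _ (proj1 (tn_blinl _ _ _ _))).
rewrite exchange_big /= {1}/Ug (lin_sum _ _ _ (proj1 (delta_blin R m))).
rewrite (eq_bigr _ (fun g _ => @delta_W R m t g)).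
rewrite exchange_big /=; apply: eq_bigr => h _.
rewrite -(lin_sum _ _ _ (proj1 (tn_blinr _ _ _ _))).
rewrite (bigD1_seq (i (fbe h t))) ?undup_uniq //=; last first.
  by rewrite mem_undup; apply/mapP; exists h; rewrite ?mem_enum.
rewrite eqxx scale1r u_i.
rewrite [X in _ = _ + X]big1 ?addr0; last first.
  move=> r hr; rewrite eq_sym (negbTE hr) scale0r.
  exact: lin0 (proj1 (tn_blinl _ _ _ _)).
congr (tens2 _ _); rewrite /Ug (reindex_inj (mulgI h)); apply: eq_bigr => g _.
by rewrite mulKg.
Qed.
Lemma counit_u (x : D) (f : fn) : Gam P x -> chi (@fix1 m) (u x ** al f) = f 1%g.
Proof.
move=> [t _ <-]; rewrite u_i /al /diag cmul_sumr (lin_sum _ _ _ (proj1 (chi_blin R (@fix1 m)))).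
rewrite (bigD1 (1%g : K)) //= cmulZr WE (linZ (proj1 (chi_blin R (@fix1 m)))) chi_W eqxx.
rewrite big1 ?addr0; last first.
  by move=> g g1; rewrite cmulZr WE (linZ (proj1 (chi_blin R (@fix1 m)))) chi_W (negbTE g1) scaler0.
by rewrite fj1 -[_ *: _]/(_ * _) mulr1.
Qed.

Theorem bicrossed_is_bicrossed : is_bicrossed_product P (bicrossed R m).
Proof.
exists al, u, al2; split.
- exact: crossed_product.
- by split; [exact: al2_hom|move=> f f' _ _; exact: al2_tens].
- by move=> f _; exact: delta_al.
- exact: delta_u.
- by move=> x f Gx _; exact: counit_u.
Qed.
End Link.

(** * A subgroup of SL_3(F_5[X]) *)

Section Elementary.
Variables (R : comNzRingType) (n : nat).
Local Notation D := (delta_mx : 'I_n.+1 -> 'I_n.+1 -> 'M[R]_n.+1).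
Definition elem (i j : 'I_n.+1) (a : R) : 'M[R]_n.+1 := 1 + a *: D i j.
Lemma delta_mul i j k l a b : (a *: D i j) * (b *: D k l) = if j == k then (a * b) *: D i l else 0.
Proof.
rewrite -scalerAl -scalerAr scalerA -[D i j * _]/(D i j *m _) mul_delta_mx_cond.
by case: eqP; rewrite ?mulr1n ?mulr0n ?scaler0.
Qed.
Lemma elemD i j a b : i != j -> elem i j a * elem i j b = elem i j (a + b).
Proof.
move=> ij; rewrite /elem !mulrDl !mulrDr !mul1r !mulr1 delta_mul eq_sym (negbTE ij) addr0.
by rewrite scalerDl -addrA [b *: _ + _]addrC.
Qed.
Lemma elem0 i j : elem i j 0 = 1. Proof. by rewrite /elem scale0r addr0. Qed.
Lemma elem_exp i j a k : i != j -> elem i j a ^+ k = elem i j (a *+ k).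
Proof.
move=> ij; elim: k => [|k IH]; first by rewrite elem0 expr0.
by rewrite exprS IH elemD // mulrS.
Qed.
Lemma elemC i j k l a b : j != k -> l != i -> elem i j a * elem k l b = elem k l b * elem i j a.
Proof.
move=> jk li; rewrite /elem !mulrDl !mulrDr !mul1r !mulr1 !delta_mul (negbTE jk) (negbTE li) !addr0.
by rewrite -!addrA [b *: _ + _]addrC.
Qed.
Lemma elem_comm i j k a b : i != j -> j != k -> k != i ->
  elem i j a * elem j k b = elem j k b * elem i j a * elem i k (a * b).
Proof.
move=> ij jk ki; rewrite /elem !mulrDl !mulrDr !mul1r !mulr1 !delta_mul (negbTE ki) eqxx.
rewrite !mulrDl !delta_mul (negbTE ki) eq_sym (negbTE ij) mul0r !addr0 !addrA.
by rewrite mul1r [1 + b *: _ + a *: _]addrAC [RHS]addrAC.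
Qed.
End Elementary.

Local Notation P5 := {poly 'F_5}.
Local Notation M3 := 'M[{poly 'F_5}]_3.
Local Notation i0 := (ord0 : 'I_3).
Local Notation i1 := (lift ord0 ord0 : 'I_3).
Local Notation i2 := (ord_max : 'I_3).

Definition gmat (k : 'I_3) : M3 :=
  if k == i0 then elem i0 i1 1 else if k == i1 then elem i1 i2 1 else elem i2 i0 'X.
Lemma elem5 (i j : 'I_3) (a : P5) : i != j -> elem i j a ^+ 5 = 1.
Proof.
move=> ij; rewrite elem_exp // -[a]mul1r -mulrnAl (_ : 1 *+ 5 = 0) ?mul0r ?elem0 //.
by rewrite -polyC1 -polyCMn (_ : 1 *+ 5 = 0) //; exact/val_inj.
Qed.
Lemma gmat5 k : gmat k ^+ 5 = 1.
Proof. by rewrite /gmat; case: ifP => _; [|case: ifP => _]; exact: elem5. Qed.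

Definition wprod (w : seq 'I_3) : M3 := \prod_(k <- w) gmat k.
(** The fourth power of a generator is its inverse, so words in the generators alone already form a
    group. *)
Definition winv (w : seq 'I_3) : seq 'I_3 := flatten [seq nseq 4 k | k <- rev w].
Lemma winv_cons k w : winv (k :: w) = winv w ++ nseq 4 k.
Proof. by rewrite /winv rev_cons map_rcons -cats1 flatten_cat. Qed.
Lemma wprod_cat w w' : wprod (w ++ w') = wprod w * wprod w'.
Proof. exact: big_cat. Qed.
Lemma wprod4 k : wprod (nseq 4 k) = gmat k ^+ 4.
Proof. by rewrite /wprod !big_cons big_nil mulr1 !exprS expr0 mulr1. Qed.
Lemma winvP w : wprod (winv w) * wprod w = 1 /\ wprod w * wprod (winv w) = 1.
Proof.
elim: w => [|k w [h1 h2]]; first by rewrite /wprod /winv !big_nil mulr1.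
have e : wprod (k :: w) = gmat k * wprod w by rewrite /wprod big_cons.
rewrite e winv_cons wprod_cat wprod4; split.
  by rewrite mulrA -(mulrA _ _ (gmat k)) -exprSr gmat5 mulr1.
by rewrite mulrA -(mulrA (gmat k)) h2 mulr1 -exprS gmat5.
Qed.

(* The subgroup of SL_3(F_5[X]) generated by the elementary matrices with entry 1
   in positions (1,2) and (2,3) and entry X in position (3,1). *)
Definition in_words (M : M3) : bool := `[< exists w, M = wprod w >].
Lemma in_wordsP w : in_words (wprod w). Proof. by apply/asboolP; exists w. Qed.
Definition wgroup := {M : M3 | in_words M}.
HB.instance Definition _ := SubType.on wgroup.
HB.instance Definition _ := Choice.on wgroup.
Definition word_of (x : wgroup) : seq 'I_3 := sval (cid (asboolW (valP x))).
Lemma word_ofE x : val x = wprod (word_of x).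
Proof. exact: (svalP (cid (asboolW (valP x)))). Qed.
Definition wg (w : seq 'I_3) : wgroup := exist _ (wprod w) (in_wordsP w).
Lemma wg_word x : wg (word_of x) = x. Proof. by apply: val_inj; rewrite [RHS]word_ofE. Qed.
Definition wmul (x y : wgroup) := wg (word_of x ++ word_of y).
Definition wone := wg [::].
Definition wginv (x : wgroup) := wg (winv (word_of x)).
Lemma val_wmul x y : val (wmul x y) = val x * val y.
Proof. by rewrite [LHS]wprod_cat -!word_ofE. Qed.
Lemma val_wone : val wone = 1. Proof. by rewrite /= /wprod big_nil. Qed.
Lemma wmulA : associative wmul.
Proof. by move=> x y z; apply: val_inj; rewrite !val_wmul mulrA. Qed.
Lemma wmul1l : left_id wone wmul.
Proof. by move=> x; apply: val_inj; rewrite val_wmul val_wone mul1r. Qed.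
Lemma wmul1r : right_id wone wmul.
Proof. by move=> x; apply: val_inj; rewrite val_wmul val_wone mulr1. Qed.
Lemma wmulVl : left_inverse wone wginv wmul.
Proof. by move=> x; apply: val_inj; rewrite val_wmul val_wone (word_ofE x); case: (winvP (word_of x)). Qed.
Lemma wmulVr : right_inverse wone wginv wmul.
Proof. by move=> x; apply: val_inj; rewrite val_wmul val_wone (word_ofE x); case: (winvP (word_of x)). Qed.
HB.instance Definition _ := isGroup.Build wgroup wmulA wmul1l wmul1r wmulVl wmulVr.

Lemma val_wM (x y : wgroup) : val (x * y)%g = val x * val y. Proof. exact: val_wmul. Qed.
Lemma val_w1 : val (1%g : wgroup) = 1. Proof. exact: val_wone. Qed.
Lemma val_wX (x : wgroup) k : val (x ^+ k)%g = val x ^+ k.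
Proof. by elim: k => [|k IH]; rewrite ?expg0 ?val_w1 // expgS val_wM IH exprS. Qed.
Lemma val_wV (a b : wgroup) M : val a * M = val b -> val (a^-1 * b)%g = M.
Proof. by move=> h; rewrite val_wM -h mulrA -val_wM mulVg val_w1 mul1r. Qed.

Definition wgen (k : 'I_3) : wgroup := wg [:: k].
Lemma val_wgen k : val (wgen k) = gmat k.
Proof. by rewrite /= /wprod big_seq1. Qed.
Lemma wgen5 k : (wgen k ^+ 5 = 1)%g.
Proof. by apply: val_inj; rewrite val_wX val_wgen gmat5 val_w1. Qed.

Lemma wgroup_enum : exists x : nat -> wgroup, forall t, exists n, x n = t.
Proof.
exists (fun n => wg (odflt [::] (choice.unpickle n))) => t.
by exists (choice.pickle (word_of t)); rewrite choice.pickleK /= wg_word.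
Qed.

Lemma wgroup_generates : generates [:: wgen i0; wgen i1; wgen i2].
Proof.
move=> P P1 PF PM PV t; rewrite -(wg_word t); elim: (word_of t) => [//|k w IH].
have -> : wg (k :: w) = (wgen k * wg w)%g.
  by apply: val_inj; rewrite val_wM val_wgen /= /wprod big_cons.
apply: PM => //; apply: PF; rewrite !inE.
by case: k => [[|[|[|k]]] hk] //; apply/or3P; [constructor 1|constructor 2|constructor 3]; apply/eqP; congr wgen; exact/val_inj.
Qed.

Section WordGroup.
Local Notation x := (wgen i0).
Local Notation y := (wgen i1).
Local Notation z := (wgen i2).
Definition wcomm (a b : wgroup) : wgroup := ((b * a)^-1 * (a * b))%g.
Lemma wcommE a b : (a * b = b * a * wcomm a b)%g.
Proof. by rewrite /wcomm mulKVg. Qed.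
Lemma val_x : val x = elem i0 i1 1. Proof. exact: val_wgen. Qed.
Lemma val_y : val y = elem i1 i2 1. Proof. exact: val_wgen. Qed.
Lemma val_z : val z = elem i2 i0 'X. Proof. exact: val_wgen. Qed.
Lemma val_xy : val (wcomm x y) = elem i0 i2 1.
Proof. by apply: val_wV; rewrite !val_wM val_x val_y [RHS]elem_comm // mul1r. Qed.
Lemma val_yz : val (wcomm y z) = elem i1 i0 'X.
Proof. by apply: val_wV; rewrite !val_wM val_y val_z [RHS]elem_comm // mul1r. Qed.
(** Here [elem_comm] computes [z * x], the opposite order, so the commutator comes out inverted:
    hence the sign. *)
Lemma val_xz : val (wcomm x z) = elem i2 i1 (- 'X).
Proof.
apply: val_wV; rewrite !val_wM val_x val_z elem_comm //; rewrite -[LHS]mulrA mulr1 elemD // subrr elem0.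
by rewrite mulr1.
Qed.
Lemma wcomm5 (a : wgroup) i j c : i != j -> val a = elem i j c -> (a ^+ 5 = 1)%g.
Proof. by move=> ij h; apply: val_inj; rewrite val_wX h elem5 // val_w1. Qed.
Lemma wcommute (a b : wgroup) i j k l c d : val a = elem i j c -> val b = elem k l d ->
  j != k -> l != i -> commute a b.
Proof. by move=> ha hb jk li; apply: val_inj; rewrite !val_wM ha hb elemC. Qed.

Lemma wgroup_kazhdan (R : realType) : kazhdan_linear [:: x; y; z] (420%:R : R).
Proof.
exact: (heisenberg3_kazhdan (wgen5 _) (wgen5 _) (wgen5 _)
  (wcomm5 (isT : i0 != i2) val_xy) (wcomm5 (isT : i1 != i0) val_yz) (wcomm5 (isT : i2 != i1) val_xz)
  (wcommute val_xy val_x isT isT) (wcommute val_xy val_y isT isT) (wcommE x y)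
  (wcommute val_yz val_y isT isT) (wcommute val_yz val_z isT isT) (wcommE y z)
  (wcommute val_xz val_x isT isT) (wcommute val_xz val_z isT isT) (wcommE x z) wgroup_generates).
Qed.

Lemma wgroup_nonabelian : (x * y)%g <> (y * x)%g.
Proof.
move=> h; have : val (wcomm x y) i0 i2 = 0 by rewrite /wcomm h mulVg val_w1 mxE.
by rewrite val_xy !mxE /= mulr1 add0r => /eqP; rewrite oner_eq0.
Qed.

(** The product of the elementary matrices with entry 1 in position (1,2) and X in position (2,1),
    an element of infinite order. *)
Definition wunip : wgroup := (x * wcomm y z)%g.
(** The first two entries (a, b) of the first row evolve by [a' = a + (a + b) X] and [b' = a + b],
    so their degrees grow by one at each step. *)
Lemma wunip_size n : size (val (wunip ^+ n)%g i0 i0) = n.+1 /\ size (val (wunip ^+ n)%g i0 i1) = n.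
Proof.
elim: n => [|n [h1 h2]]; first by rewrite expg0 val_w1 !mxE /= size_poly1 size_poly0.
rewrite expgSr val_wM; set N := val _ in h1 h2 *.
have eM : val wunip = elem i0 i1 1 * elem i1 i0 'X by rewrite val_wM val_x val_yz.
have e : N * val wunip = N + N *m ('X *: delta_mx i1 i0) + (N *m (1 *: delta_mx i0 i1) + N *m ('X *: delta_mx i0 i0)).
  have -> : val wunip = 1 + 'X *: delta_mx i1 i0 + (1 *: delta_mx i0 i1 + 'X *: delta_mx i0 i0).
    by rewrite eM /elem mulrDl mul1r mulrDr mulr1 delta_mul eqxx mul1r.
  by rewrite !mulrDr mulr1.
have Nd (a : P5) (k l c : 'I_3) : (N *m (a *: delta_mx k l)) i0 c = if c == l then a * N i0 k else 0.
  rewrite -scalemxAr mxE mxE (bigD1 k) //= big1 => [|j jk]; last by rewrite mxE (negbTE jk) mulr0.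
  by rewrite mxE eqxx /= addr0; case: eqP; rewrite ?mulr1 ?mulr0.
have addE (A B : M3) r c : (A + B) r c = A r c + B r c by rewrite mxE.
have e00 : (N * val wunip) i0 i0 = N i0 i0 + (N i0 i0 + N i0 i1) * 'X.
  by rewrite e !addE !Nd /=; ring.
have e01 : (N * val wunip) i0 i1 = N i0 i0 + N i0 i1.
  by rewrite e !addE !Nd /=; ring.
have s : size (N i0 i0 + N i0 i1) = n.+1 by rewrite size_polyDl ?h1 ?h2.
rewrite e00 e01 s; split => //.
have s' : size ((N i0 i0 + N i0 i1) * 'X) = n.+2.
  by rewrite size_mulX ?s // -size_poly_eq0 s.
by rewrite addrC size_polyDl s' // h1.
Qed.
Lemma wunip_inj : injective (fun n => wunip ^+ n)%g.
Proof. by move=> n k h; have [] := wunip_size n; rewrite h; have [-> _] := wunip_size k => -[]. Qed.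
End WordGroup.

(** * The family *)

Section ProductFinite.
Variables (R : realType) (T : groupType) (A : finGroupType).
Lemma pair_mulE (a b : T * A) : (a * b)%g = (a.1 * b.1, a.2 * b.2)%g. Proof. by []. Qed.
Lemma pair_exp (t : T) (s : A) n : ((t, s) ^+ n)%g = (t ^+ n, s ^+ n)%g.
Proof. by elim: n => [|n IH]; rewrite ?expg0 // !expgS IH. Qed.

Definition product_gens (F : seq T) : seq (T * A) := [seq (t, 1%g) | t <- F] ++ [seq (1%g, s) | s <- enum A].
Lemma product_generates (F : seq T) : generates F -> generates (product_gens F).
Proof.
move=> gF P P1 PF PM PV [t s].
have -> : (t, s) = ((t, 1) * (1, s))%g :> T * A by rewrite pair_mulE /= mulg1 mul1g.
apply: (PM); last by apply: PF; rewrite mem_cat; apply/orP; right; apply/mapP; exists s; rewrite ?mem_enum.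
move: t; apply: gF => [//|t tF|t t' ht ht'|t ht].
- by apply: PF; rewrite mem_cat; apply/orP; left; apply/mapP; exists t.
- by have := PM _ _ ht ht'; rewrite pair_mulE /= mulg1.
- have -> : (t^-1, 1)%g = (t, 1%g)^-1%g :> T * A; last exact: PV.
  by apply: (mulgI (t, 1%g)); rewrite mulgV pair_mulE /= mulgV mulg1.
Qed.

(* Averaging over the finite factor. *)
Lemma kazhdan_product (F : seq T) (c : R) : 0 <= c -> kazhdan_linear F c -> kazhdan R (T * A)%type.
Proof.
(* Here [(c + 1) e = 1/2]: the linear estimate costs [c e], and the motion of [xi] under the finite
   factor another [e]. *)
move=> c0 hF; pose e := (2 * (c + 1))^-1.
have c1 : 0 < 2 * (c + 1) by lra.
have e0 : 0 < e by rewrite invr_gt0.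
exists (product_gens F), e; split => // H U ur xi xi1 hxi.
have UL t := proj1 (ur_b ur t).
have urT : unirep (fun t : T => U (t, 1%g)).
  split.
  - by move=> t; exact: (ur_b ur).
  - move=> t v w; rewrite (ur_adj ur); congr (inner v (U _ w)).
    by apply: (mulgI (t, 1%g)); rewrite mulgV pair_mulE /= mulgV mulg1.
  - exact: (ur1 ur).
  - by move=> s t v; rewrite -(urM ur) pair_mulE /= mulg1.
have [eta [de ie]] : exists eta, nr (xi - eta) <= c * e /\ forall t : T, U (t, 1%g) eta = eta.
  apply: (hF H _ urT xi e (ltW e0)) => t tF; apply: hxi; rewrite mem_cat; apply/orP; left.
  by apply/mapP; exists t.
have N0 : (0 : R) < #|A|%:R by rewrite ltr0n; apply/card_gt0P; exists 1%g.
pose av : H := ((#|A|%:R : R)^-1)%:C *: \sum_(s : A) U (1%g, s) eta.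
exists av; split.
  have -> : xi - av = ((#|A|%:R : R)^-1)%:C *: \sum_(s : A) (xi - U (1%g, s) eta).
    rewrite sumrB sumr_const scalerBr; congr (_ - _).
    by rewrite -scalerMnr scalerMnl -rmorphMn /= -(mulr_natr _ #|A|) mulVf ?scale1r // gt_eqF.
  have Ni : 0 <= (#|A|%:R : R)^-1 by rewrite invr_ge0 ltW.
  rewrite nrZ ca_real ger0_norm // ler_pdivrMl //.
  apply: le_trans (nr_sum _ _ _) _.
  have e2 : (c + 1) * e = 2^-1 by rewrite /e invfM mulrCA divff ?mulr1 // gt_eqF //; lra.
  apply: le_trans (_ : \sum_(s : A) 2^-1 <= _); last by rewrite sumr_const mulr_natl.
  apply: ler_sum => s _; have := nr_tri (U (1%g, s) xi) xi (U (1%g, s) eta).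
  rewrite -(linB (@UL _)) (ur_nr ur) [nr (xi - U _ xi)]nr_subC.
  have : nr (U (1%g, s) xi - xi) <= e.
    by apply: hxi; rewrite mem_cat; apply/orP; right; apply/mapP; exists s; rewrite ?mem_enum.
  lra.
move=> [t s]; rewrite /av (linZ (@UL _)) (lin_sum _ _ _ (@UL _)); congr (_ *: _).
rewrite [RHS](reindex_inj (mulgI s)) /=; apply: eq_bigr => s' _.
rewrite -(urM ur); have -> : ((t, s) * (1, s') = (1, s * s') * (t, 1))%g.
  by rewrite !pair_mulE /= mulg1 mul1g mulg1.
by rewrite (urM ur) ie.
Qed.
End ProductFinite.

(* The symmetric group on Z/4 is the product of the translations and the
   stabilizer of 0, neither of which is normal. *)
Lemma stab_group_set : group_set [set s : {perm 'Z_4} | s 0 == 0]%SET.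
Proof.
apply/group_setP; split; first by rewrite inE perm1.
by move=> s t; rewrite !inE permM => /eqP -> /eqP ->.
Qed.
Definition stab0 := Group stab_group_set.
Definition shift4 (c : 'Z_4) : {perm 'Z_4} := perm (@addIr _ c).
Lemma shift4E c x : shift4 c x = x + c. Proof. by rewrite permE. Qed.
Lemma shift4D b c : shift4 (b + c) = (shift4 b * shift4 c)%g.
Proof. by apply/permP => x; rewrite permM !shift4E addrA. Qed.

Section Family.
Variable n : nat.
Local Notation S4 := {perm 'Z_4}.
Local Notation T := (wgroup * [subg stab0])%type.
Local Notation K := ('Z_4 * 'I_n.+1)%type.
Local Notation H := (wgroup * (S4 * 'I_n.+1))%type.

Definition ex_i (t : T) : H := (t.1, (sgval t.2, 1%g)).
Definition ex_j (g : K) : H := (1%g, (shift4 g.1, g.2)).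
(** In [shift4 c * s] with [s 0 = 0] the left permutation acts first, so [- c] is the point sent to
    0; this recovers [c]. *)
Definition ex_k (x : H) : K := (- (x.2.1^-1%g 0), x.2.2).
Definition ex_t (x : H) : T := (x.1, subg stab0 ((shift4 (- (x.2.1^-1%g 0)))^-1 * x.2.1)%g).

Lemma ex_enum : exists x : nat -> T, forall t, exists k, x k = t.
Proof.
have [x hx] := wgroup_enum.
exists (fun k => oapp (fun q : nat * [subg stab0] => (x q.1, q.2)) (1%g, 1%g) (choice.unpickle k)) => -[t s].
by have [k <-] := hx t; exists (choice.pickle (k, s)); rewrite choice.pickleK.
Qed.
Lemma stab0_shift (l : S4) : ((shift4 (- (l^-1%g 0)))^-1 * l)%g \in stab0.
Proof.
rewrite inE permM; have -> : (shift4 (- (l^-1%g 0)))^-1%g 0 = l^-1%g 0.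
  by apply: (@perm_inj _ (shift4 (- (l^-1%g 0)))); rewrite permKV shift4E subrr.
by rewrite permKV.
Qed.
Lemma ex_E x : x = (ex_j (ex_k x) * ex_i (ex_t x))%g.
Proof.
case: x => t [l k]; rewrite /ex_j /ex_k /ex_i /ex_t /= subgK ?stab0_shift //.
by congr (_, (_, _)); rewrite ?mul1g ?mulg1 ?mulKVg.
Qed.
Lemma ex_kt g t : ex_k (ex_j g * ex_i t)%g = g /\ ex_t (ex_j g * ex_i t)%g = t.
Proof.
case: g => c k; case: t => t s.
have -> : (ex_j (c, k) * ex_i (t, s))%g = (t, (shift4 c * sgval s, k))%g.
  by congr (_, (_, _)); rewrite ?mul1g ?mulg1.
have e : - ((shift4 c * sgval s)^-1%g 0) = c.
  apply/eqP; rewrite eqr_oppLR; apply/eqP/(@perm_inj _ (shift4 c * sgval s)%g).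
  rewrite permKV permM shift4E addNr; have := subgP s.
  by rewrite inE => /eqP.
by rewrite /ex_k /ex_t /= e mulKg sgvalK.
Qed.
Definition ex : factorization.
refine (@Factorization H T K ex_i ex_j ex_k ex_t _ _ ex_E _ _ ex_enum).
- by move=> [t s] [t' s']; congr (_, (_, _)); rewrite ?mulg1 ?morphM ?inE.
- by move=> [c k] [c' k']; congr (_, (_, _)); rewrite ?mul1g // -shift4D.
- by move=> g t; case: (ex_kt g t).
- by move=> g t; case: (ex_kt g t).
Defined.

Definition swap12 : [subg stab0] := subg stab0 (tperm (1 : 'Z_4) 2%:R).
Lemma swap12E : sgval swap12 = tperm (1 : 'Z_4) 2%:R.
Proof. by rewrite subgK // inE tpermD. Qed.
(** Exchanging the factors of this product exhibits both actions as nontrivial: it sends 2 to 0, so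
    its translation part on the left is 2 instead of 3, and the stabilizer part changes as well. *)
Definition cycle12 : S4 := (tperm (1%R : 'Z_4) 2%:R * shift4 3%:R)%g.
Lemma cycle12_point : - (cycle12^-1%g 0) = 2%:R.
Proof.
apply/eqP; rewrite eqr_oppLR; apply/eqP/(@perm_inj _ cycle12).
rewrite permKV (_ : - 2%:R = 2%:R :> 'Z_4); last exact/val_inj.
by rewrite /cycle12 permM tpermR shift4E; apply/val_inj.
Qed.
Lemma ex_swap : (ex_i (1%g, swap12) * ex_j (3%:R, 1%g))%g = (1%g, (cycle12, 1%g)) :> H.
Proof. by rewrite /ex_i /= swap12E; congr (_, (_, _)); rewrite ?mulg1 ?mul1g. Qed.

Lemma ex_alpha : fal (F := ex) (1%g, swap12) (3%:R, 1%g) <> (3%:R, 1%g).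
Proof. by rewrite /fal [fpk _](congr1 ex_k ex_swap) /ex_k /= cycle12_point => -[]. Qed.
Lemma ex_beta : fbe (F := ex) (3%:R, 1%g) (1%g, swap12) <> (1%g, swap12).
Proof.
rewrite /fbe [fpt _](congr1 ex_t ex_swap) /ex_t /= => -[] /(congr1 sgval).
rewrite subgK ?stab0_shift // cycle12_point swap12E => /(congr1 (mulg (shift4 2%:R))).
(* Evaluation at 0 gives 3 on one side and 1 on the other. *)
rewrite mulKVg => /(congr1 (fun s : S4 => s 0)).
rewrite /cycle12 !permM !shift4E tpermD // (_ : 0 + 2%:R = 2%:R :> 'Z_4) ?tpermR; last exact/val_inj.
by move=> /(congr1 val).
Qed.
(** Z/(n+1) is a central direct factor of the ambient group, so its elements commute with the
    discrete group. *)
Lemma ex_fixed (k : 'I_n.+1) (t : fT ex) : fal (F := ex) t (0, k) = (0, k).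
Proof.
case: t => t s; have [] // := @f_swapP ex (t, s) (0, k) (0, k) (t, s).
have e0 : shift4 0 = 1%g by apply/permP => z; rewrite shift4E perm1 addr0.
by rewrite /= /ex_i /ex_j /= e0; congr (_, (_, _)); rewrite ?mulg1 ?mul1g.
Qed.

Definition ex_gens : seq (fT ex) := product_gens [subg stab0] [:: wgen ord0; wgen (lift ord0 ord0); wgen ord_max].
Lemma ex_generates : generates ex_gens.
Proof. exact: product_generates wgroup_generates. Qed.
Definition ex_exponent := (5 * #|[set: [subg stab0]]%SET|)%N.
Lemma ex_order t : t \in ex_gens -> (t ^+ ex_exponent = 1)%g.
Proof.
rewrite mem_cat => /orP[/mapP[x xF ->]|/mapP[s _ ->]]; rewrite pair_exp expg1n.
  have -> : (x ^+ ex_exponent = 1)%g; last by [].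
  rewrite expgnA; have -> : (x ^+ 5 = 1)%g; last exact: expg1n.
  by move: xF; rewrite !inE => /or3P[] /eqP ->; exact: wgen5.
have -> : (s ^+ ex_exponent = 1)%g; last by [].
by rewrite /ex_exponent mulnC expgnA expg_cardG ?inE // expg1n.
Qed.
End Family.

Section Main.
Variable R : realType.
Local Notation pair n := (pair_of R (ex n)).
Local Notation cqg n := (bicrossed R (mpair_of (ex n))).

Lemma ex_finite n : finite_set (star_characters (cqg n)).
Proof.
apply: (@characters_finite R (mpair_of (ex n)) (ex_gens n) ex_exponent (@ex_generates n) _ (@ex_order n)).
by rewrite /ex_exponent muln_gt0 cardG_gt0.
Qed.
Lemma ex_count : exists c : nat -> nat, forall n,
  (star_characters (cqg n) #= `I_(c n))%card /\ (n < c n)%N.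
Proof.
have /choice[c hc] n : exists c, (star_characters (cqg n) #= `I_c)%card := ex_finite n.
exists c => n; split => //; rewrite -card_le_II -(card_le_eqr (hc n)).
apply: (@characters_ge R (mpair_of (ex n)) n.+1 (fun k => (0, k))) => [k k' []//|k t].
exact: ex_fixed.
Qed.
Lemma ex_kazhdan n : dual_property_T (cqg n).
Proof.
apply: bicrossed_T; exact: (@kazhdan_product R wgroup [subg stab0] _ _ (ler0n _ _) (@wgroup_kazhdan R)).
Qed.
Lemma ex_nonabelian n : exists s t : fT (ex n), (s * t)%g <> (t * s)%g.
Proof.
exists (wgen ord0, 1%g), (wgen (lift ord0 ord0), 1%g) => /(congr1 fst).
exact: wgroup_nonabelian.
Qed.
Lemma ex_infinite n : cqg_infinite_dimensional (cqg n).
Proof.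
apply: (@bicrossed_infinite R (mpair_of (ex n)) (fun k => ((wunip ^+ k)%g, 1%g))).
by move=> k k' [] /wunip_inj.
Qed.
End Main.

Theorem theorem7p10 (R : realType) :
  exists (I : Type) (P : I -> compactMatchedPair R)
         (Q : I -> compactQuantumGroup R),
    [/\ infinite_set [set: I],
        forall i, nontrivial_pair (P i) /\ is_bicrossed_product (P i) (Q i),
        forall i j, i <> j -> ~ cqg_isomorphic (Q i) (Q j),
        forall i, [/\ ~ cqg_commutative (Q i),
                      ~ cqg_cocommutative (Q i) &
                      cqg_infinite_dimensional (Q i)] &
        forall i, dual_property_T (Q i)].
Proof.
have [c hc] := ex_count R; pose size k := iter k c 0%N.
have size_lt k k' : (k < k')%N -> (c (size k) < c (size k'))%N.
  elim: k' => // k' IH; rewrite ltnS leq_eqVlt => /orP[/eqP ->|/IH h]; first by have [] := hc (size k'.+1).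
  by apply: ltn_trans h _; have [] := hc (size k'.+1).
(* The number of characters is finite and exceeds [n], so along [size] it is
   strictly increasing. *)
exists nat, (fun k => pair_of R (ex (size k))), (fun k => bicrossed R (mpair_of (ex (size k)))); split.
- exact: infinite_nat.
- move=> k; split; last exact: bicrossed_is_bicrossed.
  by apply: pair_of_nontrivial; do 2!eexists; [exact: ex_alpha|exact: ex_beta].
- move=> k k' kk /cqg_isomorphic_characters e.
  have [h _] := hc (size k); have [h' _] := hc (size k').
  have /card_eq_II cc : (`I_(c (size k)) #= `I_(c (size k')))%card.
    exact: card_eq_trans (card_eq_trans (card_esym h) e) h'.
  by move: kk; case: (ltngtP k k') => // /size_lt; rewrite cc ltnn.
- move=> k; split; last exact: ex_infinite.
    by have [s [t st]] := ex_nonabelian (size k); exact: (@bicrossed_noncomm R (mpair_of (ex _)) s t).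
  exact: (@bicrossed_noncocomm R (mpair_of (ex _)) _ _ (@ex_beta _)).
- by move=> k; exact: ex_kazhdan.
Qed.
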